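(* Let $\rho>0$, $\nu>0$, and let $f=\delta_\mu\mathcal{F}$ satisfy the standing assumption stated in the context. Let $(S_t)_{t\ge0}$ be an admissible test flow. Then any stationary equilibrium $\mu\in\mathcal{P}^2_+(\mathbb{T}^d)$ satisfies $$\frac{d}{dt}\Big|_{t=0}\Phi(S_t\mu)=0,$$ where $\Phi(\mu)=\rho\,\nu\,\mathrm{Ent}(\mu)+\frac{\nu^2}{2}I(\mu)+\mathcal{F}(\mu)$ for $\mu\in\mathcal{P}^2_+(\mathbb{T}^d)$.
   Context: Setting. $\mathbb{T}^d=(\mathbb{R}/2\pi\mathbb{Z})^d$; $\mathcal{P}(\mathbb{T}^d)$ is the set of probability measures on $\mathbb{T}^d$ with the weak topology. $\mathcal{P}^2_+(\mathbb{T}^d)$ is the set of twice continuously differentiable, strictly positive probability densities on $\mathbb{T}^d$ (with respect to Lebesgue measure $dx$), identified with the corresponding measures. For $\mu(dx)=m(x)dx$ in $\mathcal{P}^2_+(\mathbb{T}^d)$: $\mathrm{Ent}(\mu)=\int_{\mathbb{T}^d} m\log m\,dx$ and $I(\mu)=\int_{\mathbb{T}^d}\frac{|\nabla m|^2}{m}dx$. Derivatives at time $0$ are right-sided. Admissible test flow. A family of maps $S_t:\mathcal{P}^2_+(\mathbb{T}^d)\to\mathcal{P}^2_+(\mathbb{T}^d)$, $t\ge0$, is an admissible test flow if for all $\mu\in\mathcal{P}^2_+(\mathbb{T}^d)$: $S_0\mu=\mu$; $\|S_h\mu-\mu\|_{C^2}\to0$ as $h\downarrow0$; and there exists a map $V:\mathcal{P}^2_+(\mathbb{T}^d)\to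 C(\mathbb{T}^d)$ with $\|h^{-1}(S_h\mu-\mu)-V\mu\|_\infty\to0$ as $h\downarrow0$. Mean-field game. Fix a filtered probability space $(\Omega,\mathscr{F},(\mathscr{F}_t)_{t\ge0},\mathbb{P})$ carrying a $d$-dimensional Brownian motion $W$ and rich enough to support $\mathscr{F}_0$-measurable random variables with the required initial law; let $\mathscr{A}$ be the set of progressively measurable $d$-dimensional processes. Given a measure flow $\boldsymbol{\mu}=(\mu_t)_{t\ge0}$ in $\mathcal{P}(\mathbb{T}^d)$, a typical player minimizes over $\alpha\in\mathscr{A}$ $$\mathbb{E}\Big[\int_0^\infty e^{-\rho t}\big(\tfrac12|\alpha_t|^2+f(X^\alpha_t,\mu_t)\big)dt\Big],\qquad dX^\alpha_t=\alpha_t\,dt+\sqrt{2\nu}\,dW_t,\quad X_0^\alpha\sim\mu_0,$$ with the state regarded modulo $2\pi$. An equilibrium starting from $\mu$ is a flow $\boldsymbol{\mu}$ with $\mu_0=\mu$ for which there is an optimal control $\alpha^*$ with $\mathrm{Law}(X^{\alpha^*}_t)=\mu_t$ for all $t\ge0$. A stationary equilibrium is a measure $\mu\in\mathcal{P}(\mathbb{T}^d)$ such that the constant flow $\mu_t\equiv\mu$ is an equilibrium starting from $\mu$. Equivalently, $\mu(dx)=m(x)dx$ where $(u,m)$ solves on $\mathbb{T}^d$ the system $\rho u-\nu\Delta u+\frac12|\nabla u|^2=f(x,\mu)$, $-\nu\Delta m-\nabla\cdot(m\nabla u)=0$; solutions are classical and $m=e^{-u/\nu}/\int_{\mathbb{T}^d}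 e^{-u/\nu}dy$. Linear derivative. A function $\phi:\mathcal{P}(\mathbb{T}^d)\to\mathbb{R}$ is linearly differentiable with linear derivative $\delta_\mu\phi:\mathcal{P}(\mathbb{T}^d)\times\mathbb{T}^d\to\mathbb{R}$ if $\phi(\mu')-\phi(\mu)=\int_0^1\int_{\mathbb{T}^d}\delta_\mu\phi((1-\tau)\mu+\tau\mu',x)\,(\mu'-\mu)(dx)\,d\tau$ for all $\mu,\mu'$; it is defined up to a $\mu$-dependent constant. Standing assumption on $f$. (a) Potential structure: there is $\mathcal{F}:\mathcal{P}(\mathbb{T}^d)\to\mathbb{R}$, bounded from below, with $f=\delta_\mu\mathcal{F}$. (b) Regularity: $f$ is twice continuously differentiable in $x$ and once continuously differentiable in $\mu$ with derivative $\delta_\mu f(x,\mu,y)$; $\sup_{\mu\in\mathcal{P}(\mathbb{T}^d)}\|f(\cdot,\mu)\|_{C^2(\mathbb{T}^d)}<\infty$; and $\nabla_x\delta_\mu f$, $\nabla_y\delta_\mu f$, $\partial_{x_i}\partial_{y_j}\delta_\mu f$, $\Delta_y\delta_\mu f$ all exist and are continuous on $\mathbb{T}^d\times\mathcal{P}(\mathbb{T}^d)\times\mathbb{T}^d$. *)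

(* Defs.v *)
From HB Require Import structures.
From mathcomp Require Import all_boot all_order all_algebra.
From mathcomp Require Import all_classical all_reals all_analysis.

Set Implicit Arguments.
Unset Strict Implicit.
Unset Printing Implicit Defensive.

Import Order.TTheory GRing.Theory Num.Theory.
Import numFieldNormedType.Exports.
Local Open Scope classical_set_scope.
Local Open Scope ring_scope.

Definition rV_coord {R : realType} {d : nat} (i : 'I_d) (x : 'rV[R]_d) : R :=
  x ord0 i.

Definition rV_display : measure_display.
Proof. exact: default_measure_display. Qed.

Section measurable_rV.
Context {R : realType} {d : nat}.

Let rV_set0 : g_sigma_preimage (@rV_coord R d) set0.
Proof. exact: sigma_algebra0. Qed.

Let rV_setC A :
  g_sigma_preimage (@rV_coord R d) A -> g_sigma_preimage (@rV_coord R d) (~` A).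
Proof. exact: sigma_algebraC. Qed.

Let rV_bigcup (F : (set 'rV[R]_d)^nat) :
  (forall i, g_sigma_preimage (@rV_coord R d) (F i)) ->
  g_sigma_preimage (@rV_coord R d) (\bigcup_i (F i)).
Proof. exact: sigma_algebra_bigcup. Qed.

(* The sigma-algebra generated by the coordinates: the Borel sets of R^d. *)
HB.instance Definition _ := @isMeasurable.Build rV_display 'rV[R]_d
  (g_sigma_preimage (@rV_coord R d)) rV_set0 rV_setC rV_bigcup.

End measurable_rV.

Lemma measurable_rV_coord {R : realType} {d : nat} (i : 'I_d) :
  measurable_fun [set: 'rV[R]_d] (@rV_coord R d i).
Proof.
move=> _ Y mY; rewrite setTI; apply: sub_sigma_algebra => /=.
rewrite -bigcup_seq/=; exists i => /=; first by rewrite mem_index_enum.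
by exists Y => //; rewrite setTI.
Qed.

Lemma measurable_fun_rVP {R : realType} {d : nat} {disp : measure_display}
    {T : measurableType disp} (f : T -> 'rV[R]_d) :
  measurable_fun [set: T] f <->
  forall i, measurable_fun [set: T] (rV_coord i \o f).
Proof.
split=> [mf i|mf].
  by apply: measurableT_comp => //; exact: measurable_rV_coord.
have mfE : preimage_set_system setT f (g_sigma_preimage (@rV_coord R d))
    `<=` measurable.
  rewrite -g_sigma_preimage_comp.
  apply: smallest_sub; first exact: sigma_algebra_measurable.
  rewrite -bigcup_seq; apply: bigcup_sub => i _.
  by move=> A [B mB <-]; exact: mf.
by move=> _ A mA; apply: mfE; exists A.
Qed.

Definition rV_cons {R : realType} {d : nat} (p : measurableTypeR R * 'rV[R]_d) :
    'rV[R]_d.+1 :=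
  \row_i (if unlift ord0 i is Some j then p.2 ord0 j else p.1).

Lemma measurable_rV_cons {R : realType} {d : nat} :
  measurable_fun [set: measurableTypeR R * 'rV[R]_d] (@rV_cons R d).
Proof.
apply/measurable_fun_rVP => i.
case: (unliftP ord0 i) => [j ->|->].
- rewrite [X in measurable_fun _ X](_ : _ = rV_coord j \o snd).
    by apply: measurableT_comp => //; exact: measurable_rV_coord.
  by apply/funext => p; rewrite /rV_coord/= mxE liftK.
- rewrite [X in measurable_fun _ X](_ : _ = fst); first exact: measurable_fst.
  by apply/funext => p; rewrite /rV_coord/= mxE unlift_none.
Qed.

Section lebesgue_cons.
Context {R : realType} {d : nat}.
Variable m : {sigma_finite_measure set 'rV[R]_d -> \bar R}.
Local Open Scope ereal_scope.

Definition lebesgue_cons : set 'rV[R]_d.+1 -> \bar R :=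
  pushforward (lebesgue_measure \x m) (@rV_cons R d).

Let lebesgue_cons0 : lebesgue_cons set0 = 0.
Proof. by rewrite /lebesgue_cons /pushforward preimage_set0 measure0. Qed.

Let lebesgue_cons_ge0 A : 0 <= lebesgue_cons A.
Proof. by rewrite /lebesgue_cons /pushforward; exact: measure_ge0. Qed.

Let lebesgue_cons_sigma_additive : semi_sigma_additive lebesgue_cons.
Proof.
move=> F mF tF mUF; rewrite /lebesgue_cons /pushforward preimage_bigcup.
apply: measure_semi_sigma_additive.
- by move=> n; rewrite -[X in measurable X]setTI; exact: measurable_rV_cons.
- apply/trivIsetP => /= i j _ _ ij; rewrite -preimage_setI.
  by move/trivIsetP : tF => /(_ _ _ _ _ ij) ->//; rewrite preimage_set0.
- by rewrite -preimage_bigcup -[X in measurable X]setTI;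
    exact: measurable_rV_cons.
Qed.

HB.instance Definition _ := isMeasure.Build _ _ _ lebesgue_cons
  lebesgue_cons0 lebesgue_cons_ge0 lebesgue_cons_sigma_additive.

Let lebesgue_cons_sigma_finite : sigma_finite setT lebesgue_cons.
Proof.
have /sigma_finiteP[F [TF ndF Foo]] :=
  sigma_finiteT [the {sigma_finite_measure set _ -> \bar R}
    of @lebesgue_measure R].
have /sigma_finiteP[G [TG ndG Goo]] := sigma_finiteT m.
pose tl : 'rV[R]_d.+1 -> 'rV[R]_d := fun x => \row_j x ord0 (lift ord0 j).
have mtl : measurable_fun setT tl.
  apply/measurable_fun_rVP => i.
  rewrite [X in measurable_fun _ X](_ : _ = rV_coord (lift ord0 i)).
    exact: measurable_rV_coord.
  by apply/funext => x; rewrite /rV_coord/= mxE.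
exists (fun n => rV_coord ord0 @^-1` F n `&` tl @^-1` G n).
  rewrite predeqE => x; split=> // _.
  have [n _ Fnx] : (\bigcup_n F n) (rV_coord ord0 x) by rewrite -TF.
  have [k _ Gkx] : (\bigcup_n G n) (tl x) by rewrite -TG.
  exists (maxn n k) => //; split => /=.
  - by move: Fnx; exact/subsetPset/ndF/leq_maxl.
  - by move: Gkx; exact/subsetPset/ndG/leq_maxr.
move=> k; have [mFk Fkoo] := Foo k; have [mGk Gkoo] := Goo k; split.
  apply: measurableI.
    by rewrite -[X in measurable X]setTI; exact: measurable_rV_coord.
  by rewrite -[X in measurable X]setTI; exact: mtl.
rewrite /lebesgue_cons /pushforward.
rewrite [X in (_ \x _)%E X](_ : _ = F k `*` G k).
  by rewrite product_measure1E// lte_mul_pinfty// ge0_fin_numE.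
apply/seteqP; split=> -[a v] /=; rewrite /rV_coord /tl /rV_cons mxE unlift_none.
  move=> [Fa]; rewrite (_ : \row_j _ = v)//.
  by apply/rowP => j; rewrite !mxE liftK.
move=> [Fa Gv]; split=> //; rewrite (_ : \row_j _ = v)//.
by apply/rowP => j; rewrite !mxE liftK.
Qed.

HB.instance Definition _ := Measure_isSigmaFinite.Build _ _ _ lebesgue_cons
  lebesgue_cons_sigma_finite.

End lebesgue_cons.

Fixpoint lebesgue_rV (R : realType) (d : nat) :
    {sigma_finite_measure set 'rV[R]_d -> \bar R} :=
  match d with
  | 0 => \d_(0 : 'rV[R]_0)
  | d'.+1 => lebesgue_cons (lebesgue_rV R d')
  end.

(* T^d = (R / 2 pi Z)^d is encoded as follows. A function on T^d is a function
   on R^d that is 2 pi-periodic in each coordinate; a point of T^d is represented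
   in the cell [0, 2 pi)^d, and a Borel measure on T^d by a Borel measure on R^d
   carried by that cell. *)

Definition basis_vec {R : realType} {d : nat} (i : 'I_d) : 'rV[R]_d :=
  delta_mx ord0 i.

Definition periodic {R : realType} {d : nat} (phi : 'rV[R]_d -> R) : Prop :=
  forall (x : 'rV[R]_d) (i : 'I_d), phi (x + (2 * pi) *: basis_vec i) = phi x.

Definition cell {R : realType} {d : nat} : set 'rV[R]_d :=
  [set x | forall i, 0 <= rV_coord i x < 2 * pi].

Definition torus_proj {R : realType} {d : nat} (x : 'rV[R]_d) : 'rV[R]_d :=
  \row_i (x ord0 i - (2 * pi) * (Num.floor (x ord0 i / (2 * pi)))%:~R).

Definition torus_int {R : realType} {d : nat} (phi : 'rV[R]_d -> R) : R :=
  \int[lebesgue_rV R d]_(x in cell) phi x.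

Definition sqnorm {R : realType} {d : nat} (v : 'rV[R]_d) : R :=
  \sum_i (v ord0 i) ^+ 2.

Definition partial {R : realType} {d : nat} (i : 'I_d) (phi : 'rV[R]_d -> R) :
    'rV[R]_d -> R :=
  fun x => 'D_(basis_vec i) phi x.

Definition has_partial {R : realType} {d : nat} (i : 'I_d)
    (phi : 'rV[R]_d -> R) : Prop :=
  forall x, derivable phi x (basis_vec i).

Definition grad {R : realType} {d : nat} (phi : 'rV[R]_d -> R) (x : 'rV[R]_d) :
    'rV[R]_d :=
  \row_i partial i phi x.

Definition laplacian {R : realType} {d : nat} (phi : 'rV[R]_d -> R)
    (x : 'rV[R]_d) : R :=
  \sum_i partial i (partial i phi) x.

Record C2 {R : realType} {d : nat} (phi : 'rV[R]_d -> R) : Prop := {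
  C2_continuous : continuous phi ;
  C2_has_partial : forall i, has_partial i phi ;
  C2_partial_continuous : forall i, continuous (partial i phi) ;
  C2_has_partial2 : forall i j, has_partial j (partial i phi) ;
  C2_partial2_continuous :
    forall i j, continuous (partial j (partial i phi)) }.

Definition sup_norm {R : realType} {d : nat} (phi : 'rV[R]_d -> R) : \bar R :=
  ereal_sup [set `|phi x|%:E | x in setT].

(* Extended-valued, so that no boundedness is presupposed. *)
Definition C2_norm {R : realType} {d : nat} (phi : 'rV[R]_d -> R) : \bar R :=
  (sup_norm phi + \sum_(i < d) sup_norm (partial i phi)
   + \sum_(i < d) \sum_(j < d) sup_norm (partial j (partial i phi)))%E.

Record tprob (R : realType) (d : nat) := TProb {
  tprob_law :> probability 'rV[R]_d R ;
  tprob_cell : tprob_law cell = 1%E }.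

(* The library's measures are functions on all sets, so two elements of tprob
   are the same measure when they agree on the measurable sets. *)
Definition same_law {R : realType} {d : nat} (mu nu : tprob R d) : Prop :=
  forall A, measurable A -> mu A = nu A.

Definition torus_C0 (R : realType) (d : nat) :=
  {phi : 'rV[R]_d -> R | continuous phi /\ periodic phi}.

Definition tprob_eval {R : realType} {d : nat} (mu : tprob R d) :
    {ptws torus_C0 R d -> R} :=
  fun phi => \int[mu]_x (sval phi) x.

HB.instance Definition _ (R : realType) (d : nat) := gen_eqMixin (tprob R d).
HB.instance Definition _ (R : realType) (d : nat) :=
  gen_choiceMixin (tprob R d).
(* The weak topology: the coarsest one for which mu |-> \int phi dmu is
   continuous for every continuous phi on T^d. *)
HB.instance Definition _ (R : realType) (d : nat) :=
  Topological.copy (tprob R d) (initial_topology (@tprob_eval R d)).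

(* The mixture (1 - t) mu + t nu below is made total in t by truncating t to
   [0, 1]; it is used only for t in [0, 1]. *)
Definition clamp01 {R : realType} (t : R) : R := Num.max 0 (Num.min t 1).

Lemma clamp01_ge0 {R : realType} (t : R) : 0 <= clamp01 t.
Proof. by rewrite /clamp01 le_max lexx. Qed.

Lemma onem_clamp01_ge0 {R : realType} (t : R) : 0 <= 1 - clamp01 t.
Proof. by rewrite subr_ge0 /clamp01 ge_max ler01 ge_min lexx orbT. Qed.

Lemma clamp01_id {R : realType} (t : R) : 0 <= t <= 1 -> clamp01 t = t.
Proof. by move=> /andP[t0 t1]; rewrite /clamp01 min_l// max_r. Qed.

Section mixture.
Context {R : realType} {d : nat}.
Variables (t : R) (mu nu : tprob R d).
Local Open Scope ereal_scope.

Definition mixture_measure : set 'rV[R]_d -> \bar R :=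
  measure_add (mscale (NngNum (onem_clamp01_ge0 t)) mu)
              (mscale (NngNum (clamp01_ge0 t)) nu).

HB.instance Definition _ := Measure.on mixture_measure.

Lemma mixture_measureE A :
  mixture_measure A = (1 - clamp01 t)%:E * mu A + (clamp01 t)%:E * nu A.
Proof. by rewrite /mixture_measure measure_addE. Qed.

Let mixture_setT : mixture_measure setT = 1.
Proof. by rewrite mixture_measureE !probability_setT !mule1 -EFinD subrK. Qed.

HB.instance Definition _ :=
  Measure_isProbability.Build _ _ _ mixture_measure mixture_setT.

Let mixture_cell : mixture_measure cell = 1.
Proof. by rewrite mixture_measureE !tprob_cell !mule1 -EFinD subrK. Qed.

Definition mixture : tprob R d := TProb mixture_cell.

End mixture.

Definition linear_derivative {R : realType} {d : nat} (phi : tprob R d -> R)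
    (dphi : tprob R d -> 'rV[R]_d -> R) : Prop :=
  forall mu mu' : tprob R d,
    phi mu' - phi mu =
    \int[lebesgue_measure]_(t in `[0, 1])
      (\int[mu']_x dphi (mixture t mu mu') x
       - \int[mu]_x dphi (mixture t mu mu') x).

(* An element of P^2_+(T^d): a measure together with its C^2 density. *)
Record pdens (R : realType) (d : nat) := PDens {
  pdens_prob :> tprob R d ;
  dens : 'rV[R]_d -> R ;
  dens_periodic : periodic dens ;
  dens_C2 : C2 dens ;
  dens_gt0 : forall x, 0 < dens x ;
  dens_spec : forall A, measurable A ->
    pdens_prob A = (\int[lebesgue_rV R d]_(x in A `&` cell) (dens x)%:E)%E }.

Definition Ent {R : realType} {d : nat} (mu : pdens R d) : R :=
  torus_int (fun x => dens mu x * ln (dens mu x)).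

Definition Fisher {R : realType} {d : nat} (mu : pdens R d) : R :=
  torus_int (fun x => sqnorm (grad (dens mu) x) / dens mu x).

Definition Phi {R : realType} {d : nat} (rho nu : R) (F : tprob R d -> R)
    (mu : pdens R d) : R :=
  rho * nu * Ent mu + nu ^+ 2 / 2 * Fisher mu + F mu.

Record admissible_test_flow {R : realType} {d : nat}
    (S : R -> pdens R d -> pdens R d) : Prop := {
  flow0 : forall mu x, dens (S 0 mu) x = dens mu x ;
  flow_C2 : forall mu,
    C2_norm (fun x => dens (S h mu) x - dens mu x) @[h --> 0^'+] --> 0%E ;
  flow_velocity : exists V : pdens R d -> 'rV[R]_d -> R, forall mu,
    [/\ continuous (V mu), periodic (V mu) &
      sup_norm (fun x => h^-1 * (dens (S h mu) x - dens mu x) - V mu x)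
        @[h --> 0^'+] --> 0%E] }.

Record standing_assumption {R : realType} {d : nat} (F : tprob R d -> R)
    (f : 'rV[R]_d -> tprob R d -> R) : Prop := {
  potential_bounded_below : exists c, forall mu, c <= F mu ;
  potential_derivative : linear_derivative F (fun mu x => f x mu) ;
  cost_periodic : forall mu, periodic (f ^~ mu) ;
  cost_C2 : forall mu, C2 (f ^~ mu) ;
  cost_C2_bounded : (ereal_sup [set C2_norm (f ^~ mu) | mu in setT] < +oo)%E ;
  cost_measure_derivative :
    exists df : 'rV[R]_d -> tprob R d -> 'rV[R]_d -> R,
    [/\ forall x, linear_derivative (f x) (df x),
        forall mu y, periodic (fun x => df x mu y),
        forall x mu, periodic (df x mu) &
        continuous (fun z : 'rV[R]_d * tprob R d * 'rV[R]_d =>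
          df z.1.1 z.1.2 z.2)] /\
    [/\ forall i mu y, has_partial i (fun x => df x mu y),
        forall i, continuous (fun z : 'rV[R]_d * tprob R d * 'rV[R]_d =>
          partial i (fun x => df x z.1.2 z.2) z.1.1),
        forall j x mu, has_partial j (df x mu) &
        forall j, continuous (fun z : 'rV[R]_d * tprob R d * 'rV[R]_d =>
          partial j (df z.1.1 z.1.2) z.2)] /\
    [/\ forall i j mu y, has_partial i (fun x => partial j (df x mu) y),
        forall i j, continuous (fun z : 'rV[R]_d * tprob R d * 'rV[R]_d =>
          partial i (fun x => partial j (df x z.1.2) z.2) z.1.1),
        forall j x mu, has_partial j (partial j (df x mu)) &
        continuous (fun z : 'rV[R]_d * tprob R d * 'rV[R]_d =>
          laplacian (df z.1.1 z.1.2) z.2)] }.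

Record filtration {R : realType} {dO : measure_display}
    {Omega : measurableType dO} (G : R -> set (set Omega)) : Prop := {
  filtration_sigma_algebra : forall t, 0 <= t -> sigma_algebra setT (G t) ;
  filtration_measurable : forall t, 0 <= t -> G t `<=` measurable ;
  filtration_nondecreasing : forall s t, 0 <= s -> s <= t -> G s `<=` G t }.

Definition measurable_wrt {R : realType} {d : nat} {Omega : Type}
    (G : set (set Omega)) (X : Omega -> 'rV[R]_d) : Prop :=
  forall B, measurable B -> G (X @^-1` B).

(* The increment over [s, t] is independent of the past and its coordinates are
   independent centred Gaussian variables with standard deviation
   sqrt (t - s). *)
Record brownian_motion {R : realType} {d : nat} {dO : measure_display}
    {Omega : measurableType dO} (P : probability Omega R)
    (G : R -> set (set Omega)) (W : R -> Omega -> 'rV[R]_d) : Prop := {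
  brownian0 : {ae P, forall w, W 0 w = 0} ;
  brownian_adapted : forall t, 0 <= t -> measurable_wrt (G t) (W t) ;
  brownian_continuous :
    forall w, {within `[0, +oo[, continuous (fun t => W t w)} ;
  brownian_increment : forall s t, 0 <= s -> s < t ->
    forall (A : set Omega) (B : 'I_d -> set R),
    G s A -> (forall i, measurable (B i)) ->
    P (A `&` [set w | forall i, B i (rV_coord i (W t w - W s w))]) =
    (P A * \prod_(i < d) normal_prob 0 (Num.sqrt (t - s)) (B i))%E }.

Definition progressively_measurable {R : realType} {d : nat}
    {dO : measure_display} {Omega : measurableType dO}
    (G : R -> set (set Omega)) (a : R -> Omega -> 'rV[R]_d) : Prop :=
  forall t, 0 <= t ->
    measurable_fun (`[0, t] `*` setT : set (R * g_sigma_algebraType (G t)))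
      (fun p => a p.1 p.2).

Section mean_field_game.
Context {R : realType} {d : nat} {dO : measure_display}
  {Omega : measurableType dO}.
Variables (P : probability Omega R) (G : R -> set (set Omega)).
Variables (W : R -> Omega -> 'rV[R]_d) (rho nu : R).
Variable f : 'rV[R]_d -> tprob R d -> R.

(* The solution of dX = a dt + sqrt (2 nu) dW with X_0 = xi. A control whose
   paths are not locally integrable has infinite cost, so that the value of
   the integral is irrelevant for it. *)
Definition state (xi : Omega -> 'rV[R]_d) (a : R -> Omega -> 'rV[R]_d) (t : R)
    (w : Omega) : 'rV[R]_d :=
  xi w + (\row_i \int[lebesgue_measure]_(s in `[0, t]) (a s w ord0 i))
  + Num.sqrt (2 * nu) *: W t w.

Definition cost (m : R -> tprob R d) (xi : Omega -> 'rV[R]_d)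
    (a : R -> Omega -> 'rV[R]_d) : \bar R :=
  (\int[P]_w \int[lebesgue_measure]_(t in `[0%R, +oo[)
    (expR (- (rho * t)) *
      (2^-1 * sqnorm (a t w) + f (state xi a t w) (m t)))%:E)%E.

Definition has_torus_law (X : Omega -> 'rV[R]_d) (mu : tprob R d) : Prop :=
  forall A, measurable A -> P [set w | A (torus_proj (X w))] = mu A.

Definition optimal (m : R -> tprob R d) (xi : Omega -> 'rV[R]_d)
    (a : R -> Omega -> 'rV[R]_d) : Prop :=
  progressively_measurable G a /\
  forall b, progressively_measurable G b -> (cost m xi a <= cost m xi b)%E.

Definition equilibrium_from (mu : tprob R d) (m : R -> tprob R d) : Prop :=
  same_law (m 0) mu /\
  exists xi : Omega -> 'rV[R]_d, exists a : R -> Omega -> 'rV[R]_d,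
    [/\ measurable_wrt (G 0) xi, has_torus_law xi (m 0), optimal m xi a &
        forall t, 0 <= t -> has_torus_law (state xi a t) (m t)].

Definition stationary_equilibrium (mu : tprob R d) : Prop :=
  equilibrium_from mu (fun=> mu).

End mean_field_game.

(* Main.v *)
(** Write m for the density of mu, k_h for the increment of the density along the flow, and
    g = f(., mu) + rho nu ln m - nu^2 (div (grad m / m) + |grad m|^2 / (2 m^2)).
    Since k_h = O(h) uniformly and k_h -> 0 in C^2, Phi (S_h mu) - Phi mu = \int g k_h + o(h); the
    gradient term of the Fisher information is o(h) because \int |d_i k|^2 = - \int k d_i d_i k.
    So it is enough that \int g r = 0 for every C^2 function r of mean zero.

    Averaging along one axis at a time reduces this to r = d_i zeta.  An optimal control a keeps the
    law of the state equal to mu, so E (nu ln m)(X_t) is constant and the drift must compensate the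
    diffusion; by Young's inequality \int_0^T E|a|^2 >= T nu^2 I(mu), and the equilibrium cost is at
    least (nu^2/2 I(mu) + \int f m) / rho.  On the other hand, for small e of either sign the
    feedback drift b_t = (nu grad q_t - e exp(-t) zeta e_i) / q_t moves the law along
    q_t = m + e (1 - exp(-t)) r.  Implemented by an Euler scheme, so that no stochastic differential
    equation has to be solved, it costs (nu^2/2 I(mu) + \int f m) / rho + c e \int g r + O(e^2)
    with c > 0, and optimality forces \int g r = 0. *)

Require Import Defs.
From HB Require Import structures.
From mathcomp Require Import all_boot all_order all_algebra.
From mathcomp Require Import all_classical all_reals all_analysis.
From mathcomp Require Import measurable_realfun ring lra.
Import Order.TTheory GRing.Theory Num.Def Num.Theory.
Import numFieldNormedType.Exports.
Import Defs.
Local Open Scope classical_set_scope.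
Local Open Scope ring_scope.
Set Implicit Arguments.
Unset Strict Implicit.

(** * Measures and integrals *)

(** The equilibrium is known only through optimality in a control problem where [mu] is frozen in
    [f], so costs are compared directly, without value function or PDE system. The initial law
    cannot be perturbed, hence [q_t] starts at [m]. The profile 1 - exp(-t) makes the discounted
    integrals explicit: the position derivative [I1] gets the weight 1/rho - 1/(rho + 1) and the
    speed derivative [I2] the weight 1/(rho + 1). The first-order cost is therefore e (I1 + rho I2)
    / (rho (rho + 1)), and I2 = nu \int r ln m by parts; this is where rho nu Ent enters. The
    competitor needs bounds uniform in the mesh. Through an Euler step a test function keeps only a
    bound and a Lipschitz constant; the Lipschitz gradient that consistency requires comes from the
    Gaussian noise of that same step. At mesh delta it costs delta^(-1/2) against a squared drift
    displacement of order delta^2, so the local error is o(delta). The equilibrium control is only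
    progressively measurable and could have infinite energy, so the lower bound is obtained from
    increments over short intervals instead of stochastic calculus. *)

Section rV_measurable.
Context {R : realType} {d : nat}.

Definition box (B : 'I_d -> set R) : set 'rV[R]_d :=
  [set x | forall i, B i (rV_coord i x)].

Lemma measurable_box (B : 'I_d -> set R) :
  (forall i, measurable (B i)) -> measurable (box B).
Proof.
move=> mB; rewrite (_ : box B = \big[setI/setT]_(i < d) (rV_coord i @^-1` B i)).
  apply: bigsetI_measurable => i _; rewrite -[X in measurable X]setTI.
  exact: measurable_rV_coord.
apply/seteqP; split=> x.
  by move=> Bx; rewrite -bigcap_seq => i _; exact: Bx.
by rewrite -bigcap_seq => Bx i; apply: Bx; rewrite /= mem_index_enum.
Qed.

Lemma norm_coord_le (x : 'rV[R]_d) i : `|x ord0 i| <= `|x|.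
Proof.
have /mapP[j Hj ->] : `|x ord0 i| \in [seq `|x k.1 k.2| | k : 'I_1 * 'I_d].
  by apply/mapP; exists (ord0, i) => //=; rewrite mem_enum.
by rewrite [leRHS]/normr /= mx_normrE; apply/bigmax_geP; right => /=; exists j.
Qed.

Lemma norm_rV_le (x : 'rV[R]_d) (M : R) : 0 <= M -> (forall i, `|x ord0 i| <= M) -> `|x| <= M.
Proof.
move=> M0 xM; rewrite [leLHS]/normr /= mx_normrE.
by apply/bigmax_leP; split => //= -[k i] _ /=; rewrite (ord1 k); exact: xM.
Qed.

(** The sigma-algebra is generated by the coordinates, so openness is traced back to boxes: each
    point of [U] lies in a cube inside [U] with rational centre and radius 1/(n+1), and there are
    countably many such cubes. *)
Lemma open_rV_measurable (U : set 'rV[R]_d) : open U -> measurable U.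
Proof.
move=> oU.
pose B (q : 'rV[rat]_d * nat) : set 'rV[R]_d :=
  box (fun i => ball (ratr (q.1 ord0 i) : R) (q.2.+1%:R^-1)).
have mB q : measurable (B q).
  by apply: measurable_box => i; exact: measurable_ball.
rewrite (_ : U = \bigcup_(q in [set q | B q `<=` U]) B q).
  rewrite bigcup_mkcond.
  have -> : \bigcup_i (if i \in [set q | B q `<=` U] then B i else set0) =
     \bigcup_k (oapp (fun i => if i \in [set q | B q `<=` U] then B i else set0)
       set0 (unpickle k)).
    apply/seteqP; split=> x [k _].
      by move=> Hx; exists (pickle k) => //=; rewrite pickleK.
    by case: unpickle => [q /= Hq|//]; exists q.
  apply: bigcupT_measurable => k; case: unpickle => [q /=|]; last exact: measurable0.
  by case: ifP => // _; exact: measurable0.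
apply/seteqP; split=> x; last by move=> [q qU]; exact: qU.
move=> Ux; have /nbhs_ballP[e /= e0 xeU] := open_nbhs_nbhs (conj oU Ux).
(* Half of [e], because a point of the cube is reached from [x] through the rational centre. *)
have [n ne] : exists n, n.+1%:R^-1 < e / 2.
  have := @near_infty_natSinv_lt R (PosNum (divr_gt0 e0 (ltr0n R 2))).
  by move=> [n _ /(_ n (leqnn n))/= ?]; exists n.
have n0 : 0 < n.+1%:R^-1 :> R by rewrite invr_gt0.
have /choice[q Hq] : forall i, exists r : rat, ball (x ord0 i) (n.+1%:R^-1) (ratr r : R).
  move=> i; have := @dense_rat R (ball (x ord0 i) n.+1%:R^-1).
  case; first by exists (x ord0 i); exact: ballxx.
    exact: ball_open.
  by move=> y [By [r _ ry]]; exists r; rewrite ry.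
exists (\row_i q i, n) => /=.
  move=> y Hy; apply: xeU; rewrite -ball_normE/=.
  apply: (@le_lt_trans _ _ (n.+1%:R^-1 + n.+1%:R^-1)); last first.
    by rewrite [ltRHS](splitr e) ltrD.
  apply: norm_rV_le; first by rewrite addr_ge0// ltW.
  move=> i; have /= := Hy i; have := Hq i; rewrite !mxE -!ball_normE/= /rV_coord.
  move=> H1 H2; rewrite -[x ord0 i](subrK (ratr (q i))) -addrA.
  by rewrite (le_trans (ler_normD _ _))// lerD// ltW.
by move=> i /=; rewrite mxE; apply: ball_sym; exact: Hq.
Qed.

Lemma continuous_rV_measurable (f : 'rV[R]_d -> R) :
  continuous f -> measurable_fun setT f.
Proof.
move=> /continuousP cf.
apply: (measurability _ (RGenOpens.measurableE R)).
move=> _ [_ [a [b ->]] <-]; rewrite setTI.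
by apply: open_rV_measurable; apply: cf; exact: itv_open.
Qed.

(** Boxes form a pi-system that generates the sigma-algebra: a coordinate preimage is the box whose
    other sides are the whole line. *)
Lemma rV_measure_unique (m1 m2 : {measure set 'rV[R]_d -> \bar R}) :
  (m1 setT < +oo)%E ->
  (forall B : 'I_d -> set R, (forall i, measurable (B i)) ->
    m1 (box B) = m2 (box B)) ->
  forall A, measurable A -> m1 A = m2 A.
Proof.
move=> m1oo m12 A mA.
pose G : set (set 'rV[R]_d) :=
  [set X | exists2 B : 'I_d -> set R, (forall i, measurable (B i)) & X = box B].
have GT : G setT.
  by exists (fun=> setT) => //; apply/seteqP.
apply: (g_sigma_algebra_measure_unique G _ (fun=> setT)) => //.
- by move=> _ [B mB ->]; exact: measurable_box.
- by rewrite bigcup_const.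
- move=> _ _ [B mB ->] [C mC ->]; exists (fun i => B i `&` C i).
    by move=> i; exact: measurableI.
  apply/seteqP; split=> x /=; first by move=> [Bx Cx] i; split; [exact: Bx|exact: Cx].
  by move=> BCx; split=> i; have [] := BCx i.
- by move=> _ [B mB ->]; exact: m12.
- move: A mA; apply: smallest_sub; first exact: smallest_sigma_algebra.
  rewrite -bigcup_seq; apply: bigcup_sub => i _ A [B mB <-].
  apply: sub_sigma_algebra; rewrite setTI.
  exists (fun j => if j == i then B else setT).
    by move=> j; case: ifP.
  apply/seteqP; split=> x /=.
    by move=> Bx j; case: eqP => // ->.
  by move=> /(_ i); rewrite eqxx.
Qed.

Lemma measurable_rVD {disp} {T : measurableType disp} (f g : T -> 'rV[R]_d) :
  measurable_fun setT f -> measurable_fun setT g ->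
  measurable_fun setT (fun x => f x + g x).
Proof.
move=> /measurable_fun_rVP mf /measurable_fun_rVP mg.
apply/measurable_fun_rVP => i.
rewrite (_ : _ \o _ = (rV_coord i \o f) \+ (rV_coord i \o g)); last first.
  by apply/funext => x; rewrite /rV_coord /= mxE.
by apply: measurable_funD; [exact: mf|exact: mg].
Qed.

Lemma measurable_rVZ {disp} {T : measurableType disp} (k : T -> R)
    (g : T -> 'rV[R]_d) :
  measurable_fun setT k -> measurable_fun setT g ->
  measurable_fun setT (fun x => k x *: g x).
Proof.
move=> mk /measurable_fun_rVP mg; apply/measurable_fun_rVP => i.
rewrite (_ : _ \o _ = k \* (rV_coord i \o g)); last first.
  by apply/funext => x; rewrite /rV_coord /= mxE.
by apply: measurable_funM; [exact: mk|exact: mg].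
Qed.

Definition set_coord (i : 'I_d) (x : 'rV[R]_d) (t : R) : 'rV[R]_d :=
  \row_j (if j == i then t else x ord0 j).

Lemma set_coordE (i : 'I_d) (x : 'rV[R]_d) t :
  set_coord i x t = x + (t - x ord0 i) *: basis_vec i.
Proof.
apply/rowP => j; rewrite !mxE eqxx/=; case: eqP => [->|_].
  by rewrite mulr1 addrC subrK.
by rewrite mulr0 addr0.
Qed.

Lemma measurable_set_coord i :
  measurable_fun setT (fun p : 'rV[R]_d * measurableTypeR R => set_coord i p.1 p.2).
Proof.
apply/measurable_fun_rVP => j; rewrite /comp /rV_coord.
case: (eqVneq j i) => [ji|ji].
  rewrite (_ : (fun _ => _) = snd).
    exact: (@measurable_snd _ _ 'rV[R]_d (measurableTypeR R)).
  by apply/funext => p; rewrite mxE ji eqxx.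
rewrite (_ : (fun _ => _) = rV_coord j \o fst).
  by apply: measurableT_comp => //; exact: measurable_rV_coord.
by apply/funext => p; rewrite mxE (negbTE ji).
Qed.

End rV_measurable.

(** The working class of integrands: integrability against a finite measure is automatic, and the
    class is stable under algebra, composition and partial integration. *)
Definition bmeas {disp} {T : measurableType disp} {R : realType} (f : T -> R) :=
  measurable_fun setT f /\ exists M, forall x, `|f x| <= M.

Section bounded_measurable.
Context {disp} {T : measurableType disp} {R : realType}.
Implicit Types f g : T -> R.

Lemma bmeas_integrable (mu : {finite_measure set T -> \bar R}) f :
  bmeas f -> mu.-integrable setT (EFin \o f).
Proof.
move=> [mf [M fM]]; apply: measurable_bounded_integrable => //.
  by rewrite -ge0_fin_numE// fin_num_measure.
by exists M; split; [exact: num_real|move=> x Mx y _; exact: le_trans (fM y) (ltW Mx)].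
Qed.

Lemma bmeas_cst (c : R) : bmeas (fun _ : T => c).
Proof. by split; [exact: measurable_cst|exists `|c|]. Qed.

Lemma bmeasD f g : bmeas f -> bmeas g -> bmeas (fun x => f x + g x).
Proof.
move=> [mf [M fM]] [mg [N gN]]; split; first exact: measurable_funD.
by exists (M + N) => x; rewrite (le_trans (ler_normD _ _))// lerD.
Qed.

Lemma bmeasN f : bmeas f -> bmeas (fun x => - f x).
Proof.
move=> [mf [M fM]]; split; first exact: measurable_funN.
by exists M => x; rewrite normrN.
Qed.

Lemma bmeasB f g : bmeas f -> bmeas g -> bmeas (fun x => f x - g x).
Proof. by move=> ? ?; apply: bmeasD => //; exact: bmeasN. Qed.

Lemma bmeasM f g : bmeas f -> bmeas g -> bmeas (fun x => f x * g x).
Proof.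
move=> [mf [M fM]] [mg [N gN]]; split; first exact: measurable_funM.
by exists (M * N) => x; rewrite normrM ler_pM.
Qed.

Lemma bmeas_sum (I : Type) (s : seq I) (F : I -> T -> R) :
  (forall i, bmeas (F i)) -> bmeas (fun x => \sum_(i <- s) F i x).
Proof.
move=> bF; elim: s => [|i s IH].
  by under eq_fun do rewrite big_nil; exact: bmeas_cst.
by under eq_fun do rewrite big_cons; exact: bmeasD.
Qed.

Lemma bmeas_comp {disp'} {T' : measurableType disp'} (h : T' -> T) f :
  measurable_fun setT h -> bmeas f -> bmeas (fun x => f (h x)).
Proof.
move=> mh [mf [M fM]]; split; first exact: measurableT_comp mf mh.
by exists M.
Qed.

Section Rint.
Variable mu : {finite_measure set T -> \bar R}.

Lemma intD f g : bmeas f -> bmeas g ->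
  \int[mu]_x (f x + g x) = \int[mu]_x f x + \int[mu]_x g x.
Proof. by move=> bf bg; rewrite RintegralD//; exact: bmeas_integrable. Qed.

Lemma intB f g : bmeas f -> bmeas g ->
  \int[mu]_x (f x - g x) = \int[mu]_x f x - \int[mu]_x g x.
Proof. by move=> bf bg; rewrite RintegralB//; exact: bmeas_integrable. Qed.

Lemma intZ (c : R) f : bmeas f -> \int[mu]_x (c * f x) = c * \int[mu]_x f x.
Proof. by move=> bf; rewrite RintegralZl//; exact: bmeas_integrable. Qed.

Lemma int_cst (c : R) : \int[mu]_x c = c * fine (mu setT).
Proof. by rewrite Rintegral_cst. Qed.

Lemma int_eq_cst f (c : R) : (forall x, f x = c) -> \int[mu]_x f x = c * fine (mu setT).
Proof. by move=> H; rewrite -int_cst; apply: eq_Rintegral => x _; exact: H. Qed.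

Lemma int_sum (I : Type) (s : seq I) (F : I -> T -> R) :
  (forall i, bmeas (F i)) ->
  \int[mu]_x (\sum_(i <- s) F i x) = \sum_(i <- s) \int[mu]_x F i x.
Proof.
move=> bF; elim: s => [|i s IH].
  by rewrite big_nil; under eq_Rintegral do rewrite big_nil; rewrite int_cst mul0r.
rewrite big_cons -IH -intD//; last exact: bmeas_sum.
by apply: eq_Rintegral => x _; rewrite big_cons.
Qed.

Lemma int_le f g : bmeas f -> bmeas g -> (forall x, f x <= g x) ->
  \int[mu]_x f x <= \int[mu]_x g x.
Proof. by move=> bf bg fg; apply: le_Rintegral => //; exact: bmeas_integrable. Qed.

Lemma int_le_cst f (M : R) : bmeas f -> (forall x, f x <= M) ->
  \int[mu]_x f x <= M * fine (mu setT).
Proof. by move=> bf fM; rewrite -int_cst; apply: int_le => //; exact: bmeas_cst. Qed.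

Lemma int_abs_le f (M : R) : bmeas f -> (forall x, `|f x| <= M) ->
  `|\int[mu]_x f x| <= M * fine (mu setT).
Proof.
move=> bf fM; rewrite ler_norml -mulNr -!int_cst; apply/andP; split;
  apply: int_le => //; try exact: bmeas_cst; move=> x; have := fM x;
  by rewrite ler_norml => /andP[].
Qed.

End Rint.

End bounded_measurable.

Section image_measure.
Context {d1 d2} {T1 : measurableType d1} {T2 : measurableType d2} {R : realType}.
Variables (m : {measure set T1 -> \bar R}) (h : T1 -> T2).
Variable mh : measurable_fun setT h.

Definition image_measure : {measure set T2 -> \bar R} :=
  measure_function_pushforward__canonical__measure_function_Measure m mh.

Lemma image_measureE A : image_measure A = m (h @^-1` A).
Proof. by []. Qed.

End image_measure.

(** [m] is compared with the image of [mu] on measurable sets only: measures here are functions on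
    all sets, and laws are identified on measurable ones. *)
Lemma int_image_integrable {disp disp'} {T : measurableType disp}
    {T' : measurableType disp'} {R : realType} (mu : {measure set T -> \bar R})
    (m : {measure set T' -> \bar R}) (h : T -> T') (k : T' -> R) :
  measurable_fun setT h ->
  (forall A, measurable A -> m A = mu (h @^-1` A)) -> measurable_fun setT k ->
  mu.-integrable setT (EFin \o (k \o h)) ->
  \int[m]_y k y = \int[mu]_x k (h x).
Proof.
move=> mh mE mk ik.
have H := @integral_pushforward _ _ _ _ R h mh mu setT (EFin \o k).
rewrite /Rintegral; have -> : (\int[mu]_x (k (h x))%:E = \int[m]_y (k y)%:E)%E; last by [].
rewrite -[LHS]/((\int[mu]_(x in h @^-1` setT) ((EFin \o k) \o h) x)%E) -H//.
- by apply: eq_measure_integral => A mA _; rewrite mE.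
- exact/measurable_EFinP.
Qed.

Lemma int_image {disp disp'} {T : measurableType disp} {T' : measurableType disp'}
    {R : realType} (mu : {finite_measure set T -> \bar R})
    (m : {measure set T' -> \bar R}) (h : T -> T') (k : T' -> R) :
  measurable_fun setT h ->
  (forall A, measurable A -> m A = mu (h @^-1` A)) -> bmeas k ->
  \int[m]_y k y = \int[mu]_x k (h x).
Proof.
move=> mh mE bk; apply: int_image_integrable => //; first by case: bk.
by apply: (bmeas_integrable mu (f := fun x => k (h x))); exact: bmeas_comp.
Qed.

Section bounded_fubini.
Context {d1 d2} {T1 : measurableType d1} {T2 : measurableType d2} {R : realType}.
Variables (m1 : {finite_measure set T1 -> \bar R}).
Variables (m2 : {finite_measure set T2 -> \bar R}).

Lemma bmeas_pair1 (f : T1 * T2 -> R) x : bmeas f -> bmeas (fun y => f (x, y)).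
Proof. by move=> bf; apply: bmeas_comp bf; exact: pair1_measurable. Qed.

Lemma bmeas_pair2 (f : T1 * T2 -> R) y : bmeas f -> bmeas (fun x => f (x, y)).
Proof. by move=> bf; apply: bmeas_comp bf; exact: pair2_measurable. Qed.

Lemma bmeas_prod_integrable (f : T1 * T2 -> R) :
  bmeas f -> (m1 \x m2)%E.-integrable setT (EFin \o f).
Proof.
move=> [mf [M fM]]; apply: measurable_bounded_integrable => //.
  rewrite -setXTT [X in (X < _)%E]product_measure1E// lte_mul_pinfty//.
    by rewrite fin_num_measure.
  by rewrite -ge0_fin_numE// fin_num_measure.
by exists M; split; [exact: num_real|move=> x Mx y _; exact: le_trans (fM y) (ltW Mx)].
Qed.

Lemma bmeas_int (f : T1 * T2 -> R) : bmeas f ->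
  bmeas (fun x => \int[m2]_y f (x, y)).
Proof.
move=> bf; split.
  apply: (measurableT_comp (f := fine)) => //.
  exact: (measurable_fubini_F (bmeas_prod_integrable bf)).
have [_ [M fM]] := bf.
by exists (M * fine (m2 setT)) => x; apply: int_abs_le => //; exact: bmeas_pair1.
Qed.

Lemma int_prod (f : T1 * T2 -> R) : bmeas f ->
  \int[(m1 \x m2)%E]_z f z = \int[m1]_x \int[m2]_y f (x, y).
Proof.
move=> bf; rewrite /Rintegral -(integral12_prod_meas1 (bmeas_prod_integrable bf)).
congr fine; apply: eq_integral => x _; rewrite fineK//.
apply: integrable_fin_num => //; exact: bmeas_integrable (bmeas_pair1 _ bf).
Qed.

Lemma int_prod2 (f : T1 * T2 -> R) : bmeas f ->
  \int[(m1 \x m2)%E]_z f z = \int[m2]_y \int[m1]_x f (x, y).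
Proof.
move=> bf; rewrite /Rintegral -(integral21_prod_meas1 (bmeas_prod_integrable bf)).
congr fine; apply: eq_integral => x _; rewrite fineK//.
apply: integrable_fin_num => //; exact: bmeas_integrable (bmeas_pair2 _ bf).
Qed.

Lemma int_swap (f : T1 * T2 -> R) : bmeas f ->
  \int[m1]_x \int[m2]_y f (x, y) = \int[m2]_y \int[m1]_x f (x, y).
Proof. by move=> bf; rewrite -int_prod// int_prod2. Qed.

End bounded_fubini.

Section density.
Context {disp} {T : measurableType disp} {R : realType}.
Variables (lam nu : {measure set T -> \bar R}) (D : set T) (w : T -> R).
Hypotheses (mD : measurable D) (mw : measurable_fun setT w).
Hypothesis w0 : forall x, 0 <= w x.
Hypothesis nuE : forall A, measurable A ->
  nu A = (\int[lam]_(x in A `&` D) (w x)%:E)%E.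
Local Open Scope ereal_scope.

Let density_indic E : measurable E ->
  \int[nu]_x (\1_E x)%:E = \int[lam]_(x in D) ((\1_E x)%:E * (w x)%:E).
Proof.
move=> mE; rewrite integral_indic// setIT nuE// setIC integral_mkcondr.
apply: eq_integral => x xD; rewrite patchE indicE.
by case: ifPn => xE; rewrite ?mul1e ?mul0e.
Qed.

Import HBNNSimple.

Let density_nnsfun (f : {nnsfun T >-> R}) :
  \int[nu]_x (f x)%:E = \int[lam]_(x in D) ((f x)%:E * (w x)%:E).
Proof.
under [LHS]eq_integral do rewrite fimfunE -fsumEFin//.
rewrite [LHS]ge0_integral_fsum//; last 2 first.
  - by move=> r; exact/measurable_EFinP/measurableT_comp.
  - by move=> n x _; rewrite EFinM nnfun_muleindic_ge0.
under [RHS]eq_integral.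
  move=> x xD; rewrite fimfunE -fsumEFin// ge0_mule_fsuml; last first.
    by move=> r; rewrite EFinM nnfun_muleindic_ge0.
  over.
have mi r : measurable_fun D (fun x : T => (\1_(f @^-1` [set r]) x)%:E * (w x)%:E).
  apply: measurable_funTS; under eq_fun do rewrite -EFinM.
  by apply/measurable_EFinP; apply: measurable_funM => //; exact: measurable_indic.
rewrite [RHS]ge0_integral_fsum//; last 2 first.
  - move=> r; under eq_fun do rewrite -EFinM.
    apply/measurable_EFinP; apply: measurable_funM; last exact: measurable_funTS.
    by do 2 apply/measurableT_comp => //.
  - by move=> n x _; apply: mule_ge0; rewrite ?lee_fin//; rewrite -lee_fin EFinM nnfun_muleindic_ge0.
apply: eq_fsbigr => r _.
have [r0|r0] := leP 0%R r.
  under [RHS]eq_integral do rewrite EFinM -muleA.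
  rewrite ge0_integralZl//; last by move=> x _; rewrite mule_ge0 ?lee_fin.
  rewrite -density_indic//; under eq_integral do rewrite EFinM.
  by rewrite ge0_integralZl//; exact/measurable_EFinP/measurable_indic.
rewrite preimage_nnfun0//.
by rewrite !integral0_eq// => x _; rewrite indic0 mulr0 ?mul0e.
Qed.

Lemma ge0_integral_density (f : T -> \bar R) :
  measurable_fun setT f -> (forall x, 0 <= f x) ->
  \int[nu]_x f x = \int[lam]_(x in D) (f x * (w x)%:E).
Proof.
move=> mf f0; pose f_ := nnsfun_approx measurableT mf.
transitivity (lim (\int[nu]_x (f_ n x)%:E @[n --> \oo])).
  rewrite -monotone_convergence//=.
  - apply: eq_integral => ? /[!inE] xD; apply/esym/cvg_lim => //=.
    exact: cvg_nnsfun_approx.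
  - by move=> n; exact/measurable_EFinP/measurable_funTS.
  - by move=> n ? _; rewrite lee_fin.
  - by move=> ? _ ? ? mn; rewrite lee_fin; exact/lefP/nd_nnsfun_approx.
rewrite (_ : (fun n => _) = fun n => \int[lam]_(x in D) ((f_ n x)%:E * (w x)%:E)); last first.
  by apply/funext => n; rewrite density_nnsfun.
rewrite -monotone_convergence//=.
- apply: eq_integral => x _; apply/cvg_lim => //.
  apply: cvgeZr => //.
  by apply: cvg_nnsfun_approx.
- move=> n; under eq_fun do rewrite -EFinM.
  by apply/measurable_EFinP/measurable_funTS; exact: measurable_funM.
- by move=> n x _; rewrite mule_ge0 ?lee_fin.
- move=> x _ a b ab; apply: lee_wpmul2r; first by rewrite lee_fin.
  by rewrite lee_fin; exact/lefP/nd_nnsfun_approx.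
Qed.

(** Multiplication by the nonnegative weight [w] commutes with taking positive and negative parts,
    so each part is treated by the nonnegative case. *)
Lemma integral_density (f : T -> R) : measurable_fun setT f ->
  \int[nu]_x (f x)%:E = \int[lam]_(x in D) (f x * w x)%:E.
Proof.
move=> mf.
have mfp : measurable_fun setT ((fun x => (f x)%:E)^\+).
  exact/measurable_funepos/measurable_EFinP.
have mfn : measurable_fun setT ((fun x => (f x)%:E)^\-).
  exact/measurable_funeneg/measurable_EFinP.
rewrite integralE [RHS]integralE !ge0_integral_density//.
congr (_ - _); apply: eq_integral => x _.
  by rewrite !funeposE -!EFin_max -EFinM maxr_pMl// mul0r.
by rewrite !funenegE -!EFinN -!EFin_max -EFinM maxr_pMl// mul0r mulNr.
Qed.

Lemma int_density (f : T -> R) : measurable_fun setT f ->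
  (\int[nu]_x f x = \int[lam]_(x in D) (f x * w x))%R.
Proof. by move=> mf; rewrite /Rintegral integral_density. Qed.

End density.

Lemma int_mrestr {disp} {T : measurableType disp} {R : realType}
    (mu : {measure set T -> \bar R}) (D : set T) (mD : measurable D) (f : T -> R) :
  measurable_fun setT f -> \int[mrestr mu mD]_x f x = \int[mu]_(x in D) f x.
Proof.
move=> mf; rewrite (@int_density _ _ _ mu _ D (fun=> 1))//.
  by apply: eq_Rintegral => x _; rewrite mulr1.
move=> A mA; rewrite /mrestr integral_cst//=; last exact: measurableI.
by rewrite mul1e.
Qed.

(** Fubini in a single coordinate: a measure that is a product on boxes is reproduced, up to the
    mass of its [i]-th factor, when the [i]-th coordinate is redrawn. It serves both the torus and
    Gaussian vectors. *)
Lemma int_resample {R : realType} {d : nat}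
    (k : {finite_measure set 'rV[R]_d -> \bar R})
    (ki : 'I_d -> {finite_measure set (measurableTypeR R) -> \bar R}) (i : 'I_d) (phi : 'rV[R]_d -> R) :
  (forall B : 'I_d -> set R, (forall j, measurable (B j)) ->
    k (box B) = (\prod_(j < d) ki j (B j))%E) ->
  bmeas phi ->
  \int[k]_x \int[ki i]_t phi (set_coord i x t) = fine (ki i setT) * \int[k]_x phi x.
Proof.
move=> kE bphi.
have kiT : (0 <= fine (ki i setT)) by rewrite fine_ge0.
pose c := NngNum kiT.
have bset : bmeas (fun p : 'rV[R]_d * measurableTypeR R => phi (set_coord i p.1 p.2)).
  exact: bmeas_comp (measurable_set_coord i) bphi.
rewrite -(@int_prod _ _ _ _ _ k (ki i)
  (fun p : 'rV[R]_d * measurableTypeR R => phi (set_coord i p.1 p.2)))//.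
transitivity (\int[mscale c k]_x phi x); last first.
  rewrite (@int_density _ _ _ k _ setT (fun=> c%:num))//; last first.
  - by case: bphi.
  - move=> A mA; rewrite setIT integral_cst//=.
  under eq_Rintegral do rewrite mulrC.
  by rewrite intZ.
apply/esym; apply: int_image_integrable.
- exact: measurable_set_coord.
- move=> A mA.
  have mset := @measurable_set_coord R d i.
  have H : forall B : 'I_d -> set R, (forall j, measurable (B j)) ->
    mscale c k (box B) = (k \x ki i)%E ((fun p : 'rV[R]_d * measurableTypeR R => set_coord i p.1 p.2) @^-1` (box B)).
    move=> B mB; rewrite /mscale/= kE//.
    (* Coordinate [i] of the original point is forgotten, so its side becomes the whole line and the
       constraint passes to the fresh sample. *)
    pose B' (j : 'I_d) : set R := if j == i then setT else B j.
    have mB' j : measurable (B' j) by rewrite /B'; case: ifP.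
    rewrite (_ : _ @^-1` _ = box B' `*` B i); last first.
      apply/seteqP; split=> -[x t] /=; rewrite /box /rV_coord/=.
        move=> H; split; last by have := H i; rewrite mxE eqxx.
        by move=> j; rewrite /B'; have := H j; rewrite mxE; case: eqP.
      move=> [H Bt] j; rewrite mxE; case: eqP => [->//|/eqP ji].
      by have := H j; rewrite /B' (negbTE ji).
    rewrite product_measure1E; [|exact: measurable_box|exact: mB].
    rewrite -[X in _ = (X * _)%E]/(k (box B')) (kE B' mB') [in RHS](bigD1 i)//= [in LHS](bigD1 i)//= /B' eqxx fineK ?fin_num_measure//.
    under [in RHS]eq_bigr => j ji do rewrite (negbTE ji).
    by rewrite muleCA muleC.
  apply: (@rV_measure_unique R d (mscale c k) (image_measure (k \x ki i)%E mset) _ H A mA).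
  by rewrite -ge0_fin_numE// fin_num_measure.
- by case: bphi.
- exact: bmeas_prod_integrable bset.
Qed.

(** * The torus *)

Section circle_and_torus.
Context {R : realType}.

Lemma twopi_gt0 : 0 < 2 * pi :> R.
Proof. by rewrite mulr_gt0// pi_gt0. Qed.

Let circle_lty :
  (lebesgue_measure ([set` `[(0 : R)%R, (2 * pi)%R[] : set R) < +oo)%E.
Proof. by rewrite lebesgue_measure_itv/= lte_fin twopi_gt0 -EFinB ltry. Qed.

Definition circle_measure : {finite_measure set (measurableTypeR R) -> \bar R} :=
  measure_function_mfrestr__canonical__measure_function_FiniteMeasure
    (mu := @lebesgue_measure R) (D := [set` `[(0 : R)%R, (2 * pi)%R[])
    (measurable_itv _) circle_lty.

Lemma circle_intE (h : R -> R) : measurable_fun setT h ->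
  \int[circle_measure]_t h t = \int[lebesgue_measure]_(t in `[(0 : R), 2 * pi[) h t.
Proof. by move=> mh; exact: (@int_mrestr _ (measurableTypeR R)). Qed.

Lemma circle_measureT : circle_measure setT = (2 * pi)%:E.
Proof.
by rewrite /circle_measure/= /mfrestr /mrestr setTI lebesgue_measure_itv/= lte_fin twopi_gt0 sube0.
Qed.

Lemma cellE d : @cell R d = box (fun=> [set` `[(0 : R), 2 * pi[]).
Proof. by apply/seteqP; split=> x /= H i; have /= := H i; rewrite in_itv. Qed.

Lemma measurable_torus_cell (d : nat) : measurable (@cell R d).
Proof. by rewrite cellE; exact: measurable_box. Qed.

Lemma lebesgue_rV_box d (B : 'I_d -> set R) : (forall i, measurable (B i)) ->
  lebesgue_rV R d (box B) = (\prod_(i < d) lebesgue_measure (B i))%E.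
Proof.
elim: d B => [|d IH] B mB.
  by rewrite big_ord0/= diracE (_ : box B = setT) ?in_setT//; apply/seteqP; split=> // x _ [].
rewrite big_ord_recl/= /lebesgue_cons /pushforward.
rewrite (_ : _ @^-1` _ = B ord0 `*` box (fun i => B (lift ord0 i))); last first.
  apply/seteqP; split=> -[a v] /=; rewrite /box /rV_coord /rV_cons/=.
    move=> H; split; first by have := H ord0; rewrite mxE unlift_none.
    by move=> i; have := H (lift ord0 i); rewrite mxE liftK.
  move=> [Ba Hv] i; rewrite mxE; case: (unliftP ord0 i) => [j ->|->]//=.
rewrite product_measure1E; [|exact: mB|by apply: measurable_box => i; exact: mB].
by congr (_ * _)%E; exact: IH.
Qed.

Let torus_lty d : (lebesgue_rV R d (@cell R d) < +oo)%E.
Proof.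
rewrite cellE lebesgue_rV_box// (eq_bigr (fun=> (2 * pi)%:E)) ?prodEFin ?ltry//.
by move=> i _; rewrite lebesgue_measure_itv/= lte_fin twopi_gt0 sube0.
Qed.

(** Restricting the measure instead of the domain of integration lets periodic functions be
    integrated over all of R^d by the rules for finite measures. *)
Definition torus_measure d : {finite_measure set 'rV[R]_d -> \bar R} :=
  mfrestr (@measurable_torus_cell d) (@torus_lty d).

Lemma torus_measure_box d (B : 'I_d -> set R) : (forall i, measurable (B i)) ->
  torus_measure d (box B) = (\prod_(i < d) circle_measure (B i))%E.
Proof.
move=> mB; rewrite /torus_measure/= /mfrestr /mrestr cellE.
rewrite (_ : _ `&` _ = box (fun i => B i `&` [set` `[(0 : R), 2 * pi[])).
  by rewrite lebesgue_rV_box// => i; exact: measurableI.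
apply/seteqP; split=> x /=; first by move=> [H1 H2] i; split; [exact: H1|exact: H2].
by move=> H; split=> i; have [] := H i.
Qed.

Lemma torus_measureT d : torus_measure d setT = ((2 * pi) ^+ d)%:E.
Proof.
rewrite (_ : setT = box (fun=> setT)); last by apply/seteqP.
rewrite torus_measure_box// (eq_bigr (fun=> (2 * pi)%:E)); last first.
  by move=> i _; exact: circle_measureT.
by rewrite prodEFin prodr_const card_ord.
Qed.

Lemma torus_intE d (phi : 'rV[R]_d -> R) : measurable_fun setT phi ->
  torus_int phi = \int[torus_measure d]_x phi x.
Proof. by move=> mphi; rewrite /torus_int -(int_mrestr _ (@measurable_torus_cell d)). Qed.

End circle_and_torus.
Arguments circle_measure R : clear implicits.
Arguments torus_measure R d : clear implicits.

Section periodic_continuous.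
Context {R : realType} {d : nat}.
Implicit Types phi : 'rV[R]_d -> R.

Lemma periodicZ phi : periodic phi -> forall x i (k : int),
  phi (x + (2 * pi * k%:~R) *: basis_vec i) = phi x.
Proof.
move=> pphi.
have H x i (n : nat) : phi (x + (2 * pi * n%:R) *: basis_vec i) = phi x.
  elim: n => [|n IH]; first by rewrite mulr0 scale0r addr0.
  by rewrite -[n.+1%:R]natr1 mulrDr mulr1 scalerDl addrA pphi.
move=> x i [n|n]; first exact: H.
by rewrite NegzE mulrNz mulrN scaleNr -[LHS](H _ i n.+1) subrK.
Qed.

Lemma row_sum_basis (x : 'rV[R]_d) : x = \sum_i x ord0 i *: basis_vec i.
Proof. exact: row_sum_delta. Qed.

Lemma periodic_shift phi : periodic phi -> forall (x y : 'rV[R]_d) (k : 'I_d -> int),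
  (forall i, y ord0 i = x ord0 i + 2 * pi * (k i)%:~R) -> phi y = phi x.
Proof.
move=> pphi x y k yx.
have -> : y = x + \sum_i (2 * pi * (k i)%:~R) *: basis_vec i.
  apply/rowP => j; rewrite mxE summxE yx; congr (_ + _).
  rewrite (bigD1 j)//= big1 ?addr0 => [|i ij]; first by rewrite !mxE !eqxx mulr1.
  by rewrite !mxE eqxx/= eq_sym (negbTE ij) mulr0.
elim: (index_enum _) => [|i s IH]; first by rewrite big_nil addr0.
by rewrite big_cons addrCA addrC periodicZ.
Qed.

Lemma periodic_proj phi : periodic phi -> forall x z,
  phi (torus_proj x + z) = phi (x + z).
Proof.
move=> pphi x z; apply/esym/(periodic_shift pphi (k := fun i => Num.floor (x ord0 i / (2 * pi)))).
by move=> i; rewrite !mxE; ring.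
Qed.

Lemma torus_proj_itv (x : 'rV[R]_d) i : 0 <= torus_proj x ord0 i < 2 * pi.
Proof.
rewrite mxE; have p0 := @twopi_gt0 R.
have /andP[H1 H2] := Num.Theory.floor_itv (x ord0 i / (2 * pi)).
rewrite subr_ge0 ltrBlDl; apply/andP; split.
  by rewrite mulrC -ler_pdivlMr.
rewrite -[X in _ + X]mulr1 -mulrDr mulrC -ltr_pdivrMr//.
by rewrite intrD in H2.
Qed.

(** The half-open cell is not compact; its closure is, and still contains a representative of every
    point of the torus. *)
Definition closed_cell : set 'rV[R]_d :=
  [set x | forall i, `[0, 2 * pi]%classic (x ord0 i)].

Lemma compact_closed_cell : compact closed_cell.
Proof. by apply: (@rV_compact R d (fun=> `[0, 2 * pi]%classic)) => i; exact: segment_compact. Qed.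

Lemma torus_proj_closed_cell (x : 'rV[R]_d) : closed_cell (torus_proj x).
Proof.
move=> i; have /andP[H1 /ltW H2] := torus_proj_itv x i.
by rewrite /= in_itv/= H1.
Qed.

Lemma continuous_rVP phi : continuous phi <->
  forall x (e : R), 0 < e -> exists2 h : R, 0 < h &
    forall z, `|z| < h -> `|phi (x + z) - phi x| < e.
Proof.
split=> [cphi x e e0|H x].
  have /cvgrPdist_lt/(_ e e0)/nbhs_ballP[h /= h0 hx] := cphi x.
  exists h => // z zh; rewrite distrC; apply: hx.
  by rewrite -ball_normE/= opprD addNKr normrN.
apply/(@cvgrPdist_lt _ _ _ (nbhs x) (nbhs_filter x)) => e e0; have [h h0 hx] := H x e e0.
apply/nbhs_ballP; exists h => //= y; rewrite -ball_normE/= => xy.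
by rewrite distrC -[y](subrK x) [_ + x]addrC; apply: hx; rewrite distrC.
Qed.

Definition cper phi := continuous phi /\ periodic phi.

Lemma cper_bounded phi : cper phi -> exists M : R, forall x, `|phi x| <= M.
Proof.
move=> [cphi pphi].
have : \forall M \near +oo, forall x, closed_cell x -> `|phi x| <= M.
  apply: (proj1 (compact_near_coveringP _) compact_closed_cell).
  move=> x _; exists ((fun y => `|phi x - phi y| < 1) : set 'rV[R]_d, (fun M => `|phi x| + 1 <= M) : set R).
    split=> /=; first by have /cvgrPdist_lt := cphi x; apply.
    exact: nbhs_pinfty_ge.
  move=> [y M] /= [xy xM]; rewrite (le_trans _ xM)//.
  by rewrite -[phi y](subrK (phi x)) addrC (le_trans (ler_normD _ _))// lerD2l ltW// distrC.
move=> [M [_ HM]]; exists (M + 1) => x.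
rewrite -[x]addr0 -(periodic_proj pphi) addr0.
by apply: HM; [rewrite ltrDl|exact: torus_proj_closed_cell].
Qed.

Lemma cper_bmeas phi : cper phi -> bmeas phi.
Proof.
move=> cp; split; last exact: cper_bounded.
by apply: continuous_rV_measurable; case: cp.
Qed.

Lemma cper_unif phi : cper phi -> forall e : R, 0 < e ->
  exists2 h : R, 0 < h & forall x z, `|z| < h -> `|phi (x + z) - phi x| < e.
Proof.
move=> [cphi pphi] e e0.
have : \forall z \near (0 : 'rV[R]_d), forall x, closed_cell x -> `|phi (x + z) - phi x| < e.
  apply: (proj1 (compact_near_coveringP _) compact_closed_cell _ (nbhs (0 : 'rV[R]_d))).
  (* Both [phi (y + z)] and [phi y] are compared with [phi x], each within [e / 2]; the radii
     [h / 2] keep [y + z] within [h] of [x]. *)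
  move=> x _; have e2 : 0 < e / 2 by rewrite divr_gt0.
  have [h h0 xh] := (continuous_rVP phi).1 cphi x _ e2.
  have h2 : 0 < h / 2 by rewrite divr_gt0.
  exists (ball x (h / 2), ball (0 : 'rV[R]_d) (h / 2)).
    by split=> /=; exact: nbhsx_ballx.
  move=> [y z] /=; rewrite -!ball_normE/= sub0r normrN => -[xy zh].
  have H1 : `|phi (y + z) - phi x| < e / 2.
    rewrite -(subrK x y) [_ + x]addrC -addrA; apply: xh.
    rewrite (le_lt_trans (ler_normD _ _))// [ltRHS](splitr h) ltrD//.
    by rewrite distrC.
  have H2 : `|phi x - phi y| < e / 2.
    rewrite distrC -(subrK x y) [_ + x]addrC; apply: xh.
    by rewrite distrC (lt_trans xy)// ltr_pdivrMr// ltr_pMr// ltr1n.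
  rewrite -(subrK (phi x) (phi (y + z))) -addrA (le_lt_trans (ler_normD _ _))//.
  by rewrite [ltRHS](splitr e) ltrD.
move=> /nbhs_ballP[h /= h0 H]; exists h => // x z zh.
have := H z _ _ (torus_proj_closed_cell x); rewrite (periodic_proj pphi).
have -> : phi (torus_proj x) = phi x by rewrite -[torus_proj x]addr0 (periodic_proj pphi) addr0.
apply.
by rewrite -ball_normE/= sub0r normrN.
Qed.

Lemma cper_cst (c : R) : cper (fun=> c).
Proof. by split=> //; exact: cst_continuous. Qed.

Lemma cperD phi psi : cper phi -> cper psi -> cper (fun x => phi x + psi x).
Proof.
move=> [c1 p1] [c2 p2]; split; last by move=> x i; rewrite p1 p2.
by move=> x; apply: continuousD; [exact: c1|exact: c2].
Qed.

Lemma cperN phi : cper phi -> cper (fun x => - phi x).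
Proof.
move=> [c1 p1]; split; last by move=> x i; rewrite p1.
by move=> x; apply: continuousN; exact: c1.
Qed.

Lemma cperB phi psi : cper phi -> cper psi -> cper (fun x => phi x - psi x).
Proof. by move=> ? ?; apply: cperD => //; exact: cperN. Qed.

Lemma cperM phi psi : cper phi -> cper psi -> cper (fun x => phi x * psi x).
Proof.
move=> [c1 p1] [c2 p2]; split; last by move=> x i; rewrite p1 p2.
by move=> x; apply: continuousM; [exact: c1|exact: c2].
Qed.

Lemma cperV phi : cper phi -> (forall x, phi x != 0) -> cper (fun x => (phi x)^-1).
Proof.
move=> [c1 p1] phi0; split; last by move=> x i; rewrite p1.
by move=> x; apply: continuousV => //; exact: c1.
Qed.

Lemma cper_sum (I : Type) (s : seq I) (F : I -> 'rV[R]_d -> R) :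
  (forall i, cper (F i)) -> cper (fun x => \sum_(i <- s) F i x).
Proof.
move=> cF; elim: s => [|i s IH].
  by under eq_fun do rewrite big_nil; exact: cper_cst.
by under eq_fun do rewrite big_cons; exact: cperD.
Qed.

Lemma cper_shift phi a : cper phi -> cper (fun x => phi (x + a)).
Proof.
move=> [c1 p1]; split; last by move=> x i; rewrite addrAC p1.
apply/continuous_rVP => x e e0.
have [h h0 H] := (continuous_rVP phi).1 c1 (x + a) e e0.
by exists h => // z zh; rewrite addrAC H.
Qed.

Lemma cper_lower_bound phi : cper phi -> (forall x, 0 < phi x) ->
  exists2 c : R, 0 < c & forall x, c <= phi x.
Proof.
move=> cp phi0.
have [M HM] := cper_bounded (cperV cp (fun x => lt0r_neq0 (phi0 x))).
have M0 : 0 < M.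
  by apply: lt_le_trans (HM 0); rewrite normr_gt0 invr_neq0// lt0r_neq0.
exists M^-1; first by rewrite invr_gt0.
move=> x; rewrite -[leRHS]invrK lef_pV2 ?posrE ?invr_gt0//.
by apply: le_trans (HM x); rewrite ler_norm.
Qed.

End periodic_continuous.

(** * Antiderivatives and integrals over one period *)

Section antiderivative.
Context {R : realType}.
Implicit Types h : R -> R.

Lemma derivative_continuous h dh : (forall x, is_derive x (1 : R) h (dh x)) ->
  continuous h.
Proof.
move=> H x; apply/differentiable_continuous/derivable1_diffP.
exact: (@ex_derive _ _ _ _ _ _ _ (H x)).
Qed.

Lemma continuous_integrable_itv h a b : continuous h ->
  lebesgue_measure.-integrable `[a, b] (EFin \o h).
Proof.
move=> ch; apply: continuous_compact_integrable; first exact: segment_compact.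
exact: continuous_subspaceT.
Qed.

(** The oriented integral from 0 is differentiated near [x] by comparing it with the integral from a
    base point [- c] left of both 0 and [x]: the two differ by a constant, and the second falls
    under the fundamental theorem. *)
Lemma antiderivative h : continuous h ->
  exists2 H : R -> R, H 0 = 0 & forall x, is_derive x (1 : R) H (h x).
Proof.
move=> ch.
pose H x := \int[lebesgue_measure]_(t in `]0%R, x]) h t
            - \int[lebesgue_measure]_(t in `]x, 0%R]) h t.
pose A c x := \int[lebesgue_measure]_(t in `[- c, x]) h t.
have HA c x : - c <= 0 -> - c <= x -> H x = A c x - A c 0.
  move=> c0 cx; rewrite /H /A.
  have [x0|x0] := leP 0 x.
    rewrite (@Rintegral_itvB R h (BLeft (- c)) (BRight x) 0) ?bnd_simp//; last first.
      exact: continuous_integrable_itv.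
    by rewrite [in X in _ - X]set_itv_ge ?bnd_simp -?leNgt// Rintegral_set0 subr0.
  rewrite -[RHS]opprB (@Rintegral_itvB R h (BLeft (- c)) (BRight 0) x) ?bnd_simp//; last 2 first.
    exact: continuous_integrable_itv.
    exact: ltW.
  by rewrite [in X in X - _]set_itv_ge ?bnd_simp -?leNgt 1?ltW// Rintegral_set0 sub0r.
exists H.
  by rewrite /H subrr.
move=> x; pose c := `|x| + 1.
have c0 : - c < 0 by rewrite oppr_lt0 ltr_wpDl.
have cx : - c < x by rewrite ltrNl (le_lt_trans (ler_norm _))// normrN ltrDl.
have x1 : x < x + 1 by rewrite ltrDl.
have [dA A'] := @continuous_FTC1_closed R h (- c) x (x + 1) x1
  (continuous_integrable_itv _ _ ch) cx (ch x).
have idA : is_derive x (1 : R) (A c) (h x) by apply: DeriveDef; [exact: dA|rewrite -derive1E; exact: A'].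
have idB : is_derive x (1 : R) (fun y => A c y - A c 0) (h x).
  by rewrite -[h x]subr0; apply: is_deriveB.
apply: (@near_eq_is_derive _ _ _ (fun y => A c y - A c 0) H) => //.
near=> y; rewrite (HA c y)//; first exact: ltW.
by apply: ltW; near: y; exact: lt_nbhsr.
Unshelve. all: by end_near. Qed.

Lemma circle_int_derive h dh : (forall x, is_derive x (1 : R) h (dh x)) -> continuous dh ->
  \int[circle_measure R]_t dh t = h (2 * pi) - h 0.
Proof.
move=> H cdh; rewrite circle_intE; last exact: continuous_measurable_fun.
rewrite Rintegral_itv_bndo_bndc; last first.
  apply: integrableS (continuous_integrable_itv 0 (2 * pi) cdh) => //.
  by apply: subset_itvl; rewrite bnd_simp.
have ch := derivative_continuous H.
rewrite /Rintegral (@continuous_FTC2 R dh h) //.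
- exact: twopi_gt0.
- exact: continuous_subspaceT.
- split; first by move=> x _; exact: (@ex_derive _ _ _ _ _ _ _ (H x)).
    exact/cvg_at_right_filter/ch.
  exact/cvg_at_left_filter/ch.
- by move=> x _; rewrite derive1E; exact: (@derive_val _ _ _ _ _ _ _ (H x)).
Qed.

(** For an antiderivative [H], the function H (t + 2 pi) - H t has derivative 0 by periodicity, so
    its values at [a] and at 0 agree. *)
Lemma circle_int_shift h a : continuous h -> (forall t, h (t + 2 * pi) = h t) ->
  \int[circle_measure R]_t h (t + a) = \int[circle_measure R]_t h t.
Proof.
move=> ch ph; have [H _ HH] := antiderivative ch.
rewrite (circle_int_derive HH ch).
have Hs b x : is_derive x (1 : R) (fun t => H (t + b)) (h (x + b)).
  rewrite -[h (x + b)]mulr1.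
  have D : is_derive x (1 : R) (fun t => t + b) 1.
    by rewrite -[1 in X in is_derive _ _ _ X]addr0; apply: is_deriveD.
  exact: (@is_derive1_comp R H (fun t => t + b) x (h (x + b)) 1 (HH (x + b)) D).
rewrite (@circle_int_derive (fun t => H (t + a))) //; last first.
  move=> x; have := @continuous_comp _ _ _ (fun t : R => t + a) h x _ (ch _); apply.
  by apply: cvgD; [exact: cvg_id|exact: cvg_cst].
have D x : is_derive x (1 : R) (fun t => H (t + 2 * pi) - H t) 0.
  by rewrite -(subrr (h x)) -{1}ph; apply: is_deriveB.
have := @is_derive_0_is_cst R (fun t => H (t + 2 * pi) - H t) a 0 D.
by rewrite !add0r [a + _]addrC.
Qed.

End antiderivative.

(** * Partial derivatives of periodic functions *)

Section partial_derivatives.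
Context {R : realType} {d : nat}.
Implicit Types (phi psi p q : 'rV[R]_d -> R) (i j : 'I_d).

(** A relation between [phi] and a candidate derivative, phrased along a coordinate line at 0, so
    that the one-variable rules apply and derivatives can be exhibited. *)
Definition pderiv i phi p :=
  forall x, is_derive (0 : R) (1 : R) (fun t : R => phi (x + t *: basis_vec i)) (p x).

Lemma pderivP i phi : has_partial i phi -> pderiv i phi (partial i phi).
Proof.
move=> H x; have E : (fun h : R => h^-1 *: ((fun t : R => phi (x + t *: basis_vec i)) (h *: 1 + 0)
    - phi (x + 0 *: basis_vec i))) =
    (fun h : R => h^-1 *: (phi (h *: basis_vec i + x) - phi x)).
  by apply/funext => h; rewrite addr0 scaler1 scale0r addr0 [x + _]addrC.
apply: DeriveDef.
  by have := H x; rewrite /derivable -E.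
by rewrite /partial /derive -E.
Qed.

Lemma pderiv_line i phi p : pderiv i phi p -> forall x (t : R),
  is_derive t (1 : R) (fun s : R => phi (x + s *: basis_vec i)) (p (x + t *: basis_vec i)).
Proof.
move=> H x t.
have D : is_derive t (1 : R) (fun s : R => s - t) 1.
  by rewrite -[1 in X in is_derive _ _ _ X]subr0; apply: is_deriveB.
have H0 : is_derive (t - t) (1 : R)
    (fun s : R => phi ((x + t *: basis_vec i) + s *: basis_vec i)) (p (x + t *: basis_vec i)).
  by rewrite subrr; exact: H.
have := @is_derive1_comp R _ (fun s : R => s - t) t _ 1 H0 D.
rewrite mulr1; congr is_derive; apply/funext => s /=.
by rewrite -addrA -scalerDl [t + _]addrC subrK.
Qed.

Lemma eq_pderiv i phi p q : p =1 q -> pderiv i phi p -> pderiv i phi q.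
Proof. by move=> /funext ->. Qed.

Lemma pderiv_cst i (c : R) : pderiv i (fun=> c) (fun=> 0).
Proof. by move=> x; exact: is_derive_cst. Qed.

Lemma pderivD i phi psi p q : pderiv i phi p -> pderiv i psi q ->
  pderiv i (fun x => phi x + psi x) (fun x => p x + q x).
Proof. by move=> H1 H2 x; have := H1 x; have := H2 x => ? ?; exact: is_deriveD. Qed.

Lemma pderivN i phi p : pderiv i phi p -> pderiv i (fun x => - phi x) (fun x => - p x).
Proof. by move=> H1 x; have := H1 x => ?; exact: is_deriveN. Qed.

Lemma pderivB i phi psi p q : pderiv i phi p -> pderiv i psi q ->
  pderiv i (fun x => phi x - psi x) (fun x => p x - q x).
Proof. by move=> ? ?; apply: pderivD => //; exact: pderivN. Qed.

Lemma pderivM i phi psi p q : pderiv i phi p -> pderiv i psi q ->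
  pderiv i (fun x => phi x * psi x) (fun x => phi x * q x + psi x * p x).
Proof.
move=> H1 H2 x; have := H1 x; have := H2 x => D1 D2.
have := @is_deriveM _ _ _ _ _ _ _ _ D2 D1.
by rewrite !scale0r !addr0.
Qed.

Lemma pderivZ i phi p (c : R) : pderiv i phi p ->
  pderiv i (fun x => c * phi x) (fun x => c * p x).
Proof.
move=> H; apply: eq_pderiv (pderivM (pderiv_cst i c) H) => x /=.
by rewrite mulr0 addr0.
Qed.

Lemma pderiv_comp1 i (g dg : R -> R) phi p : pderiv i phi p ->
  (forall x, is_derive (phi x) (1 : R) g (dg (phi x))) ->
  pderiv i (fun x => g (phi x)) (fun x => dg (phi x) * p x).
Proof.
move=> H Hg x.
have D : is_derive (phi (x + (0 : R) *: basis_vec i)) (1 : R) g (dg (phi x)).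
  by rewrite scale0r addr0.
exact: (@is_derive1_comp R g (fun t : R => phi (x + t *: basis_vec i)) 0 _ _ D (H x)).
Qed.

Lemma pderivV i phi p : pderiv i phi p -> (forall x, phi x != 0) ->
  pderiv i (fun x => (phi x)^-1) (fun x => - p x / phi x ^+ 2).
Proof.
move=> H phi0 x; have D := H x.
have phi0' : phi (x + (0 : R) *: basis_vec i) != 0 by rewrite scale0r addr0.
have := @is_deriveV R (fun t : R => phi (x + t *: basis_vec i)) 0 (p x) 1 phi0' D.
rewrite scale0r addr0 /GRing.scale/=; congr is_derive.
by rewrite -exprVn mulrC mulNr -mulrN.
Qed.

Lemma pderiv_ln i phi p : pderiv i phi p -> (forall x, 0 < phi x) ->
  pderiv i (fun x => ln (phi x)) (fun x => p x / phi x).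
Proof.
move=> H phi0; apply: eq_pderiv (pderiv_comp1 (dg := fun y => y^-1) H _).
  by move=> x /=; rewrite mulrC.
by move=> x; exact: is_derive1_ln.
Qed.

Lemma pderiv_mvt i phi p : pderiv i phi p -> forall x (t : R),
  exists2 c : R, `|c| <= `|t| &
    phi (x + t *: basis_vec i) - phi x = p (x + c *: basis_vec i) * t.
Proof.
move=> H x t; have L := pderiv_line H x.
have C := derivative_continuous L.
have [t0|t0] := leP 0 t.
  have [c] := MVT_segment t0 (fun y _ => L y) (continuous_subspaceT C).
  rewrite in_itv/= => /andP[c0 ct]; rewrite scale0r addr0 subr0 => E.
  by exists c => //; rewrite !ger0_norm.
have [c] := MVT_segment (ltW t0) (fun y _ => L y) (continuous_subspaceT C).
rewrite in_itv/= => /andP[c0 ct]; rewrite scale0r addr0 sub0r => E.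
exists c; last by rewrite -opprB E mulrN opprK.
by rewrite !ler0_norm ?lerN2// ltW.
Qed.

Lemma norm_scale_basis (c : R) i : `|c *: basis_vec i| <= `|c| :> R.
Proof.
apply: norm_rV_le => // j; rewrite !mxE normrM ler_piMr//.
by case: (_ && _); rewrite ?normr1 ?normr0 ?ler01.
Qed.

Lemma pderiv_unif i phi p : pderiv i phi p -> cper p -> forall e : R, 0 < e ->
  exists2 h : R, 0 < h & forall x (t : R), `|t| < h ->
    `|phi (x + t *: basis_vec i) - phi x - t * p x| <= e * `|t|.
Proof.
move=> H cp e e0; have [h h0 Hh] := cper_unif cp e0; exists h => // x t th.
have [c ct ->] := pderiv_mvt H x t.
rewrite [t * _]mulrC -mulrBl normrM ler_wpM2r// ltW// Hh//.
by rewrite (le_lt_trans (norm_scale_basis _ _))// (le_lt_trans ct).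
Qed.

(** Converse of [pderiv_unif]. Together they differentiate under an integral: a first-order estimate
    uniform in the base point survives averaging. *)
Lemma pderiv_est i phi p :
  (forall x (e : R), 0 < e -> exists2 h : R, 0 < h & forall t : R, `|t| < h ->
    `|phi (x + t *: basis_vec i) - phi x - t * p x| <= e * `|t|) ->
  pderiv i phi p.
Proof.
move=> H x.
suff C : h^-1 *: ((fun t : R => phi (x + t *: basis_vec i)) (h *: 1 + 0)
    - phi (x + (0 : R) *: basis_vec i)) @[h --> (0 : R)^'] --> p x.
  by apply: DeriveDef; [apply/cvg_ex; exists (p x)|exact/cvg_lim].
apply/cvgrPdist_le => e e0; have [h h0 Hh] := H x e e0.
exists h => // t /=; rewrite sub0r normrN => th t0.
rewrite addr0 scaler1 scale0r addr0.
have -> : p x - t^-1 *: (phi (x + t *: basis_vec i) - phi x) =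
   - (t^-1 * (phi (x + t *: basis_vec i) - phi x - t * p x)).
  by rewrite /GRing.scale/=; field.
by rewrite normrN normrM normfV ler_pdivrMl ?normr_gt0// [_ * e]mulrC; exact: Hh.
Qed.

Lemma periodic_pderiv i phi p : pderiv i phi p -> periodic phi -> periodic p.
Proof.
move=> H pphi x j.
have D1 := H (x + (2 * pi) *: basis_vec j); have D2 := H x.
have E : (fun t : R => phi (x + (2 * pi) *: basis_vec j + t *: basis_vec i)) =
    (fun t : R => phi (x + t *: basis_vec i)).
  by apply/funext => t; rewrite addrAC pphi.
rewrite E in D1.
by rewrite -(@derive_val _ _ _ _ _ _ _ D1) -(@derive_val _ _ _ _ _ _ _ D2).
Qed.

End partial_derivatives.

(** * Integration by parts and translation invariance on the torus *)

Section torus_integration.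
Context {R : realType} {d : nat}.
Implicit Types (phi psi p q : 'rV[R]_d -> R) (i j : 'I_d).

Lemma torus_resample i phi : bmeas phi ->
  \int[torus_measure R d]_x \int[circle_measure R]_t phi (set_coord i x t) =
  2 * pi * \int[torus_measure R d]_x phi x.
Proof.
move=> bphi; rewrite (@int_resample R d _ (fun=> circle_measure R))//.
  by rewrite circle_measureT.
exact: torus_measure_box.
Qed.

Lemma cper_line phi i x : cper phi ->
  continuous (fun t : R => phi (x + t *: basis_vec i)) /\
  forall t : R, phi (x + (t + 2 * pi) *: basis_vec i) = phi (x + t *: basis_vec i).
Proof.
move=> [cphi pphi]; split.
  move=> t; apply/cvgrPdist_lt => e e0.
  have [h h0 H] := (continuous_rVP phi).1 cphi (x + t *: basis_vec i) e e0.
  exists h => //= s /= ts.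
  have -> : x + s *: basis_vec i = (x + t *: basis_vec i) + (s - t) *: basis_vec i.
    by rewrite -addrA -scalerDl [t + _]addrC subrK.
  rewrite distrC H// (le_lt_trans (norm_scale_basis _ _))//.
  by rewrite distrC.
by move=> t; rewrite scalerDl addrA pphi.
Qed.

Lemma circle_set_coord phi i x : cper phi ->
  \int[circle_measure R]_t phi (set_coord i x t) =
  \int[circle_measure R]_t phi (x + t *: basis_vec i).
Proof.
move=> cp; have [c1 c2] := cper_line i x cp.
rewrite -(circle_int_shift (- x ord0 i) c1 c2).
by apply: eq_Rintegral => t _; rewrite set_coordE.
Qed.

(** Integrating coordinate [i] first leaves the difference of [phi] over one period, which is 0; the
    factor 2 pi produced by [torus_resample] is then cancelled. *)
Lemma torus_int_pderiv i phi p : cper phi -> cper p -> pderiv i phi p ->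
  \int[torus_measure R d]_x p x = 0.
Proof.
move=> cphi cp H; apply/eqP; rewrite -(mulrI_eq0 _ (mulfI (lt0r_neq0 (@twopi_gt0 R)))).
rewrite -(torus_resample i (cper_bmeas cp)).
rewrite (@int_eq_cst _ _ _ _ _ 0) ?mul0r// => x.
rewrite circle_set_coord// (circle_int_derive (pderiv_line H x)); last first.
  by have [] := cper_line i x cp.
by have [_ pp] := cphi; rewrite scale0r addr0 pp subrr.
Qed.

Lemma torus_int_by_parts i phi psi p q : cper phi -> cper psi -> cper p -> cper q ->
  pderiv i phi p -> pderiv i psi q ->
  \int[torus_measure R d]_x (phi x * q x) = - \int[torus_measure R d]_x (p x * psi x).
Proof.
move=> c1 c2 c3 c4 H1 H2; apply/eqP; rewrite -addr_eq0 -intD; last 2 first.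
  by apply/cper_bmeas; exact: cperM.
  by apply/cper_bmeas; exact: cperM.
apply/eqP; apply: (torus_int_pderiv (cperM c1 c2)).
  by apply: cperD; exact: cperM.
by apply: eq_pderiv (pderivM H1 H2) => x; rewrite [psi x * _]mulrC.
Qed.

Lemma torus_int_shift phi a : cper phi ->
  \int[torus_measure R d]_x phi (x + a) = \int[torus_measure R d]_x phi x.
Proof.
move=> cp; rewrite (row_sum_basis a).
elim: (index_enum _) => [|i s IH].
  by apply: eq_Rintegral => x _; rewrite big_nil addr0.
rewrite -IH.
set b := \sum_(i <- s) _.
have E : \int[torus_measure R d]_x phi (x + \sum_(k <- (i :: s)) a ord0 k *: basis_vec k) =
    \int[torus_measure R d]_x phi (x + b + a ord0 i *: basis_vec i).
  by apply: eq_Rintegral => x _; rewrite big_cons -/b addrA addrAC.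
rewrite {}E.
have cb := cper_shift b cp.
have cs : cper (fun x => phi (x + b + a ord0 i *: basis_vec i)).
  have := cper_shift (b + a ord0 i *: basis_vec i) cp.
  by congr cper; apply/funext => x; rewrite addrA.
apply: (mulfI (lt0r_neq0 (@twopi_gt0 R))).
rewrite -(torus_resample i (cper_bmeas cb)) -(torus_resample i (cper_bmeas cs)).
apply: eq_Rintegral => x _.
rewrite (circle_set_coord i x cs) (circle_set_coord i x cb).
have [c1 c2] := cper_line i x cb.
rewrite -(circle_int_shift (a ord0 i) c1 c2).
apply: eq_Rintegral => t _; congr phi.
by rewrite scalerDl !addrA [LHS]addrAC.
Qed.

End torus_integration.

(** * Averages along coordinate lines *)

Section averaging.
Context {R : realType} {d : nat}.
Implicit Types (phi psi p q : 'rV[R]_d -> R) (i j : 'I_d).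

Definition avg i phi x : R :=
  (2 * pi)^-1 * \int[circle_measure R]_t phi (x + t *: basis_vec i).

Lemma cper_line_bmeas phi i x : cper phi ->
  bmeas (fun t : measurableTypeR R => phi (x + t *: basis_vec i)).
Proof.
move=> cp; split; last by have [M HM] := cper_bounded cp; exists M.
have [c1 _] := cper_line i x cp.
exact: (continuous_measurable_fun c1).
Qed.

Lemma avg_le i phi (M : R) x : cper phi -> (forall y, `|phi y| <= M) -> `|avg i phi x| <= M.
Proof.
move=> cp HM; have p0 := @twopi_gt0 R.
rewrite /avg normrM gtr0_norm ?invr_gt0// ler_pdivrMl// mulrC.
have := @int_abs_le _ _ _ (circle_measure R) (fun t => phi (x + t *: basis_vec i)) M
  (cper_line_bmeas i x cp) (fun t => HM _).
by rewrite circle_measureT.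
Qed.

Lemma avgB i phi psi x : cper phi -> cper psi ->
  avg i (fun y => phi y - psi y) x = avg i phi x - avg i psi x.
Proof.
by move=> c1 c2; rewrite /avg intB -?mulrBr//; exact: cper_line_bmeas.
Qed.

Lemma avgZ i phi (c : R) x : cper phi ->
  avg i (fun y => c * phi y) x = c * avg i phi x.
Proof.
move=> c1; rewrite /avg intZ; last exact: cper_line_bmeas.
by rewrite [LHS]mulrCA.
Qed.

Lemma avg_shift i phi a x : avg i phi (x + a) = avg i (fun y => phi (y + a)) x.
Proof. by rewrite /avg; congr (_ * _); apply: eq_Rintegral => t _; rewrite addrAC. Qed.

Lemma cper_avg i phi : cper phi -> cper (avg i phi).
Proof.
move=> cp; split.
  apply/continuous_rVP => x e e0.
  have e2 : 0 < e / 2 by rewrite divr_gt0.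
  have [h h0 H] := cper_unif cp e2; exists h => // z zh.
  rewrite avg_shift -avgB//; last exact: cper_shift.
  apply: (@le_lt_trans _ _ (e / 2)); last by rewrite ltr_pdivrMr// ltr_pMr// ltr1n.
  apply: avg_le; first by apply: cperB => //; exact: cper_shift.
  by move=> y; apply/ltW/H.
move=> x j; rewrite avg_shift /avg; congr (_ * _); apply: eq_Rintegral => t _.
by have [_ ->] := cp.
Qed.

Lemma pderiv_avg i j phi p : cper phi -> cper p -> pderiv j phi p ->
  pderiv j (avg i phi) (avg i p).
Proof.
move=> c1 c2 H; apply: pderiv_est => x e e0.
have [h h0 Hh] := pderiv_unif H c2 e0; exists h => // t th.
rewrite avg_shift -avgB//; last exact: cper_shift.
have cs : cper (fun y => phi (y + t *: basis_vec j) - phi y).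
  by apply: cperB => //; exact: cper_shift.
have cz : cper (fun y => t * p y) by apply: cperM => //; exact: cper_cst.
rewrite -avgZ// -avgB//; apply: avg_le; first exact: cperB.
by move=> y; exact: Hh.
Qed.

Lemma torus_int_avg i phi : cper phi ->
  \int[torus_measure R d]_x avg i phi x = \int[torus_measure R d]_x phi x.
Proof.
move=> cp; rewrite /avg intZ.
  apply: (mulfI (lt0r_neq0 (@twopi_gt0 R))); rewrite mulrA divff ?mul1r ?lt0r_neq0 ?twopi_gt0//.
  rewrite -(torus_resample i (cper_bmeas cp)); apply: eq_Rintegral => x _.
  by rewrite circle_set_coord.
have := cperM (cper_cst (2 * pi : R)) (cper_avg i cp) => /cper_bmeas; congr bmeas.
by apply/funext => x; rewrite /avg mulrA divff ?mul1r// lt0r_neq0// twopi_gt0.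
Qed.

Definition constant_along i phi := forall x (t : R), phi (x + t *: basis_vec i) = phi x.

Lemma avg_constant i phi : cper phi -> constant_along i (avg i phi).
Proof.
move=> cp x s; rewrite /avg; congr (_ * _).
have [c1 c2] := cper_line i x cp.
rewrite -(circle_int_shift s c1 c2); apply: eq_Rintegral => t _.
by rewrite addrAC scalerDl addrA.
Qed.

Lemma avg_constant_along i j phi : constant_along j phi -> constant_along j (avg i phi).
Proof.
move=> H x s; rewrite avg_shift /avg; congr (_ * _); apply: eq_Rintegral => t _.
by rewrite H.
Qed.

Lemma avg_id i phi x : constant_along i phi -> avg i phi x = phi x.
Proof.
move=> H; rewrite /avg (@int_eq_cst _ _ _ _ _ (phi x)) => [|t]; last exact: H.
by rewrite circle_measureT [LHS]mulrCA mulVf ?mulr1// lt0r_neq0// twopi_gt0.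
Qed.

(** The derivatives are existential data, so that averages and differences inherit the class by
    exhibiting theirs. *)
Definition C2per phi := exists p : 'I_d -> 'rV[R]_d -> R,
  exists q : 'I_d -> 'I_d -> 'rV[R]_d -> R,
  [/\ cper phi, forall i, cper (p i), forall i j, cper (q i j),
      forall i, pderiv i phi (p i) & forall i j, pderiv j (p i) (q i j)].

Lemma C2per_avg i phi : C2per phi -> C2per (avg i phi).
Proof.
move=> [p [q [c1 c2 c3 H1 H2]]].
exists (fun j => avg i (p j)), (fun j k => avg i (q j k)); split.
- exact: cper_avg.
- by move=> j; exact: cper_avg.
- by move=> j k; exact: cper_avg.
- by move=> j; exact: pderiv_avg.
- by move=> j k; exact: pderiv_avg.
Qed.

Lemma C2per_sub phi psi : C2per phi -> C2per psi -> C2per (fun x => phi x - psi x).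
Proof.
move=> [p [q [c1 c2 c3 H1 H2]]] [p' [q' [c1' c2' c3' H1' H2']]].
exists (fun j x => p j x - p' j x), (fun j k x => q j k x - q' j k x).
split; [exact: cperB|by move=> ?; exact: cperB|by move=> ? ?; exact: cperB|
  by move=> ?; exact: pderivB|by move=> ? ?; exact: pderivB].
Qed.

(* A mean-zero r is, up to successive averagings along the coordinate axes, a
   sum of functions whose mean vanishes on every line parallel to some axis. *)
Lemma torus_int_orthogonal (g r : 'rV[R]_d -> R) : cper g ->
  (forall i phi, C2per phi -> (forall x, avg i phi x = 0) ->
    \int[torus_measure R d]_x (g x * phi x) = 0) ->
  C2per r -> \int[torus_measure R d]_x r x = 0 ->
  \int[torus_measure R d]_x (g x * r x) = 0.
Proof.
move=> cg H C2r r0.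
pose M (s : seq 'I_d) := foldr (fun i phi => avg i phi) r s.
have C2M s : C2per (M s) by elim: s => //= i s IH; exact: C2per_avg.
have cM s : cper (M s) by have [p [q []]] := C2M s.
have EM s : \int[torus_measure R d]_x (g x * r x) = \int[torus_measure R d]_x (g x * M s x).
  elim: s => [//|i s ->]; apply/eqP; rewrite -subr_eq0 -intB; last 2 first.
    by apply/cper_bmeas/cperM.
    by apply/cper_bmeas/cperM.
  apply/eqP; under eq_Rintegral do rewrite -mulrBr.
  apply: (H i); first by apply: C2per_sub => //; exact: C2per_avg.
  move=> x; rewrite avgB; [|exact: cM|exact: cM].
  rewrite [avg i (M (i :: s)) x]avg_id; first exact: subrr.
  by apply: avg_constant; exact: cM.
have IM s : \int[torus_measure R d]_x M s x = 0.
  by elim: s => [//|i s IH]; rewrite torus_int_avg.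
have conM s i : i \in s -> constant_along i (M s).
  elim: s => [//|j s IH]; rewrite inE => /predU1P[->|/IH]; first exact: avg_constant.
  exact: avg_constant_along.
have cstM x : M (index_enum 'I_d) x = M (index_enum 'I_d) 0.
  rewrite [in LHS](row_sum_basis x) -[X in M _ X]add0r.
  elim: (X in \sum_(i <- X) _) => [|i s IH]; first by rewrite big_nil addr0.
  by rewrite big_cons addrCA addrC conM// mem_index_enum.
have M0 : M (index_enum 'I_d) 0 = 0.
  have := IM (index_enum 'I_d); rewrite (@int_eq_cst _ _ _ _ _ (M (index_enum 'I_d) 0))//.
  rewrite torus_measureT => /eqP; rewrite mulf_eq0 => /orP[/eqP//|].
  by rewrite /= expf_eq0 (gt_eqF (@twopi_gt0 R)) andbF.
rewrite (EM (index_enum 'I_d)) (@int_eq_cst _ _ _ _ _ 0) ?mul0r// => x.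
by rewrite cstM M0 mulr0.
Qed.

End averaging.

(** * Bounded Lipschitz functions and first-order expansions *)

Section bounded_lipschitz.
Context {R : realType} {d : nat}.
Implicit Types (phi psi : 'rV[R]_d -> R) (i j : 'I_d) (A B : R).

(** A single number bounds both the size and the Lipschitz constant: this is the only norm of a test
    function that is propagated through the Euler scheme. *)
Definition BL A phi := (forall x, `|phi x| <= A) /\
  forall x z, `|phi (x + z) - phi x| <= A * `|z|.

Lemma BL_ge0 A phi : BL A phi -> 0 <= A.
Proof. by move=> [H _]; exact: le_trans (normr_ge0 _) (H 0). Qed.

Lemma BL_le A B phi : A <= B -> BL A phi -> BL B phi.
Proof.
move=> AB [H1 H2]; split=> [x|x z]; first exact: le_trans (H1 x) AB.
by rewrite (le_trans (H2 x z))// ler_wpM2r.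
Qed.

Lemma BL_continuous A phi : BL A phi -> continuous phi.
Proof.
move=> H; have A0 := BL_ge0 H; apply/continuous_rVP => x e e0.
exists (e / (A + 1)); first by rewrite divr_gt0// ltr_wpDl.
move=> z; rewrite ltr_pdivlMr ?ltr_wpDl// => ze.
rewrite (le_lt_trans (H.2 x z))// (le_lt_trans _ ze)// mulrC ler_wpM2l// lerDl//.
Qed.

Lemma BL_cper A phi : BL A phi -> periodic phi -> cper phi.
Proof. by move=> H; split=> //; exact: BL_continuous H. Qed.

Lemma BL_cst (c : R) : BL `|c| (fun=> c).
Proof. by split=> // x z; rewrite subrr normr0 mulr_ge0. Qed.

Lemma BLN A phi : BL A phi -> BL A (fun x => - phi x).
Proof.
move=> [H1 H2]; split=> [x|x z]; first by rewrite normrN.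
by rewrite -opprD normrN.
Qed.

Lemma BLD A B phi psi : BL A phi -> BL B psi -> BL (A + B) (fun x => phi x + psi x).
Proof.
move=> [H1 H2] [H3 H4]; split=> [x|x z].
  by rewrite (le_trans (ler_normD _ _))// lerD.
rewrite opprD addrACA mulrDl (le_trans (ler_normD _ _))// lerD//.
Qed.

Lemma BLM A B phi psi : BL A phi -> BL B psi ->
  BL (A * B *+ 2) (fun x => phi x * psi x).
Proof.
move=> H K; have A0 := BL_ge0 H; have B0 := BL_ge0 K; have AB := mulr_ge0 A0 B0.
move: H K => [H1 H2] [H3 H4]; split=> [x|x z].
  rewrite normrM mulr2n (@le_trans _ _ (A * B))//; last by rewrite lerDl.
  by rewrite ler_pM.
have -> : phi (x + z) * psi (x + z) - phi x * psi x =
  phi (x + z) * (psi (x + z) - psi x) + psi x * (phi (x + z) - phi x) by ring.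
rewrite (le_trans (ler_normD _ _))// !normrM mulr2n mulrDl lerD//.
  by rewrite -mulrA ler_pM.
by rewrite mulrAC mulrC ler_pM.
Qed.

(** 1/c bounds the inverse and A/c^2 is its Lipschitz constant. *)
Lemma BLV A phi (c : R) : 0 < c -> (forall x, c <= phi x) -> BL A phi ->
  BL (c^-1 + A / c ^+ 2) (fun x => (phi x)^-1).
Proof.
move=> c0 Hc H; have A0 := BL_ge0 H; move: H => [H1 H2].
have p0 x : 0 < phi x by exact: lt_le_trans (Hc x).
have iv x : (phi x)^-1 <= c^-1 by rewrite lef_pV2 ?posrE.
split=> [x|x z].
  have i0 : 0 <= (phi x)^-1 by rewrite invr_ge0 ltW.
  by rewrite (ger0_norm i0) (le_trans (iv x))// lerDl divr_ge0// sqr_ge0.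
have -> : (phi (x + z))^-1 - (phi x)^-1 =
    - (phi (x + z) - phi x) * ((phi (x + z))^-1 * (phi x)^-1).
  by field; rewrite !lt0r_neq0.
rewrite normrM normrN mulrDl (@le_trans _ _ (A / c ^+ 2 * `|z|))//; last first.
  by rewrite lerDr mulr_ge0// invr_ge0 ltW.
have P0 : 0 <= (phi (x + z))^-1 * (phi x)^-1 by rewrite mulr_ge0// invr_ge0 ltW.
rewrite mulrAC ler_pM// (ger0_norm P0).
by rewrite expr2 invfM; apply: ler_pM => //; rewrite invr_ge0 ltW.
Qed.

(** Moving the coordinates one after the other joins [x] to [x + z] by segments parallel to the
    axes, on which one-variable calculus applies. *)
Definition trunc_row (k : nat) (z : 'rV[R]_d) : 'rV[R]_d :=
  \row_j (if (j < k)%N then z ord0 j else 0).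

Lemma trunc_row0 z : trunc_row 0 z = 0.
Proof. by apply/rowP => j; rewrite !mxE. Qed.

Lemma trunc_rowd z : trunc_row d z = z.
Proof. by apply/rowP => j; rewrite !mxE ltn_ord. Qed.

Lemma trunc_rowS i z :
  trunc_row i.+1 z = trunc_row i z + z ord0 i *: basis_vec i.
Proof.
apply/rowP => j; rewrite !mxE eqxx/= ltnS leq_eqVlt.
have [->|ji] := eqVneq j i; first by rewrite eqxx ltnn/= mulr1 add0r.
by rewrite -(inj_eq val_inj) in ji; rewrite (negbTE ji)/= mulr0 addr0.
Qed.

Lemma trunc_row_le i z (c : R) : `|c| <= `|z| -> `|trunc_row i z + c *: basis_vec i| <= `|z|.
Proof.
move=> cz; apply: norm_rV_le => // j; rewrite !mxE eqxx/=.
have [->|ji] := eqVneq j i; first by rewrite ltnn mulr1 add0r.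
by rewrite mulr0 addr0; case: ifP => _; rewrite ?normr0// norm_coord_le.
Qed.

Lemma telescope_coord phi x z : phi (x + z) - phi x =
  \sum_(i < d) (phi (x + trunc_row i z + z ord0 i *: basis_vec i)
                - phi (x + trunc_row i z)).
Proof.
have := @telescope_sumr _ 0 d (fun k => phi (x + trunc_row k z)) (leq0n d).
rewrite trunc_row0 trunc_rowd addr0 => <-; rewrite big_mkord.
by apply: eq_bigr => i _; rewrite trunc_rowS addrA.
Qed.

Lemma lipschitz_of_pderiv phi (p : 'I_d -> 'rV[R]_d -> R) (M : R) :
  (forall i, pderiv i phi (p i)) -> (forall i x, `|p i x| <= M) ->
  forall x z, `|phi (x + z) - phi x| <= M *+ d * `|z|.
Proof.
move=> H HM x z; rewrite telescope_coord (le_trans (ler_norm_sum _ _ _))//.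
rewrite -[X in X *+ d](mul1r) -mulrnAl mulrAC.
rewrite (_ : _ * M = \sum_(i < d) M * `|z|); last first.
  by rewrite sumr_const card_ord -mulrnAl; ring.
apply: ler_sum => i _.
have [c _ ->] := pderiv_mvt (H i) (x + trunc_row i z) (z ord0 i).
by rewrite normrM ler_pM// norm_coord_le.
Qed.

Lemma cper_BL phi (p : 'I_d -> 'rV[R]_d -> R) : cper phi -> (forall i, cper (p i)) ->
  (forall i, pderiv i phi (p i)) -> exists A, BL A phi.
Proof.
move=> c1 c2 H; have [M HM] := cper_bounded c1.
have /choice[Mi HMi] : forall i, exists N : R, forall x, `|p i x| <= N.
  by move=> i; exact: cper_bounded (c2 i).
pose N := \sum_i `|Mi i|.
have HN i x : `|p i x| <= N.
  rewrite (le_trans (HMi i x))// (le_trans (ler_norm _))// /N (bigD1 i)//= lerDl.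
  by apply: sumr_ge0.
have L := lipschitz_of_pderiv H HN.
have M0 : 0 <= M by exact: le_trans (normr_ge0 _) (HM 0).
have N0 : 0 <= N *+ d by rewrite mulrn_wge0// sumr_ge0.
exists (M + N *+ d); split=> [x|x z]; first by rewrite (le_trans (HM x))// lerDl.
by rewrite (le_trans (L x z))// ler_wpM2r// lerDr.
Qed.

(** On each of the [d] axis-parallel segments the mean value theorem evaluates [p i] at a point
    within [|z|] of [x], since the norm is the maximum norm. Lipschitz partial derivatives are
    enough, which is what [gauss_smoothing] delivers. *)
Lemma pderiv_expansion phi (p : 'I_d -> 'rV[R]_d -> R) (K : R) :
  (forall i, pderiv i phi (p i)) ->
  (forall i x z, `|p i (x + z) - p i x| <= K * `|z|) ->
  forall x z, `|phi (x + z) - phi x - \sum_i z ord0 i * p i x| <= K *+ d * `|z| ^+ 2.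
Proof.
move=> H HK x z; rewrite telescope_coord -sumrB (le_trans (ler_norm_sum _ _ _))//.
rewrite (_ : K *+ d * _ = \sum_(i < d) K * `|z| ^+ 2); last first.
  by rewrite sumr_const card_ord -mulrnAl.
apply: ler_sum => i _.
have [c cz ->] := pderiv_mvt (H i) (x + trunc_row i z) (z ord0 i).
rewrite mulrC -mulrBr normrM expr2 mulrCA ler_pM ?norm_coord_le//.
rewrite -addrA (le_trans (HK _ _ _))//.
have cz' : `|c| <= `|z| by rewrite (le_trans cz)// norm_coord_le.
apply: ler_wpM2l; last exact: trunc_row_le.
(* The remaining goal is that [K] is nonnegative: it follows from [HK] at a nonzero increment,
   either [z] itself or a basis vector, which has norm 1. *)
have /(le_trans (normr_ge0 _)) := HK i 0 z.
have [->|z0] := eqVneq z 0; last by rewrite pmulr_lge0// normr_gt0.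
have := HK i 0 (basis_vec i).
have -> : `|basis_vec i| = 1 :> R.
  apply/eqP; rewrite eq_le; apply/andP; split.
    by have := norm_scale_basis (1 : R) i; rewrite scale1r normr1.
  by have := norm_coord_le (basis_vec i : 'rV[R]_d) i; rewrite !mxE !eqxx normr1.
by rewrite mulr1 => /(le_trans (normr_ge0 _)).
Qed.

End bounded_lipschitz.

(** * Gaussian smoothing *)

Section normal_moments.
Context {R : realType}.
Variable s : R.
Hypothesis s0 : 0 < s.
Local Notation leb := (@lebesgue_measure R).
Local Notation nrm := (normal_prob (0 : R) s).
Local Notation pdf := (normal_pdf (0 : R) s).

Let sn0 : s != 0. Proof. exact: lt0r_neq0. Qed.

Lemma normal_pdf_explicit t : pdf t = normal_peak s * expR (- (t ^+ 2) / (2 * s ^+ 2)).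
Proof.
rewrite /normal_pdf (negbTE sn0) /normal_fun subr0; congr (_ * expR (_ / _)).
by rewrite -mulr_natr mulrC.
Qed.

(** Half of the Gaussian exponent absorbs the polynomial; the other half is the density of deviation
    sqrt 2 s. *)
Lemma pow4_normal_pdf_le : exists2 C : R, 0 <= C &
  forall t, (1 + t ^+ 4) * pdf t <= C * normal_pdf 0 (Num.sqrt 2 * s) t.
Proof.
have r2 : 0 < Num.sqrt 2 * s by rewrite mulr_gt0// sqrtr_gt0.
(* With y = t^2 / (4 s^2) one has t^4 = 16 s^4 y^2, and y^2 <= 4 exp y, whence the 64. *)
pose K := 1 + 64 * s ^+ 4.
have K0 : 0 <= K by rewrite addr_ge0// mulr_ge0// exprn_ge0// ltW.
exists (K * normal_peak s / normal_peak (Num.sqrt 2 * s)).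
  by rewrite divr_ge0// ?mulr_ge0// ?normal_peak_ge0.
move=> t; rewrite normal_pdf_explicit /normal_pdf gt_eqF// /normal_fun subr0.
have P'0 : normal_peak (Num.sqrt 2 * s) != 0 by rewrite lt0r_neq0// normal_peak_gt0// lt0r_neq0.
set P' := normal_peak (_ * s) in P'0 *; set e2 := (X in _ <= _ * (_ * X)).
have -> : K * normal_peak s / P' * (P' * e2) = normal_peak s * (K * e2) by field.
rewrite mulrCA {}/e2 {P' P'0}.
rewrite ler_wpM2l ?normal_peak_ge0//.
pose y := t ^+ 2 / (4 * s ^+ 2).
have y0 : 0 <= y by rewrite divr_ge0 ?sqr_ge0// mulr_ge0// sqr_ge0.
have -> : - t ^+ 2 / ((Num.sqrt 2 * s) ^+ 2 *+ 2) = - y.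
  by rewrite exprMn sqr_sqrtr// -mulr_natr /y; field.
have -> : - t ^+ 2 / (2 * s ^+ 2) = - y + - y by rewrite /y; field.
have -> : t ^+ 4 = 16 * s ^+ 4 * y ^+ 2 by rewrite /y; field.
rewrite expRD mulrA ler_wpM2r ?expR_ge0// expRN ler_pdivrMr ?expR_gt0//.
have e1 : 1 <= expR y by rewrite -expR0 ler_expR.
have e2 : y ^+ 2 <= 4 * expR y.
  have := expR_ge1Dx (y / 2) => H.
  have h2 : 1 + y / 2 <= expR (y / 2) by [].
  have : (1 + y / 2) ^+ 2 <= expR y.
    rewrite [X in expR X](splitr y) expRD -expr2 ler_pXn2r// ?nnegrE ?expR_ge0//.
    by rewrite addr_ge0// divr_ge0.
  by nra.
have -> : K * expR y = expR y + 64 * s ^+ 4 * expR y by rewrite /K; ring.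
have s4 : 0 <= 16 * s ^+ 4 by rewrite mulr_ge0// exprn_ge0// ltW.
have := ler_wpM2l s4 e2.
lra.
Qed.

Lemma pow4_normal_pdf_bounded : exists C : R, forall t, (1 + t ^+ 4) * pdf t <= C.
Proof.
have [C C0 H] := pow4_normal_pdf_le.
exists (C * normal_peak (Num.sqrt 2 * s)) => t; rewrite (le_trans (H t))// ler_wpM2l//.
by apply: normal_pdf_ub; rewrite lt0r_neq0// mulr_gt0// sqrtr_gt0.
Qed.

(** Degree 4 is the highest moment needed: it comes from the remainder M |z|^2 in the modulus of a
    second derivative. *)
Definition pol4 (f : R -> R) :=
  measurable_fun [set: R] f /\ exists C : R, forall t, `|f t| <= C * (1 + t ^+ 4).

Lemma pol4_integrable_pdf f : pol4 f ->
  leb.-integrable [set: R] (fun t => (f t * pdf t)%:E).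
Proof.
move=> [mf [C HC]]; have [C' C0 H] := pow4_normal_pdf_le.
apply: (@le_integrable _ (measurableTypeR R) R _ _ measurableT _
  (fun t => (`|C| * C' * normal_pdf 0 (Num.sqrt 2 * s) t)%:E)).
- by apply/measurable_EFinP/measurable_funM => //; exact: measurable_normal_pdf.
- move=> t _; rewrite /= lee_fin normrM [`|pdf t|]ger0_norm ?normal_pdf_ge0//.
  rewrite [leRHS]ger0_norm ?mulr_ge0// ?normal_pdf_ge0//.
  rewrite -mulrA (@le_trans _ _ (`|C| * ((1 + t ^+ 4) * pdf t)))//; last by rewrite ler_wpM2l.
  rewrite mulrA ler_wpM2r ?normal_pdf_ge0// (le_trans (HC t))// ler_wpM2r ?ler_norm//.
  by rewrite addr_ge0// -[4%N]/(2 * 2)%N exprM sqr_ge0.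
- under eq_fun do rewrite EFinM.
  by apply: integrableZl => //; exact: integrable_normal_pdf.
Qed.

Let nrm_density (A : set (measurableTypeR R)) : measurable A ->
  nrm A = (\int[leb]_(x in A `&` setT) (pdf x)%:E)%E.
Proof. by rewrite setIT. Qed.

Lemma normal_int f : measurable_fun [set: R] f ->
  \int[nrm]_t f t = \int[leb]_t (f t * pdf t).
Proof.
move=> mf; rewrite (@int_density _ _ _ leb nrm setT pdf)//.
- exact: measurable_normal_pdf.
- by move=> x; exact: normal_pdf_ge0.
Qed.

Lemma pol4_integrable f : pol4 f -> nrm.-integrable [set: measurableTypeR R] (EFin \o f).
Proof.
move=> pf; have [mf _] := pf; apply/integrableP; split; first exact/measurable_EFinP.
under eq_integral do rewrite /= .
rewrite (@integral_density _ _ _ leb nrm setT pdf)//.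
- have /integrableP[_] := pol4_integrable_pdf pf; apply: le_lt_trans.
  rewrite le_eqVlt; apply/orP; left; apply/eqP; apply: eq_integral => t _.
  by rewrite /= normrM [X in _ = (_ * X)%:E]ger0_norm// normal_pdf_ge0.
- exact: measurable_normal_pdf.
- by move=> x; exact: normal_pdf_ge0.
- exact: measurableT_comp.
Qed.

Lemma pol4_bounded (f : R -> R) (M : R) : measurable_fun [set: R] f -> (forall t, `|f t| <= M) -> pol4 f.
Proof.
move=> mf HM; split=> //; exists M => t; rewrite (le_trans (HM t))// ler_peMr//.
  exact: le_trans (normr_ge0 _) (HM 0).
by rewrite lerDl -[4%N]/(2 * 2)%N exprM sqr_ge0.
Qed.

Lemma pol4_monom (u : R -> R) (M : R) (k : nat) : (k <= 4)%N ->
  measurable_fun [set: R] u -> (forall t, `|u t| <= M) ->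
  pol4 (fun t => u t * t ^+ k).
Proof.
move=> k4 mu HM; split.
  by apply: measurable_funM => //; exact: exprn_measurable.
exists M => t; rewrite normrM ler_pM// normrX.
have [t1|t1] := leP `|t| 1.
  by rewrite (@le_trans _ _ 1) ?exprn_ile1// lerDl -[4%N]/(2 * 2)%N exprM sqr_ge0.
rewrite (@le_trans _ _ (`|t| ^+ 4))//; first by rewrite ler_eXn2l.
by rewrite -normrX ger0_norm ?lerDr// -[4%N]/(2 * 2)%N exprM sqr_ge0.
Qed.

(** The integral over [-(n+1), n+1] is a difference of two values of [F], each at most C/(n+1);
    dominated convergence identifies the limit. *)
Lemma integral_derivative0 (F f : R -> R) (C : R) :
  (forall t, is_derive t (1 : R) F (f t)) -> continuous f ->
  leb.-integrable [set: R] (EFin \o f) -> (forall t, `|t * F t| <= C) ->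
  \int[leb]_t f t = 0.
Proof.
move=> HF cf intf HC.
pose fn (n : nat) := f \_ [set` `[- n.+1%:R, n.+1%:R]].
have mfn n : measurable_fun setT (EFin \o fn n).
  apply/measurable_EFinP/(measurable_restrictT f (measurable_itv _)).
  by apply: measurable_funTS; exact: continuous_measurable_fun.
have cvfn : {ae leb, forall x, setT x -> (EFin \o fn n) x @[n --> \oo] --> (f x)%:E}.
  apply: aeW => x _; apply/fine_cvgP; split; first by near=> n.
  apply: cvg_near_cst; near=> n; rewrite /= /fn patchE ifT// inE/= in_itv/= -ler_norml.
  apply: (@le_trans _ _ n%:R); last by rewrite ler_nat.
  by near: n; exact: nbhs_infty_ger.
have bfn : {ae leb, forall x n, setT x -> (`|(EFin \o fn n) x| <= (`|f x|)%:E)%E}.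
  apply: aeW => x n _; rewrite /= lee_fin /fn patchE.
  by case: ifP => _ //; rewrite normr0.
have mf : measurable_fun setT (EFin \o f).
  by apply/measurable_EFinP; exact: continuous_measurable_fun.
have intnf : leb.-integrable setT (fun x => (`|f x|)%:E) by exact: integrable_norm.
have [_ _ cv] := @dominated_convergence _ _ _ leb setT measurableT (fun n => EFin \o fn n)
  (EFin \o f) (fun x => (`|f x|)%:E) mfn mf cvfn intnf bfn.
have E n : (\int[leb]_x (fn n x)%:E = (F n.+1%:R - F (- n.+1%:R))%:E)%E.
  have -> : (\int[leb]_x (fn n x)%:E = \int[leb]_(x in `[(- n.+1%:R)%R, n.+1%:R%R]) (f x)%:E)%E.
    by rewrite [RHS]integral_mkcond; apply: eq_integral => x _; rewrite /fn restrict_EFin.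
  have cF := derivative_continuous HF.
  rewrite (@continuous_FTC2 R f F)//.
  - by rewrite -subr_gt0 opprK -natrD ltr0n.
  - exact: continuous_subspaceT.
  - split; first by move=> x _; exact: (@ex_derive _ _ _ _ _ _ _ (HF x)).
      exact/cvg_at_right_filter/cF.
    exact/cvg_at_left_filter/cF.
  - by move=> x _; rewrite derive1E; exact: (@derive_val _ _ _ _ _ _ _ (HF x)).
have cv0 : (\int[leb]_x (EFin \o fn n) x)%E @[n --> \oo] --> (0 : \bar R).
  under eq_fun do rewrite E.
  apply: cvg_EFin; first by near=> n.
  apply/cvgrPdist_le => e e0; near=> n; rewrite /= sub0r normrN.
  have n0 : 0 < n.+1%:R :> R by rewrite ltr0n.
  have B1 : `|F n.+1%:R| <= C / n.+1%:R.
    by rewrite ler_pdivlMr// mulrC -{1}(ger0_norm (ltW n0)) -normrM.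
  have B2 : `|F (- n.+1%:R)| <= C / n.+1%:R.
    by rewrite ler_pdivlMr// mulrC -{1}(ger0_norm (ltW n0)) -[`|_%:R|]normrN -normrM.
  rewrite (le_trans (ler_normB _ _))// (le_trans (lerD B1 B2))//.
  rewrite -mulrDl ler_pdivrMr// -ler_pdivrMl// mulrC.
  rewrite (le_trans (ler_norm _))//.
  apply: (@le_trans _ _ n%:R); last by rewrite ler_nat.
  by near: n; exact: nbhs_infty_ger.
by rewrite /Rintegral (cvg_unique _ cv cv0).
Unshelve. all: by end_near. Qed.

Lemma is_derive_normal_pdf t : is_derive t (1 : R) pdf (- (t / s ^+ 2) * pdf t).
Proof.
rewrite (_ : pdf = fun t => normal_peak s * expR (- (t ^+ 2) / (2 * s ^+ 2))); last first.
  by apply/funext => x; rewrite normal_pdf_explicit.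
apply: is_derive_eq.
rewrite /GRing.scale/=; field.
by rewrite sn0.
Qed.

(** Stein's identity. The growth degree 3 makes [t * v t * pdf t] bounded, so the boundary terms
    vanish. *)
Lemma gaussian_by_parts (v dv : R -> R) (M : R) (k : nat) : (k <= 3)%N ->
  (forall t, is_derive t (1 : R) v (dv t)) -> continuous dv ->
  (forall t, `|v t| <= M * (1 + `|t| ^+ k)) -> pol4 dv -> pol4 (fun t => v t * t) ->
  \int[nrm]_t dv t = s ^- 2 * \int[nrm]_t (v t * t).
Proof.
move=> k3 Hv cdv vM pdv pvt.
have M0 : 0 <= M.
  have := vM 0; case: k {k3 vM} => [|k]; last by rewrite normr0 exprS mul0r addr0 mulr1; exact: le_trans.
  rewrite expr0 => /(le_trans (normr_ge0 _)); rewrite pmulr_lge0//; lra.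
have cv := derivative_continuous Hv.
have cpdf : continuous pdf by exact: continuous_normal_pdf.
have HF t : is_derive t (1 : R) (fun t => v t * pdf t)
    (dv t * pdf t - s ^- 2 * (v t * t * pdf t)).
  have D1 := Hv t; have D2 := is_derive_normal_pdf t.
  apply: is_derive_eq; rewrite /GRing.scale/=; ring.
have [C HC] := pow4_normal_pdf_bounded.
have i1 := pol4_integrable_pdf pdv.
have i2 := pol4_integrable_pdf pvt.
have i2' : leb.-integrable [set: R] (fun t => (s ^- 2 * (v t * t * pdf t))%:E).
  by under eq_fun do rewrite EFinM; exact: integrableZl.
have : \int[leb]_t (dv t * pdf t - s ^- 2 * (v t * t * pdf t)) = 0.
  apply: (@integral_derivative0 _ _ (M * 2 * C) HF).
  - move=> t; apply: cvgB; first by apply: cvgM; [exact: cdv|exact: cpdf].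
    apply: cvgM; first exact: cvg_cst.
    apply: cvgM; last exact: cpdf.
    by apply: cvgM; [exact: cv|exact: cvg_id].
  - by have := integrableB measurableT i1 i2'; apply: eq_integrable.
  - move=> t; rewrite !normrM [`|pdf t|]ger0_norm ?normal_pdf_ge0//.
    rewrite mulrA -mulrA.
    apply: (@le_trans _ _ (M * 2 * ((1 + t ^+ 4) * pdf t))); last first.
      by rewrite ler_wpM2l ?mulr_ge0.
    rewrite !mulrA ler_wpM2r ?normal_pdf_ge0//.
    rewrite (@le_trans _ _ (`|t| * (M * (1 + `|t| ^+ k))))//; first by rewrite ler_wpM2l.
    rewrite mulrCA -mulrA ler_wpM2l//.
    have -> : t ^+ 4 = `|t| ^+ 4.
      by rewrite -normrX ger0_norm// -[4%N]/(2 * 2)%N exprM sqr_ge0.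
    have a0 := normr_ge0 t; move: (`|t|) a0 => a a0.
    rewrite mulrDr mulr1 -exprS.
    have [a1|a1] := leP a 1.
      have : a ^+ k.+1 <= 1 by rewrite exprn_ile1.
      have : 0 <= a ^+ 4 by rewrite exprn_ge0.
      lra.
    have : a ^+ k.+1 <= a ^+ 4 by rewrite ler_eXn2l.
    have : a <= a ^+ 4 by rewrite -[X in X <= _]expr1 ler_eXn2l.
    lra.
rewrite RintegralB// RintegralZl// => /eqP; rewrite subr_eq0 => /eqP.
by rewrite -!normal_int//; [case: pvt|case: pdv].
Qed.

Let mid : measurable_fun [set: R] (fun t : R => t). Proof. exact: measurable_id. Qed.

Lemma pol4_pow k : (k <= 4)%N -> pol4 (fun t => t ^+ k).
Proof.
move=> k4; have := @pol4_monom (fun=> 1) 1 k k4 (measurable_cst _) _.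
have : (fun t : R => 1 * t ^+ k) = (fun t => t ^+ k) by apply/funext => t; rewrite mul1r.
by move=> <-; apply => t; rewrite normr1.
Qed.

Lemma normal_int_cst (c : R) : \int[nrm]_t c = c.
Proof.
transitivity (c * fine (1%E : \bar R)); last by rewrite /= mulr1.
by rewrite int_cst; congr (_ * fine _); exact: probability_setT.
Qed.

(** This moment and the second and fourth ones are Stein's identity for v = 1, t and t^3. *)
Lemma normal_moment1 : \int[nrm]_t t = 0.
Proof.
have := @gaussian_by_parts (fun=> 1) (fun=> 0) 1 0 isT.
have E : (fun t : R => 1 * t) = (fun t => t) by apply/funext => t; rewrite mul1r.
rewrite E normal_int_cst => H.
have : 0 = s ^- 2 * \int[nrm]_t t.
  apply: H.
  - exact: cst_continuous.
  - by move=> t; rewrite expr0 normr1 mul1r lerDl.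
  - by apply: (@pol4_bounded _ 0) => // t; rewrite normr0.
  - by have := @pol4_pow 1 isT.
by move/esym/eqP; rewrite mulf_eq0 invr_eq0 expf_eq0 (negbTE sn0) andbF => /eqP.
Qed.

Lemma normal_moment2 : \int[nrm]_t (t ^+ 2) = s ^+ 2.
Proof.
have := @gaussian_by_parts (fun t => t) (fun=> 1) 1 1 isT.
rewrite normal_int_cst => H.
have : 1 = s ^- 2 * \int[nrm]_t (t * t).
  apply: H.
  - exact: cst_continuous.
  - by move=> t; rewrite expr1 mul1r lerDr.
  - by apply: (@pol4_bounded _ 1) => // t; rewrite normr1.
  - by have := @pol4_pow 2 isT.
by move=> E; rewrite -[RHS]mulr1 E mulrA mulfV ?mul1r// expf_eq0 (negbTE sn0) andbF.
Qed.

Lemma normal_moment4 : \int[nrm]_t (t ^+ 4) = 3 * s ^+ 4.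
Proof.
have := @gaussian_by_parts (fun t => t ^+ 3) (fun t => 3 * t ^+ 2) 1 3 isT.
have i2 : nrm.-integrable [set: measurableTypeR R] (EFin \o (fun t : R => t ^+ 2)).
  exact: pol4_integrable (@pol4_pow 2 isT).
rewrite RintegralZl// normal_moment2 => H.
have E : 3 * s ^+ 2 = s ^- 2 * \int[nrm]_t (t ^+ 3 * t).
  apply: H.
  - move=> t; apply: is_derive_eq; rewrite /GRing.scale/= -mulr_natl; ring.
  - move=> t; apply: cvgM; first exact: cvg_cst.
    exact: exprn_continuous.
  - by move=> t; rewrite normrX mul1r lerDr.
  - split; first by apply: measurable_funM => //; exact: exprn_measurable.
    have [_ [C HC]] := @pol4_pow 2 isT; exists (3 * C) => t.
    by rewrite normrM ger0_norm// -mulrA ler_wpM2l.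
  - have -> : (fun t : R => t ^+ 3 * t) = (fun t => t ^+ 4) by apply/funext => t; rewrite -exprSr.
    exact: pol4_pow.
rewrite (_ : s ^+ 4 = s ^+ 2 * s ^+ 2); last by rewrite -exprD.
rewrite mulrA E mulrAC mulVf ?mul1r; last by rewrite expf_eq0 (negbTE sn0) andbF.
by apply: eq_Rintegral => t _; rewrite -exprSr.
Qed.

Lemma pol4_norm : pol4 (fun t => `|t|).
Proof.
split; first exact: measurableT_comp.
have [_ [C HC]] := @pol4_pow 1 isT; exists C => t.
by rewrite normr_id; exact: HC.
Qed.

(** Integrate |t| <= t^2 / (2 s) + s / 2, whose right-hand side has mean exactly s. *)
Lemma normal_abs_moment : \int[nrm]_t `|t| <= s.
Proof.
have i2 : nrm.-integrable [set: measurableTypeR R] (EFin \o (fun t : R => t ^+ 2)).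
  exact: pol4_integrable (@pol4_pow 2 isT).
have i2' : nrm.-integrable [set: measurableTypeR R] (EFin \o (fun t : R => (2 * s)^-1 * t ^+ 2)).
  by rewrite /comp; under eq_fun do rewrite EFinM; exact: integrableZl.
have ic : nrm.-integrable [set: measurableTypeR R] (EFin \o (fun t : R => s / 2)).
  by apply: pol4_integrable; apply: (@pol4_bounded _ (s / 2)) => // t; rewrite ger0_norm// divr_ge0// ltW.
apply: (@le_trans _ _ (\int[nrm]_t ((2 * s)^-1 * t ^+ 2 + s / 2))).
  apply: le_Rintegral => //; first exact: (pol4_integrable pol4_norm).
    by rewrite /comp; under eq_fun do rewrite EFinD; exact: integrableD.
  move=> t _; rewrite -real_normK ?num_real//.
  rewrite -subr_ge0 (_ : _ - _ = (2 * s)^-1 * (`|t| - s) ^+ 2); last by field.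
  by rewrite mulr_ge0 ?sqr_ge0// invr_ge0 mulr_ge0// ltW.
rewrite RintegralD// normal_int_cst.
have -> : \int[nrm]_t ((2 * s)^-1 * t ^+ 2) = (2 * s)^-1 * s ^+ 2.
  by rewrite RintegralZl// normal_moment2.
by rewrite (_ : (2 * s)^-1 * s ^+ 2 + s / 2 = s)//; field.
Qed.

End normal_moments.

Section one_variable.
Context {R : realType}.

Lemma mvt_abs (F f : R -> R) : (forall x, is_derive x (1 : R) F (f x)) ->
  forall y z, exists2 c : R, `|c| <= `|z| & F (y + z) - F y = f (y + c) * z.
Proof.
move=> D y z; have C := derivative_continuous D.
have [z0|z0] := leP 0 z.
  have yz : y <= y + z by rewrite lerDl.
  have [c] := MVT_segment yz (fun x _ => D x) (continuous_subspaceT C).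
  rewrite in_itv/= => /andP[c1 c2]; rewrite [y + z]addrC addrK => E.
  have cy : 0 <= c - y by rewrite subr_ge0.
  exists (c - y); first by rewrite (ger0_norm z0) (ger0_norm cy) lerBlDl.
  by rewrite [y + _]addrC subrK.
have yz : y + z <= y by rewrite gerDl ltW.
have [c] := MVT_segment yz (fun x _ => D x) (continuous_subspaceT C).
rewrite in_itv/= => /andP[c1 c2] E.
have cy : c - y <= 0 by rewrite subr_le0.
exists (c - y).
  by rewrite (ltr0_norm z0) (ler0_norm cy) lerN2 lerBrDl.
by rewrite [y + (c - y)]addrC subrK -opprB E opprD addrA subrr sub0r mulrN opprK.
Qed.

Lemma is_derive_est (V : R -> R) (y q : R) :
  (forall e : R, 0 < e -> exists2 h : R, 0 < h &
    forall t : R, `|t| < h -> `|V (y + t) - V y - t * q| <= e * `|t|) ->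
  is_derive y (1 : R) V q.
Proof.
move=> H.
suff C : h^-1 *: (V (h *: 1 + y) - V y) @[h --> (0 : R)^'] --> q.
  by apply: DeriveDef; [apply/cvg_ex; exists q|exact/cvg_lim].
apply/cvgrPdist_le => e e0; have [h h0 Hh] := H e e0.
exists h => // t /=; rewrite sub0r normrN => th t0.
rewrite scaler1 [t + y]addrC.
have -> : q - t^-1 *: (V (y + t) - V y) = - (t^-1 * (V (y + t) - V y - t * q)).
  by rewrite /GRing.scale/=; field.
by rewrite normrN normrM normfV ler_pdivrMl ?normr_gt0// [_ * e]mulrC; exact: Hh.
Qed.

Lemma lipschitz_continuous (u : R -> R) (L : R) : 0 <= L ->
  (forall t z, `|u (t + z) - u t| <= L * `|z|) -> continuous u.
Proof.
move=> L0 uL t; apply/cvgrPdist_lt => e e0.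
exists (e / (L + 1)); first by rewrite /= divr_gt0// ltr_wpDl.
move=> y /=; rewrite ltr_pdivlMr ?ltr_wpDl// => te.
rewrite -[t](subrK y) [_ + y]addrC (le_lt_trans (uL _ _))// (le_lt_trans _ te)//.
by rewrite mulrC ler_wpM2l// lerDl.
Qed.

End one_variable.

(** * Gaussian smoothing of Lipschitz functions of one variable *)

Section gaussian_smoothing_line.
Context {R : realType}.
Variable s : R.
Hypothesis s0 : 0 < s.
Local Notation nrm := (normal_prob (0 : R) s).

Lemma normal_int_le (f : R -> R) (M : R) : measurable_fun [set: R] f ->
  (forall t, `|f t| <= M) -> `|\int[nrm]_t f t| <= M.
Proof.
move=> mf HM; have H : bmeas (f : measurableTypeR R -> R) by split=> //; exists M.
have := @int_abs_le _ _ _ nrm f M H HM; congr (_ <= _).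
rewrite -[RHS]mulr1; congr (_ * _).
transitivity (fine (1%E : \bar R)) => //; congr fine; exact: probability_setT.
Qed.

Lemma normal_int_le_pol (f : R -> R) (a b c k : R) : measurable_fun [set: R] f ->
  0 <= a -> 0 <= b -> 0 <= c -> 0 <= k ->
  (forall t, `|f t| <= a + b * `|t| + c * t ^+ 2 + k * t ^+ 4) ->
  `|\int[nrm]_t f t| <= a + b * s + c * s ^+ 2 + k * (3 * s ^+ 4).
Proof.
move=> mf a0 b0 c0 k0 Hf.
have p0 : pol4 (fun=> a : R) by apply: (@pol4_bounded _ _ a) => // t; rewrite ger0_norm.
have i0 := pol4_integrable s0 p0.
have ZI (g : R -> R) (z : R) : pol4 g ->
    nrm.-integrable [set: measurableTypeR R] (fun t => (z * g t)%:E).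
  move=> pg; under eq_fun do rewrite EFinM.
  by apply: integrableZl => //; exact: (pol4_integrable s0 pg).
have i1 := ZI _ b pol4_norm.
have i2 := ZI _ c (@pol4_pow _ 2 isT).
have i4 := ZI _ k (@pol4_pow _ 4 isT).
have i01 : nrm.-integrable [set: measurableTypeR R] (fun t => (a + b * `|t|)%:E).
  by under eq_fun do rewrite EFinD; exact: integrableD.
have i012 : nrm.-integrable [set: measurableTypeR R] (fun t => (a + b * `|t| + c * t ^+ 2)%:E).
  by under eq_fun do rewrite EFinD; exact: integrableD.
have i0124 : nrm.-integrable [set: measurableTypeR R]
    (fun t => (a + b * `|t| + c * t ^+ 2 + k * t ^+ 4)%:E).
  by under eq_fun do rewrite EFinD; exact: integrableD.
have iff : nrm.-integrable [set: measurableTypeR R] (EFin \o f).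
  apply: (le_integrable measurableT _ _ i0124); first exact/measurable_EFinP.
  by move=> t _; rewrite /= lee_fin (le_trans (Hf t))// ler_norm.
apply: (@le_trans _ _ (\int[nrm]_t `|f t|)).
  exact: le_normr_Rintegral.
apply: (@le_trans _ _ (\int[nrm]_t (a + b * `|t| + c * t ^+ 2 + k * t ^+ 4))).
  by apply: le_Rintegral => //; exact: integrable_norm.
rewrite RintegralD// RintegralD// RintegralD// normal_int_cst//.
rewrite RintegralZl//; last exact: (pol4_integrable s0 pol4_norm).
rewrite RintegralZl//; last exact: (pol4_integrable s0 (@pol4_pow _ 2 isT)).
rewrite RintegralZl//; last exact: (pol4_integrable s0 (@pol4_pow _ 4 isT)).
rewrite normal_moment2// normal_moment4// !lerD//.
by rewrite ler_wpM2l// normal_abs_moment.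
Qed.

Section lipschitz.
Variables (u : R -> R) (A L : R).
Hypotheses (uA : forall t, `|u t| <= A) (uL : forall t z, `|u (t + z) - u t| <= L * `|z|).

Let L0 : 0 <= L.
Proof. by have := uL 0 1; rewrite normr1 mulr1; exact: le_trans. Qed.

Let cu : continuous u. Proof. exact: lipschitz_continuous L0 uL. Qed.

Let shift_derive (H h : R -> R) (b : R) : (forall x, is_derive x (1 : R) H (h x)) ->
  forall x, is_derive x (1 : R) (fun t => H (t + b)) (h (x + b)).
Proof.
move=> HH x; rewrite -[h (x + b)]mulr1.
have D : is_derive x (1 : R) (fun t => t + b) 1.
  by rewrite -[1 in X in is_derive _ _ _ X]addr0; apply: is_deriveD.
exact: (@is_derive1_comp R H (fun t => t + b) x (h (x + b)) 1 (HH (x + b)) D).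
Qed.

Let bm_shift (v : R -> R) (z : R) : continuous v -> measurable_fun [set: R] (fun t => v (z + t)).
Proof.
move=> cv; apply: continuous_measurable_fun => t.
have := @continuous_comp _ _ _ (fun t : R => z + t) v t _ (cv _); apply.
by apply: cvgD; [exact: cvg_cst|exact: cvg_id].
Qed.

(** The Lipschitz function [u] is replaced by [v], its mean over [t, t + e], which is differentiable
    with Lipschitz derivative [w] and within L e of [u]. The terms of the bound that carry [e] are
    the price of going back from [v] to [u]. *)
Let smoothing_regularized (e : R) : 0 < e -> forall z : R,
  `|\int[nrm]_t u (z + t) - \int[nrm]_t u (0 + t)
    - z * (s ^- 2 * \int[nrm]_t (u (0 + t) * t))| <=
  L / s * z ^+ 2 + 2 * L * e + `|z| * (L / s * e).
Proof.
move=> e0 z; have [H _ HH] := antiderivative cu.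
pose v t := e^-1 * (H (t + e) - H t).
pose w t := e^-1 * (u (t + e) - u t).
have Hv t : is_derive t (1 : R) v (w t).
  have D1 := shift_derive e HH t; have D2 := HH t.
  apply: is_derive_eq; rewrite /GRing.scale/= /w; ring.
have vc (t : R) : exists2 c, 0 <= c <= e & v t = u (t + c).
  have D y : y \in `]t, (t + e)[ -> is_derive y (1 : R) H (u y) by [].
  have te : t <= t + e by rewrite lerDl ltW.
  have [c] := MVT_segment te D (continuous_subspaceT (derivative_continuous HH)).
  rewrite in_itv/= => /andP[c1 c2] E; exists (c - t).
    by rewrite subr_ge0 c1 lerBlDl.
  by rewrite /v E addrAC subrr add0r [t + _]addrC subrK mulrC mulfK// lt0r_neq0.
have vu t : `|v t - u t| <= L * e.
  have [c /andP[c0 c1] ->] := vc t.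
  by rewrite (le_trans (uL _ _))// ler_wpM2l// ger0_norm.
have vL t y : `|v (t + y) - v t| <= L * `|y|.
  have D x : is_derive x (1 : R) (fun x => H (x + (t + y)) - H (x + t))
      (u (x + (t + y)) - u (x + t)).
    by apply: is_deriveB; exact: shift_derive.
  have [c _] := MVT_segment (ltW e0) (fun y _ => D y)
    (continuous_subspaceT (derivative_continuous D)).
  rewrite subr0 => E.
  have -> : v (t + y) - v t = u (c + (t + y)) - u (c + t).
    apply: (mulIf (lt0r_neq0 e0)); rewrite -E /v !add0r [e + (t + y)]addrC [e + t]addrC.
    by field; rewrite lt0r_neq0.
  by rewrite addrA uL.
have vA t : `|v t| <= A by have [c _ ->] := vc t.
have cv : continuous v := derivative_continuous Hv.
have wL t : `|w t| <= L.
  by rewrite /w normrM gtr0_norm ?invr_gt0// ler_pdivrMl// mulrC -{2}(gtr0_norm e0) uL.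
have wL2 t y : `|w (t + y) - w t| <= 2 * L / e * `|y|.
  rewrite /w -mulrBr normrM gtr0_norm ?invr_gt0// ler_pdivrMl//.
  have -> : e * (2 * L / e * `|y|) = L * `|y| + L * `|y| by field; rewrite lt0r_neq0.
  have -> : u (t + y + e) - u (t + y) - (u (t + e) - u t) =
    (u (t + e + y) - u (t + e)) - (u (t + y) - u t) by rewrite [t + y + e]addrAC; ring.
  by rewrite (le_trans (ler_normB _ _))// lerD.
have cw : continuous w.
  by apply: (@lipschitz_continuous _ _ (2 * L / e)) => //; rewrite divr_ge0 ?mulr_ge0 ?(ltW e0).
pose V y := \int[nrm]_t v (y + t).
pose Q y := s ^- 2 * \int[nrm]_t (v (y + t) * t).
have bv y : bmeas ((fun t => v (y + t)) : measurableTypeR R -> R).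
  by split; [exact: bm_shift|exists A].
have bw y : bmeas ((fun t => w (y + t)) : measurableTypeR R -> R).
  by split; [exact: bm_shift|exists L].
(* Stein's identity trades the derivative [w], whose Lipschitz constant 2 L / e explodes, for the
   weight [t]: written as [Q], the derivative of [V] has Lipschitz constant L / s whatever [e]
   is. *)
have QE y : Q y = \int[nrm]_t w (y + t).
  symmetry; apply: (@gaussian_by_parts _ _ s0 (fun t => v (y + t)) (fun t => w (y + t)) A 0) => //.
  - move=> t; have := shift_derive y Hv t; rewrite [t + y]addrC; congr is_derive.
    by apply/funext => x; rewrite addrC.
  - apply: (@lipschitz_continuous _ _ (2 * L / e)) => [|t z'].
      by rewrite divr_ge0 ?mulr_ge0 ?(ltW e0).
    by rewrite addrA wL2.
  - move=> t; rewrite expr0 (le_trans (vA _))// ler_peMr ?lerDl//.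
    exact: le_trans (normr_ge0 _) (vA 0).
  - by apply: (@pol4_bounded _ _ L) => //; exact: bm_shift.
  - by apply: (@pol4_monom _ (fun t => v (y + t)) A 1) => //; exact: bm_shift.
have HV y : is_derive y (1 : R) V (Q y).
  rewrite QE; apply: is_derive_est => k k0; exists (k * e / (2 * L + 1)).
    by rewrite divr_gt0 ?mulr_gt0// ltr_wpDl// mulr_ge0.
  move=> h; rewrite ltr_pdivlMr ?ltr_wpDl ?mulr_ge0// => hk.
  have bvh : bmeas ((fun t => v (y + h + t)) : measurableTypeR R -> R) by exact: bv.
  have bwh : bmeas ((fun t => h * w (y + t)) : measurableTypeR R -> R).
    by apply: bmeasM => //; exact: bmeas_cst.
  have bvv := bmeasB bvh (bv y).
  rewrite /V -(@intZ _ _ _ nrm h _ (bw y)) -(@intB _ _ _ nrm _ _ bvh (bv y)).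
  rewrite -(@intB _ _ _ nrm _ _ bvv bwh).
  apply: normal_int_le; first by case: (bmeasB bvv bwh).
  move=> t; have [c ch E] := mvt_abs Hv (y + t) h.
  rewrite [y + h + t]addrAC E mulrC -mulrBr normrM mulrC ler_wpM2r//.
  rewrite (le_trans (wL2 _ _))// mulrAC ler_pdivrMr//.
  rewrite (@le_trans _ _ ((2 * L + 1) * `|c|))//; first by rewrite ler_wpM2r// lerDl.
  rewrite mulrC (le_trans _ (ltW hk))// ler_wpM2r// addr_ge0// mulr_ge0//.
have QL y z' : `|Q (y + z') - Q y| <= L / s * `|z'|.
  have p1 b : pol4 (fun t => v (b + t) * t).
    by apply: (@pol4_monom _ (fun t => v (b + t)) A 1) => //; exact: bm_shift.
  have i1 b := pol4_integrable s0 (p1 b).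
  rewrite /Q -mulrBr -RintegralB//.
  have mf : measurable_fun [set: R] (fun t => v (y + z' + t) * t - v (y + t) * t).
    by apply: measurable_funB; [case: (p1 (y + z'))|case: (p1 y)].
  have H1 t : `|v (y + z' + t) * t - v (y + t) * t| <=
      0 + (L * `|z'|) * `|t| + 0 * t ^+ 2 + 0 * t ^+ 4.
    by rewrite -mulrBl normrM add0r !mul0r !addr0 ler_wpM2r// addrAC vL.
  have := @normal_int_le_pol _ 0 (L * `|z'|) 0 0 mf (lexx _) (mulr_ge0 L0 (normr_ge0 _)) (lexx _) (lexx _) H1.
  rewrite add0r !mul0r !addr0 normrM => H2.
  rewrite gtr0_norm ?invr_gt0 ?exprn_gt0// ler_pdivrMl ?exprn_gt0//.
  by rewrite (le_trans H2)// le_eqVlt; apply/orP; left; apply/eqP; field; rewrite lt0r_neq0.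
have VE : `|V z - V 0 - z * Q 0| <= L / s * z ^+ 2.
  have [c cz] := mvt_abs HV 0 z; rewrite !add0r => ->.
  rewrite mulrC -mulrBr normrM -[z ^+ 2](real_normK (num_real z)) expr2.
  rewrite mulrA [leRHS]mulrC ler_wpM2l//.
  have := QL 0 c; rewrite add0r => H1; rewrite (le_trans H1)// ler_wpM2l//.
  by rewrite divr_ge0// ltW.
have bu y : bmeas ((fun t => u (y + t)) : measurableTypeR R -> R).
  by split; [exact: bm_shift|exists A].
have VU y : `|V y - \int[nrm]_t u (y + t)| <= L * e.
  rewrite /V -(@intB _ _ _ nrm _ _ (bv y) (bu y)); apply: normal_int_le.
    by case: (bmeasB (bv y) (bu y)).
  by move=> t; exact: vu.
have QU : `|Q 0 - s ^- 2 * \int[nrm]_t (u (0 + t) * t)| <= L / s * e.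
  have p1 : pol4 (fun t => v (0 + t) * t).
    by apply: (@pol4_monom _ (fun t => v (0 + t)) A 1) => //; exact: bm_shift.
  have p2 : pol4 (fun t => u (0 + t) * t).
    by apply: (@pol4_monom _ (fun t => u (0 + t)) A 1) => //; exact: bm_shift.
  have i1 := pol4_integrable s0 p1; have i2 := pol4_integrable s0 p2.
  rewrite /Q -mulrBr -RintegralB//.
  have mf : measurable_fun [set: R] (fun t => v (0 + t) * t - u (0 + t) * t).
    by apply: measurable_funB; [case: p1|case: p2].
  have H1 t : `|v (0 + t) * t - u (0 + t) * t| <=
      0 + (L * e) * `|t| + 0 * t ^+ 2 + 0 * t ^+ 4.
    by rewrite -mulrBl normrM !add0r !mul0r !addr0 ler_wpM2r.
  have := @normal_int_le_pol _ 0 (L * e) 0 0 mf (lexx _) (mulr_ge0 L0 (ltW e0)) (lexx _) (lexx _) H1.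
  rewrite add0r !mul0r !addr0 normrM => H2.
  rewrite gtr0_norm ?invr_gt0 ?exprn_gt0// ler_pdivrMl ?exprn_gt0//.
  by rewrite (le_trans H2)// le_eqVlt; apply/orP; left; apply/eqP; field; rewrite lt0r_neq0.
set U1 := \int[nrm]_t u (z + t); set U0 := \int[nrm]_t u (0 + t).
set Q1 := s ^- 2 * _ in QU *.
have H1 := VU z; have H2 := VU 0; rewrite -/U1 in H1; rewrite -/U0 in H2.
have -> : U1 - U0 - z * Q1 = (V z - V 0 - z * Q 0) - (V z - U1) + (V 0 - U0) + z * (Q 0 - Q1) by ring.
have H3 : `|z * (Q 0 - Q1)| <= `|z| * (L / s * e) by rewrite normrM ler_wpM2l.
have := ler_normD (V z - V 0 - z * Q 0 - (V z - U1) + (V 0 - U0)) (z * (Q 0 - Q1)).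
have := ler_normD (V z - V 0 - z * Q 0 - (V z - U1)) (V 0 - U0).
have := ler_normB (V z - V 0 - z * Q 0) (V z - U1).
lra.
Qed.

(** The regularization parameter tends to 0; [K] collects the coefficients of its error terms. The
    mean of [u (z + t)] thus has an explicit derivative at z = 0 with a quadratic remainder. *)
Lemma normal_smoothing (z : R) :
  `|\int[nrm]_t u (z + t) - \int[nrm]_t u t - z * (s ^- 2 * \int[nrm]_t (u t * t))|
  <= L / s * z ^+ 2.
Proof.
have -> : \int[nrm]_t u t = \int[nrm]_t u (0 + t).
  by apply: eq_Rintegral => t _; rewrite add0r.
have -> : \int[nrm]_t (u t * t) = \int[nrm]_t (u (0 + t) * t).
  by apply: eq_Rintegral => t _; rewrite add0r.
apply/ler_addgt0Pr => e e0.
pose K := 2 * L + `|z| * (L / s).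
have Ls0 : 0 <= L / s by rewrite divr_ge0// ltW.
have K0 : 0 <= K by apply: addr_ge0; apply: mulr_ge0.
have e1 : 0 < e / (K + 1) by rewrite divr_gt0// ltr_wpDl.
apply: (le_trans (smoothing_regularized e1 z)).
have -> : L / s * z ^+ 2 + 2 * L * (e / (K + 1)) + `|z| * (L / s * (e / (K + 1))) =
    L / s * z ^+ 2 + K * (e / (K + 1)) by set y := e / _; rewrite /K; ring.
rewrite lerD2l.
rewrite mulrA ler_pdivrMr ?ltr_wpDl// mulrC ler_wpM2l ?lerDl//; exact: ltW.
Qed.

End lipschitz.
End gaussian_smoothing_line.

Lemma image_integrable {disp disp'} {T : measurableType disp}
    {T' : measurableType disp'} {R : realType} (mu : {measure set T -> \bar R})
    (m : {measure set T' -> \bar R}) (h : T -> T') (k : T' -> R) :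
  measurable_fun setT h ->
  (forall A, measurable A -> m A = mu (h @^-1` A)) ->
  m.-integrable setT (EFin \o k) -> mu.-integrable setT (EFin \o (k \o h)).
Proof.
move=> mh mE /integrableP[/measurable_EFinP mk ik]; apply/integrableP; split.
  by apply/measurable_EFinP; exact: measurableT_comp.
apply: le_lt_trans ik; rewrite (eq_measure_integral (image_measure mu mh)).
  rewrite [leRHS](@ge0_integral_pushforward _ _ _ _ R h mh mu setT (fun y => `|(k y)%:E|%E))//.
  by apply: measurableT_comp => //; exact/measurable_EFinP.
by move=> A mA _; exact: mE.
Qed.

(** * Gaussian vectors and their averaging operators on the torus *)

Section gauss.
Context {R : realType} {d : nat}.
Implicit Types (phi psi : 'rV[R]_d -> R) (g : {finite_measure set 'rV[R]_d -> \bar R}).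

(** A predicate rather than one fixed measure, because the law of a Brownian increment is given
    through its values on boxes. *)
Definition gauss (s : R) g := forall B : 'I_d -> set R, (forall i, measurable (B i)) ->
  g (box B) = (\prod_(i < d) normal_prob (0 : R) s (B i))%E.

Lemma normal_probT (s : R) : fine (normal_prob (0 : R) s [set: measurableTypeR R]) = 1.
Proof. by transitivity (fine (1%E : \bar R)) => //; congr fine; exact: probability_setT. Qed.

Lemma gauss_setT s g : gauss s g -> g setT = 1%E.
Proof.
move=> /(_ (fun=> setT) (fun=> measurableT)).
rewrite (_ : box _ = setT); last by apply/seteqP.
move=> ->; rewrite big1// => i _; exact: probability_setT.
Qed.

Lemma gauss_int_cst s g (c : R) : gauss s g -> \int[g]_x c = c.
Proof. by move=> /gauss_setT gT; rewrite int_cst gT mulr1. Qed.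

Lemma gauss_int_abs_le s g phi (M : R) : gauss s g -> bmeas phi -> (forall x, `|phi x| <= M) ->
  `|\int[g]_x phi x| <= M.
Proof.
by move=> gg bp pM; have := int_abs_le g bp pM; rewrite (gauss_setT gg) mulr1.
Qed.

Lemma gauss_resample s g (i : 'I_d) phi : gauss s g -> bmeas phi ->
  \int[g]_x \int[normal_prob (0 : R) s]_t phi (set_coord i x t) = \int[g]_x phi x.
Proof.
move=> gg bp; have := @int_resample _ _ g (fun=> normal_prob (0 : R) s) i phi gg bp.
by rewrite normal_probT mul1r.
Qed.

Lemma gauss_marginal s g (i : 'I_d) : gauss s g -> forall A : set (measurableTypeR R), measurable A ->
  normal_prob (0 : R) s A = g ((rV_coord i : 'rV[R]_d -> measurableTypeR R) @^-1` A).
Proof.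
move=> gg A mA.
have := gg (fun j => if j == i then A else setT) _; rewrite (bigD1 i)//= eqxx big1.
  rewrite mule1 => <-; last by move=> j; case: ifP.
  congr (g _); apply/seteqP; split=> x /=.
    by move=> /(_ i); rewrite eqxx.
  by move=> Ax j; case: eqP => // ->.
by move=> j /negbTE ->; exact: probability_setT.
Qed.

Lemma gauss_coord_integrable s g (i : 'I_d) (k : R -> R) : 0 < s -> gauss s g -> pol4 k ->
  g.-integrable setT (EFin \o (fun x : 'rV[R]_d => k (x ord0 i))).
Proof.
move=> s0 gg pk.
apply: (@image_integrable _ _ _ (measurableTypeR R) R g (normal_prob (0 : R) s) (rV_coord i) k).
- exact: measurable_rV_coord.
- exact: gauss_marginal.
- exact: pol4_integrable.
Qed.

Lemma gauss_coord_int s g (i : 'I_d) (k : R -> R) : 0 < s -> gauss s g -> pol4 k ->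
  \int[g]_x k (x ord0 i) = \int[normal_prob (0 : R) s]_t k t.
Proof.
move=> s0 gg pk.
rewrite (@int_image_integrable _ _ _ _ _ g (normal_prob (0 : R) s) (rV_coord i) k)//.
- exact: measurable_rV_coord.
- exact: gauss_marginal.
- by case: pk.
- exact: gauss_coord_integrable s0 gg pk.
Qed.

Lemma gauss_moment2 s g (i : 'I_d) : 0 < s -> gauss s g -> \int[g]_x (x ord0 i ^+ 2) = s ^+ 2.
Proof.
move=> s0 gg; rewrite (@gauss_coord_int s g i (fun t => t ^+ 2))//; last exact: pol4_pow.
exact: normal_moment2.
Qed.

Lemma gauss_le_quadratic s g phi (a b : R) : 0 < s -> gauss s g -> bmeas phi -> 0 <= b ->
  (forall x, `|phi x| <= a + b * \sum_i x ord0 i ^+ 2) ->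
  `|\int[g]_x phi x| <= a + b * (d%:R * s ^+ 2).
Proof.
move=> s0 gg bp b0 H.
have iq (i : 'I_d) := @gauss_coord_integrable s g i (fun t => t ^+ 2) s0 gg (@pol4_pow _ 2 isT).
have isum : g.-integrable setT (fun x => (\sum_i x ord0 i ^+ 2)%:E).
  under eq_fun do rewrite -sumEFin.
  by apply: integrable_sum => // i _; exact: iq.
have isb : g.-integrable setT (fun x => (b * \sum_i x ord0 i ^+ 2)%:E).
  by under eq_fun do rewrite EFinM; exact: integrableZl.
have ia : g.-integrable setT (EFin \o (fun=> a)) by exact: bmeas_integrable (bmeas_cst a).
have iH : g.-integrable setT (fun x => (a + b * \sum_i x ord0 i ^+ 2)%:E).
  by under eq_fun do rewrite EFinD; exact: integrableD.
have ip := bmeas_integrable g bp.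
apply: (@le_trans _ _ (\int[g]_x `|phi x|)); first exact: le_normr_Rintegral.
apply: (@le_trans _ _ (\int[g]_x (a + b * \sum_i x ord0 i ^+ 2))).
  by apply: le_Rintegral => //; exact: integrable_norm.
rewrite RintegralD// RintegralZl// (gauss_int_cst _ gg).
suff -> : \int[g]_x (\sum_i x ord0 i ^+ 2) = d%:R * s ^+ 2 by [].
rewrite /Rintegral; under eq_integral do rewrite -sumEFin.
rewrite integral_sum//.
transitivity (\sum_(i < d) \int[g]_x (x ord0 i ^+ 2)).
  by rewrite /Rintegral -sum_fine// => i _; apply: integrable_fin_num => //; exact: iq.
under eq_bigr do rewrite (gauss_moment2 _ s0 gg).
by rewrite sumr_const card_ord mulr_natl.
Qed.

Lemma norm_sqr_le_sum (x : 'rV[R]_d) : `|x| ^+ 2 <= \sum_i x ord0 i ^+ 2.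
Proof.
have S0 : 0 <= \sum_i x ord0 i ^+ 2 by rewrite sumr_ge0// => i _; rewrite sqr_ge0.
rewrite -[leRHS]sqr_sqrtr// ler_pXn2r ?nnegrE ?sqrtr_ge0//.
apply: norm_rV_le; first exact: sqrtr_ge0.
move=> i; rewrite -sqrtr_sqr ler_sqrt// (bigD1 i)//= lerDl.
by rewrite sumr_ge0// => j _; rewrite sqr_ge0.
Qed.

Lemma continuous_affine (x : 'rV[R]_d) (c : R) phi : continuous phi ->
  continuous (fun y : 'rV[R]_d => phi (x + c *: y)).
Proof.
move=> cp y; have := @continuous_comp _ _ _ (fun y : 'rV[R]_d => x + c *: y) phi y _ (cp _); apply.
apply: continuousD; first exact: cst_continuous.
by apply: continuousZ; [exact: cst_continuous|].
Qed.

(** The expectation of [phi (x + c Y)] for Y of law [g]. With c = sqrt (2 nu) and deviation sqrt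
    delta it is the transition operator of the pure noise over a time delta. *)
Definition gop g (c : R) phi (x : 'rV[R]_d) : R := \int[g]_y phi (x + c *: y).

Lemma cper_affine_bmeas phi x (c : R) : cper phi -> bmeas (fun y : 'rV[R]_d => phi (x + c *: y)).
Proof.
move=> cp; split; last by have [M HM] := cper_bounded cp; exists M.
by apply: continuous_rV_measurable; apply: continuous_affine; case: cp.
Qed.

Lemma gop_BL s g (c A : R) phi : gauss s g -> cper phi -> BL A phi -> BL A (gop g c phi).
Proof.
move=> gg cp [p1 p2]; split=> [x|x z].
  exact: gauss_int_abs_le gg (cper_affine_bmeas _ _ cp) _.
rewrite /gop -(intB g (cper_affine_bmeas _ _ cp) (cper_affine_bmeas _ _ cp)).
apply: (gauss_int_abs_le gg).
  by apply: bmeasB; exact: cper_affine_bmeas.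
by move=> y; rewrite addrAC.
Qed.

Lemma gop_cper s g (c : R) phi : gauss s g -> cper phi -> cper (gop g c phi).
Proof.
move=> gg cp; split; last first.
  by move=> x i; apply: eq_Rintegral => y _; rewrite addrAC; case: cp => _ ->.
apply/continuous_rVP => x e e0.
have e2 : 0 < e / 2 by rewrite divr_gt0.
have [h h0 H] := cper_unif cp e2; exists h => // z zh.
rewrite /gop -(intB g (cper_affine_bmeas _ _ cp) (cper_affine_bmeas _ _ cp)).
apply: (@le_lt_trans _ _ (e / 2)); last by rewrite [ltRHS]splitr ltrDl.
apply: (gauss_int_abs_le gg); first by apply: bmeasB; exact: cper_affine_bmeas.
by move=> y; rewrite addrAC ltW// H.
Qed.

(** The inequality |y| <= s + |y|^2 / s reduces the first moment of the norm to the second moments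
    of the coordinates. *)
Lemma gop_close s g (c A : R) phi x : 0 < s -> gauss s g -> cper phi -> BL A phi ->
  `|gop g c phi x - phi x| <= A * `|c| * (1 + d%:R) * s.
Proof.
move=> s0 gg cp [p1 p2]; have A0 : 0 <= A by exact: le_trans (normr_ge0 _) (p1 0).
have -> : gop g c phi x - phi x = \int[g]_y (phi (x + c *: y) - phi x).
  rewrite (intB g (cper_affine_bmeas _ _ cp) (bmeas_cst _)).
  by rewrite (gauss_int_cst _ gg).
have -> : A * `|c| * (1 + d%:R) * s = A * `|c| * s + A * `|c| / s * (d%:R * s ^+ 2).
  by field; rewrite lt0r_neq0.
apply: (gauss_le_quadratic s0 gg).
- by apply: bmeasB; [exact: cper_affine_bmeas|exact: bmeas_cst].
- by rewrite divr_ge0 ?mulr_ge0// ltW.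
move=> y; rewrite (le_trans (p2 _ _))// normrZ mulrA.
set S := \sum_i _; have -> : A * `|c| * s + A * `|c| / s * S = A * `|c| * (s + s^-1 * S) by ring.
rewrite ler_wpM2l ?mulr_ge0// {}/S.
have := norm_sqr_le_sum y; have a0 := normr_ge0 y; move: (`|y|) a0 => a a0 H.
apply: (@le_trans _ _ (s + s^-1 * a ^+ 2)); last by rewrite lerD2l ler_wpM2l// invr_ge0 ltW.
rewrite -subr_ge0 -(pmulr_rge0 _ s0).
have -> : s * (s + s^-1 * a ^+ 2 - a) = s ^+ 2 + a ^+ 2 - s * a by field; rewrite lt0r_neq0.
by nra.
Qed.

(** Fubini, then translation of the torus by [c *: y] for each fixed [y]: the adjoint averages over
    the reflected displacement. *)
Lemma gop_adjoint s g (c : R) phi psi : gauss s g -> cper phi -> cper psi ->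
  \int[torus_measure R d]_x (gop g c phi x * psi x) =
  \int[torus_measure R d]_x (phi x * gop g (- c) psi x).
Proof.
move=> gg cp cq.
have mx (a b : R) : measurable_fun setT (fun p : 'rV[R]_d * 'rV[R]_d => a *: p.1 + b *: p.2).
  by apply: measurable_rVD; apply: measurable_rVZ => //.
have bj a b a' b' : bmeas (fun p : 'rV[R]_d * 'rV[R]_d =>
    phi (a *: p.1 + b *: p.2) * psi (a' *: p.1 + b' *: p.2)).
  by apply: bmeasM; apply: bmeas_comp (mx _ _) _; exact: cper_bmeas.
transitivity (\int[torus_measure R d]_x \int[g]_y (phi (1 *: x + c *: y) * psi (1 *: x + 0 *: y))).
  apply: eq_Rintegral => x _; rewrite /gop mulrC -intZ; last exact: cper_affine_bmeas.
  by apply: eq_Rintegral => y _; rewrite !scale1r scale0r addr0 mulrC.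
have := @int_swap _ _ _ _ _ (torus_measure R d) g _ (bj 1 c 1 0); rewrite /= => ->.
transitivity (\int[torus_measure R d]_x \int[g]_y (phi (1 *: x + 0 *: y) * psi (1 *: x + (- c) *: y))); last first.
  apply: eq_Rintegral => x _; rewrite /gop -intZ; last exact: cper_affine_bmeas.
  by apply: eq_Rintegral => y _; rewrite !scale1r scale0r addr0.
have := @int_swap _ _ _ _ _ (torus_measure R d) g _ (bj 1 0 1 (- c)); rewrite /= => ->.
apply: eq_Rintegral => y _.
have cc : cper (fun x => phi x * psi (x + (- c) *: y)) by apply: cperM => //; exact: cper_shift.
transitivity (\int[torus_measure R d]_x (phi (x + c *: y) * psi (x + c *: y + (- c) *: y))).
  apply: eq_Rintegral => x _.
  by rewrite scale1r scale0r addr0 -addrA -scalerDl subrr scale0r addr0.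
rewrite (torus_int_shift (c *: y) cc).
by apply: eq_Rintegral => x _; rewrite scale1r scale0r addr0.
Qed.

End gauss.

(** * Second-order expansion and smoothing by Gaussian vectors *)

Section gauss_expansion.
Context {R : realType} {d : nat}.
Implicit Types (phi psi : 'rV[R]_d -> R) (g : {finite_measure set 'rV[R]_d -> \bar R}).

Lemma scaled_line_measurable phi (w : 'rV[R]_d) (c : R) i : cper phi ->
  measurable_fun [set: R] (fun t : R => phi (w + (c * t) *: basis_vec i)).
Proof.
move=> cp; have [cl _] := cper_line i w cp.
have m1 : measurable_fun [set: R] (fun t : R => phi (w + t *: basis_vec i)).
  exact: continuous_measurable_fun.
have m2 : measurable_fun [set: R] (fun t : R => c * t) by exact: measurable_funM.
exact: measurableT_comp m1 m2.
Qed.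

Lemma scaled_line_bmeas phi (w : 'rV[R]_d) (c : R) i : cper phi ->
  bmeas (fun t : measurableTypeR R => phi (w + (c * t) *: basis_vec i)).
Proof.
move=> cp; split; first exact: scaled_line_measurable.
by have [M HM] := cper_bounded cp; exists M.
Qed.

Lemma measurable_set_coordl i (t : R) : measurable_fun setT (fun x : 'rV[R]_d => set_coord i x t).
Proof.
apply/measurable_fun_rVP => j.
rewrite (_ : _ \o _ = fun x => if j == i then t else rV_coord j x); last first.
  by apply/funext => x; rewrite /rV_coord/= mxE.
by case: (j == i); [exact: measurable_cst|exact: measurable_rV_coord].
Qed.

Lemma set_coord0 i (y : 'rV[R]_d) t : set_coord i y t = set_coord i y 0 + t *: basis_vec i.
Proof.
apply/rowP => j; rewrite !mxE eqxx/=; case: eqP => _; first by rewrite mulr1 add0r.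
by rewrite mulr0 addr0.
Qed.

(** Uniform continuity handles |z| < h and boundedness the rest, where |z|^2 / h^2 >= 1. A merely
    continuous second derivative thereby acquires a modulus that Gaussian moments can integrate. *)
Lemma cper_quadratic_modulus phi (e : R) : cper phi -> 0 < e ->
  exists2 M : R, 0 <= M & forall x z, `|phi (x + z) - phi x| <= e + M * `|z| ^+ 2.
Proof.
move=> cp e0; have [h h0 H] := cper_unif cp e0; have [N HN] := cper_bounded cp.
have N0 : 0 <= N by exact: le_trans (normr_ge0 _) (HN 0).
exists (2 * N / h ^+ 2); first by rewrite divr_ge0 ?sqr_ge0// mulr_ge0.
move=> x z; have [zh|zh] := ltP `|z| h.
  by rewrite (le_trans (ltW (H _ _ zh)))// lerDl mulr_ge0 ?sqr_ge0// divr_ge0 ?sqr_ge0// mulr_ge0.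
rewrite (@le_trans _ _ (2 * N))//.
  by rewrite (le_trans (ler_normB _ _))// mulr_natl mulr2n lerD.
rewrite ler_wpDl// ?(ltW e0)// -mulrA ler_peMr ?mulr_ge0//.
by rewrite mulrC ler_pdivlMr ?exprn_gt0// mul1r ler_pXn2r ?nnegrE ?(ltW h0).
Qed.

Lemma pderiv2_expansion i phi p q (e M : R) : pderiv i phi p -> pderiv i p q ->
  (forall x z, `|q (x + z) - q x| <= e + M * `|z| ^+ 2) -> 0 <= M -> forall w (h : R),
  `|phi (w + h *: basis_vec i) - phi w - h * p w - h ^+ 2 / 2 * q w|
    <= e * h ^+ 2 + M * h ^+ 4.
Proof.
move=> Hp Hq HM M0 w h.
have D t : is_derive t (1 : R) (fun t => phi (w + t *: basis_vec i) - t * p w - t ^+ 2 / 2 * q w)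
    (p (w + t *: basis_vec i) - p w - t * q w).
  have D1 := pderiv_line Hp w t.
  apply: is_derive_eq.
  by rewrite /GRing.scale/=; field.
have [c ch E] := mvt_abs D 0 h.
have -> : phi (w + h *: basis_vec i) - phi w - h * p w - h ^+ 2 / 2 * q w =
    (p (w + c *: basis_vec i) - p w - c * q w) * h.
  move: E; rewrite !add0r scale0r addr0 => <-; ring.
have [b bc ->] := pderiv_mvt Hq w c.
rewrite [q _ * c]mulrC -mulrBr !normrM.
have h2 : h ^+ 2 = `|h| ^+ 2 by rewrite real_normK// num_real.
have h4 : h ^+ 4 = `|h| ^+ 4 by rewrite -normrX ger0_norm// -[4%N]/(2 * 2)%N exprM sqr_ge0.
rewrite h2 h4; have := HM w (b *: basis_vec i).
have bh : `|b *: basis_vec i : 'rV[R]_d| <= `|h|.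
  by rewrite (le_trans (norm_scale_basis _ _))// (le_trans bc).
have b2 : `|b *: basis_vec i : 'rV[R]_d| ^+ 2 <= `|h| ^+ 2 by rewrite ler_pXn2r ?nnegrE.
set Q := `|q _ - q w| => HQ.
have HQ' : Q <= e + M * `|h| ^+ 2 by rewrite (le_trans HQ)// lerD2l ler_wpM2l.
rewrite -mulrA mulrC -mulrA.
have -> : e * `|h| ^+ 2 + M * `|h| ^+ 4 = (e + M * `|h| ^+ 2) * (`|h| * `|h|) by ring.
have hc : `|h| * `|c| <= `|h| * `|h| by rewrite ler_wpM2l.
exact: (ler_pM (normr_ge0 _) (mulr_ge0 (normr_ge0 _) (normr_ge0 _)) HQ' hc).
Qed.

(** The first moment kills the term in [p], the second gives the term in [q], and the fourth, 3 s^4,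
    integrates the remainder. *)
Lemma normal_line_expansion i phi p q (e M s c : R) w : 0 < s -> cper phi ->
  pderiv i phi p -> pderiv i p q ->
  (forall x z, `|q (x + z) - q x| <= e + M * `|z| ^+ 2) -> 0 <= M -> 0 <= e ->
  `|\int[normal_prob (0 : R) s]_t (phi (w + (c * t) *: basis_vec i) - phi w)
     - c ^+ 2 * s ^+ 2 / 2 * q w| <= e * c ^+ 2 * s ^+ 2 + M * c ^+ 4 * (3 * s ^+ 4).
Proof.
move=> s0 cp Hp Hq HM M0 e0.
pose nrm := normal_prob (0 : R) s.
pose f (t : R) := phi (w + (c * t) *: basis_vec i) - phi w.
have bf : bmeas (f : measurableTypeR R -> R).
  by apply: bmeasB; [exact: scaled_line_bmeas|exact: bmeas_cst].
have if_ := bmeas_integrable nrm bf.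
have ZI (k : R -> R) (z : R) : pol4 k ->
    nrm.-integrable [set: measurableTypeR R] (fun t => (z * k t)%:E).
  move=> pg; under eq_fun do rewrite EFinM.
  by apply: integrableZl => //; exact: (pol4_integrable s0 pg).
have i1 := ZI _ (c * p w) (@pol4_pow _ 1 isT).
have i2 := ZI _ (c ^+ 2 / 2 * q w) (@pol4_pow _ 2 isT).
have if1 : nrm.-integrable [set: measurableTypeR R] (fun t => (f t - c * p w * t ^+ 1)%:E).
  by under eq_fun do rewrite EFinB; exact: integrableB.
have -> : \int[nrm]_t f t - c ^+ 2 * s ^+ 2 / 2 * q w =
    \int[nrm]_t (f t - c * p w * t ^+ 1 - c ^+ 2 / 2 * q w * t ^+ 2).
  rewrite RintegralB// RintegralB// RintegralZl//; last exact: (pol4_integrable s0 (@pol4_pow _ 1 isT)).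
  rewrite RintegralZl//; last exact: (pol4_integrable s0 (@pol4_pow _ 2 isT)).
  have -> : \int[nrm]_t (t ^+ 1) = 0 by exact: normal_moment1.
  by rewrite normal_moment2//; ring.
have -> : e * c ^+ 2 * s ^+ 2 + M * c ^+ 4 * (3 * s ^+ 4) =
    0 + 0 * s + e * c ^+ 2 * s ^+ 2 + M * c ^+ 4 * (3 * s ^+ 4) by ring.
have c4 : 0 <= c ^+ 4 by rewrite -[4%N]/(2 * 2)%N exprM sqr_ge0.
apply: normal_int_le_pol => //.
- apply: measurable_funB; first apply: measurable_funB.
  + by case: bf.
  + by apply: measurable_funM => //; exact: exprn_measurable.
  + by apply: measurable_funM => //; exact: exprn_measurable.
- by rewrite mulr_ge0// sqr_ge0.
- by rewrite mulr_ge0.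
move=> t; have := pderiv2_expansion Hp Hq HM M0 w (c * t).
rewrite /f !exprMn expr1.
have -> : c * t * p w = c * p w * t by ring.
have -> : c ^+ 2 * t ^+ 2 / 2 * q w = c ^+ 2 / 2 * q w * t ^+ 2 by ring.
by rewrite mul0r !add0r !mulrA.
Qed.

Lemma measurable_trunc_row k (c : R) (x : 'rV[R]_d) :
  measurable_fun setT (fun y : 'rV[R]_d => x + trunc_row k (c *: y)).
Proof.
apply/measurable_fun_rVP => i.
rewrite (_ : _ \o _ = fun y => x ord0 i + (if (i < k)%N then c * rV_coord i y else 0)); last first.
  by apply/funext => y; rewrite /rV_coord/= !mxE.
apply: measurable_funD; first exact: measurable_cst.
by case: (i < k)%N; [apply: measurable_funM => //; exact: measurable_rV_coord|exact: measurable_cst].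
Qed.

Lemma trunc_row_set_coord (i : 'I_d) (c : R) (y : 'rV[R]_d) t :
  trunc_row i (c *: set_coord i y t) = trunc_row i (c *: y).
Proof.
apply/rowP => j; rewrite !mxE; case: ifP => // ji.
by rewrite ifF//; apply/eqP => jE; rewrite jE ltnn in ji.
Qed.

Lemma norm_trunc_row k (z : 'rV[R]_d) : `|trunc_row k z| <= `|z|.
Proof.
apply: norm_rV_le => // i; rewrite mxE; case: ifP => _; first exact: norm_coord_le.
by rewrite normr0.
Qed.

(** For a C^2 function the remainder is o(s^2) uniformly in [x]; this is expressed by a constant [K]
    that depends on [e] but not on [s], [g] or [x]. The displacement is split into its coordinates,
    each of which is integrated on its own line. *)
Lemma gauss_taylor phi (p q : 'I_d -> 'rV[R]_d -> R) (c e : R) :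
  cper phi -> (forall i, cper (q i)) -> (forall i, pderiv i phi (p i)) ->
  (forall i, pderiv i (p i) (q i)) -> 0 < e ->
  exists2 K : R, 0 <= K & forall s g x, 0 < s -> gauss s g ->
    `|gop g c phi x - phi x - c ^+ 2 * s ^+ 2 / 2 * \sum_i q i x|
      <= e * s ^+ 2 + K * s ^+ 4.
Proof.
move=> cp cq Hp Hq e0.
have c2 : 0 <= c ^+ 2 by exact: sqr_ge0.
have c4 : 0 <= c ^+ 4 by rewrite -[4%N]/(2 * 2)%N exprM sqr_ge0.
pose D : R := d%:R; have D0 : 0 <= D by rewrite /D.
(* The error [e'] occurs twice for each of the [D] coordinates: in the expansion on the line, and
   when [q i] is moved from [w i y] back to [x]. *)
pose B : R := D * c ^+ 2 * 2 + 1.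
have B0 : 0 < B by rewrite /B; have := mulr_ge0 D0 c2; lra.
pose e' := e / B; have e'0 : 0 < e' by rewrite divr_gt0.
have /choice[N HN] : forall i, exists M : R, 0 <= M /\
    forall x z, `|q i (x + z) - q i x| <= e' + M * `|z| ^+ 2.
  by move=> i; have [M M0 HM] := cper_quadratic_modulus (cq i) e'0; exists M.
pose M := \sum_i N i.
have M0 : 0 <= M by rewrite sumr_ge0// => i _; case: (HN i).
have HM i x z : `|q i (x + z) - q i x| <= e' + M * `|z| ^+ 2.
  have [_ H] := HN i; rewrite (le_trans (H x z))// lerD2l ler_wpM2r ?sqr_ge0//.
  by rewrite /M (bigD1 i)//= lerDl sumr_ge0// => j _; case: (HN j).
exists (D * (3 * M * c ^+ 4 + c ^+ 4 * M * D)); first by apply: mulr_ge0 => //; apply: addr_ge0; apply: mulr_ge0 => //; exact: mulr_ge0.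
move=> s g x s0 gg; pose nrm := normal_prob (0 : R) s.
pose w (i : 'I_d) (y : 'rV[R]_d) := x + trunc_row i (c *: y).
pose T (i : 'I_d) (y : 'rV[R]_d) := phi (w i y + (c * y ord0 i) *: basis_vec i) - phi (w i y).
have mw (i : 'I_d) : measurable_fun setT (w i) by exact: measurable_trunc_row.
have mT (i : 'I_d) : measurable_fun setT (fun y => w i y + (c * y ord0 i) *: basis_vec i : 'rV[R]_d).
  rewrite (_ : (fun _ => _) = fun y => x + trunc_row i.+1 (c *: y)).
    exact: measurable_trunc_row.
  by apply/funext => y; rewrite trunc_rowS addrA mxE.
have bT i : bmeas (T i).
  by apply: bmeasB; apply: bmeas_comp (cper_bmeas cp).
have bq i : bmeas (fun y => q i (w i y)) by apply: bmeas_comp (mw i) (cper_bmeas (cq i)).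
have E1 : gop g c phi x - phi x = \sum_i \int[g]_y T i y.
  rewrite -(int_sum g (index_enum 'I_d) bT) -(gauss_int_cst (phi x) gg) /gop.
  rewrite -(intB g (cper_affine_bmeas _ _ cp) (bmeas_cst _)).
  apply: eq_Rintegral => y _; rewrite telescope_coord; apply: eq_bigr => i _.
  by rewrite /T /w mxE.
(* The base point [w i y] involves only the coordinates before [i], so coordinate [i] may be redrawn
   as an independent one-dimensional Gaussian. *)
have E2 i : \int[g]_y T i y = \int[g]_y \int[nrm]_t (phi (w i y + (c * t) *: basis_vec i) - phi (w i y)).
  rewrite -(gauss_resample i gg (bT i)); apply: eq_Rintegral => y _.
  apply: eq_Rintegral => t _.
  by rewrite /T /w trunc_row_set_coord mxE eqxx.
have E3 i : `|\int[g]_y T i y - c ^+ 2 * s ^+ 2 / 2 * q i x| <=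
    e' * c ^+ 2 * s ^+ 2 + M * c ^+ 4 * (3 * s ^+ 4)
    + c ^+ 2 * s ^+ 2 * (e' + M * c ^+ 2 * (D * s ^+ 2)).
  have bI : bmeas (fun y => \int[nrm]_t (phi (w i y + (c * t) *: basis_vec i) - phi (w i y))).
    have : bmeas (fun z : 'rV[R]_d * measurableTypeR R =>
        phi (w i z.1 + (c * z.2) *: basis_vec i) - phi (w i z.1)).
      apply: bmeasB.
        apply: bmeas_comp (cper_bmeas cp); apply: measurable_rVD.
          exact: measurableT_comp (mw i) (@measurable_fst _ _ _ _).
        by apply: measurable_rVZ => //; apply: measurable_funM.
      apply: bmeas_comp (cper_bmeas cp).
      exact: measurableT_comp (mw i) (@measurable_fst _ _ _ _).
    exact: bmeas_int.
  pose k := c ^+ 2 * s ^+ 2 / 2.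
  have k0 : 0 <= k by rewrite /k divr_ge0// mulr_ge0 ?sqr_ge0.
  have bkq : bmeas (fun y => k * q i (w i y)) by apply: bmeasM => //; exact: bmeas_cst.
  have -> : \int[g]_y T i y - k * q i x =
     \int[g]_y (\int[nrm]_t (phi (w i y + (c * t) *: basis_vec i) - phi (w i y)) - k * q i (w i y))
     + k * \int[g]_y (q i (w i y) - q i x).
    rewrite (intB g bI bkq) (intB g (bq i) (bmeas_cst _)) (gauss_int_cst _ gg) (intZ g k (bq i)) E2; ring.
  rewrite (le_trans (ler_normD _ _))// lerD//.
    apply: (gauss_int_abs_le gg); first exact: bmeasB.
    by move=> y; apply: normal_line_expansion => //; exact: ltW.
  rewrite normrM ger0_norm//.
  have H : `|\int[g]_y (q i (w i y) - q i x)| <= e' + M * c ^+ 2 * (D * s ^+ 2).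
    apply: (gauss_le_quadratic s0 gg).
    - by apply: bmeasB => //; exact: bmeas_cst.
    - by rewrite mulr_ge0.
    move=> y; rewrite (le_trans (HM _ _ _))// lerD2l -mulrA ler_wpM2l//.
    have := norm_trunc_row i (c *: y); rewrite normrZ => H.
    rewrite (@le_trans _ _ ((`|c| * `|y|) ^+ 2))//.
      by rewrite ler_pXn2r ?nnegrE ?mulr_ge0.
    by rewrite exprMn real_normK ?num_real// ler_wpM2l// norm_sqr_le_sum.
  rewrite ler_pM// /k ler_pdivrMr//.
  by rewrite mulr_natr mulr2n lerDl mulr_ge0// sqr_ge0.
rewrite E1 mulr_sumr -sumrB (le_trans (ler_norm_sum _ _ _))//.
rewrite (le_trans (ler_sum _ (fun i _ => E3 i)))//.
rewrite sumr_const card_ord -[leLHS]mulr_natl -/D.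
have -> : D * (e' * c ^+ 2 * s ^+ 2 + M * c ^+ 4 * (3 * s ^+ 4)
    + c ^+ 2 * s ^+ 2 * (e' + M * c ^+ 2 * (D * s ^+ 2))) =
  (D * c ^+ 2 * 2) * e' * s ^+ 2 + D * (3 * M * c ^+ 4 + c ^+ 4 * M * D) * s ^+ 4 by ring.
rewrite lerD2r ler_wpM2r ?sqr_ge0//.
by rewrite /e' mulrA ler_pdivrMr// mulrC ler_wpM2l ?(ltW e0)// lerDl.
Qed.

(** Averaging over the noise turns a Lipschitz function into one with Lipschitz gradient, at the
    price 1/(c s). Coordinate [i] of the noise is redrawn and [normal_smoothing] applies on its
    line; the other coordinates are then averaged. *)
Lemma gauss_smoothing s g (c A : R) phi : 0 < s -> 0 < c -> gauss s g -> cper phi -> BL A phi ->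
  exists p : 'I_d -> 'rV[R]_d -> R,
    [/\ forall i, pderiv i (gop g c phi) (p i), forall i, cper (p i) &
        forall i x z, `|p i (x + z) - p i x| <= A / (c * s) * `|z|].
Proof.
move=> s0 c0 gg cp [pA pL]; pose nrm := normal_prob (0 : R) s.
have A0 : 0 <= A by exact: le_trans (normr_ge0 _) (pA 0).
pose u i (w : 'rV[R]_d) (t : R) := phi (w + (c * t) *: basis_vec i).
pose J i w := s ^- 2 * \int[nrm]_t (u i w t * t).
have mu_ i w : measurable_fun [set: R] (u i w) by exact: scaled_line_measurable.
have put i w : pol4 (fun t => u i w t * t).
  exact: (@pol4_monom _ (u i w) A 1 isT (mu_ i w) (fun t => pA _)).
have s2 : 0 < s ^+ 2 by rewrite exprn_gt0.
have JA i w : `|J i w| <= A / s.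
  rewrite /J normrM gtr0_norm ?invr_gt0// ler_pdivrMl//.
  have -> : s ^+ 2 * (A / s) = 0 + A * s + 0 * s ^+ 2 + 0 * (3 * s ^+ 4) by field; rewrite lt0r_neq0.
  apply: normal_int_le_pol => //; first by case: (put i w).
  by move=> t; rewrite !mul0r !addr0 add0r normrM ler_wpM2r//; exact: pA.
have JL i w z : `|J i (w + z) - J i w| <= A / s * `|z|.
  rewrite /J -mulrBr -RintegralB//; [|exact: pol4_integrable|exact: pol4_integrable].
  rewrite normrM gtr0_norm ?invr_gt0// ler_pdivrMl//.
  have -> : s ^+ 2 * (A / s * `|z|) = 0 + (A * `|z|) * s + 0 * s ^+ 2 + 0 * (3 * s ^+ 4).
    by field; rewrite lt0r_neq0.
  apply: normal_int_le_pol => //; [|by rewrite mulr_ge0|].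
    by apply: measurable_funB; [case: (put i (w + z))|case: (put i w)].
  by move=> t; rewrite !mul0r !addr0 add0r -mulrBl normrM ler_wpM2r// /u addrAC.
have cJ i : continuous (J i).
  by apply: (@BL_continuous _ _ (A / s)); split; [exact: JA|exact: JL].
pose w i x (y : 'rV[R]_d) := x + c *: set_coord i y 0.
have mw i x : measurable_fun setT (w i x).
  apply: measurable_rVD => //; apply: measurable_rVZ => //.
  exact: measurable_set_coordl.
have bJ i x : bmeas (fun y => J i (w i x y)).
  apply: (bmeas_comp (mw i x)); split; first exact: continuous_rV_measurable.
  by exists (A / s).
(* [J i] is the Stein form of the derivative in the noise variable; since that variable enters as
   [c t], a displacement in space is divided by [c]. *)
pose p i x := c^-1 * \int[g]_y J i (w i x y).
have pLip i x z : `|p i (x + z) - p i x| <= A / (c * s) * `|z|.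
  rewrite /p -mulrBr normrM gtr0_norm ?invr_gt0// ler_pdivrMl//.
  have -> : c * (A / (c * s) * `|z|) = A / s * `|z| by field; rewrite !lt0r_neq0.
  rewrite -(intB g (bJ _ _) (bJ _ _)); apply: (gauss_int_abs_le gg); first exact: bmeasB.
  by move=> y; rewrite /w addrAC.
have Hp i : pderiv i (gop g c phi) (p i).
  apply: pderiv_est => x e e0.
  (* As a function of the noise variable [phi] has Lipschitz constant A c, and the displacement
     there is t / c, whence the c^2. *)
  pose L := A * c / s / c ^+ 2; have L0 : 0 <= L by rewrite !divr_ge0 ?mulr_ge0 ?sqr_ge0 ?(ltW c0) ?(ltW s0).
  exists (e / (L + 1)); first by rewrite divr_gt0// ltr_wpDl.
  move=> t; rewrite ltr_pdivlMr ?ltr_wpDl// => te.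
  have bres x' : bmeas (fun y => \int[nrm]_r phi (x' + c *: set_coord i y r)).
    have : bmeas (fun z : 'rV[R]_d * measurableTypeR R => phi (x' + c *: set_coord i z.1 z.2)).
      apply: bmeas_comp (cper_bmeas cp); apply: measurable_rVD => //.
      by apply: measurable_rVZ => //; exact: measurable_set_coord.
    exact: bmeas_int.
  rewrite /gop -(gauss_resample i gg (cper_affine_bmeas (x + t *: basis_vec i) c cp)).
  rewrite -(gauss_resample i gg (cper_affine_bmeas x c cp)).
  rewrite -(intB g (bres _) (bres _)) /p mulrA -(intZ g _ (bJ i x)).
  have bz : bmeas (fun y => t / c * J i (w i x y)) by apply: bmeasM => //; exact: bmeas_cst.
  have bb := bmeasB (bres (x + t *: basis_vec i)) (bres x).
  rewrite -(intB g bb bz).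
  apply: (@le_trans _ _ (L * t ^+ 2)); last first.
    rewrite -real_normK ?num_real// expr2 mulrA ler_wpM2r// mulrC (le_trans _ (ltW te))//.
    by rewrite ler_wpM2l// lerDl.
  apply: (gauss_int_abs_le gg); first exact: bmeasB.
  move=> y.
  have uA' r : `|u i (w i x y) r| <= A by exact: pA.
  have uL' r r' : `|u i (w i x y) (r + r') - u i (w i x y) r| <= A * c * `|r'|.
    rewrite /u mulrDr scalerDl addrA (le_trans (pL _ _))// -mulrA ler_wpM2l//.
    by rewrite (le_trans (norm_scale_basis _ _))// normrM gtr0_norm.
  have := normal_smoothing s0 uA' uL' (t / c).
  have -> : A * c / s * (t / c) ^+ 2 = L * t ^+ 2 by rewrite /L; field; rewrite !lt0r_neq0.
  have -> : \int[nrm]_r phi (x + c *: set_coord i y r) = \int[nrm]_r u i (w i x y) r.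
    apply: eq_Rintegral => r _.
    by rewrite /u /w [set_coord _ _ r]set_coord0 scalerDr scalerA addrA.
  have -> : \int[nrm]_r phi (x + t *: basis_vec i + c *: set_coord i y r) =
      \int[nrm]_r u i (w i x y) (t / c + r).
    apply: eq_Rintegral => r _.
    rewrite /u /w [set_coord _ _ r]set_coord0 scalerDr scalerA mulrDr mulrC [c * (t / c)]mulrC.
    by rewrite divfK ?lt0r_neq0// scalerDl addrACA.
  by [].
exists p; split; [exact: Hp| |exact: pLip].
move=> i; have cper_P := gop_cper c gg cp.
split; last by apply: periodic_pderiv (Hp i) _; case: cper_P.
have := @BL_continuous _ _ (A / (c * s) + `|A / (c * s)| + c^-1 * (A / s)) (p i); apply.
have K0 : 0 <= A / (c * s) by rewrite divr_ge0// mulr_ge0// ltW.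
have K1 : 0 <= c^-1 * (A / s) by rewrite mulr_ge0 ?invr_ge0 ?(ltW c0)// divr_ge0// ltW.
split=> [x|x z].
  rewrite /p normrM gtr0_norm ?invr_gt0//.
  rewrite (@le_trans _ _ (c^-1 * (A / s)))//; last by rewrite lerDr addr_ge0.
  by rewrite ler_wpM2l ?invr_ge0 ?(ltW c0)//; apply: (gauss_int_abs_le gg) => // y; exact: JA.
rewrite (le_trans (pLip _ _ _))// ler_wpM2r// -addrA lerDl addr_ge0//.
Qed.

End gauss_expansion.

(** * Consistency of the perturbed Euler scheme *)

Section directional_primitive.
Context {R : realType} {d : nat}.
Implicit Types (phi : 'rV[R]_d -> R).

(** The identity on the period carrying [circle_measure], truncated outside so as to be a bounded
    function on the whole line. *)
Definition ramp (t : R) : R := Num.max 0 (Num.min t (2 * pi)).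

Lemma ramp_le t : `|ramp t| <= 2 * pi.
Proof.
have p0 := @twopi_gt0 R.
by rewrite /ramp ger0_norm ?le_max ?lexx// ge_max (ltW p0)/= ge_min lexx orbT.
Qed.

Lemma ramp_id t : 0 <= t < 2 * pi -> ramp t = t.
Proof. by move=> /andP[t0 t1]; rewrite /ramp min_l ?(ltW t1)// max_r. Qed.

Lemma bmeas_ramp : bmeas (ramp : measurableTypeR R -> R).
Proof.
split; last by exists (2 * pi); exact: ramp_le.
by apply: measurable_maxr; [exact: measurable_cst|apply: measurable_minr => //; exact: measurable_cst].
Qed.

(* Integrating [t * d_i phi] by parts over a period shows that this weighted average of
   [d_i phi] is [phi - avg i phi]. *)
Definition prim i phi x : R :=
  (2 * pi)^-1 * \int[circle_measure R]_t (ramp t * phi (x + t *: basis_vec i)).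

Lemma prim_bmeas i phi x : cper phi ->
  bmeas (fun t : measurableTypeR R => ramp t * phi (x + t *: basis_vec i)).
Proof. by move=> cp; apply: bmeasM; [exact: bmeas_ramp|exact: cper_line_bmeas]. Qed.

Lemma prim_le (psi : R -> R) (M : R) : bmeas (psi : measurableTypeR R -> R) ->
  (forall t, `|psi t| <= M) -> `|(2 * pi)^-1 * \int[circle_measure R]_t (ramp t * psi t)| <= 2 * pi * M.
Proof.
move=> bp HM; have p0 := @twopi_gt0 R.
rewrite normrM gtr0_norm ?invr_gt0// ler_pdivrMl//.
have bb : bmeas (fun t : measurableTypeR R => ramp t * psi t) by apply: bmeasM => //; exact: bmeas_ramp.
have H t : `|ramp t * psi t| <= 2 * pi * M by rewrite normrM ler_pM// ramp_le.
have := int_abs_le (circle_measure R) bb H.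
by rewrite circle_measureT/= mulrC.
Qed.

(** For [phi] of zero mean along axis [i] this is the potential [zeta] of the perturbation. Only its
    Lipschitz bound and its derivative along [i] are ever used. *)
Lemma prim_BL i A phi : periodic phi -> BL A phi -> BL (2 * pi * A) (prim i phi).
Proof.
move=> pp bp; have cp := BL_cper bp pp; have [p1 p2] := bp; split=> [x|x z].
  by apply: prim_le => //; exact: cper_line_bmeas.
rewrite /prim -mulrBr -intB; [|exact: prim_bmeas|exact: prim_bmeas].
under eq_Rintegral do rewrite -mulrBr.
rewrite -mulrA; apply: prim_le.
  by apply: bmeasB; exact: cper_line_bmeas.
by move=> t; rewrite addrAC.
Qed.

Lemma prim_periodic i phi : periodic phi -> periodic (prim i phi).
Proof.
move=> pp x j; rewrite /prim; congr (_ * _); apply: eq_Rintegral => t _.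
by rewrite addrAC pp.
Qed.

(** The derivative passes under the integral by the uniform estimate [pderiv_unif]; then the
    fundamental theorem for t phi over one period produces the boundary term [phi x] and the
    mean. *)
Lemma pderiv_prim i phi p : cper phi -> cper p -> pderiv i phi p ->
  pderiv i (prim i phi) (fun x => phi x - avg i phi x).
Proof.
move=> cp cpp Hp; have p0 := @twopi_gt0 R.
apply: (@eq_pderiv _ _ _ _ (prim i p)).
  move=> x; have [cl lp] := cper_line i x cp; have [cl' _] := cper_line i x cpp.
  pose h (t : R) := t * phi (x + t *: basis_vec i).
  have D t : is_derive t (1 : R) h (phi (x + t *: basis_vec i) + t * p (x + t *: basis_vec i)).
    have D1 := pderiv_line Hp x t.
    by apply: is_derive_eq; rewrite /GRing.scale/= mulr1 addrC.
  have cd : continuous (fun t : R => phi (x + t *: basis_vec i) + t * p (x + t *: basis_vec i)).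
    move=> t; apply: cvgD; first exact: cl.
    by apply: cvgM; [exact: cvg_id|exact: cl'].
  have := circle_int_derive D cd.
  rewrite /h mul0r subr0 (_ : _ + (2 * pi) *: _ = x + (0 + 2 * pi) *: basis_vec i); last by rewrite add0r.
  rewrite lp scale0r addr0 => E.
  have E2 : \int[circle_measure R]_t (phi (x + t *: basis_vec i) + t * p (x + t *: basis_vec i)) =
    \int[circle_measure R]_t (phi (x + t *: basis_vec i) + ramp t * p (x + t *: basis_vec i)).
    rewrite !circle_intE; first last.
    - exact: continuous_measurable_fun.
    - by case: (bmeasD (cper_line_bmeas i x cp) (prim_bmeas i x cpp)).
    by apply: eq_Rintegral => t; rewrite inE/= in_itv/= => ti; rewrite ramp_id.
  rewrite /prim /avg; apply: (mulfI (lt0r_neq0 p0)).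
  rewrite mulrBr mulVKf ?lt0r_neq0// mulVKf ?lt0r_neq0// -E E2.
  rewrite intD; [|exact: cper_line_bmeas|exact: prim_bmeas].
  by rewrite addrAC subrr add0r.
apply: pderiv_est => x e e0.
have e1 : 0 < e / (2 * pi) by rewrite divr_gt0.
have [h h0 H] := pderiv_unif Hp cpp e1; exists h => // t th.
rewrite /prim -mulrBr -intB; [|exact: prim_bmeas|exact: prim_bmeas].
rewrite mulrCA -mulrBr -intZ; last exact: prim_bmeas.
rewrite -intB; first last.
- by apply: bmeasM; [exact: bmeas_cst|exact: prim_bmeas].
- by apply: bmeasB; exact: prim_bmeas.
rewrite (_ : \int[_]_x0 _ = \int[circle_measure R]_s (ramp s *
   (phi (x + s *: basis_vec i + t *: basis_vec i) - phi (x + s *: basis_vec i) - t * p (x + s *: basis_vec i)))).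
  have -> : e * `|t| = 2 * pi * (e / (2 * pi) * `|t|).
    by rewrite mulrA [2 * pi * _]mulrC divfK// lt0r_neq0.
  apply: prim_le; last by move=> s; exact: H.
  apply: bmeasB; last by apply: bmeasM; [exact: bmeas_cst|exact: cper_line_bmeas].
  apply: bmeasB; last exact: cper_line_bmeas.
  by under eq_fun do rewrite addrAC; exact: cper_line_bmeas.
by apply: eq_Rintegral => s _; rewrite [x + t *: _ + _]addrAC; ring.
Qed.

End directional_primitive.

(** * One Euler step acting on test functions and, dually, on densities *)

Section transport.
Context {R : realType} {d : nat}.
Implicit Types (phi : 'rV[R]_d -> R) (g : {finite_measure set 'rV[R]_d -> \bar R}).

Lemma cperZ phi (a : R) : cper phi -> cper (fun x : 'rV[R]_d => a * phi x).
Proof. by move=> cp; apply: cperM => //; exact: cper_cst. Qed.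

Definition step g (c s : R) (b : 'rV[R]_d -> 'rV[R]_d) phi x := gop g c phi (x + s *: b x).

Lemma step_periodic g (c s : R) b phi : periodic phi ->
  (forall x i, b (x + (2 * pi) *: basis_vec i) = b x) -> periodic (step g c s b phi).
Proof.
move=> pp pb x i; apply: eq_Rintegral => y _.
by rewrite pb (addrAC x) (addrAC (x + _)) pp.
Qed.

(** Averaging over the noise loses nothing; the map x + s b(x) has Lipschitz constant 1 + s L, and
    this is the whole loss per step. *)
Lemma step_BL g (sg c s L A : R) b phi : gauss sg g -> cper phi -> BL A phi -> 0 <= s -> 0 <= L ->
  (forall x z, `|b (x + z) - b x| <= L * `|z|) -> BL (A * (1 + s * L)) (step g c s b phi).
Proof.
move=> gg cp bp s0 L0 bL; have [h1 h2] := gop_BL c gg cp bp.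
have A0 := BL_ge0 bp.
have lip x z : `|step g c s b phi (x + z) - step g c s b phi x| <= A * (1 + s * L) * `|z|.
  have -> : step g c s b phi (x + z) =
      gop g c phi (x + s *: b x + (z + s *: (b (x + z) - b x))).
    rewrite /step; congr (gop _ _ _ _).
    by rewrite scalerBr addrACA [s *: b x + _]addrC subrK.
  rewrite (le_trans (h2 _ _))// -mulrA ler_wpM2l//.
  rewrite (le_trans (ler_normD _ _))// mulrDl mul1r lerD2l normrZ ger0_norm// -mulrA.
  by rewrite ler_wpM2l.
split=> // x; rewrite (le_trans (h1 _))//.
by rewrite ler_peMr// lerDl mulr_ge0.
Qed.

(** A weak form of the Fokker-Planck equation: with flux [B = b q] and div B = lap - w, one step
    carries [q] to q + s w up to three errors. They come from linearizing the smoothed test function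
    in the drift, from expanding the adjoint noise on [q], and from replacing the smoothed test
    function by [phi] in the divergence term. *)
Lemma step_consistency g (sg c s A M Q D T : R) b (q lap w phi : 'rV[R]_d -> R)
    (B dB : 'I_d -> 'rV[R]_d -> R) :
  0 < sg -> 0 < c -> s = sg ^+ 2 -> gauss sg g -> cper phi -> BL A phi ->
  cper q -> (forall j, cper (B j)) -> (forall j, cper (dB j)) -> cper w -> cper lap ->
  (forall x i, b (x + (2 * pi) *: basis_vec i) = b x)  ->
  cper (step g c s b phi) ->
  (forall j, pderiv j (B j) (dB j)) -> (forall j x, b x ord0 j * q x = B j x) ->
  (forall x, \sum_j dB j x = lap x - w x) ->
  (forall x, `|b x| <= M) -> (forall x, `|q x| <= Q) -> (forall x, `|lap x - w x| <= D) ->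
  (forall x, `|gop g (- c) q x - q x - s * lap x| <= T) ->
  `|\int[torus_measure R d]_x (step g c s b phi x * q x)
    - \int[torus_measure R d]_x (phi x * (q x + s * w x))| <=
  (Q * ((A / (c * sg)) *+ d * (s * M) ^+ 2) + A * T + s * (A * c * (1 + d%:R) * sg * D)) * (2 * pi) ^+ d.
Proof.
move=> sg0 c0 sE gg cp bp cq cB cdB cw cl bper cstep HB bq HdB bM qQ lD qT.
have [p [Hp cpp pLip]] := gauss_smoothing sg0 c0 gg cp bp.
have A0 := BL_ge0 bp.
have s0 : 0 < s by rewrite sE exprn_gt0.
have M0 : 0 <= M by exact: le_trans (normr_ge0 _) (bM 0).
pose Pf := gop g c phi; have cP : cper Pf by exact: gop_cper gg cp.
have cPq : cper (gop g (- c) q) by exact: gop_cper gg cq.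
(* The step linearized in the drift displacement; the product of drift and density is already the
   flux. *)
pose main x := Pf x * q x + s * \sum_j B j x * p j x.
have cmain : cper main.
  apply: cperD; first exact: cperM.
  by apply: cperZ; apply: cper_sum => j; exact: cperM.
have cst : cper (step g c s b phi) by [].
have bst := cper_bmeas (cperM cst cq).
(* Noise and derivatives are moved from the test function to the density side: by the adjoint for
   the first term, by parts for the flux term. *)
have E0 : \int[torus_measure R d]_x main x = \int[torus_measure R d]_x
    (phi x * gop g (- c) q x - s * (Pf x * (lap x - w x))).
  have cBp : cper (fun x => s * \sum_j B j x * p j x).
    by apply: cperZ; apply: cper_sum => j; exact: cperM.
  have cPl : cper (fun x => Pf x * (lap x - w x)) by apply: cperM => //; exact: cperB.
  rewrite (intD _ (cper_bmeas (cperM cP cq)) (cper_bmeas cBp)).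
  rewrite (intB _ (cper_bmeas (cperM cp cPq)) (cper_bmeas (cperZ s cPl))).
  rewrite (gop_adjoint c gg cp cq); congr (_ + _).
  rewrite (intZ _ s (cper_bmeas cPl)) (intZ _ s); last first.
    by apply: cper_bmeas; apply: cper_sum => j; exact: cperM.
  rewrite -mulrN; congr (_ * _).
  rewrite int_sum; last by move=> j; apply: cper_bmeas; exact: cperM.
  under eq_bigr => j _ do rewrite (torus_int_by_parts (cB j) cP (cdB j) (cpp j) (HB j) (Hp j)).
  rewrite sumrN -int_sum; last by move=> j; apply: cper_bmeas; exact: cperM.
  by congr (- _); apply: eq_Rintegral => x _; rewrite -mulr_suml HdB mulrC.
have E1 : `|\int[torus_measure R d]_x (step g c s b phi x * q x) - \int[torus_measure R d]_x main x| <=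
    Q * ((A / (c * sg)) *+ d * (s * M) ^+ 2) * (2 * pi) ^+ d.
  rewrite -(intB _ bst (cper_bmeas cmain)).
  have := @int_abs_le _ _ _ (torus_measure R d) (fun x => step g c s b phi x * q x - main x)
    (Q * ((A / (c * sg)) *+ d * (s * M) ^+ 2)) (bmeasB bst (cper_bmeas cmain)).
  rewrite torus_measureT/=; apply => x.
  have -> : step g c s b phi x * q x - main x =
     (Pf (x + s *: b x) - Pf x - \sum_j (s *: b x) ord0 j * p j x) * q x.
    rewrite !mulrBl /main opprD addrA; congr (_ - _).
    rewrite mulr_sumr mulr_suml; apply: eq_bigr => j _.
    by rewrite -bq mxE; ring.
  rewrite normrM mulrC ler_pM//.
  rewrite (le_trans (pderiv_expansion Hp pLip x (s *: b x)))// ler_wpM2l//.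
    by rewrite mulrn_wge0// divr_ge0// mulr_ge0// ltW.
  by rewrite ler_pXn2r ?nnegrE ?mulr_ge0 ?(ltW s0)// normrZ gtr0_norm// ler_wpM2l// ltW.
have cphi : cper (fun x => phi x * (q x + s * w x)).
  by apply: cperM => //; apply: cperD => //; exact: cperZ.
have E2 : `|\int[torus_measure R d]_x main x - \int[torus_measure R d]_x (phi x * (q x + s * w x))| <=
    (A * T + s * (A * c * (1 + d%:R) * sg * D)) * (2 * pi) ^+ d.
  rewrite E0.
  have cc : cper (fun x => phi x * gop g (- c) q x - s * (Pf x * (lap x - w x))).
    by apply: cperB; [exact: cperM|apply: cperZ; apply: cperM => //; exact: cperB].
  rewrite -(intB _ (cper_bmeas cc) (cper_bmeas cphi)).
  have := @int_abs_le _ _ _ (torus_measure R d) _ (A * T + s * (A * c * (1 + d%:R) * sg * D))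
     (bmeasB (cper_bmeas cc) (cper_bmeas cphi)).
  rewrite torus_measureT/=; apply => x.
  have -> : phi x * gop g (- c) q x - s * (Pf x * (lap x - w x)) - phi x * (q x + s * w x) =
    phi x * (gop g (- c) q x - q x - s * lap x) - s * ((Pf x - phi x) * (lap x - w x)) by ring.
  rewrite (le_trans (ler_normB _ _))// lerD//.
    by rewrite normrM ler_pM//; case: bp.
  rewrite !normrM (gtr0_norm s0) ler_wpM2l ?(ltW s0)// ler_pM//.
  by have := gop_close c x sg0 gg cp bp; rewrite (gtr0_norm c0).
rewrite -addrA mulrDl (le_trans _ (lerD E1 E2))//.
set X := \int[_]_x (step _ _ _ _ _ _ * _); set Y := \int[_]_x main x; set Z := \int[_]_x (phi _ * _).
have -> : X - Z = (X - Y) + (Y - Z) by ring.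
exact: ler_normD.
Qed.

End transport.

(** * Perturbed densities, their drifts and their running costs *)

Section perturbed_drift.
Context {R : realType} {d : nat}.
Variables (nu e0 c0 : R) (m r zeta f : 'rV[R]_d -> R) (i0 : 'I_d).
Variables (dm dr : 'I_d -> 'rV[R]_d -> R) (ddm ddr : 'I_d -> 'I_d -> 'rV[R]_d -> R).
Hypotheses (nu0 : 0 < nu) (e01 : 0 <= e0 <= 1) (c0_gt0 : 0 < c0).
Hypotheses (cm : cper m) (cdm : forall i, cper (dm i)) (cddm : forall i j, cper (ddm i j)).
Hypotheses (cr : cper r) (cdr : forall i, cper (dr i)) (cddr : forall i j, cper (ddr i j)).
Hypotheses (m_dm : forall i, pderiv i m (dm i)) (dm_ddm : forall i j, pderiv j (dm i) (ddm i j)).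
Hypotheses (r_dr : forall i, pderiv i r (dr i)) (dr_ddr : forall i j, pderiv j (dr i) (ddr i j)).
Hypotheses (zeta_per : periodic zeta) (zeta_BL : exists A, BL A zeta) (zeta_r : pderiv i0 zeta r).
Hypotheses (f_per : periodic f) (f_BL : exists A, BL A f).
Hypothesis m_lb : forall t x, `|t| <= e0 -> c0 <= m x + t * r x.

Definition pert (t : R) x := m x + t * r x.
(** With this flux, nu Laplacian(q) - div(flux) = k d_i0 zeta = k r for q = [pert t]: the density
    moves along [r] at speed [k]. Position [t] and speed [k] are kept independent until the time
    profile is chosen. *)
Definition flux (t k : R) (j : 'I_d) x := nu * (dm j x + t * dr j x) - k * (zeta x *+ (j == i0)).
Definition drift (t k : R) x : 'rV[R]_d := \row_j (flux t k j x / pert t x).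
Definition run (t k : R) x := 2^-1 * sqnorm (drift t k x) + f x.

Let cz : cper zeta. Proof. by have [A bz] := zeta_BL; exact: BL_cper bz zeta_per. Qed.
Let cf : cper f. Proof. by have [A bf] := f_BL; exact: BL_cper bf f_per. Qed.

Let pert_neq0 t x : `|t| <= e0 -> pert t x != 0.
Proof. by move=> te; rewrite lt0r_neq0// (lt_le_trans c0_gt0)// m_lb. Qed.

Lemma cper_pert t : cper (pert t).
Proof. by apply: cperD => //; exact: cperZ. Qed.

Let cper_delta j : cper (fun x => zeta x *+ (j == i0)).
Proof. by case: (j == i0) => //=; exact: cper_cst. Qed.

Lemma cper_flux t k j : cper (flux t k j).
Proof.
by apply: cperB; apply: cperZ => //; apply: cperD => //; exact: cperZ.
Qed.

Lemma periodic_drift t k x i : drift t k (x + (2 * pi) *: basis_vec i) = drift t k x.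
Proof.
apply/rowP => j; rewrite !mxE; have [_ ->] := cper_flux t k j.
by have [_ ->] := cper_pert t.
Qed.

Lemma BLZ A phi (a k : R) : `|a| <= k -> BL A phi -> BL (k * A) (fun x : 'rV[R]_d => a * phi x).
Proof.
move=> ak bp; have A0 := BL_ge0 bp; have [p1 p2] := bp; split=> [x|x z].
  by rewrite normrM ler_pM.
by rewrite -mulrBr normrM -mulrA ler_pM.
Qed.

Lemma BL_sum A (F : 'I_d -> 'rV[R]_d -> R) : (forall j, BL A (F j)) ->
  BL (A *+ d) (fun x => \sum_j F j x).
Proof.
move=> bF; split=> [x|x z].
  rewrite (le_trans (ler_norm_sum _ _ _))// (le_trans (ler_sum _ (fun j _ => (bF j).1 x)))//.
  by rewrite sumr_const card_ord.
rewrite -sumrB (le_trans (ler_norm_sum _ _ _))// (le_trans (ler_sum _ (fun j _ => (bF j).2 x z)))//.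
by rewrite sumr_const card_ord mulrnAl.
Qed.

Lemma drift_bounds : exists2 B : R, 0 <= B & forall t k, `|t| <= e0 -> `|k| <= e0 ->
  [/\ forall x, `|drift t k x| <= B,
      forall x z, `|drift t k (x + z) - drift t k x| <= B * `|z| & BL B (run t k)].
Proof.
have /andP[e0_ge0 e0_le1] := e01.
have [Am bm] := cper_BL cm cdm m_dm; have [Ar br] := cper_BL cr cdr r_dr.
have /choice[Adm bdm] : forall j, exists A, BL A (dm j).
  by move=> j; exact: cper_BL (cdm j) (cddm j) (dm_ddm j).
have /choice[Adr bdr] : forall j, exists A, BL A (dr j).
  by move=> j; exact: cper_BL (cdr j) (cddr j) (dr_ddr j).
have [Az bz] := zeta_BL; have [Af bf] := f_BL.
pose A := Am + Ar + \sum_j Adm j + \sum_j Adr j + Az.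
have A1 := BL_ge0 bm; have A2 := BL_ge0 br; have A3 := BL_ge0 bz; have A4 := BL_ge0 bf.
have A5 j : 0 <= Adm j by exact: BL_ge0 (bdm j).
have A6 j : 0 <= Adr j by exact: BL_ge0 (bdr j).
have S5 : 0 <= \sum_j Adm j by exact: sumr_ge0.
have S6 : 0 <= \sum_j Adr j by exact: sumr_ge0.
have A0 : 0 <= A by rewrite /A !addr_ge0.
have Bm : BL A m by apply: BL_le bm; rewrite /A; lra.
have Br : BL A r by apply: BL_le br; rewrite /A; lra.
have Bz : BL A zeta by apply: BL_le bz; rewrite /A; lra.
have Bdm j : BL A (dm j).
  apply: BL_le (bdm j); apply: (@le_trans _ _ (\sum_j Adm j)); last by rewrite /A; lra.
  by rewrite (bigD1 j)//= lerDl sumr_ge0.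
have Bdr j : BL A (dr j).
  apply: BL_le (bdr j); apply: (@le_trans _ _ (\sum_j Adr j)); last by rewrite /A; lra.
  by rewrite (bigD1 j)//= lerDl sumr_ge0.
pose A' := nu * (A + 1 * A) + 1 * A.
pose B1 := A' * (c0^-1 + (A + 1 * A) / c0 ^+ 2) *+ 2.
pose B2 := 2^-1 * ((B1 * B1 *+ 2) *+ d) + Af.
have B10 : 0 <= B1.
  rewrite /B1 mulrn_wge0// mulr_ge0//.
    by rewrite /A' addr_ge0// mulr_ge0// ?addr_ge0// ?mulr_ge0// ltW.
  by rewrite addr_ge0 ?invr_ge0 ?(ltW c0_gt0)// divr_ge0 ?sqr_ge0// mul1r addr_ge0.
have B20 : 0 <= B2.
  by rewrite /B2 addr_ge0// mulr_ge0// mulrn_wge0// mulrn_wge0// mulr_ge0.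
exists (B1 + B2); first by rewrite addr_ge0.
move=> t k te ke; have t1 := le_trans te e0_le1; have k1 := le_trans ke e0_le1.
have Bq : BL (A + 1 * A) (pert t) by apply: BLD => //; exact: BLZ.
have BV : BL (c0^-1 + (A + 1 * A) / c0 ^+ 2) (fun x => (pert t x)^-1).
  by apply: BLV => // x; exact: m_lb.
have BF j : BL A' (flux t k j).
  apply: BLD.
    apply: BLZ; first by rewrite gtr0_norm.
    by apply: BLD => //; exact: BLZ.
  apply: BLN; apply: BLZ => //.
  case: (j == i0) => //=.
  by apply: BL_le (BL_cst (0 : R)); rewrite normr0.
have Bb j : BL B1 (fun x => flux t k j x / pert t x) by exact: BLM.
split=> [x|x z|].
- apply: norm_rV_le; first by rewrite addr_ge0.
  by move=> j; rewrite mxE (le_trans ((Bb j).1 x))// lerDl.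
- apply: norm_rV_le; first by rewrite mulr_ge0// addr_ge0.
  by move=> j; rewrite !mxE (le_trans ((Bb j).2 x z))// ler_wpM2r// lerDl.
apply: (@BL_le _ _ B2); first by rewrite lerDr.
apply: BLD => //; apply: BLZ; first by rewrite ger0_norm.
have -> : (fun x => sqnorm (drift t k x)) =
    (fun x => \sum_j (flux t k j x / pert t x) * (flux t k j x / pert t x)).
  by apply/funext => x; rewrite /sqnorm; apply: eq_bigr => j _; rewrite mxE expr2.
by apply: BL_sum => j; exact: BLM.
Qed.

Lemma periodic_run t k : periodic (run t k).
Proof. by move=> x i; rewrite /run periodic_drift f_per. Qed.

(** [run0], [run1] and [run2] are the value and the two partial derivatives, in position and in
    speed, at t = k = 0 of the cost density [run * pert]. *)
Definition run0 x := 2^-1 * \sum_j (nu * dm j x) ^+ 2 / m x + f x * m x.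
Definition run1 x := \sum_j nu ^+ 2 * (dm j x * dr j x / m x - r x * dm j x ^+ 2 / (2 * m x ^+ 2)) + f x * r x.
Definition run2 x := - (nu * zeta x * dm i0 x / m x).

(** The kinetic part is |flux|^2 / (2 q), a homogeneous function of degree 1 of flux and density, so
    its remainder after linearization is exactly a square divided by q. The part in [f] is linear in
    the density. *)
Lemma run_pert_expansion t k x : `|t| <= e0 ->
  run t k x * pert t x = run0 x + t * run1 x + k * run2 x
  + 2^-1 * \sum_j (t * (nu * (dr j x - dm j x * r x / m x)) - k * (zeta x *+ (j == i0))) ^+ 2 / pert t x.
Proof.
move=> te; have q0 := pert_neq0 x te.
have m0 : m x != 0.
  have := @pert_neq0 0 x; rewrite normr0 /pert mul0r addr0; apply.
  by case/andP: e01.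
have E2 : run2 x = \sum_j (- (nu * (zeta x *+ (j == i0)) * dm j x / m x)).
  rewrite (bigD1 i0)//= eqxx mulr1n big1 ?addr0// => j /negbTE ->.
  by rewrite mulr0n mulr0 !mul0r oppr0.
have S : 2^-1 * sqnorm (drift t k x) * pert t x = 2^-1 * \sum_j (nu * dm j x) ^+ 2 / m x
   + t * (\sum_j nu ^+ 2 * (dm j x * dr j x / m x - r x * dm j x ^+ 2 / (2 * m x ^+ 2)))
   + k * run2 x + 2^-1 * \sum_j (t * (nu * (dr j x - dm j x * r x / m x)) - k * (zeta x *+ (j == i0))) ^+ 2 / pert t x.
  rewrite E2 /sqnorm !mulr_sumr !mulr_suml -!big_split/=; apply: eq_bigr => j _.
  rewrite mxE /flux; set z := _ *+ _; move: q0; rewrite /pert => q0.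
  by field; rewrite q0 m0.
rewrite /run mulrDl S /run0 /run1 /pert; ring.
Qed.

(** First-order terms are kept exactly; only the square is estimated, by (t u - k z)^2 <= 2 (t^2 u^2
    + k^2 z^2) and [pert >= c0]. *)
Lemma int_run_le : exists2 K : R, 0 <= K & forall t k, `|t| <= e0 -> `|k| <= e0 ->
  \int[torus_measure R d]_x (run t k x * pert t x) <=
  \int[torus_measure R d]_x run0 x + t * \int[torus_measure R d]_x run1 x
  + k * \int[torus_measure R d]_x run2 x + K * (t ^+ 2 + k ^+ 2).
Proof.
have m0 x : m x != 0.
  have := @pert_neq0 0 x; rewrite normr0 /pert mul0r addr0; apply.
  by case/andP: e01.
have ciV : cper (fun x => (m x)^-1) by exact: cperV.
have cu j : cper (fun x => nu * (dr j x - dm j x * r x / m x)).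
  by apply: cperZ; apply: cperB => //; apply: cperM => //; exact: cperM.
have /choice[U HU] : forall j, exists M : R, forall x, `|nu * (dr j x - dm j x * r x / m x)| <= M.
  by move=> j; exact: cper_bounded.
have [Z HZ] := cper_bounded cz.
have Z0 : 0 <= Z by exact: le_trans (normr_ge0 _) (HZ 0).
pose K := \sum_j ((U j) ^+ 2 + Z ^+ 2) / c0.
have K0 : 0 <= K by rewrite sumr_ge0// => j _; rewrite divr_ge0 ?(ltW c0_gt0)// addr_ge0// sqr_ge0.
pose V := fine (torus_measure R d setT).
have V0 : 0 <= V by rewrite fine_ge0.
exists (K * V); first by rewrite mulr_ge0.
move=> t k te ke.
have csq (phi : 'rV[R]_d -> R) : cper phi -> cper (fun x => phi x ^+ 2).
  by move=> cp; under eq_fun do rewrite expr2; exact: cperM.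
have c0' : cper run0.
  apply: cperD; last exact: cperM.
  apply: cperZ; apply: cper_sum => j; apply: cperM => //; apply: csq; exact: cperZ.
have c1' : cper run1.
  apply: cperD; last exact: cperM.
  apply: cper_sum => j; apply: cperZ; apply: cperB.
    by apply: cperM => //; exact: cperM.
  apply: cperM; first by apply: cperM => //; exact: csq.
  apply: cperV; first by apply: cperZ; exact: csq.
  by move=> x; rewrite mulf_neq0// expf_neq0.
have c2' : cper run2.
  by apply: cperN; apply: cperM => //; apply: cperM => //; exact: cperZ.
rewrite mulrAC -int_cst.
have b0 := cper_bmeas c0'; have b1 := cper_bmeas c1'; have b2 := cper_bmeas c2'.
have b1' := bmeasM (bmeas_cst t) b1; have b2' := bmeasM (bmeas_cst k) b2.
have b01 := bmeasD b0 b1'; have b012 := bmeasD b01 b2'.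
have bK := bmeas_cst (T := 'rV[R]_d) (K * (t ^+ 2 + k ^+ 2)).
rewrite -(intZ _ _ b1) -(intZ _ _ b2) -intD// -intD// -intD//.
apply: int_le.
- apply: cper_bmeas; apply: cperM; last exact: cper_pert.
  have [B B0 HB] := drift_bounds; have [_ _ H] := HB t k te ke.
  exact: BL_cper H (periodic_run t k).
- exact: bmeasD.
move=> x; rewrite run_pert_expansion// lerD2l.
rewrite [leLHS]mulr_sumr /K [leRHS]mulr_suml ler_sum// => j _.
have qc : c0 <= pert t x by exact: m_lb.
have q0 : 0 < pert t x by exact: lt_le_trans qc.
have Uj : (nu * (dr j x - dm j x * r x / m x)) ^+ 2 <= U j ^+ 2.
  rewrite -real_normK ?num_real// ler_pXn2r ?nnegrE//.
  exact: le_trans (normr_ge0 _) (HU j x).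
have Zj : (zeta x *+ (j == i0)) ^+ 2 <= Z ^+ 2.
  rewrite -real_normK ?num_real// ler_pXn2r ?nnegrE//.
  by case: (j == i0); rewrite ?mulr1n ?mulr0n ?normr0// (le_trans (normr_ge0 _) (HZ x)).
set u := nu * _ in Uj *; set z := _ *+ _ in Zj *.
apply: (@le_trans _ _ ((t ^+ 2 * u ^+ 2 + k ^+ 2 * z ^+ 2) / pert t x)).
  rewrite mulrA ler_wpM2r ?invr_ge0 ?(ltW q0)// mulrC ler_pdivrMr//.
  rewrite -subr_ge0 (_ : _ - _ = (t * u + k * z) ^+ 2) ?sqr_ge0//; ring.
apply: (@le_trans _ _ ((t ^+ 2 * u ^+ 2 + k ^+ 2 * z ^+ 2) / c0)).
  rewrite ler_wpM2l// ?lef_pV2 ?posrE//.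
  by rewrite addr_ge0// mulr_ge0// sqr_ge0.
rewrite [leRHS]mulrAC ler_wpM2r ?invr_ge0 ?(ltW c0_gt0)//.
have t2 := sqr_ge0 t; have k2 := sqr_ge0 k; have u2 := sqr_ge0 u; have z2 := sqr_ge0 z.
have H1 := ler_wpM2l t2 Uj; have H2 := ler_wpM2l k2 Zj.
have H3 : 0 <= t ^+ 2 * Z ^+ 2 by rewrite mulr_ge0// sqr_ge0.
have H4 : 0 <= k ^+ 2 * U j ^+ 2 by rewrite mulr_ge0// sqr_ge0.
lra.
Qed.

Lemma pderiv_flux t k j : pderiv j (flux t k j)
  (fun x => nu * (ddm j j x + t * ddr j j x) - k * (r x *+ (j == i0))).
Proof.
apply: pderivB.
  by apply: pderivZ; apply: pderivD => //; exact: pderivZ.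
apply: pderivZ; have [->|_] := eqVneq j i0; first by [].
by have := @pderiv_cst R d j 0; apply: eq_pderiv.
Qed.

Variable c : R.
Hypotheses (c_gt0 : 0 < c) (c2 : c ^+ 2 = 2 * nu).

(** The threshold [h] is uniform in [t], [k] and [phi]: since [pert t] is affine in [t], it suffices
    to expand the noise on [m] and on [r]. *)
Lemma pert_consistency (eta : R) : 0 < eta -> exists2 h : R, 0 < h &
  forall sg g, 0 < sg -> sg < h -> gauss sg g -> forall t k A phi, `|t| <= e0 -> `|k| <= e0 ->
    periodic phi -> BL A phi ->
  `|\int[torus_measure R d]_x (step g c (sg ^+ 2) (drift t k) phi x * pert t x)
    - \int[torus_measure R d]_x (phi x * (pert t x + sg ^+ 2 * (k * r x)))| <= eta * sg ^+ 2 * A.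
Proof.
move=> eta0; have /andP[e0_ge0 e0_le1] := e01.
have [B B0 HB] := drift_bounds.
pose V : R := (2 * pi) ^+ d; have V0 : 0 < V by rewrite exprn_gt0// twopi_gt0.
(* The expansions on [m] and on [r] each contribute e sg^2, integrated over volume [V]: together
   half of [eta]. *)
pose e := eta / (4 * V); have e_gt0 : 0 < e by rewrite divr_gt0// mulr_gt0.
have [K1 K10 T1] := gauss_taylor (- c) cm (fun i => cddm i i) m_dm (fun i => dm_ddm i i) e_gt0.
have [K2 K20 T2] := gauss_taylor (- c) cr (fun i => cddr i i) r_dr (fun i => dr_ddr i i) e_gt0.
have [Q1 HQ1] := cper_bounded cm; have [Q2 HQ2] := cper_bounded cr.
have cL1 : cper (fun x => nu * \sum_j ddm j j x) by apply: cperZ; exact: cper_sum.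
have cL2 : cper (fun x => nu * \sum_j ddr j j x) by apply: cperZ; exact: cper_sum.
have [D1 HD1] := cper_bounded cL1; have [D2 HD2] := cper_bounded cL2.
have Q10 := le_trans (normr_ge0 _) (HQ1 0); have Q20 := le_trans (normr_ge0 _) (HQ2 0).
have D10 := le_trans (normr_ge0 _) (HD1 0); have D20 := le_trans (normr_ge0 _) (HD2 0).
pose Q := Q1 + Q2; pose D := D1 + D2 + Q2.
have Q0 : 0 <= Q by exact: addr_ge0.
have D0 : 0 <= D by rewrite addr_ge0// addr_ge0.
(* [N] collects the errors that carry an additional factor [sg]; the choice of [h] makes them the
   other half of [eta]. *)
pose N : R := Q * (c^-1 * d%:R * B ^+ 2) + (K1 + K2) + c * (1 + d%:R) * D.
have N0 : 0 <= N.
  apply: addr_ge0; first apply: addr_ge0; first apply: mulr_ge0 => //.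
  - by apply: mulr_ge0; [rewrite mulr_ge0// invr_ge0 ltW|exact: sqr_ge0].
  - exact: addr_ge0.
  - by apply: mulr_ge0 => //; rewrite mulr_ge0 ?(ltW c_gt0)// addr_ge0.
pose h := Num.min 1 (eta / (2 * V * (N + 1))).
have VN : 0 < 2 * V * (N + 1) by rewrite !mulr_gt0// ltr_wpDl.
exists h; first by rewrite lt_min ltr01 divr_gt0.
move=> sg g sg0; rewrite lt_min => /andP[sg1 sgN] gg t k A phi te ke pp bp.
have A0 := BL_ge0 bp.
have t1 := le_trans te e0_le1; have k1 := le_trans ke e0_le1.
have [b1 b2 b3] := HB t k te ke.
have cp := BL_cper bp pp.
pose lap x := nu * \sum_j ddm j j x + t * (nu * \sum_j ddr j j x).
have H := @step_consistency R d g sg c (sg ^+ 2) A B Q D (2 * e * sg ^+ 2 + (K1 + K2) * sg ^+ 4)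
  (drift t k) (pert t) lap (fun x => k * r x) phi (flux t k)
  (fun j x => nu * (ddm j j x + t * ddr j j x) - k * (r x *+ (j == i0))) sg0 c_gt0 erefl gg cp bp.
have cst : cper (step g c (sg ^+ 2) (drift t k) phi).
  apply: (BL_cper (step_BL c gg cp bp (sqr_ge0 sg) B0 b2)).
  by apply: step_periodic => //; exact: periodic_drift.
apply: le_trans (H _ _ _ _ _ _ _ _ _ _ _ _ _ _) _ => {H}.
- exact: cper_pert.
- by move=> j; exact: cper_flux.
- move=> j; apply: cperB; first by apply: cperZ; apply: cperD => //; exact: cperZ.
  by apply: cperZ; case: (j == i0) => //=; exact: cper_cst.
- exact: cperZ.
- by apply: cperD => //; exact: cperZ.
- by move=> x i; exact: periodic_drift.
- exact: cst.
- by move=> j; exact: pderiv_flux.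
- by move=> j x; rewrite mxE divfK// pert_neq0.
- move=> x; rewrite sumrB; congr (_ - _).
    by rewrite -mulr_sumr big_split/= -mulr_sumr /lap; ring.
  rewrite (bigD1 i0)//= eqxx mulr1n big1 ?addr0// => j /negbTE ->.
  by rewrite mulr0n mulr0.
- exact: b1.
- move=> x; rewrite (le_trans (ler_normD _ _))// lerD// normrM -[Q2]mul1r.
  by rewrite ler_pM.
- move=> x; rewrite (le_trans (ler_normB _ _))// lerD//.
    rewrite (le_trans (ler_normD _ _))// lerD// normrM -[D2]mul1r.
    by rewrite ler_pM.
  by rewrite normrM -[Q2]mul1r ler_pM.
- move=> x.
  have E : gop g (- c) (pert t) x = gop g (- c) m x + t * gop g (- c) r x.
    rewrite /gop -intZ; last exact: cper_affine_bmeas.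
    rewrite -intD//; [exact: cper_affine_bmeas|].
    by apply: bmeasM; [exact: bmeas_cst|exact: cper_affine_bmeas].
  have := T1 sg g x sg0 gg; have := T2 sg g x sg0 gg.
  rewrite sqrrN c2 E /pert /lap.
  set S1 := \sum_i _; set S2 := \sum_j ddm _ _ _ => H2 H1.
  have -> : gop g (- c) m x + t * gop g (- c) r x - (m x + t * r x) - sg ^+ 2 * (nu * S2 + t * (nu * S1))
    = (gop g (- c) m x - m x - 2 * nu * sg ^+ 2 / 2 * S2) +
      t * (gop g (- c) r x - r x - 2 * nu * sg ^+ 2 / 2 * S1) by field.
  have H3 : `|t * (gop g (- c) r x - r x - 2 * nu * sg ^+ 2 / 2 * S1)| <= e * sg ^+ 2 + K2 * sg ^+ 4.
    rewrite normrM -[leRHS]mul1r ler_pM//.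
  rewrite (le_trans (ler_normD _ _))// (le_trans (lerD H1 H3))//.
  by rewrite le_eqVlt; apply/orP; left; apply/eqP; ring.
rewrite -/V -[A / (c * sg) *+ d]mulr_natr.
have -> : (Q * (A / (c * sg) * d%:R * (sg ^+ 2 * B) ^+ 2)
   + A * (2 * e * sg ^+ 2 + (K1 + K2) * sg ^+ 4) + sg ^+ 2 * (A * c * (1 + d%:R) * sg * D)) * V =
   (V * (sg * (Q * (c^-1 * d%:R * B ^+ 2) + (K1 + K2) * sg + c * (1 + d%:R) * D)) + 2 * e * V) * (sg ^+ 2 * A).
  by field; rewrite !lt0r_neq0.
have G0 : 0 <= sg ^+ 2 * A by apply: mulr_ge0 => //; exact: sqr_ge0.
rewrite -[eta * _ * A]mulrA ler_wpM2r//.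
have -> : 2 * e * V = eta / 2 by rewrite /e; field; rewrite lt0r_neq0.
rewrite [leRHS]splitr lerD2r.
apply: (@le_trans _ _ (V * (sg * N))).
  rewrite ler_wpM2l ?(ltW V0)// ler_wpM2l ?(ltW sg0)// /N lerD2r lerD2l.
  by rewrite ler_piMr ?addr_ge0// ltW.
apply: (@le_trans _ _ (V * (sg * (N + 1)))).
  by rewrite ler_wpM2l ?(ltW V0)// ler_wpM2l ?(ltW sg0)// lerDl.
move: (ltW sgN); rewrite ler_pdivlMr// => H.
rewrite ler_pdivlMr// (le_trans _ H)// le_eqVlt; apply/orP; left; apply/eqP; ring.
Qed.

End perturbed_drift.

(** * Brownian increments and progressive processes *)

Section random_variables.
Context {dO : measure_display} {Omega : measurableType dO} {R : realType}.
Variable P : probability Omega R.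

Lemma prob_int_cst (c : R) : \int[P]_w c = c.
Proof.
rewrite int_cst -[RHS]mulr1; congr (_ * _).
by transitivity (fine (1%E : \bar R)) => //; congr fine; exact: probability_setT.
Qed.

Lemma prob_int_abs_le (phi : Omega -> R) (M : R) : bmeas phi -> (forall w, `|phi w| <= M) ->
  `|\int[P]_w phi w| <= M.
Proof.
move=> bp pM; rewrite (le_trans (int_abs_le P bp pM))// -[leRHS]mulr1.
rewrite le_eqVlt; apply/orP; left; apply/eqP; congr (_ * _).
by transitivity (fine (1%E : \bar R)) => //; congr fine; exact: probability_setT.
Qed.

Section law.
Context {dT : measure_display} {T : measurableType dT}.
Variables (X : Omega -> T) (mX : measurable_fun setT X).

Let law_lty : (image_measure P mX setT < +oo)%E.
Proof. by rewrite image_measureE preimage_setT -ge0_fin_numE ?fin_num_measure. Qed.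

(** The restriction to the whole space only serves to attach the finite-measure structure to the
    image measure. *)
Definition law : {finite_measure set T -> \bar R} :=
  mfrestr measurableT law_lty.

Lemma lawE A : measurable A -> law A = P (X @^-1` A).
Proof. by move=> mA; transitivity (P (X @^-1` (A `&` setT))) => //; rewrite setIT. Qed.

Lemma int_law (phi : T -> R) : bmeas phi -> \int[law]_x phi x = \int[P]_w phi (X w).
Proof. by move=> bp; apply: int_image => // A mA; exact: lawE. Qed.

End law.

(** The product formula on rectangles identifies the joint law with the product of the law of [X]
    and [m2]; Fubini then integrates the second variable. *)
Lemma independent_int {d1 d2 : measure_display} {T1 : measurableType d1} {T2 : measurableType d2}
    (X : Omega -> T1) (Y : Omega -> T2) (m2 : {finite_measure set T2 -> \bar R})
    (Psi : T1 * T2 -> R) :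
  measurable_fun setT X -> measurable_fun setT Y ->
  (forall A B, measurable A -> measurable B ->
    P (X @^-1` A `&` Y @^-1` B) = (P (X @^-1` A) * m2 B)%E) -> bmeas Psi ->
  \int[P]_w Psi (X w, Y w) = \int[P]_w \int[m2]_y Psi (X w, y).
Proof.
move=> mX mY ind bp.
have mXY : measurable_fun setT (fun w => (X w, Y w)) by exact: measurable_fun_pair.
pose h x := \int[m2]_y Psi (x, y).
have bh : bmeas h by exact: (bmeas_int (law mX) m2 bp).
rewrite -[RHS]/(\int[P]_w h (X w)) -(int_law mX bh) /h.
rewrite -(int_prod (law mX) m2 bp); symmetry.
apply: (@int_image_integrable _ _ _ _ R P (law mX \x m2)%E (fun w => (X w, Y w)) Psi mXY).
- move=> A mA; apply: (@product_measure_unique _ _ T1 T2 R (law mX) m2 (image_measure P mXY)) => //.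
  move=> B C mB mC; transitivity (P (X @^-1` B `&` Y @^-1` C)) => //.
  by rewrite ind//; congr (_ * _)%E; symmetry; exact: (lawE mX mB).
- by case: bp.
- exact: (bmeas_integrable P (bmeas_comp mXY bp)).
Qed.

End random_variables.

Section brownian.
Context {R : realType} {d : nat} {dO : measure_display} {Omega : measurableType dO}.
Variables (P : probability Omega R) (G : R -> set (set Omega)) (W : R -> Omega -> 'rV[R]_d).
Hypotheses (FG : filtration G) (BW : brownian_motion P G W).

Lemma wrt_measurable (t : R) (X : Omega -> 'rV[R]_d) : 0 <= t -> measurable_wrt (G t) X ->
  measurable_fun setT X.
Proof. by move=> t0 mX _ B mB; rewrite setTI; exact: (filtration_measurable FG t0 (mX _ mB)). Qed.

Lemma filtration_id (t : R) : 0 <= t -> <<s G t>> = G t.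
Proof. by move=> t0; exact: sigma_algebra_id (filtration_sigma_algebra FG t0). Qed.

Lemma measurable_wrtP (t : R) (X : Omega -> 'rV[R]_d) : 0 <= t -> measurable_wrt (G t) X <->
  measurable_fun [set: g_sigma_algebraType (G t)] X.
Proof.
move=> t0; split=> [mX _ B mB|mX B mB].
  by rewrite setTI; apply: sub_sigma_algebra; exact: mX.
rewrite -filtration_id// -[X in _ X]setTI; exact: (mX measurableT B mB).
Qed.

Lemma measurable_W (t : R) : 0 <= t -> measurable_fun setT (W t).
Proof. by move=> t0; exact: wrt_measurable t0 (brownian_adapted BW t0). Qed.

Lemma measurable_increment (s t : R) : 0 <= s -> 0 <= t ->
  measurable_fun setT (fun w => W t w - W s w).
Proof.
move=> s0 t0; rewrite (_ : (fun _ => _) = fun w => W t w + (-1) *: W s w); last first.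
  by apply/funext => w; rewrite scaleN1r.
by apply: measurable_rVD; [|apply: measurable_rVZ => //]; exact: measurable_W.
Qed.

Definition incr_law (s t : R) (s0 : 0 <= s) (t0 : 0 <= t) := law P (measurable_increment s0 t0).

Lemma gauss_incr_law (s t : R) (s0 : 0 <= s) (t0 : 0 <= t) : s < t ->
  gauss (Num.sqrt (t - s)) (incr_law s0 t0).
Proof.
move=> st B mB; rewrite lawE; last exact: measurable_box.
have := brownian_increment BW s0 st _ mB; move=> /(_ setT).
rewrite setTI (_ : P setT = 1%E) ?mul1e; last exact: probability_setT.
apply; have [_ GC _] := filtration_sigma_algebra FG s0.
by rewrite -filtration_id//; exact: (@measurableT _ (g_sigma_algebraType (G s))).
Qed.

(** The definition of Brownian motion gives independence on boxes; for a fixed past event both sides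
    are finite measures in the increment, and [rV_measure_unique] extends the identity to all
    measurable sets. *)
Lemma increment_independent (s t : R) (s0 : 0 <= s) (t0 : 0 <= t) (X : Omega -> 'rV[R]_d)
    (Psi : 'rV[R]_d * 'rV[R]_d -> R) : s < t -> measurable_wrt (G s) X -> bmeas Psi ->
  \int[P]_w Psi (X w, W t w - W s w) = \int[P]_w \int[incr_law s0 t0]_y Psi (X w, y).
Proof.
move=> st mX bp; apply: independent_int => //.
- exact: wrt_measurable s0 mX.
- exact: measurable_increment.
move=> A B mA mB.
pose XA := X @^-1` A.
have mXA : measurable XA by exact: (filtration_measurable FG s0 (mX _ mA)).
have mD := measurable_increment s0 t0.
pose c := NngNum (fine_ge0 (measure_ge0 P XA)).
have cE : (c%:num)%:E = P XA by rewrite /= fineK// fin_num_measure.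
have H := @rV_measure_unique R d (image_measure (mrestr P mXA) mD) (mscale c (incr_law s0 t0)).
transitivity (image_measure (mrestr P mXA) mD B).
  by rewrite image_measureE /mrestr /= setIC.
rewrite H//.
- by rewrite -cE.
- rewrite image_measureE preimage_setT -[X in (X < _)%E]/(P (setT `&` XA)) setTI.
  by rewrite -ge0_fin_numE ?fin_num_measure.
- move=> C mC.
  transitivity (P (XA `&` [set w | forall i, C i (rV_coord i (W t w - W s w))])).
    by rewrite setIC.
  rewrite (brownian_increment BW s0 st (mX _ mA) mC) -cE; congr (_ * _)%E.
  by symmetry; exact: (gauss_incr_law s0 t0 st mC).
Qed.

End brownian.

Section parametric.
Context {R : realType}.
Local Notation leb := (@lebesgue_measure R).

(** An arbitrary control need not be integrable, so the integral is measured through its positive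
    and negative parts separately. *)
Lemma measurable_int_param {d1} {T1 : measurableType d1} (f : T1 * measurableTypeR R -> \bar R) :
  measurable_fun setT f -> measurable_fun setT (fun x => \int[leb]_s f (x, s))%E.
Proof.
move=> mf; have Hp := @measurable_fun_fubini_tonelli_F _ _ T1 (measurableTypeR R) R leb (f^\+)%E
  (measurable_funepos mf) (fun x => funepos_ge0 f x).
have Hn := @measurable_fun_fubini_tonelli_F _ _ T1 (measurableTypeR R) R leb (f^\-)%E
  (measurable_funeneg mf) (fun x => funeneg_ge0 f x).
rewrite (_ : (fun x => _) = fun x => (fubini_F leb (f^\+)%E x - fubini_F leb (f^\-)%E x)%E).
  exact: (emeasurable_funB Hp Hn).
apply/funext => x; rewrite integralE /fubini_F.
by congr (_ - _)%E; apply: eq_integral => y _; rewrite ?funeposE ?funenegE.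
Qed.

Lemma measurable_Rint_param {d1} {T1 : measurableType d1} (f : T1 * measurableTypeR R -> R) :
  measurable_fun setT f -> measurable_fun setT (fun x => \int[leb]_s f (x, s)).
Proof.
move=> mf; apply: (measurableT_comp (f := fine)) => //.
by apply: (measurable_int_param (f := EFin \o f)); exact/measurable_EFinP.
Qed.

(** The cost integrand is bounded below by an integrable function, but its integral may be infinite;
    this is the subtraction rule for that situation. *)
Lemma integralB_ge0 {dT} {T : measurableType dT} (mu : {measure set T -> \bar R}) (D : set T)
    (k : T -> \bar R) (g : T -> R) : measurable D -> measurable_fun D k ->
  (forall x, D x -> 0 <= k x)%E -> (forall x, 0 <= g x) -> mu.-integrable D (EFin \o g) ->
  (\int[mu]_(x in D) (k x - (g x)%:E) = \int[mu]_(x in D) k x - \int[mu]_(x in D) (g x)%:E)%E.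
Proof.
move=> mD mk k0 g0 ig.
have mg : measurable_fun D (EFin \o g) by exact: measurable_int ig.
pose h x := (k x - (g x)%:E)%E.
have mh : measurable_fun D h by exact: emeasurable_funB.
have mp : measurable_fun D (h^\+)%E by exact: measurable_funepos.
have mn : measurable_fun D (h^\-)%E by exact: measurable_funeneg.
(* All four functions are nonnegative, so both integrals split; the part [h^\-] is dominated by [g],
   hence has finite integral and can be subtracted. *)
have E1 : (\int[mu]_(x in D) (h^\+ x + (g x)%:E) = \int[mu]_(x in D) (k x + h^\- x))%E.
  apply: eq_integral => x xD; have := k0 x (set_mem xD); rewrite funeposE funenegE /h.
  case: (k x) => [r| |] r0 //; last first.
    have -> : (+oo - (g x)%:E = +oo)%E by [].
    by rewrite max_l ?leey// max_r ?leNye// adde0.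
  rewrite -EFinB -EFinN -!EFin_max -!EFinD; congr EFin.
  by rewrite /Num.max; case: ltP => h1; case: ltP => h2; lra.
rewrite ge0_integralD// in E1.
rewrite ge0_integralD// in E1; last by move=> x _; rewrite lee_fin.
rewrite integralE.
set a := (\int[mu]_(x in D) h^\+ x)%E in E1 *; set b := (\int[mu]_(x in D) h^\- x)%E in E1 *.
set c := (\int[mu]_(x in D) (g x)%:E)%E in E1 *; set e := (\int[mu]_(x in D) k x)%E in E1 *.
have cfin : c \is a fin_num by apply: integrable_fin_num.
have b0 : (0 <= b)%E by apply: integral_ge0 => x _; exact: funeneg_ge0.
have bc : (b <= c)%E.
  apply: ge0_le_integral => //.
  move=> x Dx; have := k0 x Dx; rewrite funenegE /h.
  case: (k x) => [r| |]//=; rewrite ?lee_fin => r0.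
    by rewrite -EFin_max lee_fin ge_max g0 andbT; have := g0 x; lra.
  by rewrite max_r ?leNye// lee_fin.
have bfin : b \is a fin_num.
  by rewrite ge0_fin_numE//; apply: le_lt_trans bc _; rewrite ltey_eq cfin.
move: E1 bfin cfin; case: b {b0 bc} => // b; case: c => // c E1 _ _.
have -> : a = (e + b%:E - c%:E)%E by rewrite -E1 addeK.
case: e {E1} => [r| |]//=.
by rewrite -!EFinD; congr EFin; ring.
Qed.

Lemma integral_expR (rho : R) : 0 < rho ->
  (\int[leb]_(t in `[0%R, +oo[) (expR (- (rho * t)))%:E = (rho^-1)%:E)%E.
Proof.
move=> r0; have := integral_exponential_pdf r0.
have -> : (\int[leb]_x (exponential_pdf rho x)%:E =
    \int[leb]_(x in `[0%R, +oo[) (rho%:E * (expR (- (rho * x)))%:E))%E.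
  rewrite [RHS]integral_mkcond; apply: eq_integral => x _.
  by rewrite /exponential_pdf !patchE; case: ifP => //; rewrite mulNr.
rewrite ge0_integralZl//; last 2 first.
- apply/measurable_EFinP/measurable_funTS; apply: measurableT_comp => //.
  by apply: measurable_funN; exact: measurable_funM.
- by rewrite lee_fin ltW.
set I := (\int[leb]_(x in _) _)%E => E.
have Ifin : I \is a fin_num.
  rewrite ge0_fin_numE; last by apply: integral_ge0 => x _; rewrite lee_fin expR_ge0.
  by rewrite ltey; apply/eqP => Ioo; move: E; rewrite Ioo gt0_muley ?lte_fin.
move: E; rewrite -(fineK Ifin) -EFinM => -[E]; congr EFin.
by rewrite -[rho^-1]mulr1 -E mulKf// lt0r_neq0.
Qed.

Lemma integrable_expR (rho : R) : 0 < rho ->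
  leb.-integrable `[0%R, +oo[ (fun t => (expR (- (rho * t)))%:E).
Proof.
move=> r0; apply/integrableP; split.
  apply/measurable_EFinP/measurable_funTS; apply: measurableT_comp => //.
  by apply: measurable_funN; exact: measurable_funM.
under eq_integral do rewrite /= ger0_norm ?expR_ge0//.
by rewrite integral_expR// ltry.
Qed.

End parametric.

Section controlled_state.
Context {R : realType} {d : nat} {dO : measure_display} {Omega : measurableType dO}.
Variables (P : probability Omega R) (G : R -> set (set Omega)) (W : R -> Omega -> 'rV[R]_d).
Hypotheses (FG : filtration G) (BW : brownian_motion P G W).
Local Notation leb := (@lebesgue_measure R).

Lemma progressive_section (a : R -> Omega -> 'rV[R]_d) (t : R) (i : 'I_d) :
  progressively_measurable G a -> 0 <= t ->
  measurable_fun setT ((fun q : measurableTypeR R * g_sigma_algebraType (G t) =>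
    a q.1 q.2 ord0 i) \_ ([set` `[0, t]] `*` setT : set (measurableTypeR R * g_sigma_algebraType (G t)))).
Proof.
move=> pa t0.
have mD : measurable ([set` `[0, t]] `*` setT : set (measurableTypeR R * g_sigma_algebraType (G t))).
  by apply: measurableX.
apply: (proj1 (measurable_restrictT (fun q : measurableTypeR R * g_sigma_algebraType (G t) =>
    a q.1 q.2 ord0 i) mD)).
have m1 := pa t t0.
have m2 : measurable_fun [set: 'rV[R]_d] (@rV_coord R d i) by exact: measurable_rV_coord.
exact: (measurableT_comp m2 m1).
Qed.

Lemma progressive_integral (a : R -> Omega -> 'rV[R]_d) (t : R) (i : 'I_d) :
  progressively_measurable G a -> 0 <= t ->
  measurable_fun [set: g_sigma_algebraType (G t)]
    (fun w => \int[leb]_(s in `[0, t]) (a s w ord0 i)).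
Proof.
move=> pa t0; have m := progressive_section i pa t0.
rewrite (_ : (fun _ => _) = fun w => \int[leb]_s
  (((fun q : measurableTypeR R * g_sigma_algebraType (G t) =>
    a q.1 q.2 ord0 i) \_ ([set` `[0, t]] `*` setT : set (measurableTypeR R * g_sigma_algebraType (G t)))) (s, w))).
  apply: (measurable_Rint_param (T1 := g_sigma_algebraType (G t)) (f := fun p =>
   (((fun q : measurableTypeR R * g_sigma_algebraType (G t) =>
    a q.1 q.2 ord0 i) \_ ([set` `[0, t]] `*` setT)) (p.2, p.1)))).
  apply: (measurableT_comp m).
  by apply: measurable_fun_pair; [exact: measurable_snd|exact: measurable_fst].
apply/funext => w; rewrite Rintegral_mkcond; apply: eq_Rintegral => s _.
rewrite !patchE; congr (if _ then _ else _).
by apply/idP/idP; rewrite !inE//= => -[].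
Qed.

Lemma measurable_state_wrt (nu : R) xi a (t : R) : measurable_wrt (G 0) xi ->
  progressively_measurable G a -> 0 <= t -> measurable_wrt (G t) (state W nu xi a t).
Proof.
move=> mxi pa t0; apply: (proj2 (measurable_wrtP FG _ t0)).
apply: measurable_rVD; last first.
  apply: measurable_rVZ; first exact: measurable_cst.
  by apply: (proj1 (measurable_wrtP FG _ t0)); exact: (brownian_adapted BW t0).
apply: measurable_rVD.
  apply: (proj1 (measurable_wrtP FG _ t0)) => B mB.
  exact: (filtration_nondecreasing FG (lexx 0) t0 (mxi _ mB)).
apply/measurable_fun_rVP => i.
rewrite (_ : _ \o _ = fun w => \int[leb]_(s in `[0, t]) (a s w ord0 i)); last first.
  by apply/funext => w; rewrite /rV_coord/= mxE.
exact: progressive_integral.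
Qed.

(** Progressive measurability at time [n] gives joint measurability on [0, n]; the extensions by 0
    converge pointwise as [n] grows. *)
Lemma progressive_joint (a : R -> Omega -> 'rV[R]_d) (i : 'I_d) : progressively_measurable G a ->
  measurable_fun setT ((fun q : measurableTypeR R * Omega => a q.1 q.2 ord0 i)
    \_ ([set` `[0, +oo[] `*` setT : set (measurableTypeR R * Omega))).
Proof.
move=> pa.
pose F (n : nat) := (fun q : measurableTypeR R * Omega => a q.1 q.2 ord0 i) \_ ([set` `[0, n%:R]] `*` setT : set (measurableTypeR R * Omega)).
have mF n : measurable_fun setT (F n).
  have n0 : 0 <= n%:R :> R by [].
  have m := progressive_section i pa n0.
  have mid : measurable_fun setT (fun q : measurableTypeR R * Omega =>
      (q.1, q.2) : measurableTypeR R * g_sigma_algebraType (G n%:R)).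
    apply: measurable_fun_pair; first exact: measurable_fst.
    apply: (measurableT_comp (f := fun w : Omega => w : g_sigma_algebraType (G n%:R))).
      move=> _ B mB; rewrite setTI preimage_id.
      by apply: (filtration_measurable FG n0); rewrite -(filtration_id FG n0).
    exact: measurable_snd.
  by have := measurableT_comp m mid; congr measurable_fun; apply/funext => -[t w].
apply: (measurable_fun_cvg mF) => -[t w] _.
have [t0|t0] := leP 0 t; last first.
  rewrite patchE ifF; last first.
    by apply/negbTE/negP; rewrite inE/= in_itv/= andbT leNgt t0 => -[].
  apply: cvg_near_cst; apply: nearW => n; rewrite /F patchE ifF//.
  by apply/negbTE/negP; rewrite inE/= in_itv/= leNgt t0 => -[].
rewrite patchE ifT; last by rewrite inE/= in_itv/= t0.
apply: cvg_near_cst; near=> n; rewrite /F patchE ifT//.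
rewrite inE/= in_itv/= t0/=; split=> //.
by near: n; exact: nbhs_infty_ger.
Unshelve. all: by end_near. Qed.

Lemma brownian_right_continuous w (t e : R) : 0 <= t -> 0 < e ->
  exists2 h : R, 0 < h & forall s, t < s -> s < t + h -> `|W s w - W t w| < e.
Proof.
move=> t0 e0; have C : {within `[0, +oo[, continuous (fun t => W t w)} by exact: (brownian_continuous BW).
have [c1 c2] := proj1 (continuous_within_itvcyP _ _) C.
have : W s w @[s --> t^'+] --> W t w.
  move: t0; rewrite le_eqVlt => /predU1P[<-//|t0].
  by apply: cvg_at_right_filter; apply: c1; rewrite in_itv/= t0.
move/cvgrPdist_lt => /(_ e e0)[h h0 H]; exists h => // s ts sh.
rewrite distrC; apply: H => //=.
by rewrite distrC gtr0_norm ?subr_gt0// ltrBlDl.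
Qed.

(** Times are rounded up to a grid, where the process takes countably many measurable values, and
    right continuity passes to the limit. Negative times are folded to 0 to have a function on the
    whole line. *)
Lemma brownian_joint : measurable_fun setT
  (fun q : measurableTypeR R * Omega => W (Num.max 0 q.1) q.2).
Proof.
apply/measurable_fun_rVP => i.
pose k (n : nat) (t : R) := Num.truncn (n.+1%:R * Num.max 0 t).
(* The successor of the truncation gives a grid point strictly after [t] and at most 1/(n+1)
   away. *)
pose Wn (n : nat) (q : measurableTypeR R * Omega) := rV_coord i (W ((k n q.1).+1%:R / n.+1%:R) q.2).
have mh n : measurable_fun setT (fun q : measurableTypeR R * Omega => n.+1%:R * Num.max 0 q.1).
  apply: measurable_funM; first exact: measurable_cst.
  by apply: measurable_maxr; [exact: measurable_cst|exact: measurable_fst].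
have pos (t : R) : 0 <= Num.max 0 t by rewrite le_max lexx.
have kitv n (t : R) : ((k n t)%:R : R) <= n.+1%:R * Num.max 0 t < (k n t).+1%:R.
  by apply: truncn_itv; rewrite mulr_ge0.
have mW n : measurable_fun setT (Wn n).
  pose E j := (fun q : measurableTypeR R * Omega => n.+1%:R * Num.max 0 q.1) @^-1` [set` `[(j%:R : R), j.+1%:R[].
  have mE j : measurable (E j).
    by rewrite /E -[X in measurable X]setTI; apply: mh.
  have -> : setT = \bigcup_j E j.
    apply/seteqP; split=> // q _; exists (k n q.1) => //.
    by rewrite /E/= in_itv/=; exact: kitv.
  apply/(measurable_fun_bigcup _ mE) => j.
  have H : {in E j, (fun q : measurableTypeR R * Omega => rV_coord i (W (j.+1%:R / n.+1%:R) q.2)) =1 Wn n}.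
    move=> q; rewrite inE /E/= in_itv/= => /andP[q1 q2]; rewrite /Wn.
    have -> : k n q.1 = j by apply: truncn_def; rewrite q1 q2.
    by [].
  apply: (eq_measurable_fun _ H); apply: measurable_funTS.
  apply: measurableT_comp; first exact: measurable_rV_coord.
  apply: (measurableT_comp (f := W (j.+1%:R / n.+1%:R))); last exact: measurable_snd.
  by apply: (measurable_W FG BW); rewrite divr_ge0.
apply: (measurable_fun_cvg mW) => q _; apply/cvgrPdist_lt => e e0.
have [h h0 H] := brownian_right_continuous q.2 (pos q.1) e0.
near=> n; have n0 : 0 < n.+1%:R :> R by rewrite ltr0n.
rewrite /Wn /rV_coord/= distrC -[X in `|X|](_ : (W ((k n q.1).+1%:R / n.+1%:R) q.2 - W (Num.max 0 q.1) q.2) ord0 i = _); last by rewrite !mxE.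
rewrite (le_lt_trans (norm_coord_le _ _))//; have /andP[k1 k2] := kitv n q.1.
apply: H; first by rewrite ltr_pdivlMr// mulrC.
rewrite ltr_pdivrMr// -natr1 mulrDl mulrC.
rewrite (le_lt_trans (lerD k1 (lexx 1)))// mulrC ltrD2l.
rewrite -ltr_pdivrMl// mulr1 (@lt_trans _ _ n%:R) ?ltr_nat//.
by near: n; exact: nbhs_infty_gtr.
Unshelve. all: by end_near. Qed.

Lemma state_joint (nu : R) xi a : measurable_wrt (G 0) xi -> progressively_measurable G a ->
  measurable_fun setT (fun q : measurableTypeR R * Omega => state W nu xi a (Num.max 0 q.1) q.2).
Proof.
move=> mxi pa; apply: measurable_rVD; last first.
  by apply: measurable_rVZ; [exact: measurable_cst|exact: brownian_joint].
apply: measurable_rVD.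
  by apply: measurableT_comp; [exact: (wrt_measurable FG (lexx 0) mxi)|exact: measurable_snd].
apply/measurable_fun_rVP => i.
pose F := (fun q : measurableTypeR R * Omega => a q.1 q.2 ord0 i) \_ ([set` `[0, +oo[] `*` setT : set (measurableTypeR R * Omega)).
pose f (p : (measurableTypeR R * Omega) * measurableTypeR R) : R :=
  if p.2 <= Num.max 0 p.1.1 then F (p.2, p.1.2) else 0.
rewrite (_ : _ \o _ = fun q => \int[leb]_s f (q, s)); last first.
  apply/funext => -[t w]; rewrite /rV_coord/= mxE Rintegral_mkcond; apply: eq_Rintegral => s _.
  rewrite /f /F !patchE /=.
  have -> : (s \in [set` `[0, Num.max 0 t]]) = (0 <= s <= Num.max 0 t).
    by apply/idP/idP; rewrite inE/= in_itv.
  have -> : ((s, w) \in [set` `[0, +oo[] `*` setT) = (0 <= s).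
    by apply/idP/idP; rewrite inE/= in_itv/= andbT => // -[].
  by case: (0 <= s); case: (s <= _).
apply: measurable_Rint_param.
apply: measurable_fun_ifT.
- apply: measurable_fun_ler; first exact: measurable_snd.
  apply: measurable_maxr; first exact: measurable_cst.
  by apply: (measurableT_comp measurable_fst); exact: measurable_fst.
- apply: (measurableT_comp (progressive_joint i pa)).
  apply: measurable_fun_pair; first exact: measurable_snd.
  by apply: (measurableT_comp measurable_snd); exact: measurable_fst.
- exact: measurable_cst.
Qed.

End controlled_state.

(** * The cost of a control *)

Section cost_formula.
Context {R : realType} {d : nat} {dO : measure_display} {Omega : measurableType dO}.
Variables (P : probability Omega R) (G : R -> set (set Omega)) (W : R -> Omega -> 'rV[R]_d).
Hypotheses (FG : filtration G) (BW : brownian_motion P G W).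
Variables (rho nu C : R) (f : 'rV[R]_d -> tprob R d -> R) (mu : tprob R d).
Hypotheses (rho0 : 0 < rho) (cf : continuous (f ^~ mu)) (fC : forall x, `|f x mu| <= C).
Variables (xi : Omega -> 'rV[R]_d) (a : R -> Omega -> 'rV[R]_d).
Hypotheses (mxi : measurable_wrt (G 0) xi) (pa : progressively_measurable G a).
Local Notation leb := (@lebesgue_measure R).
Local Notation X := (state W nu xi a).

Lemma sqnorm_ge0 (v : 'rV[R]_d) : 0 <= sqnorm v.
Proof. by rewrite sumr_ge0// => i _; exact: sqr_ge0. Qed.

Lemma measurable_sqnorm {dT} {T : measurableType dT} (h : T -> 'rV[R]_d) :
  (forall i, measurable_fun setT (fun x => h x ord0 i)) -> measurable_fun setT (fun x => sqnorm (h x)).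
Proof. by move=> mh; apply: measurable_sum => i; exact: measurable_funX. Qed.

(** The constant [C] bounds [f] and makes the running cost nonnegative. *)
Definition running t w := 2^-1 * sqnorm (a t w) + f (X t w) mu + C.

Lemma running_ge0 t w : 0 <= running t w.
Proof.
rewrite /running -addrA addr_ge0 ?mulr_ge0 ?sqnorm_ge0//.
by have := fC (X t w); rewrite ler_norml => /andP[]; lra.
Qed.

Lemma control_measurable (t : R) (i : 'I_d) : 0 <= t -> measurable_fun setT (fun w => a t w ord0 i).
Proof.
move=> t0; have m := progressive_joint FG i pa.
have := measurableT_comp m (@pair1_measurable _ _ (measurableTypeR R) Omega t).
congr measurable_fun; apply/funext => w /=; rewrite patchE ifT//.
by rewrite inE/= in_itv/= t0.
Qed.

Lemma running_measurable (t : R) : 0 <= t -> measurable_fun setT (running t).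
Proof.
move=> t0; apply: measurable_funD; last exact: measurable_cst.
apply: measurable_funD.
  apply: measurable_funM; first exact: measurable_cst.
  by apply: measurable_sqnorm => i; exact: control_measurable.
apply: (measurableT_comp (continuous_rV_measurable cf)).
exact: (wrt_measurable FG t0 (measurable_state_wrt FG BW nu mxi pa t0)).
Qed.

(** Adding C / rho makes the integrand nonnegative, which legitimates exchanging expectation and
    time integral even when the cost is infinite. *)
Lemma cost_formula : (cost P W rho nu f (fun=> mu) xi a + (C / rho)%:E =
  \int[leb]_(t in `[0%R, +oo[) ((expR (- (rho * t)))%:E * \int[P]_w (running t w)%:E))%E.
Proof.
have C0 : 0 <= C by exact: le_trans (normr_ge0 _) (fC 0).
pose D := [set` `[(0 : R), +oo[].
pose F i := (fun q : measurableTypeR R * Omega => a q.1 q.2 ord0 i)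
    \_ (D `*` setT : set (measurableTypeR R * Omega)).
have mF i : measurable_fun setT (F i) by exact: (progressive_joint FG i pa).
have mX := state_joint FG BW nu mxi pa.
have me : measurable_fun [set: measurableTypeR R] (fun t : measurableTypeR R => expR (- (rho * t))).
  apply: measurableT_comp => //; apply: measurable_funN; exact: measurable_funM.
pose K0 (q : measurableTypeR R * Omega) : R := expR (- (rho * q.1)) *
  (2^-1 * \sum_i F i q ^+ 2 + f (X (Num.max 0 q.1) q.2) mu + C).
have mK0 : measurable_fun setT K0.
  apply: measurable_funM; first by apply: (measurableT_comp me); exact: measurable_fst.
  apply: measurable_funD; last exact: measurable_cst.
  apply: measurable_funD; last exact: measurableT_comp (continuous_rV_measurable cf) mX.
  apply: measurable_funM; first exact: measurable_cst.
  by apply: measurable_sum => i; exact: measurable_funX.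
have mD0 : measurable (D : set (measurableTypeR R)) by exact: measurable_itv.
have mD : measurable (D `*` setT : set (measurableTypeR R * Omega)) by exact: measurableX.
pose K := K0 \_ (D `*` setT : set (measurableTypeR R * Omega)).
have mK : measurable_fun setT K.
  by apply: (proj1 (measurable_restrictT K0 mD)); exact: measurable_funTS.
have KE t w : D t -> K (t, w) = expR (- (rho * t)) * running t w.
  move=> Dt; have t0 : 0 <= t by move: Dt; rewrite /D/= in_itv/= andbT.
  rewrite /K patchE ifT; last by rewrite inE.
  rewrite /K0 /running /= max_r//; congr (_ * (_ * _ + _ + _)).
  by apply: eq_bigr => i _; rewrite /F patchE ifT// inE.
have K_ge0 q : 0 <= K q.
  case: q => t w; have [Dt|Dt] := pselect (D t).
    by rewrite KE// mulr_ge0 ?expR_ge0 ?running_ge0.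
  by rewrite /K patchE ifF//; apply/negbTE/negP; rewrite inE => -[].
have inner w : (\int[leb]_(t in D) (expR (- (rho * t)) *
      (2^-1 * sqnorm (a t w) + f (X t w) mu))%:E =
    \int[leb]_t (K (t, w))%:E - (C / rho)%:E)%E.
  transitivity (\int[leb]_(t in D) ((K (t, w))%:E - (C * expR (- (rho * t)))%:E))%E.
    apply: eq_integral => t; rewrite inE => Dt; rewrite KE// -EFinB /running; congr EFin; ring.
  have mKw : measurable_fun D (fun t : measurableTypeR R => (K (t, w))%:E).
    apply/measurable_EFinP/measurable_funTS.
    exact: (measurableT_comp mK (@pair2_measurable _ _ (measurableTypeR R) Omega w)).
  rewrite (@integralB_ge0 R _ (measurableTypeR R) leb D (fun t => (K (t, w))%:E)
     (fun t => C * expR (- (rho * t))))//; last 3 first.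
  - by move=> t _; rewrite lee_fin.
  - by move=> t; rewrite mulr_ge0// expR_ge0.
  - rewrite /comp; under eq_fun do rewrite EFinM.
    by apply: integrableZl => //; exact: integrable_expR.
  congr (_ - _)%E.
    rewrite integral_mkcond; apply: eq_integral => t _; rewrite patchE; case: ifPn => // Dt.
    by rewrite /K patchE ifF//; apply/negbTE; apply: contra Dt; rewrite !inE => -[].
  under eq_integral do rewrite EFinM.
  rewrite ge0_integralZl//; last exact/measurable_EFinP/measurable_funTS.
  by rewrite integral_expR// -EFinM.
have mI : measurable_fun setT (fun w => \int[leb]_t (K (t, w))%:E)%E.
  apply: (measurable_int_param (f := fun p : Omega * measurableTypeR R => (K (p.2, p.1))%:E)).
  apply/measurable_EFinP; apply: (measurableT_comp mK).
  by apply: measurable_fun_pair; [exact: measurable_snd|exact: measurable_fst].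
rewrite /cost; under eq_integral do rewrite inner.
rewrite (@integralB_ge0 R _ Omega P setT _ (fun=> C / rho))//; last 3 first.
- by move=> w _; apply: integral_ge0 => t _; rewrite lee_fin.
- by move=> w; rewrite divr_ge0// ltW.
- exact: (bmeas_integrable P (bmeas_cst _)).
have -> : (\int[P]_(x in setT) (C / rho)%:E = (C / rho)%:E)%E.
  by rewrite integral_cst//= (_ : P setT = 1%E) ?mule1//; exact: probability_setT.
rewrite subeK//.
rewrite (@fubini_tonelli _ _ Omega (measurableTypeR R) R P leb (fun p => (K (p.2, p.1))%:E)); last 2 first.
- apply/measurable_EFinP; apply: (measurableT_comp mK).
  by apply: measurable_fun_pair; [exact: measurable_snd|exact: measurable_fst].
- by move=> q; rewrite lee_fin.
rewrite [RHS]integral_mkcond; apply: eq_integral => t _; rewrite patchE; case: ifPn => Dt.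
  move: Dt; rewrite inE => Dt.
  have t0 : 0 <= t by move: Dt; rewrite /D/= in_itv/= andbT.
  rewrite -ge0_integralZl//.
  - by apply: eq_integral => w _; rewrite /= KE.
  - exact/measurable_EFinP/running_measurable.
  - by move=> w _; rewrite lee_fin running_ge0.
apply: integral0_eq => w _; rewrite /K patchE ifF//.
by apply/negbTE; apply: contra Dt; rewrite !inE => -[].
Qed.

End cost_formula.

(** * The Euler scheme as a control *)

Section interval_overlap.
Context {R : realType}.
Local Notation leb := (@lebesgue_measure R).

Definition slot (a b s : R) : R := ((a <= s) && (s < b))%:R.

Lemma slot_indic (a b : R) : slot a b = \1_([set` `[a, b[] : set R).
Proof.
apply/funext => s; rewrite /slot indicE; congr (nat_of_bool _)%:R.
by apply/idP/idP; rewrite inE/= in_itv.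
Qed.

Lemma int_slotE (a b t : R) : \int[leb]_(s in `[0, t]) slot a b s =
  fine (leb ([set` `[a, b[] `&` [set` `[0, t]])).
Proof.
rewrite /Rintegral slot_indic integral_indic//; exact: measurable_itv.
Qed.

Lemma int_slot_after (a b t : R) : 0 <= a -> a <= b -> b <= t ->
  \int[leb]_(s in `[0, t]) slot a b s = b - a.
Proof.
move=> a0 ab bt; rewrite int_slotE (_ : _ `&` _ = [set` `[a, b[]).
  rewrite lebesgue_measure_itv/= lte_fin; move: ab; rewrite le_eqVlt => /predU1P[->|->//].
  by rewrite ltxx subrr.
apply/seteqP; split=> s /=; rewrite !in_itv/=; first by case.
by move=> /andP[as_ sb]; split; apply/andP; split=> //; lra.
Qed.

Lemma int_slot_before (a b t : R) : t <= a -> \int[leb]_(s in `[0, t]) slot a b s = 0.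
Proof.
move=> ta; rewrite int_slotE.
suff -> : leb ([set` `[a, b[] `&` [set` `[0, t]]) = 0%E by [].
apply/eqP; rewrite eq_le measure_ge0 andbT -(lebesgue_measure_set1 a).
apply: le_measure; rewrite ?inE//; first by apply: measurableI; exact: measurable_itv.
move=> s /=; rewrite !in_itv/= => -[/andP[as_ _] /andP[_ st]].
by apply/eqP; rewrite eq_le as_ andbT (le_trans st).
Qed.

Lemma int_slot_during (a b t : R) : 0 <= a -> a <= t -> t <= b ->
  \int[leb]_(s in `[0, t]) slot a b s = t - a.
Proof.
move=> a0 at_; rewrite le_eqVlt => /predU1P[tb|tb].
  by rewrite tb int_slot_after// -tb.
rewrite int_slotE (_ : _ `&` _ = [set` `[a, t]]).
  rewrite lebesgue_measure_itv/= lte_fin; move: at_; rewrite le_eqVlt => /predU1P[->|->//].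
  by rewrite ltxx subrr.
apply/seteqP; split=> s /=; rewrite !in_itv/=.
  by move=> [/andP[-> _] /andP[_ ->]].
by move=> /andP[as_ st]; split; apply/andP; split=> //; lra.
Qed.

Lemma slot_integrable (a b t : R) : leb.-integrable `[0, t] (fun s => (slot a b s)%:E).
Proof.
rewrite slot_indic; apply: measurable_bounded_integrable => //.
- have : (leb [set` `[(0 : R)%R, t]] < +oo)%E.
    by rewrite lebesgue_measure_itv/=; case: ifP => // _; exact: ltry.
  by [].
- exists 1; split; first exact: num_real.
  move=> x x1 y _; rewrite /= indicE (le_trans _ (ltW x1))//.
  by case: (_ \in _); rewrite ?normr1 ?normr0.
Qed.

Lemma slot_scaled_integrable (x a b t : R) :
  leb.-integrable `[0, t] (fun s => (x * slot a b s)%:E).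
Proof.
rewrite (_ : (fun s => _) = fun s => (x%:E * (slot a b s)%:E)%E).
  by apply: integrableZl; [exact: measurable_itv|exact: slot_integrable].
by apply/funext => s.
Qed.

End interval_overlap.

Section euler_scheme.
Context {R : realType} {d : nat} {dO : measure_display} {Omega : measurableType dO}.
Variables (P : probability Omega R) (G : R -> set (set Omega)) (W : R -> Omega -> 'rV[R]_d).
Hypotheses (FG : filtration G) (BW : brownian_motion P G W).
Variables (nu delta : R) (xi : Omega -> 'rV[R]_d) (n : nat) (b : nat -> 'rV[R]_d -> 'rV[R]_d).
Hypotheses (delta0 : 0 < delta) (mxi : measurable_wrt (G 0) xi).
Hypothesis mb : forall k, measurable_fun setT (b k).
Local Notation c := (Num.sqrt (2 * nu)).

Definition grid (k : nat) : R := k%:R * delta.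

(** The Euler-Maruyama chain. It starts at xi + c W_0 because [W 0] vanishes only almost surely and
    [state] contains this term. *)
Fixpoint chain (k : nat) (w : Omega) : 'rV[R]_d :=
  if k is j.+1 then
    chain j w + delta *: b j (chain j w) + c *: (W (grid j.+1) w - W (grid j) w)
  else xi w + c *: W 0 w.

(** The scheme as an open-loop control: on each grid interval it is the feedback drift frozen at the
    left end, and it vanishes after the last grid time. *)
Definition euler (t : R) (w : Omega) : 'rV[R]_d :=
  \sum_(k < n) slot (grid k) (grid k.+1) t *: b k (chain k w).

Lemma grid_ge0 k : 0 <= grid k.
Proof. by rewrite mulr_ge0// ltW. Qed.

Lemma grid0 : grid 0 = 0. Proof. by rewrite /grid mul0r. Qed.

Lemma gridS k : grid k.+1 = grid k + delta.
Proof. by rewrite /grid -natr1 mulrDl mul1r. Qed.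

Lemma grid_le j k : (j <= k)%N -> grid j <= grid k.
Proof. by move=> jk; rewrite /grid ler_wpM2r ?(ltW delta0)// ler_nat. Qed.

Lemma wrt_le s t (X : Omega -> 'rV[R]_d) : 0 <= s -> s <= t -> measurable_wrt (G s) X ->
  measurable_wrt (G t) X.
Proof. by move=> s0 st mX B mB; apply: (filtration_nondecreasing FG s0 st); exact: mX. Qed.

Lemma chain_wrt k : measurable_wrt (G (grid k)) (chain k).
Proof.
elim: k => [|k IH].
  rewrite grid0; apply: (proj2 (measurable_wrtP FG _ (lexx 0))).
  apply: measurable_rVD; first exact: (proj1 (measurable_wrtP FG _ (lexx 0)) mxi).
  apply: measurable_rVZ; first exact: measurable_cst.
  exact: (proj1 (measurable_wrtP FG _ (lexx 0)) (brownian_adapted BW (lexx 0))).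
have t0 := grid_ge0 k.+1.
have kk : grid k <= grid k.+1 by exact: grid_le.
have m1 := proj1 (measurable_wrtP FG _ t0) (wrt_le (grid_ge0 k) kk IH).
have m2 := proj1 (measurable_wrtP FG _ t0) (wrt_le (grid_ge0 k) kk (brownian_adapted BW (grid_ge0 k))).
have m3 := proj1 (measurable_wrtP FG _ t0) (brownian_adapted BW t0).
apply: (proj2 (measurable_wrtP FG _ t0)) => /=.
apply: measurable_rVD.
  apply: measurable_rVD => //; apply: measurable_rVZ; first exact: measurable_cst.
  exact: measurableT_comp (mb k) m1.
apply: measurable_rVZ; first exact: measurable_cst.
under eq_fun do rewrite -scaleN1r.
by apply: measurable_rVD => //; apply: measurable_rVZ => //; exact: measurable_cst.
Qed.

Lemma euler_progressive : progressively_measurable G euler.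
Proof.
move=> t t0.
(* Terms starting after [t] vanish on [0, t] but involve a future chain value; dropping them leaves
   only variables that are measurable at time [t]. *)
pose e (p : R * g_sigma_algebraType (G t)) : 'rV[R]_d := \sum_(k < n)
  (if grid k <= t then slot (grid k) (grid k.+1) p.1 *: b k (chain k p.2) else 0).
have me : measurable_fun setT e.
  apply/measurable_fun_rVP => i.
  rewrite (_ : _ \o _ = fun p => \sum_(k < n) ((if grid k <= t then
     slot (grid k) (grid k.+1) p.1 *: b k (chain k p.2) else 0) ord0 i)); last first.
    by apply/funext => p; rewrite /rV_coord/= summxE.
  apply: measurable_sum => k; have [kt|kt] := leP (grid k) t; last first.
    by under eq_fun do rewrite mxE; exact: measurable_cst.
  have m1 := proj1 (measurable_wrtP FG _ t0) (wrt_le (grid_ge0 k) kt (chain_wrt k)).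
  have ms : measurable_fun [set: R] (slot (grid k) (grid k.+1)).
    by rewrite slot_indic; apply: measurable_indic; exact: measurable_itv.
  have mbk : measurable_fun setT (fun p : R * g_sigma_algebraType (G t) => b k (chain k p.2)).
    apply: (measurableT_comp (mb k)); apply: (measurableT_comp m1); exact: measurable_snd.
  have := @measurable_rVZ R d _ _ (fun p : R * g_sigma_algebraType (G t) => slot (grid k) (grid k.+1) p.1)
     (fun p => b k (chain k p.2)) (measurableT_comp ms measurable_fst) mbk.
  by move=> /measurable_fun_rVP /(_ i).
apply: (eq_measurable_fun e).
  move=> [s w]; rewrite inE/= in_itv/= => -[/andP[s0 st] _].
  rewrite /e /euler; apply: eq_bigr => k _ /=; case: ifPn => //; rewrite -ltNge => tk.
  by rewrite /slot leNgt (le_lt_trans st tk)/= scale0r.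
exact: measurable_funTS.
Qed.

Lemma euler_at k t w : (k < n)%N -> grid k <= t -> t < grid k.+1 -> euler t w = b k (chain k w).
Proof.
move=> kn kt tk; rewrite /euler (bigD1 (Ordinal kn))//= big1 ?addr0.
  by rewrite /slot kt tk scale1r.
move=> j jk; rewrite /slot; have [jk'|kj] := ltnP j k.
  by rewrite [t < _]ltNge (le_trans (grid_le jk') kt) andbF scale0r.
have kj' : (k < j)%N.
  rewrite ltn_neqAle kj andbT eq_sym; apply: contra jk => /eqP jk.
  by apply/eqP/val_inj.
by rewrite leNgt (lt_le_trans tk (grid_le kj')) scale0r.
Qed.

Lemma euler_after t w : grid n <= t -> euler t w = 0.
Proof.
move=> nt; rewrite /euler big1// => k _.
by rewrite /slot [t < _]ltNge (le_trans (grid_le (ltn_ord k)) nt) andbF scale0r.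
Qed.

Lemma chainE k w : chain k w = xi w + (\sum_(j < k) delta *: b j (chain j w)) + c *: W (grid k) w.
Proof.
elim: k => [|k IH]; first by rewrite big_ord0 addr0 grid0.
rewrite big_ord_recr/= {1}IH scalerBr.
set s := \sum_(i < k) _; set v := delta *: _.
rewrite -!addrA; congr (_ + (_ + _)).
by rewrite addrCA; congr (_ + _); rewrite addrCA subrr addr0.
Qed.

(** The integral of the control counts the slots before [k] in full, slot [k] for the time t - grid
    k, and no later slot; at grid times the controlled state is therefore the chain. *)
Lemma state_euler k t w : (k < n)%N -> grid k <= t -> t <= grid k.+1 ->
  state W nu xi euler t w =
  chain k w + (t - grid k) *: b k (chain k w) + c *: (W t w - W (grid k) w).
Proof.
move=> kn kt tk; rewrite /state.
have t0 : 0 <= t by exact: le_trans (grid_ge0 k) kt.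
have E : \row_i \int[lebesgue_measure]_(s in `[0, t]) (euler s w ord0 i) =
    (\sum_(j < k) delta *: b j (chain j w)) + (t - grid k) *: b k (chain k w).
  apply/rowP => i; rewrite !mxE summxE.
  have ij (j : 'I_n) : lebesgue_measure.-integrable `[0, t]
      (fun s => (b j (chain j w) ord0 i * slot (grid j) (grid j.+1) s)%:E).
    exact: slot_scaled_integrable.
  transitivity (\sum_(j < n) (b j (chain j w) ord0 i *
      \int[lebesgue_measure]_(s in `[0, t]) slot (grid j) (grid j.+1) s)).
    transitivity (\int[lebesgue_measure]_(s in `[0, t])
        \sum_(j < n) (b j (chain j w) ord0 i * slot (grid j) (grid j.+1) s)).
      apply: eq_Rintegral => s _; rewrite /euler summxE; apply: eq_bigr => j _.
      by rewrite mxE mulrC.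
    rewrite /Rintegral; under eq_integral do rewrite -sumEFin.
    rewrite integral_sum// -sum_fine; last first.
      by move=> j _; apply: integrable_fin_num => //; exact: ij.
    apply: eq_bigr => j _; rewrite -[LHS]/(\int[lebesgue_measure]_(s in `[0, t])
       (b j (chain j w) ord0 i * slot (grid j) (grid j.+1) s)) RintegralZl//.
    exact: slot_integrable.
  have tn : (k.+1 <= n)%N by [].
  rewrite -(big_mkord xpredT (fun j => b j (chain j w) ord0 i *
      \int[lebesgue_measure]_(s in `[0, t]) slot (grid j) (grid j.+1) s)).
  rewrite (big_cat_nat (n := k.+1))//= [X in _ + X]big_nat_cond [X in _ + X]big1 ?addr0; last first.
    move=> j /andP[/andP[kj _] _]; rewrite int_slot_before ?mulr0//.
    by rewrite (le_trans tk)// grid_le.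
  rewrite big_nat_recr//= int_slot_during ?grid_ge0// [_ * (t - _)]mulrC; congr (_ + _).
  rewrite big_mkord; apply: eq_bigr => j _; rewrite int_slot_after ?grid_ge0 ?grid_le//.
    by rewrite gridS addrAC subrr add0r mxE mulrC.
  by rewrite (le_trans _ kt)// grid_le.
rewrite E chainE scalerBr.
set s := \sum_(j < k) _; set v := (_ - _) *: b k _.
rewrite -!addrA; congr (_ + (_ + _)).
by rewrite [RHS]addrCA; congr (_ + _); rewrite addrCA subrr addr0.
Qed.

End euler_scheme.

(** * Law and running cost of the Euler scheme *)

Section euler_law.
Context {R : realType} {d : nat} {dO : measure_display} {Omega : measurableType dO}.
Variables (P : probability Omega R) (G : R -> set (set Omega)) (W : R -> Omega -> 'rV[R]_d).
Hypotheses (FG : filtration G) (BW : brownian_motion P G W).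

Lemma expect_step (s t : R) (s0 : 0 <= s) (t0 : 0 <= t) (c h : R) (X : Omega -> 'rV[R]_d)
    (v : 'rV[R]_d -> 'rV[R]_d) (phi : 'rV[R]_d -> R) :
  s < t -> measurable_wrt (G s) X -> measurable_fun setT v -> cper phi ->
  \int[P]_w phi (X w + h *: v (X w) + c *: (W t w - W s w)) =
  \int[P]_w step (incr_law FG BW s0 t0) c h v phi (X w).
Proof.
move=> st mX mv cp.
rewrite (@increment_independent _ _ _ _ P G W FG BW s t s0 t0 X
  (fun p => phi (p.1 + h *: v p.1 + c *: p.2)))//.
apply: bmeas_comp (cper_bmeas cp).
apply: measurable_rVD.
  apply: measurable_rVD; first exact: measurable_fst.
  apply: measurable_rVZ; first exact: measurable_cst.
  exact: measurableT_comp mv measurable_fst.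
by apply: measurable_rVZ; [exact: measurable_cst|exact: measurable_snd].
Qed.

Variables (nu delta : R) (xi : Omega -> 'rV[R]_d) (n : nat) (b : nat -> 'rV[R]_d -> 'rV[R]_d).
Hypotheses (nu0 : 0 < nu) (delta0 : 0 < delta) (mxi : measurable_wrt (G 0) xi).
Hypothesis mb : forall k, measurable_fun setT (b k).
Local Notation c := (Num.sqrt (2 * nu)).
Variables (q : nat -> 'rV[R]_d -> R) (eta B : R).
Hypotheses (eta0 : 0 <= eta) (B0 : 0 <= B).
Hypothesis b_per : forall k x i, b k (x + (2 * pi) *: basis_vec i) = b k x.
Hypothesis b_le : forall k x, (k < n)%N -> `|b k x| <= B.
Hypothesis b_lip : forall k x z, (k < n)%N -> `|b k (x + z) - b k x| <= B * `|z|.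
Hypothesis q0_law : forall phi, cper phi ->
  \int[P]_w phi (chain W nu delta xi b 0 w) = \int[torus_measure R d]_x (phi x * q 0 x).
Hypothesis q_step : forall k g A phi, (k < n)%N -> gauss (Num.sqrt delta) g ->
  periodic phi -> BL A phi ->
  `|\int[torus_measure R d]_x (step g c delta (b k) phi x * q k x)
    - \int[torus_measure R d]_x (phi x * q k.+1 x)| <= eta * delta * A.
Local Notation Y := (chain W nu delta xi b).
Local Notation grid := (grid delta).

Let mY k : measurable_wrt (G (grid k)) (Y k).
Proof. exact: (chain_wrt FG BW nu delta0 mxi mb). Qed.

Let mY' k : measurable_fun setT (Y k).
Proof. exact: (wrt_measurable FG (grid_ge0 delta0 k) (@mY k)). Qed.

Let grid_lt k : grid k < grid k.+1.
Proof. by rewrite gridS ltrDl. Qed.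

(** The induction moves one step onto the test function, so it must range over all [phi] and [A]:
    each step multiplies the constant by 1 + delta B and adds one consistency error eta delta. *)
Lemma chain_law k A (phi : 'rV[R]_d -> R) : (k <= n)%N -> periodic phi -> BL A phi ->
  `|\int[P]_w phi (Y k w) - \int[torus_measure R d]_x (phi x * q k x)| <=
  k%:R * (eta * delta) * (A * (1 + delta * B) ^+ k).
Proof.
elim: k A phi => [|k IH] A phi kn pp bp; have cp := BL_cper bp pp.
  by rewrite q0_law// subrr normr0 !mul0r.
have k0 := grid_ge0 delta0 k; have k1 := grid_ge0 delta0 k.+1.
have A0 := BL_ge0 bp.
pose g := incr_law FG BW k0 k1.
have gg : gauss (Num.sqrt delta) g.
  have := gauss_incr_law FG BW k0 k1 (grid_lt k).
  by rewrite [X in X - _]gridS addrAC subrr add0r.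
have bT := step_BL c gg cp bp (ltW delta0) B0 (fun x z => b_lip x z kn).
have pT : periodic (step g c delta (b k) phi) by apply: step_periodic => //; exact: b_per.
have H1 := IH _ _ (ltnW kn) pT bT.
have H2 := q_step kn gg pp bp.
have -> : \int[P]_w phi (Y k.+1 w) = \int[P]_w step g c delta (b k) phi (Y k w).
  exact: expect_step (grid_lt k) (@mY k) (mb k) cp.
set E := \int[P]_w _ in H1 *; set I := \int[torus_measure R d]_x (step _ _ _ _ _ _ * _) in H1 H2.
set J := \int[_]_x _ in H2 *.
have -> : E - J = (E - I) + (I - J) by ring.
rewrite (le_trans (ler_normD _ _))// (le_trans (lerD H1 H2))//.
have -> : A * (1 + delta * B) * (1 + delta * B) ^+ k = A * (1 + delta * B) ^+ k.+1 by rewrite exprS mulrA.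
rewrite -[in leRHS]natr1 [(_ + 1) * _]mulrDl [in leRHS]mulrDl lerD2l mul1r.
have ed : 0 <= eta * delta by rewrite mulr_ge0// ltW.
rewrite ler_wpM2l// ler_peMr// exprn_ege1// lerDl.
by rewrite mulr_ge0// ltW.
Qed.

Local Notation X := (state W nu xi (euler W nu delta xi n b)).

Lemma state_drift k t A (f : 'rV[R]_d -> R) : (k < n)%N -> grid k <= t -> t < grid k.+1 -> periodic f -> BL A f ->
  `|\int[P]_w f (X t w) - \int[P]_w f (Y k w)| <=
  A * c * (1 + d%:R) * Num.sqrt delta + A * delta * B.
Proof.
move=> kn kt tk pf bf; have cf := BL_cper bf pf; have A0 := BL_ge0 bf.
have c0 : 0 < c by rewrite sqrtr_gt0 mulr_gt0.
have td : t - grid k <= delta by move: tk; rewrite gridS; lra.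
have -> : \int[P]_w f (X t w) =
    \int[P]_w f (Y k w + (t - grid k) *: b k (Y k w) + c *: (W t w - W (grid k) w)).
  by apply: eq_Rintegral => w _; rewrite (state_euler W nu xi b delta0 w kn kt (ltW tk)).
have s0 := sqrtr_ge0 delta.
(* At the grid point itself no time has elapsed and there is no Gaussian increment, so this case is
   separate. *)
move: kt; rewrite le_eqVlt => /predU1P[kt|kt].
  rewrite -kt subrr.
  have -> : \int[P]_w f (Y k w + 0 *: b k (Y k w) + c *: (W (grid k) w - W (grid k) w)) =
      \int[P]_w f (Y k w).
    by apply: eq_Rintegral => w _; rewrite subrr scaler0 scale0r !addr0.
  rewrite subrr normr0 addr_ge0// !mulr_ge0 ?(ltW c0) ?(ltW delta0) ?addr_ge0//.
have k0 := grid_ge0 delta0 k; have t0 : 0 <= t by exact: le_trans (ltW kt).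
rewrite (expect_step k0 t0 c (t - grid k) kt (@mY k) (mb k) cf).
set g := incr_law _ _ _ _.
have gg : gauss (Num.sqrt (t - grid k)) g by exact: gauss_incr_law.
have sq0 : 0 < Num.sqrt (t - grid k) by rewrite sqrtr_gt0 subr_gt0.
have cg := gop_cper c gg cf.
have ms : measurable_fun setT (step g c (t - grid k) (b k) f).
  apply: (measurableT_comp (continuous_rV_measurable (proj1 cg))).
  by apply: measurable_rVD => //; apply: measurable_rVZ => //; exact: measurable_cst.
have bs : bmeas (fun w => step g c (t - grid k) (b k) f (Y k w)).
  apply: (bmeas_comp (@mY' k)); split=> //.
  by have [M HM] := cper_bounded cg; exists M => x; exact: HM.
have bfY : bmeas (fun w => f (Y k w)) by apply: bmeas_comp (@mY' k) (cper_bmeas cf).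
rewrite -(intB P bs bfY); apply: prob_int_abs_le; first exact: bmeasB.
move=> w; set y := Y k w.
have -> : step g c (t - grid k) (b k) f y - f y =
   (gop g c f (y + (t - grid k) *: b k y) - f (y + (t - grid k) *: b k y)) +
   (f (y + (t - grid k) *: b k y) - f y) by rewrite /step; ring.
rewrite (le_trans (ler_normD _ _))// lerD//.
  rewrite (le_trans (gop_close c _ sq0 gg cf bf))// (gtr0_norm c0) ler_wpM2l//.
    by rewrite !mulr_ge0 ?(ltW c0) ?addr_ge0.
  by rewrite ler_sqrt// ltW.
rewrite (le_trans (proj2 bf _ _))// -mulrA ler_wpM2l// normrZ ger0_norm ?subr_ge0 ?(ltW kt)//.
by rewrite ler_pM// ?subr_ge0 ?(ltW kt)// b_le.
Qed.

Lemma euler_running k t A (f : 'rV[R]_d -> R) (C : R) : (k < n)%N -> grid k <= t -> t < grid k.+1 -> periodic f -> BL A f ->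
  BL A (fun x => 2^-1 * sqnorm (b k x) + f x) ->
  (\int[P]_w (2^-1 * sqnorm (euler W nu delta xi n b t w) + f (X t w) + C)%:E <=
   (\int[torus_measure R d]_x ((2^-1 * sqnorm (b k x) + f x) * q k x) + C
    + (A * c * (1 + d%:R) * Num.sqrt delta + A * delta * B
       + k%:R * (eta * delta) * (A * (1 + delta * B) ^+ k)))%:E)%E.
Proof.
move=> kn kt tk pf bf bl; have cf := BL_cper bf pf.
set l := (fun x => 2^-1 * sqnorm (b k x) + f x) in bl *.
have pl : periodic l by move=> x i; rewrite /l b_per pf.
have cl := BL_cper bl pl.
have blY : bmeas (fun w => l (Y k w)) by apply: bmeas_comp (@mY' k) (cper_bmeas cl).
have bfY : bmeas (fun w => f (Y k w)) by apply: bmeas_comp (@mY' k) (cper_bmeas cf).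
have t0 : 0 <= t by exact: le_trans (grid_ge0 delta0 k) kt.
have bfX : bmeas (fun w => f (X t w)).
  have pe := euler_progressive FG BW nu n delta0 mxi mb.
  apply: bmeas_comp (cper_bmeas cf).
  exact: (wrt_measurable FG t0 (measurable_state_wrt FG BW nu mxi pe t0)).
have blC : bmeas (fun w => l (Y k w) + C) by apply: bmeasD => //; exact: bmeas_cst.
have bd : bmeas (fun w => f (X t w) - f (Y k w)) by exact: bmeasB.
have E w : 2^-1 * sqnorm (euler W nu delta xi n b t w) + f (X t w) + C =
    l (Y k w) + C + (f (X t w) - f (Y k w)).
  by rewrite (euler_at W nu xi b delta0 w kn kt tk) /l; ring.
have -> : (\int[P]_w (2^-1 * sqnorm (euler W nu delta xi n b t w) + f (X t w) + C)%:E =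
   (\int[P]_w (l (Y k w) + C + (f (X t w) - f (Y k w))))%:E)%E.
  rewrite /Rintegral fineK; last first.
    apply: integrable_fin_num => //.
    exact: (bmeas_integrable P (bmeasD blC bd)).
  by apply: eq_integral => w _; rewrite E.
rewrite lee_fin (intD P blC bd) (intD P blY (bmeas_cst C)) prob_int_cst (intB P bfX bfY).
have H1 := state_drift kn kt tk pf bf.
have H2 := chain_law (ltnW kn) pl bl.
move: H1 H2; rewrite !ler_norml => /andP[_ H1] /andP[_ H2].
lra.
Qed.

Lemma euler_running_after t (f : 'rV[R]_d -> R) (C : R) : grid n <= t -> 0 <= C -> (forall x, `|f x| <= C) -> continuous f ->
  (\int[P]_w (2^-1 * sqnorm (euler W nu delta xi n b t w) + f (X t w) + C)%:E <= (2 * C)%:E)%E.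
Proof.
move=> nt C0 fC cf.
have t0 : 0 <= t by exact: le_trans (grid_ge0 delta0 n) nt.
have bfX : bmeas (fun w => f (X t w)).
  have pe := euler_progressive FG BW nu n delta0 mxi mb.
  apply: bmeas_comp; first exact: (wrt_measurable FG t0 (measurable_state_wrt FG BW nu mxi pe t0)).
  by split; [exact: continuous_rV_measurable|exists C].
have E w : 2^-1 * sqnorm (euler W nu delta xi n b t w) + f (X t w) + C = f (X t w) + C.
  rewrite (euler_after W nu xi b delta0 w nt) /sqnorm big1 ?mulr0 ?add0r// => i _.
  by rewrite mxE expr0n.
have bC : bmeas (fun w => f (X t w) + C) by apply: bmeasD => //; exact: bmeas_cst.
have -> : (\int[P]_w (2^-1 * sqnorm (euler W nu delta xi n b t w) + f (X t w) + C)%:E =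
   (\int[P]_w (f (X t w) + C))%:E)%E.
  rewrite /Rintegral fineK; last by apply: integrable_fin_num => //; exact: (bmeas_integrable P bC).
  by apply: eq_integral => w _; rewrite E.
rewrite lee_fin (le_trans (ler_norm _))//; apply: prob_int_abs_le => // w.
by rewrite (le_trans (ler_normD _ _))// (ger0_norm C0) mulr_natl mulr2n lerD2r.
Qed.

End euler_law.

Section nonmeasurable_monotonicity.
Context {dT : measure_display} {T : measurableType dT} {R : realType}.
Local Open Scope ereal_scope.

(* No measurability of [f1] is needed: the integral of a nonnegative function is a supremum
   over the simple functions below it. *)
Lemma ge0_integral_mono (mu : {measure set T -> \bar R}) (D : set T) (f1 f2 : T -> \bar R) :
  (forall x, D x -> 0 <= f1 x) -> (forall x, D x -> f1 x <= f2 x) ->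
  \int[mu]_(x in D) f1 x <= \int[mu]_(x in D) f2 x.
Proof.
move=> f10 f12; rewrite [leLHS]integral_mkcond [leRHS]integral_mkcond.
have h1 x : 0 <= (f1 \_ D) x by apply: erestrict_ge0.
have h12 x : (f1 \_ D) x <= (f2 \_ D) x.
  by rewrite !patchE; case: ifPn => // /set_mem; exact: f12.
have h2 x : 0 <= (f2 \_ D) x by exact: le_trans (h1 x) (h12 x).
rewrite !ge0_integralTE//; apply: ereal_sup_le => _ [h hf <-]; exists h => //= x.
exact: le_trans (hf x) (h12 x).
Qed.

End nonmeasurable_monotonicity.

Section exponential_bounds.
Context {R : realType}.
Implicit Types x t delta : R.

Lemma expRN_ge x : 1 - x <= expR (- x).
Proof. by have := expR_ge1Dx (- x). Qed.

Lemma expRN_itv x : 0 <= x -> 0 <= 1 - expR (- x) <= 1.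
Proof.
move=> x0; rewrite subr_ge0 gerBl expR_ge0 andbT.
by rewrite -[leRHS]expR0 ler_expR oppr_le0.
Qed.

Lemma expRN_diff x t delta : 0 <= x -> x <= t -> t <= x + delta ->
  0 <= expR (- x) - expR (- t) <= delta.
Proof.
move=> x0 xt td; rewrite subr_ge0 ler_expR lerN2 xt/=.
have e1 : expR (- x) <= 1 by rewrite -[leRHS]expR0 ler_expR oppr_le0.
have -> : - t = - x + - (t - x) by ring.
rewrite expRD -{1}[expR (- x)]mulr1 -mulrBr.
have h := expRN_ge (t - x).
have tx : 0 <= t - x by rewrite subr_ge0.
apply: (@le_trans _ _ (expR (- x) * (t - x))).
  by rewrite ler_wpM2l ?expR_ge0//; lra.
rewrite (@le_trans _ _ (1 * (t - x)))//; first by rewrite ler_wpM2r.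
by lra.
Qed.

Lemma expRN_dist x t delta : 0 <= x -> x <= t -> t <= x + delta ->
  `|1 - expR (- x) - (1 - expR (- t))| <= delta.
Proof.
move=> x0 xt td; have /andP[h1 h2] := expRN_diff x0 xt td.
by rewrite ler_norml; apply/andP; split; lra.
Qed.

(** The quotient (1 - exp(-delta)) / delta lies between 1 - delta and 1, since exp(-delta) <= 1/(1 +
    delta) <= 1 - delta + delta^2. *)
Lemma expRN_slope x t delta : 0 <= x -> x <= t -> t <= x + delta -> 0 < delta -> delta <= 1 ->
  `|(expR (- x) - expR (- (x + delta))) / delta - expR (- t)| <= delta.
Proof.
move=> x0 xt td d0 d1; have := expRN_diff x0 xt td => /andP[h1 h2].
have -> : - (x + delta) = - x + - delta by ring.
have e0 := expR_ge0 (- x).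
have e1 : expR (- x) <= 1 by rewrite -[leRHS]expR0 ler_expR oppr_le0.
rewrite expRD -{1}[expR (- x)]mulr1 -mulrBr -mulrA.
set s := (1 - _) / delta.
have s1 : s <= 1 by rewrite ler_pdivrMr// mul1r; have := expRN_ge delta; lra.
have s2 : 1 - delta <= s.
  rewrite ler_pdivlMr//.
  have ee : expR (- delta) * (1 + delta) <= 1.
    rewrite expRN ler_pdivrMl ?expR_gt0// mulr1.
    exact: expR_ge1Dx.
  have e3 : expR (- delta) <= 1 - delta + delta ^+ 2.
    rewrite -(@ler_pM2r _ (1 + delta)) ?addr_gt0// (le_trans ee)//.
    have -> : (1 - delta + delta ^+ 2) * (1 + delta) = 1 + delta ^+ 3 by ring.
    by rewrite lerDl exprn_ge0// ltW.
  by rewrite mulrBl mul1r -expr2; lra.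
have h3 : expR (- x) * s <= expR (- x) by rewrite -[leRHS]mulr1 ler_wpM2l.
have h4 : expR (- x) * (1 - delta) <= expR (- x) * s by rewrite ler_wpM2l.
have h5 : expR (- x) * delta <= delta by rewrite -[leRHS]mul1r ler_wpM2r// ltW.
rewrite mulrBr mulr1 in h4.
by rewrite ler_norml; apply/andP; split; lra.
Qed.

End exponential_bounds.

Section three_exponentials.
Context {R : realType}.
Variable rho : R.
Hypothesis rho0 : 0 < rho.
Local Notation leb := (@lebesgue_measure R).

Lemma integral_three_expR (a b g : R) :
  (\int[leb]_(t in `[0%R, +oo[) (a * expR (- (rho * t)) + b * expR (- ((rho + 1) * t))
     + g * expR (- (rho / 2 * t)))%:E = (a / rho + b / (rho + 1) + g / (rho / 2))%:E)%E.
Proof.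
have r1 : 0 < rho + 1 by rewrite addr_gt0.
have r2 : 0 < rho / 2 by rewrite divr_gt0.
have mD : measurable ([set` `[0%R, +oo[] : set (measurableTypeR R)) by exact: measurable_itv.
have I (z r : R) : 0 < r -> leb.-integrable `[0%R, +oo[ (fun t => (z * expR (- (r * t)))%:E).
  move=> r0; rewrite (_ : (fun t => _) = fun t => (z%:E * (expR (- (r * t)))%:E)%E).
    by apply: integrableZl => //; exact: integrable_expR.
  by apply/funext => t.
have J (z r : R) : 0 < r -> (\int[leb]_(t in `[0%R, +oo[) (z * expR (- (r * t)))%:E = (z / r)%:E)%E.
  move=> r0; under eq_integral do rewrite EFinM.
  by rewrite integralZl//; [rewrite integral_expR|exact: integrable_expR].
under eq_integral do rewrite EFinD EFinD.
rewrite integralD//; last 2 first.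
- by apply: integrableD => //; exact: I.
- exact: I.
rewrite integralD//; last 2 first.
- exact: I.
- exact: I.
by rewrite !J// -!EFinD.
Qed.

End three_exponentials.

Section cost_upper_bound.
Context {R : realType} {d : nat} {dO : measure_display} {Omega : measurableType dO}.
Variables (P : probability Omega R) (G : R -> set (set Omega)) (W : R -> Omega -> 'rV[R]_d).
Hypotheses (FG : filtration G) (BW : brownian_motion P G W).
Variables (rho nu C : R) (f : 'rV[R]_d -> tprob R d -> R) (mu : tprob R d).
Hypotheses (rho0 : 0 < rho) (cf : continuous (f ^~ mu)) (fC : forall x, `|f x mu| <= C).
Variables (xi : Omega -> 'rV[R]_d) (a : R -> Omega -> 'rV[R]_d).
Hypotheses (mxi : measurable_wrt (G 0) xi) (pa : progressively_measurable G a).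

(** The three terms serve different purposes: [al] the constant part, [be] the decaying profile, and
    [ga] a growing majorant of what happens after the horizon, still integrable against the
    discount. *)
Lemma cost_upper (al be ga : R) :
  (forall t, 0 <= t -> (\int[P]_w (running W nu C f mu xi a t w)%:E <=
     (al + be * expR (- t) + ga * expR (rho / 2 * t))%:E)%E) ->
  (cost P W rho nu f (fun=> mu) xi a <= ((al - C) / rho + be / (rho + 1) + ga / (rho / 2))%:E)%E.
Proof.
move=> H.
have E : (cost P W rho nu f (fun=> mu) xi a + (C / rho)%:E <=
    (al / rho + be / (rho + 1) + ga / (rho / 2))%:E)%E.
  rewrite (cost_formula FG BW nu rho0 cf fC mxi pa) -(integral_three_expR rho0).
  apply: ge0_integral_mono => t; rewrite /= in_itv/= andbT => t0.
    rewrite mule_ge0 ?lee_fin ?expR_ge0//; apply: integral_ge0 => w _.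
    by rewrite lee_fin; exact: running_ge0.
  apply: (@le_trans _ _ ((expR (- (rho * t)))%:E * (al + be * expR (- t) + ga * expR (rho / 2 * t))%:E)%E).
    by rewrite lee_wpmul2l ?lee_fin ?expR_ge0//; exact: H.
  rewrite -EFinM lee_fin le_eqVlt; apply/orP; left; apply/eqP.
  have -> : - ((rho + 1) * t) = - (rho * t) + - t by ring.
  have -> : - (rho / 2 * t) = - (rho * t) + rho / 2 * t by field.
  by rewrite !expRD; ring.
rewrite -(leeD2rE (x := (C / rho)%:E))// (le_trans E)// -EFinD lee_fin.
by rewrite le_eqVlt; apply/orP; left; apply/eqP; ring.
Qed.

End cost_upper_bound.

(** * Cost of the perturbed control and the resulting stationarity *)

Section perturbation_inequality.
Context {R : realType} {d : nat} {dO : measure_display} {Omega : measurableType dO}.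
Variables (P : probability Omega R) (G : R -> set (set Omega)) (W : R -> Omega -> 'rV[R]_d).
Hypotheses (FG : filtration G) (BW : brownian_motion P G W).
Variables (rho nu e0 c0 : R) (F : 'rV[R]_d -> tprob R d -> R) (mu : tprob R d).
Local Notation f := (F ^~ mu).
Variables (m r zeta : 'rV[R]_d -> R) (i0 : 'I_d).
Variables (dm dr : 'I_d -> 'rV[R]_d -> R) (ddm ddr : 'I_d -> 'I_d -> 'rV[R]_d -> R).
Hypotheses (rho0 : 0 < rho) (nu0 : 0 < nu) (e01 : 0 <= e0 <= 1) (c0_gt0 : 0 < c0).
Hypotheses (cm : cper m) (cdm : forall i, cper (dm i)) (cddm : forall i j, cper (ddm i j)).
Hypotheses (cr : cper r) (cdr : forall i, cper (dr i)) (cddr : forall i j, cper (ddr i j)).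
Hypotheses (m_dm : forall i, pderiv i m (dm i)) (dm_ddm : forall i j, pderiv j (dm i) (ddm i j)).
Hypotheses (r_dr : forall i, pderiv i r (dr i)) (dr_ddr : forall i j, pderiv j (dr i) (ddr i j)).
Hypotheses (zeta_per : periodic zeta) (zeta_BL : exists A, BL A zeta) (zeta_r : pderiv i0 zeta r).
Hypotheses (f_per : periodic f) (f_BL : exists A, BL A f).
Hypothesis m_lb : forall t x, `|t| <= e0 -> c0 <= m x + t * r x.
Local Notation c := (Num.sqrt (2 * nu)).
Variable xi : Omega -> 'rV[R]_d.
Hypothesis mxi : measurable_wrt (G 0) xi.
Hypothesis law0 : forall phi, cper phi ->
  \int[P]_w phi (xi w + c *: W 0 w) = \int[torus_measure R d]_x (phi x * m x).

Local Notation I0 := (\int[torus_measure R d]_x run0 nu m f dm x).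
Local Notation I1 := (\int[torus_measure R d]_x run1 nu m r f dm dr x).
Local Notation I2 := (\int[torus_measure R d]_x run2 nu m zeta i0 dm x).

Lemma measurable_drift t k : `|t| <= e0 -> measurable_fun setT (drift nu m r zeta i0 dm dr t k).
Proof.
move=> te; apply/measurable_fun_rVP => j.
rewrite (_ : _ \o _ = fun x => flux nu zeta i0 dm dr t k j x * (pert m r t x)^-1); last first.
  by apply/funext => x; rewrite /rV_coord/= mxE.
have ci : cper (fun x => (pert m r t x)^-1).
  apply: cperV; first exact: cper_pert.
  by move=> x; rewrite lt0r_neq0// (lt_le_trans c0_gt0)// m_lb.
apply: continuous_rV_measurable; apply: (proj1 (cperM _ ci)).
exact: cper_flux.
Qed.

Let running_combination (X a0 a1 a2 a3 b1 b2 b3 s1 s2 s3 s4 q h g be z e1 C : R) :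
  X <= a0 + a1 + a2 + a3 -> a1 <= b1 + s3 -> a2 <= b2 + s4 -> a3 <= b3 -> q <= h -> h <= e1 / 2 ->
  s1 + s2 + s3 + s4 <= e1 / 2 -> 0 <= g -> be + z = b1 + b2 ->
  X + C + (s1 + s2 + q) <= (a0 + z + b3 + e1 + C) + be + g.
Proof. lra. Qed.

Let after_lower (x0 x1 n0 n1 q y1 y2 K : R) : - n0 <= x0 -> - n1 <= x1 -> 0 <= q -> 0 <= y1 -> 0 <= y2 ->
  0 <= K -> - (n0 + n1 + 2 * K + y2 + 1) <= x0 + x1 + q + y1 + y2.
Proof. lra. Qed.

Let after_combine (x s1 s2 a b g : R) : x + s1 + s2 <= g -> - s1 <= a -> - s2 <= b -> x <= a + b + g.
Proof. lra. Qed.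

Let small_step (p A B y z s delta : R) : 0 <= A -> 0 <= B -> 0 <= y -> 0 <= z -> delta <= s ->
  p * s + A * delta * B + delta * y + delta * z <= (p + A * B + y + z) * s.
Proof.
move=> A0 B0 y0 z0 ds; rewrite !mulrDl.
have h1 : A * delta * B <= A * B * s by rewrite mulrAC ler_wpM2l// mulr_ge0.
have h2 : delta * y <= y * s by rewrite mulrC ler_wpM2l.
have h3 : delta * z <= z * s by rewrite mulrC ler_wpM2l.
lra.
Qed.

(** The position follows e (1 - exp(-t)) and the speed e exp(-t) up to a finite horizon, after which
    no control is applied. Horizon and mesh are chosen after [e] and [e1], so that everything except
    the quadratic term in [e] fits into [e1]. *)
Lemma perturbed_cost : exists2 K : R, 0 <= K & forall e e1, `|e| <= e0 -> 0 < e1 -> e1 <= 1 ->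
  exists2 b, progressively_measurable G b &
  (cost P W rho nu F (fun=> mu) xi b <=
    ((I0 + e * I1 + K * e ^+ 2 + e1) / rho + e * (I2 - I1) / (rho + 1) + e1 / rho)%:E)%E.
Proof.
have /andP[e0_ge0 e0_le1] := e01.
have [B B0 HB] := drift_bounds i0 nu0 e01 c0_gt0 cm cdm cddm cr cdr cddr m_dm dm_ddm r_dr dr_ddr zeta_BL f_BL m_lb.
have [K K0 HK] := int_run_le i0 nu0 e01 c0_gt0 cm cdm cddm cr cdr cddr m_dm dm_ddm r_dr dr_ddr
  zeta_per zeta_BL f_per f_BL m_lb.
have [Af bf] := f_BL; have Af0 := BL_ge0 bf.
have cf := BL_cper bf f_per.
pose A := Af + B; have A0 : 0 <= A by exact: addr_ge0.
have bfA : BL A f by apply: BL_le bf; rewrite lerDl.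
have c_gt0 : 0 < c by rewrite sqrtr_gt0 mulr_gt0.
have c2 : c ^+ 2 = 2 * nu by rewrite sqr_sqrtr// mulr_ge0// ltW.
exists (2 * K); first by rewrite mulr_ge0.
move=> e e1 ee e10 e11; have e_le1 := le_trans ee e0_le1.
(* The shifted running cost after the horizon is at most 2 [Af]; the other summands bound from below
   what al + be exp(-t) can be. *)
pose M := 2 * Af + (`|I0| + `|I1| + 2 * K + Af + 1) + (`|I1| + `|I2|).
have M0 : 0 <= M by rewrite !addr_ge0 ?mulr_ge0.
(* The tail costs at most e1 / rho once 2 M <= e1 exp(rho T / 2), and exp x >= x reduces this to a
   linear condition on [T]. *)
pose T := 4 * M / (rho * e1) + 1.
have re1 : 0 < rho * e1 by exact: mulr_gt0.
have T0 : 0 < T by rewrite ltr_wpDl// divr_ge0 ?mulr_ge0// ltW.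
(* Discrete Gronwall: the consistency errors accumulated up to the horizon are at most [H] times
   [eta]. *)
pose H := T * A * expR (T * B); have H0 : 0 <= H by rewrite !mulr_ge0 ?expR_ge0// ltW.
pose eta := e1 / (2 * (H + 1)).
have H1 : 0 < H + 1 by rewrite ltr_wpDl.
have eta0 : 0 < eta by rewrite divr_gt0// mulr_gt0.
(* The coefficient of sqrt delta in the time discretization: motion inside a slot, and replacing the
   sampled exponentials by their values at [t]. *)
pose N1 := A * c * (1 + d%:R) + A * B + `|I1| + `|I2|.
have N10 : 0 <= N1.
  by rewrite /N1 !addr_ge0 ?mulr_ge0 ?addr_ge0// ltW.
have [h h0 Hc] := pert_consistency nu0 e01 c0_gt0 cm cdm cddm cr cdr cddr m_dm dm_ddm r_dr dr_ddr
  zeta_per zeta_BL zeta_r f_BL m_lb c_gt0 c2 eta0.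
pose x0 := Num.min h (Num.min 1 (e1 / (2 * (N1 + 1)))).
have N11 : 0 < N1 + 1 by rewrite ltr_wpDl.
have x00 : 0 < x0 by rewrite !lt_min h0 ltr01 divr_gt0// mulr_gt0.
pose n := (Num.truncn (T / x0 ^+ 2)).+1.
pose delta := T / n%:R.
have n0 : 0 < n%:R :> R by rewrite ltr0n.
have delta0 : 0 < delta by rewrite divr_gt0.
have dx : delta < x0 ^+ 2.
  rewrite ltr_pdivrMr// mulrC -ltr_pdivrMr ?exprn_gt0//.
  exact: truncnS_gt.
have sd0 : 0 < Num.sqrt delta by rewrite sqrtr_gt0.
have sdx : Num.sqrt delta < x0.
  by rewrite -(ger0_norm (ltW x00)) -sqrtr_sqr ltr_sqrt// exprn_gt0.
have sd2 : Num.sqrt delta ^+ 2 = delta by rewrite sqr_sqrtr// ltW.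
move: (sdx); rewrite !lt_min => /and3P[sdh sd1 sdN].
have dsd : delta <= Num.sqrt delta by rewrite -[leLHS]sd2 expr2 ler_piMr// ltW.
have d1 : delta <= 1 by rewrite (le_trans dsd)// ltW.
have gn : grid delta n = T by rewrite /grid /delta mulrC divfK// lt0r_neq0.
pose th k := e * (1 - expR (- grid delta k)).
(* The speed is the exact difference quotient of the position, so that one step carries the density
   at grid time [k] to the one at [k.+1] without discretization error. *)
pose ka k := e * ((expR (- grid delta k) - expR (- (grid delta k + delta))) / delta).
have g0 k : 0 <= grid delta k by exact: grid_ge0.
have the k : `|th k| <= e0.
  have /andP[h1 h2] := expRN_itv (g0 k).
  by rewrite normrM (le_trans _ ee)// ler_piMr// ger0_norm.
have kae k : `|ka k| <= e0.
  have gd : grid delta k <= grid delta k + delta by rewrite lerDl ltW.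
  have /andP[h1 h2] := expRN_diff (g0 k) gd (lexx _).
  rewrite normrM (le_trans _ ee)// ler_piMr// ger0_norm; last by rewrite divr_ge0// ltW.
  by rewrite ler_pdivrMr// mul1r.
have th2 k : th k ^+ 2 <= e ^+ 2.
  have /andP[h1 h2] := expRN_itv (g0 k).
  by rewrite exprMn ler_piMr ?sqr_ge0// expr_le1.
have ka2 k : ka k ^+ 2 <= e ^+ 2.
  have gd : grid delta k <= grid delta k + delta by rewrite lerDl ltW.
  have /andP[h1 h2] := expRN_diff (g0 k) gd (lexx _).
  have s0 : 0 <= (expR (- grid delta k) - expR (- (grid delta k + delta))) / delta.
    by rewrite divr_ge0// ltW.
  have s1 : (expR (- grid delta k) - expR (- (grid delta k + delta))) / delta <= 1.
    by rewrite ler_pdivrMr// mul1r.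
  by rewrite exprMn ler_piMr ?sqr_ge0// expr_le1.
pose bb k := drift nu m r zeta i0 dm dr (th k) (ka k).
pose q k := pert m r (th k).
have mb k : measurable_fun setT (bb k) by exact: measurable_drift.
have q_step k g A' phi : (k < n)%N -> gauss (Num.sqrt delta) g -> periodic phi -> BL A' phi ->
  `|\int[torus_measure R d]_x (step g c delta (bb k) phi x * q k x)
    - \int[torus_measure R d]_x (phi x * q k.+1 x)| <= eta * delta * A'.
  move=> _ gg pp bp; have := Hc _ g sd0 sdh gg (th k) (ka k) A' phi (the k) (kae k) pp bp.
  rewrite sd2; congr (`|_ - _| <= _); apply: eq_Rintegral => x _; congr (_ * _).
  by rewrite /q /pert /th gridS /ka; field; rewrite lt0r_neq0.
have q0_law phi : cper phi -> \int[P]_w phi (chain W nu delta xi bb 0 w) =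
    \int[torus_measure R d]_x (phi x * q 0%N x).
  move=> cp; rewrite law0//; apply: eq_Rintegral => x _; congr (_ * _).
  by rewrite /q /pert /th grid0 oppr0 expR0 subrr mulr0 mul0r addr0.
have b_per k x i : bb k (x + (2 * pi) *: basis_vec i) = bb k x by exact: periodic_drift.
have b_le k x : (k < n)%N -> `|bb k x| <= B by move=> _; have [Hb _ _] := HB _ _ (the k) (kae k); exact: Hb.
have b_lip k x z : (k < n)%N -> `|bb k (x + z) - bb k x| <= B * `|z|.
  by move=> _; have [_ Hb _] := HB _ _ (the k) (kae k); exact: Hb.
have b_run k : BL A (fun x => 2^-1 * sqnorm (bb k x) + f x).
  have [_ _ bl] := HB _ _ (the k) (kae k).
  by apply: BL_le bl; rewrite lerDr.
have fC x : `|f x| <= Af by case: bf.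
pose al := I0 + e * I1 + 2 * K * e ^+ 2 + e1 + Af.
pose be := e * (I2 - I1).
(* Scaled so that the growing term ga exp(rho t / 2) reaches [M] exactly at the horizon. *)
pose ga := M * expR (- (rho / 2 * T)).
exists (euler W nu delta xi n bb); first exact: (euler_progressive FG BW nu n delta0 mxi mb).
have ga0 : 0 <= ga by rewrite mulr_ge0// expR_ge0.
have Hrun t : 0 <= t -> (\int[P]_w (running W nu Af F mu xi (euler W nu delta xi n bb) t w)%:E <=
     (al + be * expR (- t) + ga * expR (rho / 2 * t))%:E)%E.
  move=> t0; have [tT|Tt] := ltP t T; last first.
    have gt : grid delta n <= t by rewrite gn.
    have := euler_running_after FG BW nu delta0 mxi mb gt Af0 fC (proj1 cf).
    move=> /le_trans; apply; rewrite lee_fin.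
    have E1 : M <= ga * expR (rho / 2 * t).
      rewrite /ga -mulrA -expRD ler_peMr// -[leLHS]expR0 ler_expR.
      by rewrite addrC subr_ge0 ler_wpM2l// ltW// divr_gt0.
    have E2 : - (`|I0| + `|I1| + 2 * K + Af + 1) <= al.
      have h1 : - `|I0| <= I0 by rewrite lerNl ler_normr lexx orbT.
      have h2 : - `|I1| <= e * I1.
        rewrite lerNl (le_trans (ler_norm _))// normrN normrM.
        by rewrite -[leRHS]mul1r ler_wpM2r.
      have h3 : 0 <= 2 * K * e ^+ 2 by apply: mulr_ge0; [exact: mulr_ge0|exact: sqr_ge0].
      exact: after_lower h1 h2 h3 (ltW e10) Af0 K0.
    have E3 : - (`|I1| + `|I2|) <= be * expR (- t).
      rewrite lerNl (le_trans (ler_norm _))// normrN normrM (ger0_norm (expR_ge0 _)).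
      have /andP[h1 h2] := expRN_itv t0.
      rewrite (@le_trans _ _ `|be|)//; first by rewrite ler_piMr// -subr_ge0.
      rewrite /be normrM (@le_trans _ _ `|I2 - I1|)//; first by rewrite ler_piMl.
      by rewrite (le_trans (ler_normB _ _))// addrC.
    exact: after_combine E1 E2 E3.
  pose k := Num.truncn (t / delta).
  have /andP[k1 k2] : k%:R <= t / delta < k.+1%:R by apply: truncn_itv; rewrite divr_ge0// ltW.
  have kt : grid delta k <= t by rewrite /grid -ler_pdivlMr.
  have tk : t < grid delta k.+1 by rewrite /grid -ltr_pdivrMr.
  have kn : (k < n)%N.
    by rewrite -(ltr_nat R) (le_lt_trans k1)// ltr_pdivrMr// -/(grid delta n) gn.
  have := euler_running FG BW nu0 delta0 mxi mb (ltW eta0) B0 b_per b_le b_lip q0_law q_step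
    Af kn kt tk f_per bfA (b_run k).
  move=> /le_trans; apply; rewrite lee_fin.
  have HI := HK _ _ (the k) (kae k).
  rewrite -[\int[_]_x (run _ _ _ _ _ _ _ _ _ _ _ * _)]/(\int[torus_measure R d]_x
    ((2^-1 * sqnorm (bb k x) + f x) * q k x)) in HI.
  have tk' : t <= grid delta k + delta by move: tk; rewrite gridS => /ltW.
  have /andP[h1 h2] := expRN_diff (g0 k) kt tk'.
  have h3 := expRN_slope (g0 k) kt tk' delta0 d1.
  have D1 : th k * I1 <= e * (1 - expR (- t)) * I1 + delta * `|I1|.
    rewrite -lerBlDl -mulrBl (le_trans (ler_norm _))// normrM ler_wpM2r//.
    rewrite /th -mulrBr normrM -[leRHS]mul1r ler_pM//.
    exact: expRN_dist (g0 k) kt tk'.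
  have D2 : ka k * I2 <= e * expR (- t) * I2 + delta * `|I2|.
    rewrite -lerBlDl -mulrBl (le_trans (ler_norm _))// normrM ler_wpM2r//.
    by rewrite /ka -mulrBr normrM -[leRHS]mul1r ler_pM.
  have D3 : K * (th k ^+ 2 + ka k ^+ 2) <= 2 * K * e ^+ 2.
    rewrite [2 * K]mulrC -mulrA ler_wpM2l// mulr_natl mulr2n lerD//.
  have D4 : k%:R * (eta * delta) * (A * (1 + delta * B) ^+ k) <= eta * H.
    have kT : k%:R * delta <= T by rewrite -gn; apply: grid_le => //; exact: ltnW.
    have dB0 : 0 <= delta * B by rewrite mulr_ge0// ltW.
    have p1 : (1 + delta * B) ^+ k <= expR (T * B).
      rewrite (@le_trans _ _ (expR (delta * B) ^+ k))//.
        rewrite lerXn2r ?nnegrE ?expR_ge0 ?addr_ge0//; exact: expR_ge1Dx.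
      by rewrite -expRM_natl ler_expR mulrA ler_wpM2r.
    have aux (u v w y p : R) : y * (u * v) * (w * p) = u * (w * (y * v * p)) by ring.
    rewrite aux.
    have -> : H = A * (T * expR (T * B)) by rewrite /H [T * A]mulrC mulrA.
    rewrite ler_wpM2l ?(ltW eta0)// ler_wpM2l//.
    apply: ler_pM => //; first by apply: mulr_ge0 => //; exact: ltW.
    by apply: exprn_ge0; exact: addr_ge0.
  have D5 : eta * H <= e1 / 2.
    have aux (x y : R) : 0 < y -> x / 2 = x / (2 * y) * y by move=> y0; field; rewrite lt0r_neq0.
    by rewrite (aux e1 (H + 1) H1) -/eta ler_wpM2l ?(ltW eta0)// lerDl.
  have D6 : A * c * (1 + d%:R) * Num.sqrt delta + A * delta * B + delta * `|I1| + delta * `|I2| <= e1 / 2.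
    apply: (@le_trans _ _ (N1 * Num.sqrt delta)).
      by apply: small_step => //; exact: normr_ge0.
    apply: (@le_trans _ _ ((N1 + 1) * Num.sqrt delta)); first by rewrite ler_wpM2r ?(ltW sd0)// lerDl.
    move: (ltW sdN); rewrite ler_pdivlMr ?mulr_gt0// => h4.
    have aux (x y : R) : y * (2 * x) = x * y * 2 by ring.
    by rewrite ler_pdivlMr// -aux.
  have D7 : 0 <= ga * expR (rho / 2 * t) by rewrite mulr_ge0// expR_ge0.
  have E : be * expR (- t) + e * I1 = e * (1 - expR (- t)) * I1 + e * expR (- t) * I2.
    by rewrite /be; ring.
  exact: running_combination HI D1 D2 D3 D4 D5 D6 D7 E.
apply: (le_trans (cost_upper FG BW rho0 (proj1 cf) fC mxi
  (euler_progressive FG BW nu n delta0 mxi mb) Hrun)).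
rewrite lee_fin /al addrK lerD2l -/be.
have -> : ga / (rho / 2) = 2 * M * expR (- (rho / 2 * T)) / rho by rewrite /ga; field; rewrite lt0r_neq0.
rewrite ler_wpM2r ?invr_ge0 ?(ltW rho0)// expRN ler_pdivrMr ?expR_gt0//.
have h5 : rho / 2 * T <= expR (rho / 2 * T).
  by rewrite (le_trans _ (expR_ge1Dx _))// lerDr.
apply: (@le_trans _ _ (e1 * (rho / 2 * T))); last by rewrite ler_wpM2l// ltW.
have -> : e1 * (rho / 2 * T) = 2 * M + rho * e1 / 2 by rewrite /T; field; rewrite !lt0r_neq0.
by rewrite lerDl divr_ge0// ltW.
Qed.

(** The increase of the cost is linear in [e] up to a quadratic error and nonnegative for both signs
    of [e], so its slope vanishes. *)
Lemma perturbation_stationary : 0 < e0 ->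
  (forall b, progressively_measurable G b -> ((I0 / rho)%:E <= cost P W rho nu F (fun=> mu) xi b)%E) ->
  I1 + rho * I2 = 0.
Proof.
move=> e0_gt0 opt; have [K K0 HK] := perturbed_cost.
pose S := I1 + rho * I2.
have r1 : 0 < rho + 1 by rewrite addr_gt0.
(* Multiplying by rho (rho + 1) turns e I1 / rho + e (I2 - I1) / (rho + 1) into e (I1 + rho I2). *)
have key e : `|e| <= e0 -> 0 <= e * S + (rho + 1) * K * e ^+ 2.
  move=> ee; apply/ler_addgt0Pr => e2 e20.
  pose e1 := Num.min 1 (e2 / (2 * (rho + 1))).
  have rr : 0 < 2 * (rho + 1) by rewrite mulr_gt0.
  have e10 : 0 < e1 by rewrite lt_min ltr01 divr_gt0.
  have e11 : e1 <= 1 by rewrite ge_min lexx.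
  have [b pb Hb] := HK e e1 ee e10 e11.
  have := le_trans (opt b pb) Hb; rewrite lee_fin.
  have e12 : e1 * (2 * (rho + 1)) <= e2.
    by rewrite -ler_pdivlMr// ge_min lexx orbT.
  rewrite -subr_ge0 -(@pmulr_rge0 _ (rho * (rho + 1))) ?mulr_gt0//.
  have -> : rho * (rho + 1) * ((I0 + e * I1 + K * e ^+ 2 + e1) / rho
      + e * (I2 - I1) / (rho + 1) + e1 / rho - I0 / rho) =
    e * S + (rho + 1) * K * e ^+ 2 + e1 * (2 * (rho + 1)).
    by rewrite /S; field; rewrite !lt0r_neq0.
  by move=> h; apply: (le_trans h); rewrite lerD2l.
have K1 : 0 <= (rho + 1) * K by rewrite mulr_ge0// ltW.
suff bound e2 : 0 < e2 -> `|S| <= e2.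
  apply/eqP; rewrite -/S -normr_le0; apply/ler_addgt0Pl => e2 e20.
  by rewrite addr0 bound.
move=> e20; pose e := Num.min e0 (e2 / ((rho + 1) * K + 1)).
have K2 : 0 < (rho + 1) * K + 1 by rewrite ltr_wpDl.
have e_gt0 : 0 < e by rewrite lt_min e0_gt0 divr_gt0.
have ee : `|e| <= e0 by rewrite gtr0_norm// ge_min lexx.
have eK : (rho + 1) * K * e <= e2.
  rewrite (@le_trans _ _ (((rho + 1) * K + 1) * e)) ?ler_wpM2r ?(ltW e_gt0) ?lerDl//.
  by rewrite mulrC -ler_pdivlMr// ge_min lexx orbT.
have k1 := key e ee; have k2 : 0 <= - e * S + (rho + 1) * K * (- e) ^+ 2 by apply: key; rewrite normrN.
move: k1 k2.
have -> : e * S + (rho + 1) * K * e ^+ 2 = e * (S + (rho + 1) * K * e) by ring.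
have -> : - e * S + (rho + 1) * K * (- e) ^+ 2 = e * (- S + (rho + 1) * K * e) by ring.
rewrite !pmulr_rge0// => k1 k2.
by rewrite ler_norml; apply/andP; split; lra.
Qed.

End perturbation_inequality.

(** * The cost of an equilibrium is at least the stationary one *)

Section increment_bound.
Context {R : realType}.
Local Notation leb := (@lebesgue_measure R).
Implicit Types g : R -> R.

(* The library's integral of a function with infinite positive or negative part is infinite,
   and its real-valued version is then 0. *)
Lemma Rint_not_integrable (D : set (measurableTypeR R)) g : measurable D -> measurable_fun D g ->
  ~ leb.-integrable D (EFin \o g) -> \int[leb]_(x in D) g x = 0.
Proof.
move=> mD mg ni; have mG : measurable_fun D (EFin \o g) by exact/measurable_EFinP.
rewrite /Rintegral integralE.
have p0 : (0 <= \int[leb]_(x in D) (EFin \o g)^\+ x)%E by apply: integral_ge0 => x _; exact: funepos_ge0.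
have n0 : (0 <= \int[leb]_(x in D) (EFin \o g)^\- x)%E by apply: integral_ge0 => x _; exact: funeneg_ge0.
have [pf|pf] := eqVneq (\int[leb]_(x in D) (EFin \o g)^\+ x)%E (+oo)%E.
  by rewrite pf; case: (\int[leb]_(x in D) (EFin \o g)^\- x)%E n0.
have [nf|nf] := eqVneq (\int[leb]_(x in D) (EFin \o g)^\- x)%E (+oo)%E.
  by rewrite nf; case: (\int[leb]_(x in D) (EFin \o g)^\+ x)%E p0 pf.
exfalso; apply: ni; apply/integrableP; split=> //.
have -> : (\int[leb]_(x in D) `|(EFin \o g) x| =
    \int[leb]_(x in D) (EFin \o g)^\+ x + \int[leb]_(x in D) (EFin \o g)^\- x)%E.
  rewrite -ge0_integralD//.
  - by apply: eq_integral => x _; rewrite -[LHS]/((abse \o (EFin \o g)) x) fune_abse.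
  - exact: measurable_funepos.
  - exact: measurable_funeneg.
by rewrite lte_add_pinfty// ltey.
Qed.

(** Cauchy-Schwarz, read off from the nonnegative integral of (g - l)^2 with [l] the mean of [g]. *)
Lemma square_Rint_le (s t : R) g : s < t -> measurable_fun `]s, t] g ->
  leb.-integrable `]s, t] (EFin \o (fun u => g u ^+ 2)) ->
  leb.-integrable `]s, t] (EFin \o g) ->
  (\int[leb]_(u in `]s, t]) g u) ^+ 2 <= (t - s) * \int[leb]_(u in `]s, t]) (g u ^+ 2).
Proof.
move=> st mg i2 i1; set I := \int[leb]_(u in _) g u; set J := \int[leb]_(u in _) (g u ^+ 2).
have ts0 : 0 < t - s by rewrite subr_gt0.
have mD : measurable ([set` `]s, t]] : set (measurableTypeR R)) by exact: measurable_itv.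
pose l := I / (t - s).
have il : leb.-integrable `]s, t] (EFin \o (fun u => 2 * l * g u)).
  rewrite (_ : EFin \o _ = fun u => ((2 * l)%:E * (g u)%:E)%E); last by apply/funext.
  exact: integrableZl.
have lebD : leb [set` `]s, t]] = (t - s)%:E.
  by rewrite lebesgue_measure_itv/= lte_fin st EFinB.
have ic : leb.-integrable `]s, t] (EFin \o (fun=> l ^+ 2)).
  have lt : (leb [set` `]s, t]] < +oo)%E by rewrite lebD ltry.
  apply: measurable_bounded_integrable => //.
  by exists `|l ^+ 2|; split; [exact: num_real|move=> x lx y _; exact: ltW].
have iB : leb.-integrable `]s, t] (EFin \o (fun u => g u ^+ 2 - 2 * l * g u)).
  rewrite (_ : EFin \o _ = fun u => ((g u ^+ 2)%:E - (2 * l * g u)%:E)%E); last by apply/funext.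
  exact: integrableB.
have E : \int[leb]_(u in `]s, t]) (g u ^+ 2 - 2 * l * g u + l ^+ 2) = J - 2 * l * I + l ^+ 2 * (t - s).
  rewrite RintegralD// RintegralB// RintegralZl// Rintegral_cst//.
  by congr (_ + _ * _); transitivity (fine (t - s)%:E) => //; congr fine.
have : 0 <= \int[leb]_(u in `]s, t]) (g u ^+ 2 - 2 * l * g u + l ^+ 2).
  apply: Rintegral_ge0 => u _.
  by rewrite (_ : _ + _ = (g u - l) ^+ 2) ?sqr_ge0//; ring.
rewrite E => H.
have : 0 <= (t - s) * (J - 2 * l * I + l ^+ 2 * (t - s)) by rewrite mulr_ge0// ltW.
rewrite (_ : _ * _ = (t - s) * J - I ^+ 2) ?subr_ge0//.
by rewrite /l; field; rewrite lt0r_neq0.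
Qed.

(** This has to hold for every control path, including those whose drift integral takes the default
    value 0. If the energy on ]s, t] is finite, then [g] is integrable there, so it is integrable on
    [0, s] exactly when it is on [0, t]; otherwise both integrals are 0 and so is the increment. *)
Lemma square_increment_le (s t : R) g : 0 <= s -> s < t -> measurable_fun `[0, t] g ->
  (((\int[leb]_(u in `[0, t]) g u - \int[leb]_(u in `[0, s]) g u) ^+ 2)%:E <=
   (t - s)%:E * \int[leb]_(u in `]s, t]) (g u ^+ 2)%:E)%E.
Proof.
move=> s0 st mg; have ts0 : 0 < t - s by rewrite subr_gt0.
have mD (i : interval R) : measurable ([set` i] : set (measurableTypeR R)) by exact: measurable_itv.
have sub1 : ([set` `]s, t]] : set R) `<=` [set` `[0, t]].
  by move=> u; rewrite /= !in_itv/= => /andP[su ->]; rewrite (le_trans s0)//= ltW.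
have sub2 : ([set` `[0, s]] : set R) `<=` [set` `[0, t]].
  by move=> u; rewrite /= !in_itv/= => /andP[-> us]; rewrite (le_trans us)//= ltW.
have mg1 : measurable_fun `]s, t] g by exact: measurable_funS mg.
have mg2 : measurable_fun `[0, s] g by exact: measurable_funS mg.
have [fin|] := eqVneq (\int[leb]_(u in `]s, t]) (g u ^+ 2)%:E)%E (+oo)%E.
  by rewrite fin gt0_muley ?lte_fin// leey.
rewrite -ltey => fin.
have mg3 : measurable_fun `]s, t] (EFin \o (fun u => g u ^+ 2)).
  by apply/measurable_EFinP; exact: measurable_funX.
have i2 : leb.-integrable `]s, t] (EFin \o (fun u => g u ^+ 2)).
  apply/integrableP; split=> //; apply: le_lt_trans fin.
  rewrite le_eqVlt; apply/orP; left; apply/eqP; apply: eq_integral => u _.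
  by rewrite /= ger0_norm// sqr_ge0.
have lebD : (leb [set` `]s, t]] < +oo)%E.
  by rewrite lebesgue_measure_itv/= lte_fin st -EFinB ltry.
have ic : leb.-integrable `]s, t] (EFin \o (fun=> 1)).
  apply: measurable_bounded_integrable => //.
  by exists 1; split; [exact: num_real|move=> x lx y _; rewrite /= normr1 ltW].
have i1 : leb.-integrable `]s, t] (EFin \o g).
  apply: (le_integrable (mD _) _ _ (integrableD (mD _) ic i2)); first exact/measurable_EFinP.
  move=> u _; rewrite /= lee_fin [leRHS]ger0_norm ?addr_ge0 ?sqr_ge0//.
  rewrite -[g u ^+ 2]real_normK ?num_real//.
  by have := sqr_ge0 (`|g u| - 1); have := normr_ge0 (g u); nra.
have fin_num_J : (\int[leb]_(u in `]s, t]) (g u ^+ 2)%:E)%E \is a fin_num.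
  exact: integrable_fin_num.
rewrite -(fineK fin_num_J) -EFinM lee_fin.
have [i0|ni] := pselect (leb.-integrable `[0, s] (EFin \o g)).
  have it : leb.-integrable `[0, t] (EFin \o g).
    have U : ([set` `[0, t]] : set R) = [set` `[0, s]] `|` [set` `]s, t]].
      apply/seteqP; split=> u.
        rewrite /= !in_itv/= => /andP[u0 ut]; have [us|su] := leP u s; first by left; apply/andP.
        by right; apply/andP.
      by move=> [/sub2|/sub1].
    have mG : measurable_fun ([set` `[0, t]] : set R) (EFin \o g) by exact/measurable_EFinP.
    apply/integrableP; split=> //; rewrite U ge0_integral_setU//.
    - by move/integrableP : i0 => [_ i0]; move/integrableP : i1 => [_ i1]; exact: lte_add_pinfty.
    - by rewrite -U; exact: measurableT_comp.
    - apply/disj_setPS => u [] /=; rewrite !in_itv/= => /andP[_ us] /andP[su _].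
      by rewrite ltNge us in su.
  rewrite Rintegral_itvB//; first exact: square_Rint_le.
  by rewrite bnd_simp ltW.
rewrite (Rint_not_integrable (mD _) mg2 ni) (Rint_not_integrable (mD _) mg); last first.
  by move=> H; apply: ni; exact: integrableS H.
by rewrite subrr expr0n mulr_ge0 ?(ltW ts0)//; apply: Rintegral_ge0 => u _; rewrite sqr_ge0.
Qed.

End increment_bound.

(** * From cumulative to discounted lower bounds *)

Section layer_cake.
Context {R : realType}.
Variable rho : R.
Hypothesis rho0 : 0 < rho.
Local Notation leb := (@lebesgue_measure R).

Lemma integral_tail_expR (u : R) : 0 <= u ->
  (\int[leb]_(t in `[u, +oo[) (rho * expR (- (rho * t)))%:E = (expR (- (rho * u)))%:E)%E.
Proof.
move=> u0.
have ce : continuous (fun t : R => - expR (- (rho * t))).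
  apply: (@derivative_continuous R _ (fun t => rho * expR (- (rho * t)))) => x.
  by apply: is_derive_eq; rewrite /GRing.scale/=; ring.
have cp : continuous (fun t : R => rho * expR (- (rho * t))).
  apply: (@derivative_continuous R _ (fun t => - (rho * rho) * expR (- (rho * t)))) => x.
  by apply: is_derive_eq; rewrite /GRing.scale/=; ring.
rewrite (@ge0_continuous_FTC2y R _ (fun t => - expR (- (rho * t))) u 0).
- by rewrite sub0e -EFinN opprK.
- by move=> x _; rewrite mulr_ge0 ?expR_ge0// ltW.
- exact: continuous_subspaceT.
- rewrite -oppr0; apply: cvgN.
  rewrite (_ : (fun x => expR (- (rho * x))) = (fun z => expR (- z)) \o (fun z => rho * z)); last first.
    by [].
  apply: (@cvg_comp _ _ _ _ _ _ (pinfty_nbhs R)); last exact: cvgr_expR.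
  exact: gt0_cvgMry.
- by move=> x _.
- exact/cvg_at_right_filter/ce.
- move=> x _; rewrite derive1E.
  have D : is_derive x (1 : R) (fun t : R => - expR (- (rho * t))) (rho * expR (- (rho * x))).
    by apply: is_derive_eq; rewrite /GRing.scale/=; ring.
  by rewrite (@derive_val _ _ _ _ _ _ _ D).
Qed.

(** The discount exp(-rho u) is the integral of rho exp(-rho t) over t >= u; Tonelli exchanges [t]
    and [u]. *)
Lemma layer_cake (al : measurableTypeR R -> \bar R) : measurable_fun setT al -> (forall u, 0 <= al u)%E ->
  (\int[leb]_(u in `[0%R, +oo[) ((expR (- (rho * u)))%:E * al u) =
   \int[leb]_(t in `[0%R, +oo[) ((rho * expR (- (rho * t)))%:E * \int[leb]_(u in `[0%R, t]) al u))%E.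
Proof.
move=> mal al0.
have me : measurable_fun [set: measurableTypeR R] (fun t : measurableTypeR R => rho * expR (- (rho * t))).
  apply: measurable_funM => //; apply: measurableT_comp => //; apply: measurable_funN; exact: measurable_funM.
pose h (p : measurableTypeR R * measurableTypeR R) : \bar R :=
  if (0 <= p.1) && (p.1 <= p.2) then ((rho * expR (- (rho * p.2)))%:E * al p.1)%E else 0%E.
have mh : measurable_fun setT h.
  apply: measurable_fun_ifT.
  - apply: measurable_and.
      by apply: measurable_fun_ler; [exact: measurable_cst|exact: measurable_fst].
    by apply: measurable_fun_ler; [exact: measurable_fst|exact: measurable_snd].
  - apply: emeasurable_funM.
      by apply/measurable_EFinP; apply: (measurableT_comp me); exact: measurable_snd.
    by apply: (measurableT_comp mal); exact: measurable_fst.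
  - exact: measurable_cst.
have h0 p : (0 <= h p)%E.
  by rewrite /h; case: ifP => // _; rewrite mule_ge0// lee_fin mulr_ge0 ?expR_ge0// ltW.
have mDu (i : interval R) : measurable ([set` i] : set (measurableTypeR R)) by exact: measurable_itv.
transitivity (\int[leb]_u \int[leb]_t h (u, t))%E.
  rewrite integral_mkcond; apply: eq_integral => u _; rewrite patchE.
  have -> : (u \in [set` `[0, +oo[]) = (0 <= u) by apply/idP/idP; rewrite inE/= in_itv/= andbT.
  case: ifPn => u0; last first.
    by apply/esym/integral0_eq => t _; rewrite /h/= (negbTE u0).
  rewrite -integral_tail_expR// -ge0_integralZr//; last 2 first.
  - by apply/measurable_EFinP; exact: measurable_funTS.
  - by move=> t _; rewrite lee_fin mulr_ge0 ?expR_ge0// ltW.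
  rewrite integral_mkcond; apply: eq_integral => t _; rewrite patchE /h/= u0/=.
  have -> : (t \in [set` `[u, +oo[]) = (u <= t) by apply/idP/idP; rewrite inE/= in_itv/= andbT.
  by case: (u <= t).
rewrite fubini_tonelli// [RHS]integral_mkcond; apply: eq_integral => t _; rewrite patchE.
have -> : (t \in [set` `[0, +oo[]) = (0 <= t) by apply/idP/idP; rewrite inE/= in_itv/= andbT.
case: ifPn => t0; last first.
  apply: integral0_eq => u _; rewrite /h/=; case: ifP => // /andP[u0 ut].
  by rewrite (le_trans u0 ut) in t0.
rewrite -ge0_integralZl//; last 2 first.
- exact: measurable_funTS.
- by rewrite lee_fin mulr_ge0 ?expR_ge0// ltW.
rewrite [RHS]integral_mkcond; apply: eq_integral => u _; rewrite patchE /h/=.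
have -> : (u \in [set` `[0, t]]) = (0 <= u <= t) by apply/idP/idP; rewrite inE/= in_itv.
by case: (_ && _).
Qed.

(** The energy bound is available only in cumulative form, on [0, t] for every [t]; the layer-cake
    identity turns it into the discounted bound attained by the constant rate [K]. *)
Lemma layer_cake_ge (al : measurableTypeR R -> \bar R) (K : R) : 0 <= K ->
  measurable_fun setT al -> (forall u, 0 <= al u)%E ->
  (forall t, 0 <= t -> ((K * t)%:E <= \int[leb]_(u in `[0%R, t]) al u)%E) ->
  ((K / rho)%:E <= \int[leb]_(u in `[0%R, +oo[) ((expR (- (rho * u)))%:E * al u))%E.
Proof.
move=> K0 mal al0 H; rewrite layer_cake//.
have -> : (K / rho)%:E = (\int[leb]_(u in `[0%R, +oo[) ((expR (- (rho * u)))%:E * K%:E))%E.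
  rewrite ge0_integralZr//; first by rewrite integral_expR// -EFinM mulrC.
    apply/measurable_EFinP/measurable_funTS; apply: measurableT_comp => //.
    by apply: measurable_funN; exact: measurable_funM.
rewrite (@layer_cake (fun=> K%:E))//.
apply: ge0_integral_mono => t; rewrite /= in_itv/= andbT => t0.
  rewrite mule_ge0//; first by rewrite lee_fin mulr_ge0 ?expR_ge0// ltW.
  by apply: integral_ge0.
rewrite lee_wpmul2l//; first by rewrite lee_fin mulr_ge0 ?expR_ge0// ltW.
rewrite (le_trans _ (H t t0))// integral_cst//=.
rewrite lebesgue_measure_itv/= lte_fin; case: ifPn => [t1|].
  by rewrite sube0 -EFinM.
by rewrite mule0 lee_fin mulr_ge0.
Qed.

End layer_cake.

Section torus_law.
Context {R : realType} {d : nat} {dO : measure_display} {Omega : measurableType dO}.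
Variable P : probability Omega R.

Lemma measurable_torus_proj : measurable_fun setT (@torus_proj R d).
Proof.
apply/measurable_fun_rVP => i.
rewrite (_ : _ \o _ = fun x : 'rV[R]_d => rV_coord i x -
    (2 * pi) * (Num.floor (rV_coord i x / (2 * pi)))%:~R); last first.
  by apply/funext => x; rewrite /rV_coord/= mxE.
apply: measurable_funB; first exact: measurable_rV_coord.
apply: measurable_funM; first exact: measurable_cst.
have mf : measurable_fun [set: R] (fun y : R => (Num.floor y)%:~R : R).
  apply: nondecreasing_measurable => //.
  by move=> x y xy; rewrite ler_int; exact: le_floor.
apply: (measurableT_comp mf); apply: measurable_funM; last exact: measurable_cst.
exact: measurable_rV_coord.
Qed.

Lemma pdens_int (mu : pdens R d) phi : cper phi ->
  \int[mu]_x phi x = \int[torus_measure R d]_x (phi x * dens mu x).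
Proof.
move=> cp.
have cd : cper (dens mu) by split; [exact: C2_continuous (dens_C2 mu)|exact: dens_periodic].
have mphi : measurable_fun setT phi by apply: continuous_rV_measurable; case: cp.
have md : measurable_fun setT (dens mu) by apply: continuous_rV_measurable; case: cd.
rewrite (@int_density _ _ _ (lebesgue_rV R d) mu cell (dens mu))//.
- by rewrite -torus_intE//; exact: measurable_funM.
- exact: measurable_torus_cell.
- by move=> x; exact/ltW/dens_gt0.
- exact: dens_spec.
Qed.

(** Only the law of the projected state is prescribed, and periodic test functions do not
    distinguish a point from its projection. *)
Lemma torus_law_int (X : Omega -> 'rV[R]_d) (mu : pdens R d) phi : measurable_fun setT X ->
  has_torus_law P X mu -> cper phi ->
  \int[P]_w phi (X w) = \int[torus_measure R d]_x (phi x * dens mu x).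
Proof.
move=> mX lX cp.
transitivity (\int[P]_w phi (torus_proj (X w))).
  apply: eq_Rintegral => w _; have := periodic_proj (proj2 cp) (X w) 0.
  by rewrite !addr0 => ->.
have mP : measurable_fun setT (fun w => torus_proj (X w)) by exact: measurableT_comp measurable_torus_proj mX.
rewrite -(@int_image _ _ Omega _ R P (mu : probability 'rV[R]_d R) (fun w => torus_proj (X w)) phi mP); last 2 first.
- by move=> A mA; symmetry; exact: lX.
- exact: cper_bmeas.
exact: pdens_int.
Qed.

End torus_law.

Section drift_increment.
Context {R : realType} {d : nat}.

Lemma young (a b s : R) : 0 < s -> a * b <= s / 2 * b ^+ 2 + (2 * s)^-1 * a ^+ 2.
Proof.
move=> s0; rewrite -subr_ge0.
rewrite (_ : _ - _ = (2 * s)^-1 * (s * b - a) ^+ 2); last by field; rewrite lt0r_neq0.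
by rewrite mulr_ge0 ?sqr_ge0// invr_ge0 mulr_ge0// ltW.
Qed.

(** Here [z] is the noise displacement and [A] the drift displacement. Young's inequality is applied
    with weight [delta] to the gradient at [x] and with the larger weight sqrt delta to its small
    variation, so that delta times the coefficient of |A|^2 tends to 1/2. *)
Lemma increment_le (phi : 'rV[R]_d -> R) (p : 'I_d -> 'rV[R]_d -> R) (K delta : R) x z A :
  (forall i, pderiv i phi (p i)) ->
  (forall i x z, `|p i (x + z) - p i x| <= K * `|z|) -> 0 <= K -> 0 < delta ->
  phi (x + z + A) - phi (x + z) - delta / 2 * \sum_i p i x ^+ 2
    - Num.sqrt delta / 2 * \sum_i (p i (x + z) - p i x) ^+ 2 <=
  ((2 * delta)^-1 + (2 * Num.sqrt delta)^-1 + K *+ d) * \sum_i A ord0 i ^+ 2.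
Proof.
move=> H HK K0 d0; have s0 : 0 < Num.sqrt delta by rewrite sqrtr_gt0.
set s := Num.sqrt delta in s0 *.
have /ler_normlW := pderiv_expansion H HK (x + z) A.
have : K *+ d * `|A| ^+ 2 <= K *+ d * \sum_i A ord0 i ^+ 2.
  by rewrite ler_wpM2l ?mulrn_wge0// norm_sqr_le_sum.
have : \sum_i A ord0 i * p i (x + z) <= delta / 2 * (\sum_i p i x ^+ 2)
    + s / 2 * (\sum_i (p i (x + z) - p i x) ^+ 2) + ((2 * delta)^-1 + (2 * s)^-1) * \sum_i A ord0 i ^+ 2.
  rewrite !mulr_sumr -!big_split/=; apply: ler_sum => i _.
  have := young (A ord0 i) (p i x) d0; have := young (A ord0 i) (p i (x + z) - p i x) s0.
  by rewrite (_ : A ord0 i * p i (x + z) = A ord0 i * p i x + A ord0 i * (p i (x + z) - p i x)); [lra|ring].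
move=> h1 h2 h3; rewrite [leRHS]mulrDl; move: h1 h2 h3.
by set a1 := \sum_i _ * _; set a2 := K *+ d * _; set a3 := K *+ d * _; lra.
Qed.

Lemma expectation_le_scaled {disp} {T : measurableType disp} (P : probability T R) (h g : T -> R) (k : R) :
  bmeas h -> measurable_fun setT g -> (forall w, 0 <= g w) -> 0 <= k -> (forall w, h w <= k * g w) ->
  ((\int[P]_w h w)%:E <= k%:E * \int[P]_w (g w)%:E)%E.
Proof.
move=> bh mg g0 k0 hg.
have bm : bmeas (fun w => Num.max (h w) 0).
  case: bh => mh [M HM]; split; first by apply: measurable_maxr => //; exact: measurable_cst.
  exists `|M| => w; rewrite ger0_norm ?le_max ?lexx ?orbT// ge_max normr_ge0 andbT.
  by rewrite (le_trans (ler_norm _))// (le_trans (HM w))// ler_norm.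
have ih := bmeas_integrable P bh; have im := bmeas_integrable P bm.
rewrite -ge0_integralZl//; last 2 first.
- exact/measurable_EFinP.
- by move=> w _; rewrite lee_fin.
apply: (@le_trans _ _ (\int[P]_w (Num.max (h w) 0)%:E)%E).
  rewrite /Rintegral fineK; last exact: integrable_fin_num.
  by apply: le_integral => // w _; rewrite lee_fin le_max lexx.
apply: ge0_integral_mono => w _; first by rewrite lee_fin le_max lexx orbT.
by rewrite -EFinM lee_fin ge_max hg mulr_ge0.
Qed.

End drift_increment.

(** * Energy needed to keep the law constant *)

Section cost_lower_bound.
Context {R : realType} {d : nat} {dO : measure_display} {Omega : measurableType dO}.
Let step_constants (M s e x1 x2 x3 : R) : 0 < e -> 0 <= s -> s <= 1 -> M * s <= e / 2 ->
  0 <= x1 -> 0 <= x2 -> 0 <= x3 -> M = x1 + x2 + 1 + x3 ->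
  2^-1 + s / 2 + x3 * s ^+ 2 <= 2^-1 + e /\ x1 * s ^+ 2 + x2 * s <= e / 2.
Proof.
move=> e0 s0 s1 Ms a1 a2 a3 ME; rewrite {}ME in Ms.
have ss : s ^+ 2 <= s by rewrite expr2 ler_piMl.
have h1 : x1 * s ^+ 2 <= x1 * s by rewrite ler_wpM2l.
have h3 : x3 * s ^+ 2 <= x3 * s by rewrite ler_wpM2l.
have g1 : 0 <= x1 * s by exact: mulr_ge0.
have g2 : 0 <= x2 * s by exact: mulr_ge0.
have g3 : 0 <= x3 * s by exact: mulr_ge0.
by split; lra.
Qed.

Let taylor_weight (gp f e k y z w : R) : 0 <= w -> gp - f - y * z <= e + k ->
  gp * w <= f * w + y * (z * w) + (e + k) * w.
Proof.
move=> w0 h; have : gp <= f + y * z + (e + k) by lra.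
by move=> /(ler_wpM2r w0); rewrite !mulrDl mulrA.
Qed.

Let gap_combine (E e D I1 I2 I4 u r C : R) :
  2 * E * D - (e / 2 * D + u) <= I1 - I2 -> u + C * r * D <= e / 2 * D -> r / 2 * I4 <= C * r * D ->
  (E - e) * D <= I1 - I2 - E * D - r / 2 * I4.
Proof. by move=> h1 h2 h3; rewrite mulrBl; lra. Qed.

Variables (P : probability Omega R) (G : R -> set (set Omega)) (W : R -> Omega -> 'rV[R]_d).
Hypotheses (FG : filtration G) (BW : brownian_motion P G W).
Variables (nu : R) (xi : Omega -> 'rV[R]_d) (a : R -> Omega -> 'rV[R]_d).
Hypotheses (nu0 : 0 < nu) (mxi : measurable_wrt (G 0) xi) (pa : progressively_measurable G a).
Variables (m : 'rV[R]_d -> R) (dm : 'I_d -> 'rV[R]_d -> R) (ddm : 'I_d -> 'I_d -> 'rV[R]_d -> R).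
Hypotheses (cm : cper m) (cdm : forall i, cper (dm i)) (cddm : forall i j, cper (ddm i j)).
Hypotheses (m_dm : forall i, pderiv i m (dm i)) (dm_ddm : forall i j, pderiv j (dm i) (ddm i j)).
Hypotheses (m0 : forall x, 0 < m x) (m1 : \int[torus_measure R d]_x m x = 1).
Local Notation leb := (@lebesgue_measure R).
Local Notation c := (Num.sqrt (2 * nu)).
Local Notation X := (state W nu xi a).
Hypothesis lawX : forall t phi, 0 <= t -> cper phi ->
  \int[P]_w phi (X t w) = \int[torus_measure R d]_x (phi x * m x).

Let ctl i := (fun q : measurableTypeR R * Omega => a q.1 q.2 ord0 i)
    \_ ([set` `[(0 : R), +oo[] `*` setT : set (measurableTypeR R * Omega)).

Let mctl i : measurable_fun setT (ctl i).
Proof. exact: (progressive_joint FG i pa). Qed.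

Let ctlE i u w : 0 <= u -> ctl i (u, w) = a u w ord0 i.
Proof. by move=> u0; rewrite /ctl patchE ifT// inE/= in_itv/= u0. Qed.

(** Extended-valued, since a control may have infinite energy; negative times count as 0 so that it
    is a function on the whole line. *)
Definition control_energy (u : measurableTypeR R) : \bar R :=
  (\int[P]_w (\sum_i ctl i (u, w) ^+ 2)%:E)%E.

Let msq : measurable_fun setT (fun q : measurableTypeR R * Omega => (\sum_i ctl i q ^+ 2)%:E).
Proof. by apply/measurable_EFinP; apply: measurable_sum => i; exact: measurable_funX. Qed.

Let sq_ge0 q : (0 <= (\sum_i ctl i q ^+ 2)%:E)%E.
Proof. by rewrite lee_fin sumr_ge0// => i _; exact: sqr_ge0. Qed.

Lemma measurable_control_energy : measurable_fun setT control_energy.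
Proof. exact: (@measurable_fun_fubini_tonelli_F _ _ _ _ _ P _ msq sq_ge0). Qed.

Lemma control_energy_ge0 u : (0 <= control_energy u)%E.
Proof. by apply: integral_ge0 => w _; exact: sq_ge0. Qed.

Lemma control_energyE u : 0 <= u -> control_energy u = (\int[P]_w (sqnorm (a u w))%:E)%E.
Proof.
move=> u0; apply: eq_integral => w _; congr EFin.
by apply: eq_bigr => i _; rewrite ctlE.
Qed.

(** Obtained by subtracting the noise from the state, a form in which its measurability in the
    sample point is immediate. *)
Let drift_part s t w : 'rV[R]_d := X t w - X s w - c *: (W t w - W s w).

Let drift_partE s t w i : drift_part s t w ord0 i =
  \int[leb]_(u in `[0, t]) a u w ord0 i - \int[leb]_(u in `[0, s]) a u w ord0 i.
Proof. by rewrite /drift_part/state !mxE; ring. Qed.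

Let mX t : 0 <= t -> measurable_fun setT (X t).
Proof. by move=> t0; exact: (wrt_measurable FG t0 (measurable_state_wrt FG BW nu mxi pa t0)). Qed.

Let measurable_drift_part s t i : 0 <= s -> 0 <= t -> measurable_fun setT (fun w => drift_part s t w ord0 i).
Proof.
move=> s0 t0; have mW u : 0 <= u -> measurable_fun setT (W u).
  by move=> u0; exact: (measurable_W FG BW u0).
have co (Y : Omega -> 'rV[R]_d) : measurable_fun setT Y -> measurable_fun setT (fun w => Y w ord0 i).
  by move=> mY; exact: measurableT_comp (measurable_rV_coord i) mY.
rewrite (_ : (fun w => _) = fun w => X t w ord0 i - X s w ord0 i - c * (W t w ord0 i - W s w ord0 i)); last first.
  by apply/funext => w; rewrite /drift_part !mxE.
apply: measurable_funB; first by apply: measurable_funB; apply: co; exact: mX.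
apply: measurable_funM; first exact: measurable_cst.
by apply: measurable_funB; apply: co; exact: mW.
Qed.

(** Cauchy-Schwarz on each path and each coordinate, then Tonelli. *)
Lemma increment_energy s t : 0 <= s -> s < t ->
  (\int[P]_w (\sum_i drift_part s t w ord0 i ^+ 2)%:E <=
   (t - s)%:E * \int[leb]_(u in `]s, t]) control_energy u)%E.
Proof.
move=> s0 st; have t0 : 0 <= t by exact: le_trans (ltW st).
have ts0 : (0 <= (t - s)%:E)%E by rewrite lee_fin subr_ge0 ltW.
pose h (q : measurableTypeR R * Omega) : \bar R :=
  if (s < q.1) && (q.1 <= t) then (\sum_i ctl i q ^+ 2)%:E else 0%E.
have mh : measurable_fun setT h.
  apply: measurable_fun_ifT => //.
  apply: measurable_and.
    by apply: measurable_fun_ltr; [exact: measurable_cst|exact: measurable_fst].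
  by apply: measurable_fun_ler; [exact: measurable_fst|exact: measurable_cst].
have h0 q : (0 <= h q)%E by rewrite /h; case: ifP.
have itvE u : (u \in ([set` `]s, t]] : set R)) = (s < u) && (u <= t).
  by apply/idP/idP; rewrite inE/= in_itv.
have -> : (\int[leb]_(u in `]s, t]) control_energy u = \int[leb]_u \int[P]_w h (u, w))%E.
  rewrite integral_mkcond; apply: eq_integral => u _; rewrite patchE itvE.
  by case: ifPn => H; [apply: eq_integral => w _|apply/esym/integral0_eq => w _]; rewrite /h/= ?H// (negbTE H).
rewrite (@fubini_tonelli _ _ (measurableTypeR R) Omega R leb P h mh h0).
rewrite -ge0_integralZl//; last 2 first.
- exact: (@measurable_fun_fubini_tonelli_G _ _ _ _ _ leb _ mh h0).
- by move=> w _; apply: integral_ge0 => u _; exact: h0.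
apply: ge0_integral_mono => w _; first by rewrite lee_fin sumr_ge0// => i _; exact: sqr_ge0.
have -> : (\int[leb]_u h (u, w) = \sum_i \int[leb]_(u in `]s, t]) (a u w ord0 i ^+ 2)%:E)%E.
  rewrite -ge0_integral_sum//.
  - rewrite [RHS]integral_mkcond; apply: eq_integral => u _; rewrite patchE itvE /h/=.
    case: ifP => // /andP[su _]; rewrite -sumEFin; apply: eq_bigr => i _.
    by rewrite ctlE// (le_trans s0)// ltW.
  - move=> i; apply/measurable_EFinP; apply: measurable_funX.
    apply: (@eq_measurable_fun _ _ _ _ _ (fun u => ctl i (u, w))).
      by move=> u; rewrite inE/= in_itv/= => /andP[su _]; rewrite ctlE// (le_trans s0)// ltW.
    by apply: measurable_funTS; exact: (measurableT_comp (mctl i) (@pair2_measurable _ _ (measurableTypeR R) Omega w)).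
  - by move=> i u _; rewrite lee_fin sqr_ge0.
rewrite ge0_sume_distrr; last by move=> i _; apply: integral_ge0 => u _; rewrite lee_fin sqr_ge0.
rewrite -sumEFin; apply: lee_sum => i _; rewrite drift_partE.
apply: square_increment_le => //.
apply: (@eq_measurable_fun _ _ _ _ _ (fun u => ctl i (u, w))).
  by move=> u; rewrite inE/= in_itv/= => /andP[u0 _]; rewrite ctlE.
by apply: measurable_funTS; exact: (measurableT_comp (mctl i) (@pair2_measurable _ _ (measurableTypeR R) Omega w)).
Qed.

(** The trial function of the lower bound: its gradient [p] is the drift nu grad m / m, under which
    [m] is invariant; [q] holds the pure second derivatives. *)
Let phi x := nu * ln (m x).
Let p i x := nu * (dm i x / m x).
Let q i x := nu * (dm i x * (- dm i x / m x ^+ 2) + (m x)^-1 * ddm i i x).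

Let m_neq0 x : m x != 0. Proof. by rewrite lt0r_neq0. Qed.

Let cp i : cper (p i).
Proof. by apply: cperM; [exact: cper_cst|apply: cperM => //; exact: cperV]. Qed.

Let cphi : cper phi.
Proof.
apply: cperM; first exact: cper_cst.
split; last by move=> x i; rewrite (proj2 cm).
move=> x; apply: continuous_comp; [exact: (proj1 cm)|exact: continuous_ln].
Qed.

Let cq i : cper (q i).
Proof.
have ci : cper (fun x => (m x)^-1) by exact: cperV.
apply: cperM; first exact: cper_cst.
apply: cperD; last exact: cperM.
apply: cperM => //; apply: cperM; first exact: cperN.
apply: cperV; first by rewrite /GRing.exp/=; exact: cperM.
by move=> x; rewrite expf_neq0.
Qed.

Let phi_p i : pderiv i phi (p i).
Proof. by apply: pderivZ; exact: pderiv_ln. Qed.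

Let p_q i : pderiv i (p i) (q i).
Proof. by apply: pderivZ; apply: pderivM => //; exact: pderivV. Qed.

Let p_lip : exists2 K, 0 <= K & forall i x z, `|p i (x + z) - p i x| <= K * `|z|.
Proof.
have /choice[A bA] : forall i, exists A, BL A (p i).
  move=> i; apply: (@cper_BL _ _ _ (fun j x => nu * (dm i x * (- dm j x / m x ^+ 2) + (m x)^-1 * ddm i j x))) => //.
    move=> j; have ci : cper (fun x => (m x)^-1) by exact: cperV.
    apply: cperM; first exact: cper_cst.
    apply: cperD; last exact: cperM.
    apply: cperM => //; apply: cperM; first exact: cperN.
    apply: cperV; first by rewrite /GRing.exp/=; exact: cperM.
    by move=> x; rewrite expf_neq0.
  by move=> j; apply: pderivZ; apply: pderivM => //; exact: pderivV.
have A0 i : 0 <= A i by exact: BL_ge0 (bA i).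
exists (\sum_i A i) => [|i x z]; first exact: sumr_ge0.
rewrite (le_trans (proj2 (bA i) x z))// ler_wpM2r// (bigD1 i)//= lerDl.
exact: sumr_ge0.
Qed.

(** Equal to nu^2/2 I(mu): the kinetic cost rate of the drift nu grad m / m under [m]. *)
Definition half_drift_energy := \int[torus_measure R d]_x (2^-1 * \sum_i p i x ^+ 2 * m x).
Local Notation K0 := half_drift_energy.

(** Integration by parts, with nu [dm i] = [m] times [p i]. *)
Let int_q : nu * \int[torus_measure R d]_x ((\sum_i q i x) * m x) = - (2 * K0).
Proof.
rewrite /half_drift_energy.
have cp2 i : cper (fun x => p i x ^+ 2 * m x).
  by rewrite /GRing.exp/=; apply: cperM => //; exact: cperM.
have -> : \int[torus_measure R d]_x ((\sum_i q i x) * m x) = \sum_i \int[torus_measure R d]_x (q i x * m x).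
  rewrite -int_sum; last by move=> i; apply: cper_bmeas; exact: cperM.
  by apply: eq_Rintegral => x _; rewrite mulr_suml.
have -> : \int[torus_measure R d]_x (2^-1 * \sum_i p i x ^+ 2 * m x) =
    2^-1 * \sum_i \int[torus_measure R d]_x (p i x ^+ 2 * m x).
  rewrite -int_sum; last by move=> i; exact: cper_bmeas.
  rewrite -intZ; last by apply: bmeas_sum => i; exact: cper_bmeas.
  by [].
rewrite mulrA mulfV ?pnatr_eq0// mul1r mulr_sumr -sumrN; apply: eq_bigr => i _.
rewrite (_ : \int[_]_x (q i x * m x) = \int[torus_measure R d]_x (m x * q i x)); last first.
  by apply: eq_Rintegral => x _; rewrite mulrC.
rewrite (torus_int_by_parts cm (cp i) (cdm i) (cq i) (m_dm i) (p_q i)) mulrN; congr (- _).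
rewrite -intZ; last by apply: cper_bmeas; exact: cperM.
apply: eq_Rintegral => x _; rewrite /p; field; exact: m_neq0.
Qed.

(** Without drift, one noise step would lower the mean of nu ln m by about 2 K0 delta; this is the
    amount that the control has to restore. *)
Let int_phi_gap (delta e K : R) (g : {finite_measure set 'rV[R]_d -> \bar R}) : 0 <= delta ->
  (forall x, `|gop g c phi x - phi x - c ^+ 2 * Num.sqrt delta ^+ 2 / 2 * \sum_i q i x| <=
    e * Num.sqrt delta ^+ 2 + K * Num.sqrt delta ^+ 4) ->
  cper (gop g c phi) ->
  \int[torus_measure R d]_x (phi x * m x) - \int[torus_measure R d]_x (gop g c phi x * m x) >=
  2 * K0 * delta - (e * delta + K * delta ^+ 2).
Proof.
move=> d0 H cg.
have s2 : Num.sqrt delta ^+ 2 = delta by exact: sqr_sqrtr.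
have s4 : Num.sqrt delta ^+ 4 = delta ^+ 2 by rewrite (exprM _ 2 2) s2.
have c2 : c ^+ 2 = 2 * nu by rewrite sqr_sqrtr// mulr_ge0// ltW.
have csq : cper (fun x => \sum_i q i x) by exact: cper_sum.
have b1 : bmeas (fun x => phi x * m x) by apply: cper_bmeas; exact: cperM.
have b2 : bmeas (fun x => gop g c phi x * m x) by apply: cper_bmeas; exact: cperM.
have b3 : bmeas (fun x => (\sum_i q i x) * m x) by apply: cper_bmeas; exact: cperM.
have b4 : bmeas m by exact: cper_bmeas.
have le (x : 'rV[R]_d) : gop g c phi x * m x <= phi x * m x + nu * delta * ((\sum_i q i x) * m x) + (e * delta + K * delta ^+ 2) * m x.
  apply: taylor_weight; first exact/ltW/m0.
  have /ler_normlW := H x; rewrite s2 s4 c2.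
  by have -> : 2 * nu * delta / 2 * \sum_i q i x = nu * delta * \sum_i q i x by field.
have := int_le (torus_measure R d) b2
  (bmeasD (bmeasD b1 (bmeasM (bmeas_cst (nu * delta)) b3)) (bmeasM (bmeas_cst (e * delta + K * delta ^+ 2)) b4)) le.
rewrite (intD _ (bmeasD b1 (bmeasM (bmeas_cst (nu * delta)) b3)) (bmeasM (bmeas_cst (e * delta + K * delta ^+ 2)) b4)).
rewrite (intD _ b1 (bmeasM (bmeas_cst (nu * delta)) b3)) (intZ _ _ b3) (intZ _ _ b4) m1.
have := int_q; set I := \int[_]_x _; set J := \int[_]_x _; set J' := \int[_]_x _ => iq.
have -> : nu * delta * I = delta * (nu * I) by ring.
by rewrite iq; lra.
Qed.

(** Stationarity gives [phi (X t)] and [phi (X s)] the same mean, so the drift must make up for the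
    loss 2 K0 delta. Young's inequality takes K0 delta of it for the gradient term, and the other K0
    delta is bounded by half of the energy on ]s, t]. *)
Lemma energy_step e : 0 < e -> exists2 delta0, 0 < delta0 & forall s t, 0 <= s -> s < t -> t - s <= delta0 ->
  (((K0 - e) * (t - s))%:E <= (2^-1 + e)%:E * \int[leb]_(u in `]s, t]) control_energy u)%E.
Proof.
move=> e0; have [L L0 HL] := p_lip; have e20 : 0 < e / 2 by rewrite divr_gt0.
have [K KK0 HK] := gauss_taylor c cphi cq phi_p p_q e20.
have c_ge0 : 0 <= c by exact: sqrtr_ge0.
(* From the mean of |p(x + noise) - p(x)|^2: [d] components, Lipschitz constant L c in the Gaussian
   vector, and second moment d delta. *)
pose C := d%:R * (L * c) ^+ 2 * d%:R / 2; have C0 : 0 <= C by rewrite !mulr_ge0 ?sqr_ge0 ?invr_ge0.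
pose M := K + C + 1 + L *+ d.
have M0 : 0 < M by rewrite ltr_wpDr ?mulrn_wge0// ltr_wpDl// addr_ge0.
pose s0 := Num.min 1 (e / (2 * M)).
have s00 : 0 < s0 by rewrite lt_min ltr01 divr_gt0// mulr_gt0.
exists (s0 ^+ 2) => [|s t s_ge0 st ts]; first exact: exprn_gt0.
have t0 : 0 <= t by exact: le_trans (ltW st).
set delta := t - s in ts *; have d0 : 0 < delta by rewrite subr_gt0.
set r := Num.sqrt delta; have r0 : 0 < r by rewrite sqrtr_gt0.
have r2 : r ^+ 2 = delta by rewrite sqr_sqrtr// ltW.
have rs : r <= s0 by rewrite -(@ler_pXn2r _ 2)// ?nnegrE ?(ltW r0) ?(ltW s00)// r2.
have r1 : r <= 1 by rewrite (le_trans rs)// ge_min lexx.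
have Mr : M * r <= e / 2.
  have : r <= e / (2 * M) by rewrite (le_trans rs)// ge_min lexx orbT.
  by rewrite ler_pdivlMr ?mulr_gt0//; lra.
have Ld0 : 0 <= L *+ d by exact: mulrn_wge0.
have [k1 k2] := step_constants e0 (ltW r0) r1 Mr KK0 C0 Ld0 erefl.
pose g := incr_law FG BW s_ge0 t0.
have gg : gauss r g by exact: gauss_incr_law.
have cg := gop_cper c gg cphi.
have mW u : 0 <= u -> measurable_fun setT (W u).
  by move=> u0; exact: (measurable_W FG BW u0).
have mZ : measurable_fun setT (fun w => W t w - W s w).
  rewrite (_ : (fun w => _) = fun w => W t w + (-1) *: W s w); last by apply/funext => w; rewrite scaleN1r.
  by apply: measurable_rVD; [exact: mW|apply: measurable_rVZ; [exact: measurable_cst|exact: mW]].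
have mY : measurable_fun setT (fun w => X s w + c *: (W t w - W s w)).
  by apply: measurable_rVD; [exact: mX|apply: measurable_rVZ => //; exact: measurable_cst].
have msX := measurable_state_wrt FG BW nu mxi pa s_ge0.
have mXs := mX s_ge0; have mXt := mX t0.
pose Psi1 (z : 'rV[R]_d * 'rV[R]_d) := phi (z.1 + c *: z.2).
pose Psi2 (z : 'rV[R]_d * 'rV[R]_d) := \sum_i (p i (z.1 + c *: z.2) - p i z.1) ^+ 2.
have maff : measurable_fun setT (fun z : 'rV[R]_d * 'rV[R]_d => z.1 + c *: z.2).
  apply: measurable_rVD; first exact: measurable_fst.
  by apply: measurable_rVZ; [exact: measurable_cst|exact: measurable_snd].
have bPsi1 : bmeas Psi1 by apply: bmeas_comp maff (cper_bmeas cphi).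
have bPsi2 : bmeas Psi2.
  apply: bmeas_sum => i; rewrite /GRing.exp/=.
  have b : bmeas (fun z : 'rV[R]_d * 'rV[R]_d => p i (z.1 + c *: z.2) - p i z.1).
    apply: bmeasB; first exact: bmeas_comp maff (cper_bmeas (cp i)).
    exact: bmeas_comp measurable_fst (cper_bmeas (cp i)).
  exact: bmeasM.
have mXZ : measurable_fun setT (fun w => (X s w, W t w - W s w)) by exact: measurable_fun_pair.
have b1 : bmeas (fun w => phi (X t w)) by exact: bmeas_comp mXt (cper_bmeas cphi).
have b2 : bmeas (fun w => Psi1 (X s w, W t w - W s w)) by exact: (bmeas_comp mXZ bPsi1).
have cp2 : cper (fun x => \sum_i p i x ^+ 2) by apply: cper_sum => i; rewrite /GRing.exp/=; exact: cperM.
have b3 : bmeas (fun w => \sum_i p i (X s w) ^+ 2) by exact: (bmeas_comp mXs (cper_bmeas cp2)).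
have b4 : bmeas (fun w => Psi2 (X s w, W t w - W s w)) by exact: (bmeas_comp mXZ bPsi2).
have b3' : bmeas (fun w => delta / 2 * \sum_i p i (X s w) ^+ 2) by exact: bmeasM (bmeas_cst _) b3.
have b4' : bmeas (fun w => r / 2 * Psi2 (X s w, W t w - W s w)) by exact: bmeasM (bmeas_cst _) b4.
(* The left-hand side of [increment_le] at the state, the noise and the drift part; subtracting the
   value after pure noise isolates the effect of the drift. *)
pose h w := phi (X t w) - Psi1 (X s w, W t w - W s w) - delta / 2 * (\sum_i p i (X s w) ^+ 2)
  - r / 2 * Psi2 (X s w, W t w - W s w).
have bh : bmeas h by apply: bmeasB => //; apply: bmeasB => //; exact: bmeasB.
have E1 : \int[P]_w phi (X t w) = \int[torus_measure R d]_x (phi x * m x) by exact: lawX.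
have E2 : \int[P]_w Psi1 (X s w, W t w - W s w) = \int[torus_measure R d]_x (gop g c phi x * m x).
  by rewrite (increment_independent FG BW s_ge0 t0 st msX bPsi1) -(lawX s_ge0 cg).
have E3 : \int[P]_w (\sum_i p i (X s w) ^+ 2) = 2 * K0.
  rewrite (lawX s_ge0 cp2) /half_drift_energy -intZ; last first.
    rewrite (_ : (fun x => _) = fun x => 2^-1 * ((\sum_i p i x ^+ 2) * m x)).
      apply: bmeasM; first exact: bmeas_cst.
      by apply: cper_bmeas; exact: cperM.
    by apply/funext => x; rewrite mulr_suml.
  by apply: eq_Rintegral => x _; rewrite mulrA mulfV ?pnatr_eq0// mul1r mulr_suml.
have E4 : \int[P]_w Psi2 (X s w, W t w - W s w) <= 2 * C * delta.
  rewrite (increment_independent FG BW s_ge0 t0 st msX bPsi2).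
  apply: le_trans (ler_norm _) _; apply: prob_int_abs_le.
    apply: (bmeas_comp mXs (f := fun x => \int[g]_y Psi2 (x, y))).
    exact: (bmeas_int (torus_measure R d) g bPsi2).
  move=> w; have -> : 2 * C * delta = 0 + d%:R * (L * c) ^+ 2 * (d%:R * r ^+ 2) by rewrite r2 /C; field.
  apply: gauss_le_quadratic => //; first exact: bmeas_pair1.
    by rewrite mulr_ge0// sqr_ge0.
  move=> y; rewrite add0r /Psi2/= ger0_norm; last by apply: sumr_ge0 => i _; exact: sqr_ge0.
  rewrite (_ : d%:R * (L * c) ^+ 2 * _ = \sum_(i < d) (L * c) ^+ 2 * \sum_i y ord0 i ^+ 2); last first.
    by rewrite sumr_const card_ord -[RHS]mulr_natl mulrA.
  apply: ler_sum => i _; rewrite -real_normK ?num_real//.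
  apply: (@le_trans _ _ ((L * c) ^+ 2 * `|y| ^+ 2)).
    rewrite -exprMn ler_pXn2r// ?nnegrE ?mulr_ge0//.
    by rewrite (le_trans (HL _ _ _))// normrZ (ger0_norm c_ge0) mulrA.
  by rewrite ler_wpM2l ?sqr_ge0// norm_sqr_le_sum.
have Hgap := int_phi_gap (ltW d0) (fun x => HK r g x r0 gg) cg.
have Eh : (K0 - e) * delta <= \int[P]_w h w.
  rewrite (intB P (bmeasB (bmeasB b1 b2) b3') b4') (intB P (bmeasB b1 b2) b3') (intB P b1 b2) (intZ _ _ b3) (intZ _ _ b4).
  rewrite E1 E2 E3.
  have -> : delta / 2 * (2 * K0) = K0 * delta by field.
  apply: (gap_combine (C := C) (u := K * delta ^+ 2) Hgap).
    have := ler_wpM2r (ltW d0) k2; rewrite mulrDl r2; apply: le_trans.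
    by rewrite le_eqVlt; apply/orP; left; apply/eqP; ring.
  have -> : C * r * delta = r / 2 * (2 * C * delta) by field.
  by rewrite ler_wpM2l// divr_ge0// ltW.
(* Multiplied by [delta] this is 1/2 + r/2 + L d r^2, which the choice of [s0] keeps below 1/2 +
   e. *)
pose k := (2 * delta)^-1 + (2 * r)^-1 + L *+ d.
have k0 : 0 <= k by rewrite !addr_ge0// invr_ge0 mulr_ge0// ltW.
have kd : k * delta <= 2^-1 + e.
  apply: le_trans k1; rewrite le_eqVlt; apply/orP; left; apply/eqP.
  by rewrite /k -r2; field; rewrite lt0r_neq0.
have mg : measurable_fun setT (fun w => \sum_i drift_part s t w ord0 i ^+ 2).
  by apply: measurable_sum => i; apply: measurable_funX; exact: measurable_drift_part.
apply: (@le_trans _ _ ((\int[P]_w h w)%:E)); first by rewrite lee_fin.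
apply: (@le_trans _ _ (k%:E * \int[P]_w (\sum_i drift_part s t w ord0 i ^+ 2)%:E)%E).
  apply: expectation_le_scaled => // [w|w]; first by apply: sumr_ge0 => i _; exact: sqr_ge0.
  have := increment_le (X s w) (c *: (W t w - W s w)) (drift_part s t w) phi_p HL L0 d0.
  have -> : X s w + c *: (W t w - W s w) + drift_part s t w = X t w; last exact.
  by apply/rowP => i; rewrite !mxE; ring.
apply: (@le_trans _ _ (k%:E * (delta%:E * \int[leb]_(u in `]s, t]) control_energy u))%E).
  by rewrite lee_wpmul2l ?lee_fin//; exact: increment_energy.
rewrite muleA -EFinM lee_wpmul2r ?lee_fin//.
by apply: integral_ge0 => u _; exact: control_energy_ge0.
Qed.

(** The interval is cut into equal pieces no longer than [delta0]; both sides of [energy_step] are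
    additive, so the error stays relative to the length. *)
Lemma energy_itv_ge e T : 0 < e -> 0 < T ->
  (((K0 - e) * T)%:E <= (2^-1 + e)%:E * \int[leb]_(u in `[0%R, T]) control_energy u)%E.
Proof.
move=> e0 T0; have [delta0 d0 H] := energy_step e0.
have e20 : (0 <= (2^-1 + e)%:E)%E by rewrite lee_fin addr_ge0// ltW.
pose n := (Num.bound (T / delta0)).+1; pose dl := T / n%:R.
have n0 : 0 < n%:R :> R by rewrite ltr0n.
have dl0 : 0 < dl by exact: divr_gt0.
have dld : dl <= delta0.
  rewrite ler_pdivrMr// mulrC -ler_pdivrMr//.
  have := archi_boundP (divr_ge0 (ltW T0) (ltW d0)).
  by move=> /ltW /le_trans; apply; rewrite ler_nat.
have mE (D : set (measurableTypeR R)) : measurable_fun D control_energy.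
  by apply: measurable_funTS; exact: measurable_control_energy.
have mD (i : interval R) : measurable ([set` i] : set (measurableTypeR R)) by exact: measurable_itv.
have ind k : (((K0 - e) * (k%:R * dl))%:E <=
    (2^-1 + e)%:E * \int[leb]_(u in `]0%R, (k%:R * dl)%R]) control_energy u)%E.
  elim: k => [|k IH].
    rewrite mul0r mulr0 mule_ge0//; apply: integral_ge0 => u _; exact: control_energy_ge0.
  have k0 : 0 <= k%:R * dl by rewrite mulr_ge0// ltW.
  have kS : k.+1%:R * dl = k%:R * dl + dl by rewrite -natr1 mulrDl mul1r.
  have kk : k%:R * dl < k.+1%:R * dl by rewrite kS ltrDl.
  have U : ([set` `](0:R), (k.+1%:R * dl)]] : set R) =
      [set` `](0:R), (k%:R * dl)]] `|` [set` `](k%:R * dl), (k.+1%:R * dl)]].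
    apply/seteqP; split=> u.
      rewrite /= !in_itv/= => /andP[u0 ut]; have [us|su] := leP u (k%:R * dl).
        by left; apply/andP.
      by right; apply/andP.
    move=> [|]; rewrite /= !in_itv/= => /andP[u0 us].
      by rewrite u0/= (le_trans us)// ltW.
    by rewrite us (le_lt_trans k0).
  rewrite U ge0_integral_setU//; last 2 first.
  - by move=> u _; exact: control_energy_ge0.
  - apply/disj_setPS => u [] /=; rewrite !in_itv/= => /andP[_ us] /andP[su _].
    by rewrite ltNge us in su.
  rewrite ge0_muleDr; last 2 first.
  - by apply: integral_ge0 => u _; exact: control_energy_ge0.
  - by apply: integral_ge0 => u _; exact: control_energy_ge0.
  rewrite kS mulrDr EFinD -kS; apply: leeD => //.
  have := H _ _ k0 kk; rewrite {1 2}kS addrAC subrr add0r; exact.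
have nd : n%:R * dl = T by rewrite /dl mulrC divfK// lt0r_neq0.
have := ind n; rewrite nd => /le_trans; apply; apply: lee_wpmul2l => //.
apply: ge0_subset_integral => //.
  by move=> u _; exact: control_energy_ge0.
by move=> u; rewrite /= !in_itv/= => /andP[/ltW -> ->].
Qed.

Lemma total_energy_ge T : 0 <= T ->
  ((2 * K0 * T)%:E <= \int[leb]_(u in `[0%R, T]) control_energy u)%E.
Proof.
have J0 : (0 <= \int[leb]_(u in `[0%R, T]) control_energy u)%E.
  by apply: integral_ge0 => u _; exact: control_energy_ge0.
rewrite le_eqVlt => /predU1P[<-|T0]; first by rewrite mulr0; apply: integral_ge0 => u _; exact: control_energy_ge0.
have := fun e e0 => @energy_itv_ge e T e0 T0; move: J0.
case: (\int[leb]_(u in _) _)%E => [j|_ _|//]; last by rewrite leey.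
rewrite !lee_fin => j0 H; rewrite -subr_ge0 -(@pmulr_rge0 _ 2^-1)// mulrBr mulrA mulrA mulVf// mul1r.
rewrite subr_ge0; apply/ler_addgt0Pr => e e0.
have Tj : 0 < T + j by rewrite ltr_wpDr.
(* The error enters twice, multiplied by the length [T] and by the energy [j]. *)
have := H (e / (T + j)) (divr_gt0 e0 Tj); rewrite -EFinM lee_fin.
rewrite mulrBl mulrDl lerBlDr -addrA -mulrDr [j + T]addrC -mulrA mulVf ?lt0r_neq0// mulr1.
by [].
Qed.

Lemma half_drift_energy_ge0 : 0 <= K0.
Proof.
apply: Rintegral_ge0 => x _; rewrite mulr_ge0// sumr_ge0// => i _.
by rewrite mulr_ge0 ?sqr_ge0// ltW.
Qed.

Variables (rho : R) (f : 'rV[R]_d -> tprob R d -> R) (mu : tprob R d).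
Hypotheses (rho0 : 0 < rho) (cf : cper (f ^~ mu)).

(** The mean of [f] along the state is fixed by the law, so only the kinetic part needs a lower
    bound; adding C / rho makes both parts nonnegative. *)
Lemma stationary_cost_ge :
  (((K0 + \int[torus_measure R d]_x (f x mu * m x)) / rho)%:E <= cost P W rho nu f (fun=> mu) xi a)%E.
Proof.
have [C fC] := cper_bounded cf.
have C0 : 0 <= C by exact: le_trans (normr_ge0 _) (fC 0).
set B := \int[_]_x _.
have B0 : 0 <= B + C.
  have bf : bmeas (fun x => f x mu * m x) by apply: cper_bmeas; exact: cperM.
  have bC : bmeas (fun x => C * m x) by apply: cper_bmeas; apply: cperM => //; exact: cper_cst.
  have <- : \int[torus_measure R d]_x (f x mu * m x + C * m x) = B + C.
    by rewrite (intD _ bf bC) (intZ _ _ (cper_bmeas cm)) m1 mulr1.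
  apply: Rintegral_ge0 => x _; rewrite -mulrDl mulr_ge0 ?(ltW (m0 x))//.
  by have := fC x; rewrite ler_norml => /andP[]; lra.
rewrite -(@leeD2rE _ (C / rho)%:E)// (cost_formula FG BW nu rho0 (proj1 cf) fC mxi pa).
have mD : measurable ([set` `[(0:R), +oo[] : set (measurableTypeR R)) by exact: measurable_itv.
have me : measurable_fun [set: measurableTypeR R] (fun t : measurableTypeR R => expR (- (rho * t))).
  by apply: measurableT_comp => //; apply: measurable_funN; exact: measurable_funM.
have run t : 0 <= t -> (\int[P]_w (running W nu C f mu xi a t w)%:E =
    2^-1%:E * control_energy t + (B + C)%:E)%E.
  move=> t0; rewrite control_energyE// -ge0_integralZl//; last 2 first.
  - by apply/measurable_EFinP; apply: measurable_sqnorm => i; exact: (control_measurable FG pa i t0).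
  - by move=> w _; rewrite lee_fin sqnorm_ge0.
  have bfX : bmeas (fun w => f (X t w) mu) by exact: bmeas_comp (mX t0) (cper_bmeas cf).
  have bfC : bmeas (fun w => f (X t w) mu + C) by apply: bmeasD => //; exact: bmeas_cst.
  have -> : (B + C)%:E = (\int[P]_w (f (X t w) mu + C)%:E)%E.
    have -> : B + C = \int[P]_w (f (X t w) mu + C).
      by rewrite (intD P bfX (bmeas_cst C)) prob_int_cst (lawX t0 cf).
    by rewrite /Rintegral fineK//; apply: integrable_fin_num => //; exact: bmeas_integrable.
  rewrite -ge0_integralD//.
  - by apply: eq_integral => w _; rewrite /running -EFinM -EFinD addrA.
  - by move=> w _; rewrite mule_ge0// lee_fin sqnorm_ge0.
  - apply: emeasurable_funM => //; apply/measurable_EFinP; apply: measurable_sqnorm => i.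
    exact: (control_measurable FG pa i t0).
  - by move=> w _; rewrite lee_fin; have := fC (X t w); rewrite ler_norml => /andP[]; lra.
  - by apply/measurable_EFinP; case: bfC.
have -> : (\int[leb]_(t in `[0%R, +oo[) ((expR (- (rho * t)))%:E * \int[P]_w (running W nu C f mu xi a t w)%:E) =
    \int[leb]_(t in `[0%R, +oo[) (2^-1%:E * ((expR (- (rho * t)))%:E * control_energy t) + (expR (- (rho * t)))%:E * (B + C)%:E))%E.
  apply: eq_integral => t; rewrite inE/= in_itv/= andbT => t0; rewrite run//.
  rewrite ge0_muleDr//; last by rewrite mule_ge0// control_energy_ge0.
  by rewrite muleCA.
have mec : measurable_fun [set: measurableTypeR R] (fun t => ((expR (- (rho * t)))%:E * control_energy t)%E).
  by apply: emeasurable_funM; [exact/measurable_EFinP|exact: measurable_control_energy].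
have ec0 t : (0 <= (expR (- (rho * t)))%:E * control_energy t)%E.
  by rewrite mule_ge0 ?lee_fin ?expR_ge0// control_energy_ge0.
rewrite ge0_integralD//; last 4 first.
- by move=> t _; exact: mule_ge0.
- by apply: emeasurable_funM => //; exact: measurable_funTS.
- by move=> t _; rewrite mule_ge0// lee_fin expR_ge0.
- by apply/measurable_EFinP/measurable_funTS; exact: measurable_funM.
rewrite ge0_integralZl//; last exact: measurable_funTS.
rewrite ge0_integralZr//; last exact/measurable_EFinP/measurable_funTS.
rewrite integral_expR//.
have Ke : ((2 * K0 / rho)%:E <= \int[leb]_(u in `[0%R, +oo[) ((expR (- (rho * u)))%:E * control_energy u))%E.
  apply: layer_cake_ge => //.
  - by rewrite mulr_ge0// half_drift_energy_ge0.
  - exact: measurable_control_energy.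
  - exact: control_energy_ge0.
  - exact: total_energy_ge.
have -> : ((K0 + B) / rho)%:E + (C / rho)%:E = (2^-1%:E * (2 * K0 / rho)%:E + (rho^-1)%:E * (B + C)%:E :> \bar R)%E.
  by rewrite -!EFinM -!EFinD; congr EFin; field; rewrite lt0r_neq0.
by apply: leeD => //; rewrite lee_wpmul2l.
Qed.

End cost_lower_bound.

(** * The first variation at an equilibrium *)

Section first_variation.
Context {R : realType} {d : nat}.
Variables (rho nu : R) (m f : 'rV[R]_d -> R).
Variables (dm : 'I_d -> 'rV[R]_d -> R) (ddm : 'I_d -> 'I_d -> 'rV[R]_d -> R).
Hypotheses (cm : cper m) (cdm : forall i, cper (dm i)) (cddm : forall i j, cper (ddm i j)) (cf : cper f).
Hypotheses (m_dm : forall i, pderiv i m (dm i)) (dm_ddm : forall i j, pderiv j (dm i) (ddm i j)).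
Hypothesis m0 : forall x, 0 < m x.

Let score i x := dm i x / m x.
Let dscore i x := dm i x * (- dm i x / m x ^+ 2) + (m x)^-1 * ddm i i x.

Let m_neq0 x : m x != 0. Proof. by rewrite lt0r_neq0. Qed.

Let ci : cper (fun x => (m x)^-1). Proof. exact: cperV. Qed.

Let ci2 : cper (fun x => (m x ^+ 2)^-1).
Proof.
apply: cperV; first by rewrite /GRing.exp/=; exact: cperM.
by move=> x; rewrite expf_neq0.
Qed.

Lemma cper_ln_density : cper (fun x => ln (m x)).
Proof.
split; last by move=> x i; rewrite (proj2 cm).
by move=> x; apply: continuous_comp; [exact: (proj1 cm)|exact: continuous_ln].
Qed.

Let cscore i : cper (score i). Proof. exact: cperM. Qed.

Let cdscore i : cper (dscore i).
Proof.
apply: cperD; last exact: cperM.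
by apply: cperM => //; apply: cperM => //; exact: cperN.
Qed.

Let score_dscore i : pderiv i (score i) (dscore i).
Proof. by apply: pderivM => //; exact: pderivV. Qed.

Let csq i : cper (fun x => dm i x ^+ 2 / m x ^+ 2).
Proof. by apply: cperM => //; rewrite /GRing.exp/=; exact: cperM. Qed.

(* The linear derivative at [m dx] of [rho nu Ent + nu^2/2 I + F], up to a constant. *)
Definition first_variation x :=
  f x + rho * nu * ln (m x) - nu ^+ 2 * \sum_i (dscore i x + 2^-1 * (dm i x ^+ 2 / m x ^+ 2)).

Lemma cper_first_variation : cper first_variation.
Proof.
apply: cperB.
  by apply: cperD => //; apply: cperM; [exact: cper_cst|exact: cper_ln_density].
apply: cperM; first exact: cper_cst.
apply: cper_sum => i; apply: cperD => //; apply: cperM => //; exact: cper_cst.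
Qed.

Lemma int_score i r dr : cper r -> cper dr -> pderiv i r dr ->
  \int[torus_measure R d]_x (dm i x / m x * dr x) = - \int[torus_measure R d]_x (dscore i x * r x).
Proof. by move=> cr cdr r_dr; rewrite (torus_int_by_parts (cscore i) cr (cdscore i) cdr (score_dscore i)). Qed.

(** The derivatives of [r] in [run1] are moved onto grad m / m by parts; what [run1] does not
    produce is the entropy term. *)
Lemma int_first_variation r (dr : 'I_d -> 'rV[R]_d -> R) : cper r -> (forall i, cper (dr i)) ->
  (forall i, pderiv i r (dr i)) ->
  \int[torus_measure R d]_x (first_variation x * r x) =
  \int[torus_measure R d]_x run1 nu m r f dm dr x + rho * nu * \int[torus_measure R d]_x (ln (m x) * r x).
Proof.
move=> cr cdr r_dr.
have cl := cper_ln_density.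
have b1 : bmeas (fun x => f x * r x) by apply: cper_bmeas; exact: cperM.
have b2 : bmeas (fun x => ln (m x) * r x) by apply: cper_bmeas; exact: cperM.
have b3 i : bmeas (fun x => dscore i x * r x) by apply: cper_bmeas; exact: cperM.
have b4 i : bmeas (fun x => dm i x ^+ 2 / m x ^+ 2 * r x) by apply: cper_bmeas; exact: cperM.
have b5 i : bmeas (fun x => dm i x / m x * dr i x).
  by apply: cper_bmeas; apply: cperM => //; exact: (cscore i).
have b2' : bmeas (fun x => rho * nu * (ln (m x) * r x)) by exact: bmeasM (bmeas_cst _) b2.
have bz (z : R) i : bmeas (fun x => z * (dm i x ^+ 2 / m x ^+ 2 * r x)) by exact: bmeasM (bmeas_cst _) (b4 i).
have b6 i : bmeas (fun x => dscore i x * r x + 2^-1 * (dm i x ^+ 2 / m x ^+ 2 * r x)).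
  exact: bmeasD.
have b7 i : bmeas (fun x => dm i x / m x * dr i x - 2^-1 * (dm i x ^+ 2 / m x ^+ 2 * r x)).
  exact: bmeasB.
have b6s : bmeas (fun x => \sum_i (dscore i x * r x + 2^-1 * (dm i x ^+ 2 / m x ^+ 2 * r x))).
  exact: bmeas_sum.
have b7s : bmeas (fun x => \sum_i (dm i x / m x * dr i x - 2^-1 * (dm i x ^+ 2 / m x ^+ 2 * r x))).
  exact: bmeas_sum.
transitivity (\int[torus_measure R d]_x (f x * r x + rho * nu * (ln (m x) * r x)
  - nu ^+ 2 * \sum_i (dscore i x * r x + 2^-1 * (dm i x ^+ 2 / m x ^+ 2 * r x)))).
  apply: eq_Rintegral => x _; rewrite /first_variation mulrBl mulrDl !mulrA.
  rewrite -[nu ^+ 2 * _ * r x]mulrA mulr_suml; congr (_ - _ * _).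
  apply: eq_bigr => i _; rewrite mulrDl.
  by rewrite -[in LHS]mulrA.
rewrite (intB _ (bmeasD b1 b2') (bmeasM (bmeas_cst _) b6s)) (intD _ b1 b2') (intZ _ _ b2) (intZ _ _ b6s).
transitivity (\int[torus_measure R d]_x (f x * r x) +
  nu ^+ 2 * \int[torus_measure R d]_x (\sum_i (dm i x / m x * dr i x - 2^-1 * (dm i x ^+ 2 / m x ^+ 2 * r x)))
  + rho * nu * \int[torus_measure R d]_x (ln (m x) * r x)); last first.
  congr (_ + _); rewrite -(intZ _ _ b7s) -intD//; last exact: bmeasM (bmeas_cst _) b7s.
  apply: eq_Rintegral => x _; rewrite /run1 addrC mulr_sumr; congr (_ + _).
  by apply: eq_bigr => i _; congr (_ * _); field; exact: m_neq0.
rewrite (int_sum _ _ b6) (int_sum _ _ b7).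
have e i : \int[torus_measure R d]_x (dm i x / m x * dr i x - 2^-1 * (dm i x ^+ 2 / m x ^+ 2 * r x)) =
    - \int[torus_measure R d]_x (dscore i x * r x + 2^-1 * (dm i x ^+ 2 / m x ^+ 2 * r x)).
  rewrite (intB _ (b5 i) (bz _ i)) (intD _ (b3 i) (bz _ i)) (int_score cr (cdr i) (r_dr i)); ring.
by under [in RHS]eq_bigr do rewrite e; rewrite sumrN mulrN addrAC.
Qed.

(** By parts along [i0], the derivative of ln m moves onto [zeta], whose derivative is [r]: the
    speed cost produces the missing entropy term. *)
Lemma int_run2 i0 zeta r : cper zeta -> cper r -> pderiv i0 zeta r ->
  \int[torus_measure R d]_x run2 nu m zeta i0 dm x = nu * \int[torus_measure R d]_x (ln (m x) * r x).
Proof.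
move=> cz cr zr; have cl := cper_ln_density.
have cs : cper (fun x => dm i0 x / m x) by exact: cscore.
have l : pderiv i0 (fun x => ln (m x)) (fun x => dm i0 x / m x) by exact: pderiv_ln.
rewrite (torus_int_by_parts cl cz cs cr l zr) mulrN -mulNr -intZ; last by apply: cper_bmeas; exact: cperM.
apply: eq_Rintegral => x _; rewrite /run2; field; exact: m_neq0.
Qed.

End first_variation.

(** * Optimality of the equilibrium forces stationarity *)

Section equilibrium_variation.
Context {R : realType} {d : nat} {dO : measure_display} {Omega : measurableType dO}.
Variables (P : probability Omega R) (G : R -> set (set Omega)) (W : R -> Omega -> 'rV[R]_d).
Hypotheses (FG : filtration G) (BW : brownian_motion P G W).
Variables (rho nu : R) (f : 'rV[R]_d -> tprob R d -> R) (mu : pdens R d).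
Hypotheses (rho0 : 0 < rho) (nu0 : 0 < nu).
Hypotheses (f_per : periodic (f ^~ mu)) (f_C2 : C2 (f ^~ mu)).
Local Notation m := (dens mu).
Local Notation dm := (fun i => partial i (dens mu)).
Local Notation ddm := (fun i j => partial j (partial i (dens mu))).

Lemma C2_cper (phi : 'rV[R]_d -> R) : C2 phi -> periodic phi ->
  [/\ cper phi, forall i, cper (partial i phi), forall i j, cper (partial j (partial i phi)),
    forall i, pderiv i phi (partial i phi) & forall i j, pderiv j (partial i phi) (partial j (partial i phi))].
Proof.
move=> H pp.
have d1 i : pderiv i phi (partial i phi) by apply: pderivP; exact: C2_has_partial.
have d2 i j : pderiv j (partial i phi) (partial j (partial i phi)) by apply: pderivP; exact: C2_has_partial2.
have p1 i : periodic (partial i phi) by exact: periodic_pderiv (d1 i) pp.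
split; [|move=> i|move=> i j|exact: d1|exact: d2].
- by split; [exact: C2_continuous|exact: pp].
- by split; [exact: C2_partial_continuous|exact: p1].
- by split; [exact: C2_partial2_continuous|exact: periodic_pderiv (d2 i j) (p1 i)].
Qed.

Lemma C2_C2per (phi : 'rV[R]_d -> R) : C2 phi -> periodic phi -> C2per phi.
Proof. by move=> H pp; have [h1 h2 h3 h4 h5] := C2_cper H pp; exists (fun i => partial i phi), (fun i j => partial j (partial i phi)). Qed.

Lemma dens_int : \int[torus_measure R d]_x m x = 1.
Proof.
have cm : cper m by split; [exact: C2_continuous (dens_C2 mu)|exact: dens_periodic].
rewrite -torus_intE; last by apply: continuous_rV_measurable; case: cm.
rewrite /torus_int /Rintegral.
have := dens_spec mu (@measurableT _ 'rV[R]_d); rewrite setTI => <-.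
by transitivity (fine (1%E : \bar R)) => //; congr fine; exact: probability_setT.
Qed.

(** The equilibrium control is used only through its constant law and its optimality: the lower
    bound for its cost is inherited by every competitor, and perturbed competitors come arbitrarily
    close to it to first order. *)
Lemma equilibrium_first_variation r : stationary_equilibrium P G W rho nu f mu ->
  C2per r -> \int[torus_measure R d]_x r x = 0 ->
  \int[torus_measure R d]_x (first_variation rho nu m (f ^~ mu) dm ddm x * r x) = 0.
Proof.
move=> [_ [xi [a [mxi _ [pa opt] law]]]].
have [cm cdm cddm m_dm dm_ddm] := C2_cper (dens_C2 mu) (dens_periodic mu).
have [cf cdf _ f_df _] := C2_cper f_C2 f_per.
have m0 := dens_gt0 mu; have m1 := dens_int.
apply: torus_int_orthogonal; first exact: cper_first_variation.
move=> i phi [dphi [ddphi [cphi cdphi cddphi phi_d phi_dd]]] avg0.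
have [c0 c00 mc0] := cper_lower_bound cm m0; have [B HB] := cper_bounded cphi.
have B0 : 0 <= B by exact: le_trans (normr_ge0 _) (HB 0).
(* Small enough for m + t phi to remain above half of the lower bound of [m]. *)
pose e0 := Num.min 1 (c0 / (2 * (B + 1))).
have B1 : 0 < 2 * (B + 1) by rewrite mulr_gt0// ltr_wpDl.
have e00 : 0 < e0 by rewrite lt_min ltr01 divr_gt0.
have e01 : 0 <= e0 <= 1 by rewrite (ltW e00) ge_min lexx.
have lb t x : `|t| <= e0 -> c0 / 2 <= m x + t * phi x.
  move=> te; have e0B : e0 * (2 * (B + 1)) <= c0.
    by rewrite -ler_pdivlMr// ge_min lexx orbT.
  have : `|t * phi x| <= e0 * B by rewrite normrM ler_pM.
  rewrite ler_norml => /andP[h _]; have := mc0 x; move: e00 e0B h B0; set y := t * phi x; nra.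
have zp := pderiv_prim cphi (cdphi i) (phi_d i).
have [A bA] := cper_BL cphi cdphi phi_d.
have bz := prim_BL i (proj2 cphi) bA; have pz := prim_periodic i (proj2 cphi).
(* The zero mean of [phi] along axis [i] is used here: it gives [phi] a periodic antiderivative in
   that direction. *)
have zphi : pderiv i (prim i phi) phi by apply: eq_pderiv zp => x; rewrite avg0 subr0.
have lawX t psi : 0 <= t -> cper psi -> \int[P]_w psi (state W nu xi a t w) = \int[torus_measure R d]_x (psi x * m x).
  move=> t0 cpsi; apply: torus_law_int => //; last exact: law.
  exact: (wrt_measurable FG t0 (measurable_state_wrt FG BW nu mxi pa t0)).
(* The chain starts from the equilibrium state at time 0, whose drift integral is over a single
   point. *)
have law0 psi : cper psi -> \int[P]_w psi (xi w + Num.sqrt (2 * nu) *: W 0 w) = \int[torus_measure R d]_x (psi x * m x).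
  move=> cpsi; rewrite -(lawX 0)//; apply: eq_Rintegral => w _; rewrite /state; congr (psi (_ + _)).
  rewrite -[LHS]addr0; congr (_ + _); apply/rowP => j; rewrite !mxE.
  by rewrite set_itv1 Rintegral_set1.
have lower b : progressively_measurable G b ->
    ((\int[torus_measure R d]_x run0 nu m (f ^~ mu) dm x / rho)%:E <= cost P W rho nu f (fun=> mu) xi b)%E.
  move=> pb; apply: le_trans (opt b pb).
  have := stationary_cost_ge FG BW nu0 mxi pa cm cdm cddm m_dm dm_ddm m0 m1 lawX rho0 cf.
  apply: le_trans; rewrite lee_fin le_eqVlt; apply/orP; left; apply/eqP; congr (_ / _).
  rewrite /half_drift_energy -intD.
  - apply: eq_Rintegral => x _; rewrite /run0; congr (_ * _ + _); apply: eq_bigr => j _.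
    by field; rewrite lt0r_neq0.
  - rewrite (_ : (fun x => _) = fun x => 2^-1 * \sum_j (nu * (dm j x / m x)) ^+ 2 * m x)//.
    apply: cper_bmeas; apply: cperM; first exact: cper_cst.
    apply: cper_sum => j; apply: cperM => //; rewrite /GRing.exp/=.
    have c1 : cper (fun x => nu * (dm j x / m x)).
      apply: cperM; first exact: cper_cst.
      by apply: cperM => //; apply: cperV => // x; rewrite lt0r_neq0.
    exact: cperM.
  - by apply: cper_bmeas; exact: cperM.
have zBL : exists A, BL A (prim i phi) by exists (2 * pi * A).
have key := perturbation_stationary FG BW rho0 nu0 e01 (divr_gt0 c00 (ltr0n _ 2)) cm cdm cddm cphi cdphi cddphi
  m_dm dm_ddm phi_d phi_dd pz zBL zphi f_per (cper_BL cf cdf f_df) lb mxi law0 e00 lower.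
rewrite (int_first_variation rho nu cm cdm cddm cf m_dm dm_ddm m0 cphi cdphi phi_d).
rewrite -mulrA -(int_run2 nu cm cdm m_dm m0 (BL_cper bz pz) cphi zphi).
exact: key.
Qed.

End equilibrium_variation.

(** * Expansion of the free energy *)

Section crude_integral.
Context {disp : measure_display} {T : measurableType disp} {R : realType}.

(** The integrand in [t] of a linear derivative comes with no measurability, so only its pointwise
    bounds are used: they bound its positive and negative parts separately by constants. *)
Lemma Rintegral_between (mu : {measure set T -> \bar R}) (D : set T) (g : T -> R) (lo hi : R) :
  measurable D -> mu D = 1%E -> (forall x, D x -> lo <= g x <= hi) ->
  lo <= \int[mu]_(x in D) g x <= hi.
Proof.
move=> mD D1 H.
have c (r : R) : 0 <= r -> (\int[mu]_(x in D) r%:E = r%:E)%E.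
  by move=> r0; rewrite integral_cst// D1 mule1.
have ge (z : R) : 0 <= Num.max z 0 by rewrite le_max lexx orbT.
have monp (g1 g2 : T -> \bar R) : (forall x, D x -> 0 <= g1 x)%E -> (forall x, D x -> g1 x <= g2 x)%E ->
    (\int[mu]_(x in D) g1 x <= \int[mu]_(x in D) g2 x)%E.
  by move=> h1 h2; exact: ge0_integral_mono.
have fp x : ((EFin \o g)^\+ x)%E = (Num.max (g x) 0)%:E by rewrite funeposE/= -EFin_max.
have fn x : ((EFin \o g)^\- x)%E = (Num.max (- g x) 0)%:E by rewrite funenegE/= -EFin_max.
have max_le (u v : R) : u <= v -> Num.max u 0 <= Num.max v 0.
  by move=> uv; rewrite ge_max le_max uv/= le_max lexx orbT.
have p1 : ((Num.max lo 0)%:E <= \int[mu]_(x in D) (EFin \o g)^\+ x)%E.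
  rewrite -(c _ (ge lo)); apply: monp => x Dx; first by rewrite lee_fin.
  by rewrite fp lee_fin max_le//; case/andP: (H x Dx).
have p2 : (\int[mu]_(x in D) (EFin \o g)^\+ x <= (Num.max hi 0)%:E)%E.
  rewrite -(c _ (ge hi)); apply: monp => x Dx; first exact: funepos_ge0.
  by rewrite fp lee_fin max_le//; case/andP: (H x Dx).
have n1 : ((Num.max (- hi) 0)%:E <= \int[mu]_(x in D) (EFin \o g)^\- x)%E.
  rewrite -(c _ (ge (- hi))); apply: monp => x Dx; first by rewrite lee_fin.
  by rewrite fn lee_fin max_le// lerN2; case/andP: (H x Dx).
have n2 : (\int[mu]_(x in D) (EFin \o g)^\- x <= (Num.max (- lo) 0)%:E)%E.
  rewrite -(c _ (ge (- lo))); apply: monp => x Dx; first exact: funeneg_ge0.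
  by rewrite fn lee_fin max_le// lerN2; case/andP: (H x Dx).
have maxN (z : R) : z = Num.max z 0 - Num.max (- z) 0.
  have [z0|z0] := leP 0 z; first by rewrite max_r ?subr0// oppr_le0.
  by rewrite max_l ?opprK ?add0r// oppr_ge0 ltW.
rewrite /Rintegral integralE -[fun x => (g x)%:E]/(EFin \o g).
move: p1 p2 n1 n2.
case: (\int[mu]_(x in D) (EFin \o g)^\+ x)%E => [p| |]//.
case: (\int[mu]_(x in D) (EFin \o g)^\- x)%E => [q| |]//.
rewrite !lee_fin/= => p1 p2 n1 n2; have l1 := maxN lo; have l2 := maxN hi.
by apply/andP; split; [rewrite l1|rewrite l2]; exact: lerB.
Qed.

End crude_integral.

(** * Weak neighbourhoods and mixtures of measures *)

Section weak_topology.
Context {R : realType} {d : nat}.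
Implicit Types mu nu : tprob R d.

Lemma cvg_initial_topology (S : choiceType) (T : topologicalType) (h : S -> T) (F : set_system S) (s : S) :
  Filter F -> h @ F --> h s -> F --> (s : initial_topology h).
Proof.
move=> FF hF A; rewrite nbhsE => -[B [[C oC <-] Cs] BA].
by apply: filterS BA _; apply: hF; exact: open_nbhs_nbhs.
Qed.

(** Total-variation closeness tested on continuous periodic functions; densities that are uniformly
    close give measures that are close in this sense. *)
Definition tv_close mu (e : R) nu := forall (phi : 'rV[R]_d -> R) (M : R), cper phi ->
  (forall x, `|phi x| <= M) -> `|\int[nu]_x phi x - \int[mu]_x phi x| <= e * M.

(** The filter generated by these balls converges to [mu] under every evaluation, hence in the
    initial topology. It makes continuity in the weak topology quantitative along densities. *)
Lemma weak_nbhs_tv mu (U : set (tprob R d)) : nbhs mu U ->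
  exists2 e : R, 0 < e & forall nu, tv_close mu e nu -> U nu.
Proof.
pose F : set_system (tprob R d) := filter_from [set e : R | 0 < e] (tv_close mu).
have FF : Filter F.
  apply: filter_from_filter; first by exists 1 => /=.
  move=> e1 e2 /= e10 e20; exists (Num.min e1 e2); first by rewrite lt_min e10.
  have ge M (phi : 'rV[R]_d -> R) : (forall x, `|phi x| <= M) -> 0 <= M.
    by move=> /(_ 0); exact: le_trans.
  move=> nu H; split=> phi M cp pM; rewrite (le_trans (H phi M cp pM))// ler_wpM2r ?(ge _ _ pM)//.
    by rewrite ge_min lexx.
  by rewrite ge_min lexx orbT.
suff : F --> mu by move=> /[apply] -[e /= e0 H]; exists e.
apply: (@cvg_initial_topology _ _ (@tprob_eval R d)).
apply/cvg_sup => phi; apply: cvg_initial_topology.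
apply/cvgrPdist_le => e e0.
have cp : cper (sval phi) by exact: (svalP phi).
have [M HM] := cper_bounded cp; have M0 : 0 <= M by exact: le_trans (normr_ge0 _) (HM 0).
exists (e / (M + 1)); first by rewrite /= divr_gt0// ltr_wpDl.
move=> nu H /=; rewrite distrC; apply: le_trans (H _ _ cp HM) _.
rewrite -mulrA ger_pMr// mulrC ler_pdivrMr ?ltr_wpDl// mul1r lerDl ler01//.
Qed.

Lemma mixture_int (t : R) mu nu phi : 0 <= t <= 1 -> bmeas phi ->
  \int[mixture t mu nu]_x phi x = (1 - t) * \int[mu]_x phi x + t * \int[nu]_x phi x.
Proof.
move=> t01 bp; have [mp [M HM]] := bp.
have M0 : 0 <= M by exact: le_trans (normr_ge0 _) (HM point).
(* Shifted to be nonnegative, because integration against a sum of measures is additive for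
   nonnegative functions. *)
have bM : bmeas (fun x => phi x + M) by apply: bmeasD => //; exact: bmeas_cst.
have p0 x : 0 <= phi x + M by have := HM x; rewrite ler_norml => /andP[]; lra.
have shift (P : probability 'rV[R]_d R) : \int[P]_x (phi x + M) = \int[P]_x phi x + M.
  by rewrite (intD P bp (bmeas_cst M)) prob_int_cst.
have fin (P : probability 'rV[R]_d R) : (\int[P]_x (phi x + M)%:E = (\int[P]_x (phi x + M))%:E)%E.
  by rewrite /Rintegral fineK//; apply: integrable_fin_num => //; exact: bmeas_integrable.
suff : \int[mixture t mu nu]_x (phi x + M) = (1 - t) * \int[mu]_x (phi x + M) + t * \int[nu]_x (phi x + M).
  by rewrite !shift => H; have : forall u v w : R, u + M = (1 - t) * (v + M) + t * (w + M) -> u = (1 - t) * v + t * w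
    by [move=> u v w; lra|]; apply.
have mpM : measurable_fun setT (fun x => (phi x + M)%:E) by apply/measurable_EFinP; case: bM.
have pE x : (0 <= (phi x + M)%:E)%E by rewrite lee_fin.
apply: EFin_inj; rewrite EFinD !EFinM -!fin.
rewrite [LHS]ge0_integral_measure_add// !ge0_integral_mscale//=.
by rewrite clamp01_id.
Qed.

Lemma tv_close_mixture mu nu (t e : R) : 0 <= t <= 1 -> 0 <= e -> tv_close mu e nu ->
  tv_close mu e (mixture t mu nu).
Proof.
move=> t01 e0 H phi M cp pM; rewrite mixture_int//; last exact: cper_bmeas.
rewrite (_ : _ - _ = t * (\int[nu]_x phi x - \int[mu]_x phi x)); last by ring.
have /andP[t0 t1] := t01.
by rewrite normrM ger0_norm// (le_trans _ (H phi M cp pM))// ler_piMl.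
Qed.

End weak_topology.

(** * Second-order accuracy of the linearized potential *)

Section potential_expansion.
Context {R : realType} {d : nat}.
Variables (F : tprob R d -> R) (f : 'rV[R]_d -> tprob R d -> R).
Hypothesis sa : standing_assumption F f.
Variable mu : pdens R d.
Local Notation vol := ((2 * pi) ^+ d : R).

Let vol0 : 0 <= vol. Proof. by rewrite exprn_ge0// ltW// twopi_gt0. Qed.

Let cdens (nu : pdens R d) : cper (dens nu).
Proof. by split; [exact: C2_continuous (dens_C2 nu)|exact: dens_periodic]. Qed.

Let torus_abs_le phi (B : R) : cper phi -> (forall x, `|phi x| <= B) -> `|\int[torus_measure R d]_x phi x| <= vol * B.
Proof.
move=> cp pB; have := int_abs_le (torus_measure R d) (cper_bmeas cp) pB.
by rewrite torus_measureT mulrC.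
Qed.

Let int_diff (nu : pdens R d) phi : cper phi ->
  \int[nu]_x phi x - \int[mu]_x phi x = \int[torus_measure R d]_x (phi x * (dens nu x - dens mu x)).
Proof.
move=> cp; rewrite !pdens_int// -intB; try by apply: cper_bmeas; exact: cperM.
by apply: eq_Rintegral => x _; rewrite mulrBr.
Qed.

Let pdens_tv_close (nu : pdens R d) (delta : R) : (forall x, `|dens nu x - dens mu x| <= delta) ->
  tv_close mu (vol * delta) nu.
Proof.
move=> H phi M cp pM; rewrite int_diff// -mulrA; apply: torus_abs_le.
  by apply: cperM => //; exact: cperB.
by move=> x; rewrite normrM mulrC ler_pM.
Qed.

Let cf nu : cper (f ^~ nu).
Proof. by split; [exact/C2_continuous/(cost_C2 sa)|exact: cost_periodic sa nu]. Qed.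

(* [delta_mu f] is continuous, so by compactness of the cell it is bounded near [mu]. *)
Let derivative_bound : exists df : 'rV[R]_d -> tprob R d -> 'rV[R]_d -> R,
  [/\ forall x, linear_derivative (f x) (df x), forall x nu, cper (df x nu) &
  exists e M : R, [/\ 0 < e, 0 <= M & forall nu, tv_close mu e nu -> forall x y, `|df x nu y| <= M]].
Proof.
have [df [[lin px py cdf] _]] := cost_measure_derivative sa.
exists df; split => // [x nu|].
  split; last exact: py.
  move=> y; apply: (@continuous_comp _ _ _ (fun y => (x, nu, y)) (fun z => df z.1.1 z.1.2 z.2)); last exact: cdf.
  apply: (@cvg_pair _ _ _ (nbhs y) (nbhs (x, nu)) (nbhs y) _ _ _ (fun=> (x, nu)) id); last exact: cvg_id.
  exact: cvg_cst.
pose D (z : 'rV[R]_d * 'rV[R]_d) nu := df z.1 nu z.2.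
pose K := @closed_cell R d `*` @closed_cell R d.
have cK : compact K by apply: compact_setX; exact: compact_closed_cell.
have near1 : \forall nu \near (mu : tprob R d), K `<=` (fun z => `|D z nu - D z mu| <= 1).
  refine (proj1 (compact_near_coveringP K) cK (tprob R d) (nbhs (mu : tprob R d))
    (fun nu z => `|D z nu - D z mu| <= 1) _ _) => z Kz.
  have h1 : (fun p : ('rV[R]_d * 'rV[R]_d) * tprob R d => D p.1 p.2) p @[p --> (z, mu : tprob R d)] --> D z mu.
    apply: (@cvg_comp _ _ _ (fun p : ('rV[R]_d * 'rV[R]_d) * tprob R d => (p.1.1, p.2, p.1.2)) (fun z => df z.1.1 z.1.2 z.2)
      (nbhs (z, mu : tprob R d)) (nbhs (z.1, mu : tprob R d, z.2))); last exact: (cdf (z.1, mu : tprob R d, z.2)).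
    apply: (@cvg_pair _ _ _ (nbhs (z, mu : tprob R d)) (nbhs (z.1, mu : tprob R d)) (nbhs z.2) _ _ _
      (fun p => (p.1.1, p.2)) (fun p => p.1.2)); last first.
      by apply: (@cvg_comp _ _ _ fst snd); [exact: cvg_fst|exact: cvg_snd].
    apply: (@cvg_pair _ _ _ (nbhs (z, mu : tprob R d)) (nbhs z.1) (nbhs (mu : tprob R d)) _ _ _
      (fun p => p.1.1) snd); last exact: cvg_snd.
    by apply: (@cvg_comp _ _ _ fst fst); exact: cvg_fst.
  have h2 : (fun p : ('rV[R]_d * 'rV[R]_d) * tprob R d => D p.1 mu) p @[p --> (z, mu : tprob R d)] --> D z mu.
    apply: (@cvg_comp _ _ _ (fun p : ('rV[R]_d * 'rV[R]_d) * tprob R d => (p.1.1, mu : tprob R d, p.1.2)) (fun z => df z.1.1 z.1.2 z.2)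
      (nbhs (z, mu : tprob R d)) (nbhs (z.1, mu : tprob R d, z.2))); last exact: (cdf (z.1, mu : tprob R d, z.2)).
    apply: (@cvg_pair _ _ _ (nbhs (z, mu : tprob R d)) (nbhs (z.1, mu : tprob R d)) (nbhs z.2) _ _ _
      (fun p => (p.1.1, mu : tprob R d)) (fun p => p.1.2)); last first.
      by apply: (@cvg_comp _ _ _ fst snd); [exact: cvg_fst|exact: cvg_snd].
    apply: (@cvg_pair _ _ _ (nbhs (z, mu : tprob R d)) (nbhs z.1) (nbhs (mu : tprob R d)) _ _ _
      (fun p => p.1.1) (fun=> mu : tprob R d)); last exact: cvg_cst.
    by apply: (@cvg_comp _ _ _ fst fst); exact: cvg_fst.
  have h3 := @cvgB _ _ _ (nbhs (z, mu : tprob R d)) _ _ _ _ _ h1 h2; rewrite subrr in h3.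
  have h4 := h3 (nbhs_filter (z, mu : tprob R d)).
  exact: (proj1 (@cvgr0Pnorm_le _ _ _ _ _ _) h4 1 ltr01).
have [M HM] : exists M : R, forall z, K z -> `|D z mu| <= M.
  have cD : {within K, continuous (fun z => D z mu)}.
    apply: continuous_subspaceT => z.
    apply: (@cvg_comp _ _ _ (fun p : 'rV[R]_d * 'rV[R]_d => (p.1, mu : tprob R d, p.2)) (fun z => df z.1.1 z.1.2 z.2)
      (nbhs z) (nbhs (z.1, mu : tprob R d, z.2))); last exact: (cdf (z.1, mu : tprob R d, z.2)).
    apply: (@cvg_pair _ _ _ (nbhs z) (nbhs (z.1, mu : tprob R d)) (nbhs z.2) _ _ _
      (fun p => (p.1, mu : tprob R d)) snd); last exact: cvg_snd.
    apply: (@cvg_pair _ _ _ (nbhs z) (nbhs z.1) (nbhs (mu : tprob R d)) _ _ _ fst (fun=> mu : tprob R d)); last exact: cvg_cst.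
    exact: cvg_fst.
  have /compact_bounded [N [_ HN]] := continuous_compact cD cK.
  by exists (N + 1) => z Kz; apply: (HN (N + 1)); [rewrite ltrDl|exists z].
have [e e0 He] := weak_nbhs_tv near1.
exists e, (1 + `|M|); split=> // nu nue x y.
have -> : df x nu y = D (torus_proj x, torus_proj y) nu.
  rewrite /D/=; have := periodic_proj (px nu y) x 0; rewrite !addr0 => <-.
  by have := periodic_proj (py (torus_proj x) nu) y 0; rewrite !addr0 => <-.
have Kz : K (torus_proj x, torus_proj y) by split; exact: torus_proj_closed_cell.
have h1 := He nu nue _ Kz; have h2 := HM _ Kz; move: h1 h2.
set u := D _ nu; set v := D _ mu => /= h1 h2.
by rewrite -[u](subrK v) (le_trans (ler_normD _ _))// lerD// (le_trans h2)// ler_norm.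
Qed.

(** The remainder is quadratic because the linear derivative is used twice: once for [F], and once
    for the variation of [f] along the mixture, each giving a factor [delta]. *)
Lemma potential_expansion : exists e K : R, [/\ 0 < e, 0 <= K & forall (nu : pdens R d) delta,
  (forall x, `|dens nu x - dens mu x| <= delta) -> delta <= e ->
  `|F nu - F mu - \int[torus_measure R d]_x (f x mu * (dens nu x - dens mu x))| <= K * delta ^+ 2].
Proof.
have [df [lin cdf [e [M [e0 M0 HM]]]]] := derivative_bound.
have v0 : 0 < vol by rewrite exprn_gt0// twopi_gt0.
exists (e / vol), (vol * (vol * M)); split; first exact: divr_gt0.
  by rewrite !mulr_ge0.
move=> nu delta H de.
have d0 : 0 <= delta by exact: le_trans (normr_ge0 _) (H 0).
have nue : tv_close mu e nu.
  move=> phi N cp pN; apply: le_trans (pdens_tv_close H cp pN) _.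
  rewrite ler_wpM2r//; first exact: le_trans (normr_ge0 _) (pN 0).
  by rewrite mulrC -ler_pdivlMr.
have ck : cper (fun x => dens nu x - dens mu x) by exact: cperB.
have leb1 : lebesgue_measure ([set` `[(0:R), 1]] : set (measurableTypeR R)) = 1%E.
  by rewrite lebesgue_measure_itv/= lte_fin ltr01 sube0.
have mI : measurable ([set` `[(0:R), 1]] : set (measurableTypeR R)) by exact: measurable_itv.
(* The segment from [mu] to a mixture consists of measures that are again [e]-close to [mu], so the
   local bound on [df] holds all along it. *)
have fdiff (t : R) x : 0 <= t <= 1 -> `|f x (mixture t mu nu) - f x mu| <= vol * (M * delta).
  move=> t01; have nut := tv_close_mixture t01 (ltW e0) nue.
  rewrite lin ler_norml; apply: (Rintegral_between mI leb1) => s; rewrite /= in_itv/= => s01.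
  rewrite -ler_norml; set q := mixture s _ _.
  have nus : tv_close mu e q by exact: tv_close_mixture s01 (ltW e0) nut.
  rewrite mixture_int//; last exact: cper_bmeas.
  rewrite (_ : _ - _ = t * (\int[nu]_y df x q y - \int[mu]_y df x q y)); last by ring.
  have /andP[t0 t1] := t01.
  rewrite normrM ger0_norm// (le_trans (ler_piMl _ t1))// int_diff//.
  by apply: torus_abs_le; [exact: cperM|move=> y; rewrite normrM ler_pM// HM].
rewrite (potential_derivative sa mu nu).
set B := \int[torus_measure R d]_x _.
have : B - vol * (vol * M) * delta ^+ 2 <= \int[lebesgue_measure]_(t in `[0, 1])
    (\int[nu]_x f x (mixture t mu nu) - \int[mu]_x f x (mixture t mu nu)) <= B + vol * (vol * M) * delta ^+ 2.
  apply: (Rintegral_between mI leb1) => t; rewrite /= in_itv/= => t01.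
  rewrite (int_diff nu (cf (mixture t mu nu))) /B.
  have b1 : bmeas (fun x => f x (mixture t mu nu) * (dens nu x - dens mu x)) by apply: cper_bmeas; exact: cperM.
  have b2 : bmeas (fun x => f x mu * (dens nu x - dens mu x)) by apply: cper_bmeas; exact: cperM.
  suff : `|\int[torus_measure R d]_x (f x (mixture t mu nu) * (dens nu x - dens mu x)) -
      \int[torus_measure R d]_x (f x mu * (dens nu x - dens mu x))| <= vol * (vol * M) * delta ^+ 2.
    by rewrite ler_norml => /andP[h1 h2]; apply/andP; split; lra.
  rewrite -intB// (_ : vol * (vol * M) * delta ^+ 2 = vol * (vol * (M * delta) * delta)); last by ring.
  apply: torus_abs_le => [|x]; first by apply: cperB; exact: cperM.
  by rewrite -mulrBl normrM ler_pM// fdiff.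
by rewrite ler_distl.
Qed.

End potential_expansion.

Section pointwise_expansions.
Context {R : realType}.
Implicit Types a b m n : R.

(** Both inequalities are ln u - ln v <= u/v - 1, used with the roles of [a] and [b] exchanged. *)
Lemma entropy_expansion a b : 0 < a -> 0 < b ->
  0 <= b * ln b - a * ln a - (ln a + 1) * (b - a) <= (b - a) ^+ 2 / a.
Proof.
move=> a0 b0.
have h (u v : R) : 0 < u -> 0 < v -> ln u - ln v <= u / v - 1.
  move=> u0 v0; rewrite -ln_div ?posrE//.
  have -> : u / v = 1 + (u / v - 1) by ring.
  by apply: le_trans (le_ln1Dx _) _; [rewrite ltrBrDl addrN divr_gt0|lra].
have h1 := ler_wpM2l (ltW b0) (h b a b0 a0); have h2 := ler_wpM2l (ltW b0) (h a b a0 b0).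
have e1 : b * (b / a - 1) = (b - a) ^+ 2 / a + (b - a) by field; rewrite lt0r_neq0.
have e2 : b * (a / b - 1) = a - b by field; rewrite lt0r_neq0.
rewrite {}e1 in h1; rewrite {}e2 in h2.
by apply/andP; split; lra.
Qed.

(** The same exact identity as for the kinetic cost: the remainder is (q - (p/m) n)^2 / n. *)
Lemma fisher_expansion m n p q : m != 0 -> n != 0 ->
  q ^+ 2 / n - p ^+ 2 / m =
  2 * (p * (q - p) / m - (n - m) * p ^+ 2 / (2 * m ^+ 2)) + (q - p - p / m * (n - m)) ^+ 2 / n.
Proof. by move=> m0 n0; field; rewrite m0 n0. Qed.

Lemma sqr_subr_le a b : (a - b) ^+ 2 <= 2 * (a ^+ 2 + b ^+ 2).
Proof. by have := sqr_ge0 (a + b); rewrite !expr2; lra. Qed.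

End pointwise_expansions.

Section free_energy_expansion.
Context {R : realType} {d : nat}.
Variables (rho nu : R) (F : tprob R d -> R) (f : 'rV[R]_d -> tprob R d -> R).
Hypotheses (rho0 : 0 < rho) (nu0 : 0 < nu) (sa : standing_assumption F f).
Variable mu : pdens R d.
Local Notation vol := ((2 * pi) ^+ d : R).
Local Notation m := (dens mu).
Local Notation dm := (fun i => partial i (dens mu)).
Local Notation ddm := (fun i j => partial j (partial i (dens mu))).
Local Notation tint phi := (\int[torus_measure R d]_x phi x).

Let vol0 : 0 <= vol. Proof. by rewrite exprn_ge0// ltW// twopi_gt0. Qed.

Let cdens (mu' : pdens R d) : cper (dens mu').
Proof. by split; [exact: C2_continuous (dens_C2 mu')|exact: dens_periodic]. Qed.

Let torus_le phi (B : R) : cper phi -> (forall x, phi x <= B) -> \int[torus_measure R d]_x phi x <= vol * B.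
Proof.
move=> cp pB; have := int_le_cst (torus_measure R d) (cper_bmeas cp) pB.
by rewrite torus_measureT mulrC.
Qed.

Lemma Ent_expansion c delta (mu' : pdens R d) : 0 < c -> (forall x, c <= m x) ->
  (forall x, `|dens mu' x - m x| <= delta) ->
  `|Ent mu' - Ent mu - \int[torus_measure R d]_x ((ln (m x) + 1) * (dens mu' x - m x))| <= vol * (delta ^+ 2 / c).
Proof.
move=> c0 mc H.
have cxln (p : pdens R d) : cper (fun x => dens p x * ln (dens p x)).
  by apply: cperM => //; apply: cper_ln_density => //; exact: dens_gt0.
have EE (p : pdens R d) : Ent p = \int[torus_measure R d]_x (dens p x * ln (dens p x)).
  by rewrite /Ent torus_intE//; apply: continuous_rV_measurable; case: (cxln p).
have cl : cper (fun x => (ln (m x) + 1) * (dens mu' x - m x)).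
  apply: cperM; last exact: cperB.
  by apply: cperD; [apply: cper_ln_density => //; exact: dens_gt0|exact: cper_cst].
rewrite !EE -intB; try exact: cper_bmeas.
rewrite -intB; [|by apply: cper_bmeas; exact: cperB|exact: cper_bmeas].
set r := fun x => _; have cr : cper r by apply: cperB => //; exact: cperB.
have r_le x : 0 <= r x <= delta ^+ 2 / c.
  have /andP[r0 r1] := entropy_expansion (dens_gt0 mu x) (dens_gt0 mu' x).
  apply/andP; split; first exact: r0.
  apply: le_trans r1 _; apply: ler_pM; rewrite ?sqr_ge0 ?invr_ge0 ?(ltW (dens_gt0 _ _))//.
    by rewrite -real_normK ?num_real// ler_pXn2r// nnegrE// (le_trans _ (H x)).
  by rewrite lef_pV2 ?posrE ?dens_gt0.
rewrite ger0_norm; last by apply: Rintegral_ge0 => x _; case/andP: (r_le x).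
by apply: torus_le => // x; case/andP: (r_le x).
Qed.

Lemma Fisher_expansion c : 0 < c -> (forall x, c <= m x) -> exists2 K : R, 0 <= K &
  forall delta eta (mu' : pdens R d), delta <= c / 2 -> (forall x, `|dens mu' x - m x| <= delta) ->
  (forall i x, `|partial i (partial i (dens mu')) x - ddm i i x| <= eta) ->
  `|Fisher mu' - Fisher mu - \int[torus_measure R d]_x (\sum_i 2 * (dm i x * (partial i (dens mu') x - dm i x) / m x
     - (dens mu' x - m x) * dm i x ^+ 2 / (2 * m x ^+ 2)))| <= K * (delta ^+ 2 + delta * eta).
Proof.
move=> c0 mc.
have [_ cdm cddm m_dm dm_ddm] := C2_cper (dens_C2 mu) (dens_periodic mu).
have m0 x : m x != 0 by rewrite lt0r_neq0// dens_gt0.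
have ci : cper (fun x => (m x)^-1) by exact: cperV.
have cs i : cper (fun x => dm i x / m x) by exact: cperM.
have /choice[A HA] i : exists A : R, forall x, `|dm i x / m x| <= A by exact: cper_bounded (cs i).
exists (\sum_i 4 / c * vol * (1 + A i ^+ 2)).
  apply: sumr_ge0 => i _; apply: mulr_ge0; last by rewrite addr_ge0// sqr_ge0.
  by apply: mulr_ge0 => //; rewrite divr_ge0// ltW.
move=> delta eta mu' dc H He.
have [_ cdn cddn n_dn dn_ddn] := C2_cper (dens_C2 mu') (dens_periodic mu').
have n0 x : dens mu' x != 0 by rewrite lt0r_neq0// dens_gt0.
have cin : cper (fun x => (dens mu' x)^-1) by exact: cperV.
have delta0 : 0 <= delta by exact: le_trans (normr_ge0 _) (H 0).
have nc x : c / 2 <= dens mu' x.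
  by have := H x; have := mc x; rewrite ler_norml => + /andP[+ _]; lra.
have sq phi : cper phi -> cper (fun x => phi x ^+ 2) by move=> cp; rewrite /GRing.exp/=; exact: cperM.
have ck : cper (fun x => dens mu' x - m x) by exact: cperB.
have cb i : cper (fun x => partial i (dens mu') x - dm i x) by apply: cperB.
have cF (p : pdens R d) : cper (fun x => sqnorm (grad (dens p) x) / dens p x).
  have [_ cdp _ _ _] := C2_cper (dens_C2 p) (dens_periodic p).
  apply: cperM; last by apply: cperV => // x; rewrite lt0r_neq0// dens_gt0.
  rewrite (_ : (fun x => _) = fun x => \sum_i partial i (dens p) x ^+ 2); last first.
    by apply/funext => x; apply: eq_bigr => i _; rewrite !mxE.
  by apply: cper_sum => i; exact: sq.
have FE (p : pdens R d) : Fisher p = \int[torus_measure R d]_x (sqnorm (grad (dens p) x) / dens p x).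
  by rewrite /Fisher torus_intE//; apply: continuous_rV_measurable; case: (cF p).
pose rem i x := (partial i (dens mu') x - dm i x - dm i x / m x * (dens mu' x - m x)) ^+ 2 / dens mu' x.
have crem i : cper (rem i).
  by apply: cperM => //; apply: sq; apply: cperB => //; exact: cperM.
have cL : cper (fun x => \sum_i 2 * (dm i x * (partial i (dens mu') x - dm i x) / m x
     - (dens mu' x - m x) * dm i x ^+ 2 / (2 * m x ^+ 2))).
  apply: cper_sum => i; apply: cperM; first exact: cper_cst.
  apply: cperB; first by apply: cperM => //; exact: cperM.
  apply: cperM; first by apply: cperM => //; exact: sq.
  apply: cperV; first by apply: cperM; [exact: cper_cst|exact: sq].
  by move=> x; rewrite mulf_neq0 ?pnatr_eq0// expf_neq0.
rewrite !FE -intB; try exact: cper_bmeas.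
rewrite -intB; [|by apply: cper_bmeas; exact: cperB|exact: cper_bmeas].
have -> : \int[torus_measure R d]_x (sqnorm (grad (dens mu') x) / dens mu' x - sqnorm (grad m x) / m x -
    \sum_i 2 * (dm i x * (partial i (dens mu') x - dm i x) / m x
     - (dens mu' x - m x) * dm i x ^+ 2 / (2 * m x ^+ 2))) = \sum_i \int[torus_measure R d]_x rem i x.
  rewrite -int_sum; last by move=> i; exact: cper_bmeas.
  apply: eq_Rintegral => x _; rewrite /sqnorm !mulr_suml -!sumrB; apply: eq_bigr => i _.
  by rewrite !mxE (fisher_expansion _ _ (m0 x) (n0 x)) addrAC subrr add0r.
have rem0 i : 0 <= \int[torus_measure R d]_x rem i x.
  by apply: Rintegral_ge0 => x _; rewrite divr_ge0 ?sqr_ge0// ltW// dens_gt0.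
rewrite ger0_norm ?sumr_ge0// mulr_suml; apply: ler_sum => i _.
have b2 : \int[torus_measure R d]_x ((partial i (dens mu') x - dm i x) * (partial i (dens mu') x - dm i x)) <= vol * (delta * eta).
  have cbb : cper (fun x => partial i (partial i (dens mu')) x - ddm i i x) by apply: cperB.
  have dk : pderiv i (fun x => dens mu' x - m x) (fun x => partial i (dens mu') x - dm i x) by exact: pderivB.
  have dkk : pderiv i (fun x => partial i (dens mu') x - dm i x)
    (fun x => partial i (partial i (dens mu')) x - ddm i i x) by exact: pderivB.
  rewrite (torus_int_by_parts (cb i) ck cbb (cb i) dkk dk).
  rewrite -[X in - X]mulr1 -mulrN mulrC -intZ; last by apply: cper_bmeas; exact: cperM.
  apply: torus_le => [|x]; first by apply: cperM; [exact: cper_cst|exact: cperM].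
  apply: le_trans (ler_norm _) _; rewrite normrM normrN1 mul1r normrM mulrC.
  by apply: ler_pM.
have k2 : \int[torus_measure R d]_x ((A i) ^+ 2 * (dens mu' x - m x) ^+ 2) <= vol * (A i ^+ 2 * delta ^+ 2).
  apply: torus_le => [|x]; first by apply: cperM; [exact: cper_cst|exact: sq].
  rewrite ler_wpM2l ?sqr_ge0// -real_normK ?num_real// ler_pXn2r ?nnegrE//.
(* The factor 4 / c is the 2 of [sqr_subr_le] times the bound 2 / c for the inverse of
   [dens mu']. *)
apply: (@le_trans _ _ (4 / c * (vol * (delta * eta) + vol * (A i ^+ 2 * delta ^+ 2)))); last first.
  rewrite -(mulrDr vol) -[leRHS]mulrA -[leRHS]mulrA; apply: ler_wpM2l; first by rewrite divr_ge0// ltW.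
  apply: ler_wpM2l => //.
  have eta0 : 0 <= eta by exact: le_trans (normr_ge0 _) (He i 0).
  have := mulr_ge0 delta0 eta0; have := sqr_ge0 delta; have := sqr_ge0 (A i).
  set u := A i ^+ 2; set v := delta ^+ 2; set w := delta * eta => u0 v0 w0.
  by have := mulr_ge0 u0 w0; rewrite mulrDl mul1r mulrDr; lra.
have bb1 : bmeas (fun x => (partial i (dens mu') x - dm i x) * (partial i (dens mu') x - dm i x)).
  by apply: cper_bmeas; exact: cperM.
have bb2 : bmeas (fun x => (A i) ^+ 2 * (dens mu' x - m x) ^+ 2).
  by apply: cper_bmeas; apply: cperM; [exact: cper_cst|exact: sq].
apply: le_trans (ler_wpM2l _ (lerD b2 k2)); last by rewrite divr_ge0// ltW.
rewrite -intD// -intZ; last exact: bmeasD.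
apply: int_le; [exact: cper_bmeas|by apply: bmeasM; [exact: bmeas_cst|exact: bmeasD]|].
move=> x; rewrite /rem.
have h1 := sqr_subr_le (partial i (dens mu') x - dm i x) (dm i x / m x * (dens mu' x - m x)).
have h2 : (dm i x / m x * (dens mu' x - m x)) ^+ 2 <= A i ^+ 2 * (dens mu' x - m x) ^+ 2.
  rewrite exprMn ler_wpM2r ?sqr_ge0// -[leLHS]real_normK ?num_real// ler_pXn2r ?nnegrE//.
  exact: le_trans (normr_ge0 _) (HA i x).
have h3 : (dens mu' x)^-1 <= 2 / c.
  rewrite -[leRHS]invrK lef_pV2 ?posrE ?dens_gt0 ?invr_gt0 ?divr_gt0// invf_div.
  exact: nc.
have h4 : 4 / c = 2 * (2 / c) by field; rewrite lt0r_neq0.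
rewrite h4 -expr2; move: h1 h2; set u := (_ - _ - _) ^+ 2 => h1 h2.
apply: (@le_trans _ _ (2 / c * u)); first by rewrite mulrC ler_wpM2r// sqr_ge0.
rewrite [2 * (2 / c)]mulrC -[leRHS]mulrA; apply: ler_wpM2l; first by rewrite divr_ge0// ltW.
by apply: le_trans h1 _; rewrite ler_wpM2l// lerD2l.
Qed.

(** [delta] controls the increment and [eta] its pure second derivatives separately: along the flow
    the first is O(h), while the second merely tends to 0, which is enough since it occurs
    multiplied by [delta]. *)
Lemma Phi_expansion : exists e K : R, [/\ 0 < e, 0 <= K &
  forall delta eta (mu' : pdens R d), delta <= e -> (forall x, `|dens mu' x - m x| <= delta) ->
  (forall i x, `|partial i (partial i (dens mu')) x - ddm i i x| <= eta) -> 0 <= eta ->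
  `|Phi rho nu F mu' - Phi rho nu F mu -
    \int[torus_measure R d]_x (first_variation rho nu m (f ^~ mu) dm ddm x * (dens mu' x - m x))| <=
  K * (delta ^+ 2 + delta * eta)].
Proof.
have [cm cdm cddm m_dm dm_ddm] := C2_cper (dens_C2 mu) (dens_periodic mu).
have cf : cper (f ^~ mu) by split; [exact/C2_continuous/(cost_C2 sa)|exact: cost_periodic sa mu].
have m0 := dens_gt0 mu.
have [c c0 mc] := cper_lower_bound cm m0.
have [e [K1 [e0 K10 HF]]] := potential_expansion sa mu.
have [K2 K20 HI] := Fisher_expansion c0 mc.
exists (Num.min e (c / 2)), (rho * nu * (vol / c) + nu ^+ 2 / 2 * K2 + K1); split.
- by rewrite lt_min e0 divr_gt0.
- by rewrite !addr_ge0 ?mulr_ge0 ?invr_ge0 ?sqr_ge0 ?(ltW rho0) ?(ltW nu0) ?(ltW c0).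
move=> delta eta mu'; rewrite le_min => /andP[de dc] H He eta0.
have delta0 : 0 <= delta by exact: le_trans (normr_ge0 _) (H 0).
have [cn cdn cddn n_dn dn_ddn] := C2_cper (dens_C2 mu') (dens_periodic mu').
have ck : cper (fun x => dens mu' x - m x) by exact: cperB.
have cdk i : cper (fun x => partial i (dens mu') x - dm i x) by apply: cperB.
have dk i : pderiv i (fun x => dens mu' x - m x) (fun x => partial i (dens mu') x - dm i x) by exact: pderivB.
have cl := cper_ln_density cm m0.
have h1 := Ent_expansion c0 mc H; have h2 := HI delta eta mu' dc H He; have h3 := HF mu' delta H de.
rewrite (int_first_variation rho nu cm cdm cddm cf m_dm dm_ddm m0 ck cdk dk).
(* Equal masses remove the constant 1 in the derivative of the entropy. *)
have k_int : \int[torus_measure R d]_x (dens mu' x - m x) = 0.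
  by rewrite intB ?dens_int ?subrr//; exact: cper_bmeas.
have e1 : \int[torus_measure R d]_x ((ln (m x) + 1) * (dens mu' x - m x)) =
    \int[torus_measure R d]_x (ln (m x) * (dens mu' x - m x)).
  rewrite -[RHS]addr0 -k_int -intD; [|by apply: cper_bmeas; exact: cperM|exact: cper_bmeas].
  by apply: eq_Rintegral => x _; rewrite mulrDl mul1r.
pose L x := \sum_i 2 * (dm i x * (partial i (dens mu') x - dm i x) / m x
     - (dens mu' x - m x) * dm i x ^+ 2 / (2 * m x ^+ 2)).
have bfk : bmeas (fun x => f x mu * (dens mu' x - m x)) by apply: cper_bmeas; exact: cperM.
have cL : cper L.
  apply: cper_sum => i; apply: cperM; first exact: cper_cst.
  have sq phi : cper phi -> cper (fun x => phi x ^+ 2) by move=> cp; rewrite /GRing.exp/=; exact: cperM.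
  have nz x : m x != 0 by rewrite lt0r_neq0.
  apply: cperB; first by apply: cperM; [exact: cperM|exact: cperV].
  apply: cperM; first by apply: cperM => //; exact: sq.
  apply: cperV; first by apply: cperM; [exact: cper_cst|exact: sq].
  by move=> x; rewrite mulf_neq0 ?pnatr_eq0// expf_neq0.
have e2 : \int[torus_measure R d]_x run1 nu m (fun x => dens mu' x - m x) (f ^~ mu) dm
      (fun i x => partial i (dens mu') x - dm i x) x =
    nu ^+ 2 / 2 * \int[torus_measure R d]_x L x + \int[torus_measure R d]_x (f x mu * (dens mu' x - m x)).
  rewrite -intZ; last exact: cper_bmeas.
  rewrite -intD//; last by apply: bmeasM; [exact: bmeas_cst|exact: cper_bmeas].
  apply: eq_Rintegral => x _; rewrite /run1 /L; congr (_ + _).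
  rewrite mulr_sumr; apply: eq_bigr => i _; rewrite mulrA divfK ?pnatr_eq0//.
rewrite e1 in h1; rewrite e2.
move: h1 h2 h3; rewrite -/(L _) /Phi.
set E' := Ent mu'; set E := Ent mu; set I' := Fisher mu'; set I := Fisher mu.
set J1 := \int[_]_x _; set J2 := \int[_]_x L x; set J3 := \int[_]_x _ => h1 h2 h3.
have -> : rho * nu * E' + nu ^+ 2 / 2 * I' + F mu' - (rho * nu * E + nu ^+ 2 / 2 * I + F mu) -
    (nu ^+ 2 / 2 * J2 + J3 + rho * nu * J1) =
    rho * nu * (E' - E - J1) + nu ^+ 2 / 2 * (I' - I - J2) + (F mu' - F mu - J3) by ring.
have rn : 0 <= rho * nu by rewrite mulr_ge0// ltW.
have n2 : 0 <= nu ^+ 2 / 2 by rewrite divr_ge0// sqr_ge0.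
have q0 : 0 <= delta * eta by exact: mulr_ge0.
set z := delta ^+ 2 + delta * eta in h2 *.
rewrite [leRHS]mulrDl (mulrDl (rho * nu * _)); apply: le_trans (ler_normD _ _) _; apply: lerD; last first.
  by apply: le_trans h3 _; rewrite ler_wpM2l// lerDl.
apply: le_trans (ler_normD _ _) _; apply: lerD; rewrite normrM ger0_norm// -[leRHS]mulrA ler_wpM2l//.
apply: le_trans h1 _; rewrite (_ : vol * (delta ^+ 2 / c) = vol / c * delta ^+ 2); last by ring.
by apply: ler_wpM2l; [rewrite divr_ge0// ltW|rewrite lerDl].
Qed.

End free_energy_expansion.

Section norms.
Context {R : realType} {d : nat}.
Implicit Types phi : 'rV[R]_d -> R.

Lemma sup_norm_ub phi x : (`|phi x|%:E <= sup_norm phi)%E.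
Proof. by apply: ereal_sup_ubound; exists x. Qed.

Lemma sup_norm_ge0 phi : (0 <= sup_norm phi)%E.
Proof. by apply: le_trans (sup_norm_ub phi 0); rewrite lee_fin. Qed.

Lemma partial2_le_C2_norm phi i j x (eta : R) : (C2_norm phi <= eta%:E)%E ->
  `|partial j (partial i phi) x| <= eta.
Proof.
move=> H; rewrite -lee_fin; apply: le_trans (sup_norm_ub _ x) _; apply: le_trans H.
have s1 : (0 <= \sum_(i < d) sup_norm (partial i phi))%E by apply: sume_ge0 => k _; exact: sup_norm_ge0.
apply: (@le_trans _ _ (\sum_(k < d) \sum_(l < d) sup_norm (partial l (partial k phi)))%E); last first.
  by apply: leeDr; rewrite adde_ge0// sup_norm_ge0.
rewrite (bigD1 i)//=; apply: (@le_trans _ _ (\sum_(l < d) sup_norm (partial l (partial i phi)))%E); last first.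
  by apply: leeDl; apply: sume_ge0 => k _; apply: sume_ge0 => l _; exact: sup_norm_ge0.
by rewrite (bigD1 j)//=; apply: leeDl; apply: sume_ge0 => l _; exact: sup_norm_ge0.
Qed.

Lemma cvg0_near_le {T} (G : set_system T) {FG : Filter G} (h : T -> \bar R) (eta : R) :
  h @ G --> 0%E -> 0 < eta -> \forall t \near G, (h t <= eta%:E)%E.
Proof.
move=> /fine_cvgP[hf /cvgr0Pnorm_le/(_ eta)] + eta0 => /(_ eta0) hn.
near=> t; rewrite -[h t]fineK; last by near: t.
rewrite lee_fin; apply: le_trans (ler_norm _) _.
by near: t.
Unshelve. all: by end_near. Qed.

Lemma partialB phi psi i x : has_partial i phi -> has_partial i psi ->
  partial i (fun x => phi x - psi x) x = partial i phi x - partial i psi x.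
Proof. by move=> H1 H2; have := deriveB (H1 x) (H2 x). Qed.

Lemma partial2B phi psi i j : C2 phi -> C2 psi ->
  partial j (partial i (fun x => phi x - psi x)) = fun x => partial j (partial i phi) x - partial j (partial i psi) x.
Proof.
move=> H1 H2.
have -> : partial i (fun x => phi x - psi x) = fun x => partial i phi x - partial i psi x.
  by apply/funext => x; rewrite partialB//; exact: C2_has_partial.
by apply/funext => x; rewrite partialB//; exact: C2_has_partial2.
Qed.

End norms.

Theorem theorem1p2 (R : realType) (d : nat) (rho nu : R)
    (F : tprob R d -> R) (f : 'rV[R]_d -> tprob R d -> R)
    (dO : measure_display) (Omega : measurableType dO)
    (P : probability Omega R) (G : R -> set (set Omega))
    (W : R -> Omega -> 'rV[R]_d)
    (S : R -> pdens R d -> pdens R d) (mu : pdens R d) :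
  0 < rho -> 0 < nu ->
  standing_assumption F f ->
  filtration G -> brownian_motion P G W ->
  admissible_test_flow S ->
  stationary_equilibrium P G W rho nu f mu ->
  h^-1 * (Phi rho nu F (S h mu) - Phi rho nu F (S 0 mu)) @[h --> 0^'+] --> 0.
Proof.
move=> rho0 nu0 sa FG BW adm eq.
have [e [K [e0 K0 HK]]] := Phi_expansion rho0 nu0 sa mu.
have [V HV] := flow_velocity adm; have [cV pV limV] := HV mu.
(* Every difference of two densities has mean zero, so the linear term vanishes for each increment
   and not merely for the limiting velocity. *)
have stationary (mu' : pdens R d) : \int[torus_measure R d]_x
    (first_variation rho nu (dens mu) (f ^~ mu) (fun i => partial i (dens mu))
       (fun i j => partial j (partial i (dens mu))) x * (dens mu' x - dens mu x)) = 0.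
  apply: (equilibrium_first_variation FG BW rho0 nu0 (cost_periodic sa mu) (cost_C2 sa mu) eq).
    apply: C2per_sub; first exact: C2_C2per (dens_C2 mu') (dens_periodic mu').
    exact: C2_C2per (dens_C2 mu) (dens_periodic mu).
  have cd (p : pdens R d) : bmeas (dens p).
    by apply: cper_bmeas; split; [exact: C2_continuous (dens_C2 p)|exact: dens_periodic].
  by rewrite intB// !dens_int subrr.
have {}HK (delta eta : R) (mu' : pdens R d) : delta <= e -> (forall x, `|dens mu' x - dens mu x| <= delta) ->
    (forall i x, `|partial i (partial i (dens mu')) x - partial i (partial i (dens mu)) x| <= eta) -> 0 <= eta ->
    `|Phi rho nu F mu' - Phi rho nu F mu| <= K * (delta ^+ 2 + delta * eta).
  by move=> de h1 h2 eta0; have := HK delta eta mu' de h1 h2 eta0; rewrite stationary subr0.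
(* [S 0 mu] and [mu] share their density but may be different records, and [F] is applied to the
   record; the expansion with zero increment shows that [Phi] agrees. *)
have S0 : Phi rho nu F (S 0 mu) = Phi rho nu F mu.
  have E : dens (S 0 mu) = dens mu by apply/funext => x; exact: flow0 adm mu x.
  apply/eqP; rewrite -subr_eq0 -normr_le0.
  have := HK 0 0 (S 0 mu) (ltW e0); rewrite mul0r expr0n addr0 mulr0; apply => //.
  - by move=> x; rewrite E subrr normr0.
  - by move=> i x; rewrite E subrr normr0.
rewrite S0; have [B0 HB0] := cper_bounded (conj cV pV).
have B0_ge0 : 0 <= B0 by exact: le_trans (normr_ge0 _) (HB0 0).
(* Bounds the increment divided by [h]: the velocity, plus 1 for its distance to the difference
   quotient. *)
pose B := B0 + 1; have B1 : 0 < B by rewrite ltr_wpDl.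
apply/cvgr0Pnorm_le => eps eps0.
have KB0 : 0 <= K * B by rewrite mulr_ge0// ltW.
have KB1 : 0 < K * B + 1 by rewrite ltr_wpDl.
have KBB0 : 0 <= K * B ^+ 2 by rewrite mulr_ge0// sqr_ge0.
have KBB1 : 0 < K * B ^+ 2 + 1 by rewrite ltr_wpDl.
(* The bound on the quotient is K B^2 h + K B eta; each term is given half of [eps]. *)
pose eta := eps / (2 * (K * B + 1)); have eta0 : 0 < eta by rewrite divr_gt0// mulr_gt0.
near=> h.
have h0 : 0 < h by near: h; exact: nbhs_right_gt.
have hV : (sup_norm (fun x => h^-1 * (dens (S h mu) x - dens mu x) - V mu x)%R <= 1%:E)%E.
  by near: h; exact: cvg0_near_le.
have hC : (C2_norm (fun x => dens (S h mu) x - dens mu x)%R <= eta%:E)%E.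
  by near: h; apply: cvg0_near_le => //; exact: flow_C2 adm mu.
have he : h <= e / B by near: h; apply: nbhs_right_le; rewrite divr_gt0.
have heps : h <= eps / (2 * (K * B ^+ 2 + 1)) by near: h; apply: nbhs_right_le; rewrite divr_gt0// mulr_gt0.
have Bh : B * h <= e by rewrite mulrC -ler_pdivlMr.
have close x : `|dens (S h mu) x - dens mu x| <= B * h.
  have := le_trans (sup_norm_ub _ x) hV; rewrite lee_fin => H.
  have -> : dens (S h mu) x - dens mu x = h * ((h^-1 * (dens (S h mu) x - dens mu x) - V mu x) + V mu x).
    by rewrite subrK mulrA divff ?mul1r// lt0r_neq0.
  rewrite normrM gtr0_norm// mulrC ler_wpM2r ?(ltW h0)// addrC (le_trans (ler_normD _ _))//.
  by rewrite lerD.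
have curv i x : `|partial i (partial i (dens (S h mu))) x - partial i (partial i (dens mu)) x| <= eta.
  have := partial2_le_C2_norm i i x hC.
  by rewrite (partial2B i i (dens_C2 (S h mu)) (dens_C2 mu)).
have := HK (B * h) eta (S h mu) Bh close curv (ltW eta0).
rewrite normrM gtr0_norm ?invr_gt0// ler_pdivrMl// => /le_trans; apply.
rewrite (_ : K * _ = h * ((K * B ^+ 2) * h + K * B * eta)); last by ring.
apply: ler_wpM2l; first exact: ltW.
have t1 : K * B ^+ 2 * h <= eps / 2.
  apply: (@le_trans _ _ ((K * B ^+ 2 + 1) * (eps / (2 * (K * B ^+ 2 + 1))))).
    by apply: ler_pM => //; rewrite ?lerDl// ltW.
  by rewrite le_eqVlt; apply/orP; left; apply/eqP; field; rewrite lt0r_neq0.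
have t2 : K * B * eta <= eps / 2.
  apply: (@le_trans _ _ ((K * B + 1) * eta)); first by rewrite ler_wpM2r ?(ltW eta0)// lerDl.
  by rewrite le_eqVlt; apply/orP; left; apply/eqP; rewrite /eta; field; rewrite lt0r_neq0.
by rewrite [leRHS]splitr lerD.
Unshelve. all: by end_near. Qed.
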